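(* Let $n\ge 3$ and let $\alpha\in L^\infty(\partial\Omega;\mathbb{C})$ be such that $\operatorname{Re}\alpha\ge|\operatorname{Im}\alpha|$ (almost everywhere on $\partial\Omega$). Suppose there exist non-negative numbers $b_1,b_2$ satisfying $2C^*[b_1+S^*b_2]<1$ such that $$\|x\,\alpha\|_{L^\infty(\partial\Omega)}\le b_1\qquad\text{and}\qquad \|(-\Delta)^{1/4}(x\,\alpha)\|_{L^{2(n-1)}(\partial\Omega)}\le b_2 .$$ Then there exists a positive constant $c$ such that, for all $\lambda\in\mathbb{C}$, $$\big\|r^{-1}(-\Delta_\alpha^\Omega-\lambda)^{-1}r^{-1}\big\|_{L^2(\Omega)\to L^2(\Omega)}\le c,$$ where $r(x):=|x|$.
   Context: $\Omega:=\mathbb{R}^{n-1}\times(0,\infty)$ is the upper half-space, with $\partial\Omega$ identified with $\mathbb{R}^{n-1}$; points are $x=(x',x_n)$, and on $\partial\Omega$ one has $x=(x',0)$, $x'=(x_1,\dots,x_{n-1})$. For $\alpha\in L^\infty(\partial\Omega;\mathbb{C})$, the Robin Laplacian $-\Delta_\alpha^\Omega$ is the m-sectorial operator in $L^2(\Omega)$ associated, via the first representation theorem, with the closed form $h_\alpha[u]:=\int_\Omega|\nabla u|^2\,dx+\int_{\partial\Omega}\alpha|u|^2\,d\sigma$, $\mathcal{D}(h_\alpha):=H^1(\Omega)$ (boundary values in the sense of traces). That is, $u\in\mathcal{D}(-\Delta_\alpha^\Omega)$ iff $u\in H^1(\Omega)$ and there is $w_u\in L^2(\Omega)$ such that $\int_\Omega\nabla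 u\cdot\overline{\nabla v}\,dx+\int_{\partial\Omega}\alpha u\bar v\,d\sigma=\int_\Omega w_u\bar v\,dx$ for all $v\in H^1(\Omega)$, and then $-\Delta_\alpha^\Omega u:=w_u$. $(-\Delta)^{1/4}$ is the fractional Laplacian on $\mathbb{R}^{n-1}$, defined via the Fourier transform as the multiplier $|\xi|^{1/2}$. Set $2^*:=2(n-1)/(n-2)$. $C^*$ is the smallest constant $C$ (depending on $n$) such that the fractional Leibniz rule $$\|(-\Delta)^{1/4}(fg)\|_{L^2(\mathbb{R}^{n-1})}\le C\big[\|f\|_{L^\infty(\mathbb{R}^{n-1})}\|(-\Delta)^{1/4}g\|_{L^2(\mathbb{R}^{n-1})}+\|(-\Delta)^{1/4}f\|_{L^{2(n-1)}(\mathbb{R}^{n-1})}\|g\|_{L^{2^*}(\mathbb{R}^{n-1})}\big]$$ holds for all complex-valued functions $f,g$ on $\mathbb{R}^{n-1}$ (for which the right-hand side is finite); such a finite constant exists (homogeneous Kato–Ponce inequality). $S^*$ is the smallest constant $S$ such that $\|f\|_{L^{2^*}(\mathbb{R}^{n-1})}\le S\,\|(-\Delta)^{1/4}f\|_{L^2(\mathbb{R}^{n-1})}$ holds for all $f\in\dot H^{1/2}(\mathbb{R}^{n-1})$. Norms of the vector-valued function $x\alpha=(x_1\alpha,\dots,x_{n-1}\alpha)$ are sums over components: $\|x\alpha\|_{L^\infty(\partial\Omega)}=\sum_{j=1}^{n-1}\|x_j\alpha\|_{L^\infty(\mathbb{R}^{n-1})}$ and $\|(-\Delta)^{1/4}(x\alpha)\|_{L^{2(n-1)}(\partial\Omega)}=\sum_{j=1}^{n-1}\|(-\Delta)^{1/4}(x_j\alpha)\|_{L^{2(n-1)}(\mathbb{R}^{n-1})}$.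 The operator-norm bound (which is asserted for all $\lambda\in\mathbb{C}$, including $\lambda$ in the spectrum) is understood as the estimate $\|r^{-1}u\|_{L^2(\Omega)}\le c\,\|r f\|_{L^2(\Omega)}$ for every $u\in\mathcal{D}(-\Delta_\alpha^\Omega)$ with $f:=(-\Delta_\alpha^\Omega-\lambda)u$ satisfying $rf\in L^2(\Omega)$. *)

(* Defs.v *)
From HB Require Import structures.
From mathcomp Require Import all_boot all_order all_algebra.
From mathcomp Require Import complex.
From mathcomp Require Import all_classical all_reals all_analysis.

Set Implicit Arguments.
Unset Strict Implicit.
Unset Printing Implicit Defensive.

Import Order.TTheory GRing.Theory Num.Theory.
Import numFieldNormedType.Exports.

Local Open Scope classical_set_scope.
Local Open Scope ring_scope.
Local Open Scope complex_scope.

(* Lebesgue measure on R^n (row vectors), on the sigma-algebra generated by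
   the coordinates, which is the Borel one. *)

Definition rV_coord (R : realType) n (i : 'I_n) (x : 'rV[R]_n) :
  measurableTypeR R := x ord0 i.

Definition rV_display : measure_display. Proof. exact: default_measure_display. Qed.

Lemma rV_measurable0 (R : realType) n : g_sigma_preimage (@rV_coord R n) set0.
Proof. exact: sigma_algebra0. Qed.

Lemma rV_measurableC (R : realType) n A :
  g_sigma_preimage (@rV_coord R n) A -> g_sigma_preimage (@rV_coord R n) (~` A).
Proof. exact: sigma_algebraC. Qed.

Lemma rV_measurable_bigcup (R : realType) n (F : (set 'rV[R]_n)^nat) :
  (forall i, g_sigma_preimage (@rV_coord R n) (F i)) ->
  g_sigma_preimage (@rV_coord R n) (\bigcup_i (F i)).
Proof. exact: sigma_algebra_bigcup. Qed.

HB.instance Definition _ (R : realType) n :=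
  @isMeasurable.Build rV_display 'rV[R]_n (g_sigma_preimage (@rV_coord R n))
    (@rV_measurable0 R n) (@rV_measurableC R n) (@rV_measurable_bigcup R n).

(* (x', t) |-> x, identifying R^n * R with R^(n+1); t is the last coordinate *)
Definition snoc (R : realType) n (p : 'rV[R]_n * measurableTypeR R) :
    'rV[R]_n.+1 :=
  \row_(i < n.+1) if unlift ord_max i is Some j then p.1 ord0 j else p.2.

Definition unsnoc (R : realType) n (x : 'rV[R]_n.+1) :
    'rV[R]_n * measurableTypeR R :=
  (\row_(j < n) x ord0 (lift ord_max j), x ord0 ord_max).

Lemma snocK (R : realType) n : cancel (@snoc R n) (@unsnoc R n).
Proof.
case=> x t; rewrite /unsnoc /snoc; congr pair.
  by apply/rowP => j; rewrite !mxE liftK.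
by rewrite !mxE unlift_none.
Qed.

Lemma unsnocK (R : realType) n : cancel (@unsnoc R n) (@snoc R n).
Proof.
move=> x; apply/rowP => i; rewrite /unsnoc /snoc !mxE.
by case: unliftP => [j ->|->//]; rewrite mxE.
Qed.

Lemma measurable_rV_coord (R : realType) n (i : 'I_n) :
  measurable_fun setT (@rV_coord R n i).
Proof.
move=> _ Y mY; rewrite setTI; apply: sub_sigma_algebra => /=.
rewrite -bigcup_seq/=; exists i => /=; first by rewrite mem_index_enum.
by exists Y => //; rewrite setTI.
Qed.

Lemma measurable_fun_rV (R : realType) n d (T : measurableType d)
    (f : T -> 'rV[R]_n) :
  (forall i, measurable_fun setT (@rV_coord R n i \o f)) ->
  measurable_fun setT f.
Proof.
move=> mf _ A mA; rewrite setTI.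
suff : g_sigma_preimage (@rV_coord R n) `<=` [set B | measurable (f @^-1` B)].
  by apply; exact: mA.
apply: smallest_sub; first split => /=.
- by rewrite preimage_set0.
- by move=> B mB; rewrite setTD preimage_setC; exact: measurableC.
- by move=> F mF; rewrite preimage_bigcup; exact: bigcup_measurable.
rewrite -bigcup_seq/=; apply: bigcup_sub => i _ _ [B mB <-] /=.
by rewrite setTI -comp_preimage -[X in measurable X]setTI; exact: mf.
Qed.

Lemma measurable_snoc (R : realType) n : measurable_fun setT (@snoc R n).
Proof.
apply: measurable_fun_rV => i; rewrite /comp /rV_coord /snoc.
case: (unliftP ord_max i) => [j ->|->].
  rewrite (_ : (fun _ => _) = @rV_coord R n j \o fst).
    by apply: measurableT_comp => //; exact: measurable_rV_coord.
  by apply/funext => p; rewrite mxE liftK.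
rewrite (_ : (fun _ => _) = snd)//.
by apply/funext => p; rewrite mxE unlift_none.
Qed.

Lemma measurable_unsnoc (R : realType) n : measurable_fun setT (@unsnoc R n).
Proof.
apply/measurable_fun_pairP; split; last exact: measurable_rV_coord.
apply: measurable_fun_rV => i.
rewrite (_ : _ \o _ = @rV_coord R n.+1 (lift ord_max i)).
  exact: measurable_rV_coord.
by apply/funext => x; rewrite /comp /rV_coord /unsnoc mxE.
Qed.

Definition snoc_measure (R : realType) n
    (m : {sigma_finite_measure set 'rV[R]_n -> \bar R}) :
    set 'rV[R]_n.+1 -> \bar R :=
  pushforward (m \x @lebesgue_measure R)%E (@snoc R n).

HB.instance Definition _ (R : realType) n
    (m : {sigma_finite_measure set 'rV[R]_n -> \bar R}) :=
  Measure.copy (snoc_measure m)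
    (measure_function_pushforward__canonical__measure_function_Measure
      (m \x @lebesgue_measure R)%E (@measurable_snoc R n)).

Lemma snoc_measure_sigma_finite (R : realType) n
    (m : {sigma_finite_measure set 'rV[R]_n -> \bar R}) :
  sigma_finite setT (snoc_measure m).
Proof.
have /sigma_finiteP[F [TF ndF Foo]] := sigma_finiteT m.
have /sigma_finiteP[G [TG ndG Goo]] := sigma_finiteT (@lebesgue_measure R).
exists (fun k => @unsnoc R n @^-1` (F k `*` G k)).
  rewrite -preimage_bigcup -(preimage_setT (@unsnoc R n)); congr (_ @^-1` _).
  rewrite -setXTT TF TG predeqE => -[x y]; split.
    move=> [/= [i _ Fix] [k _ Gky]]; exists (maxn i k) => //; split.
    - by move: x Fix; exact/subsetPset/ndF/leq_maxl.
    - by move: y Gky; exact/subsetPset/ndG/leq_maxr.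
  by move=> [i _ []/= ? ?]; split; exists i.
move=> k; have [mF Fk] := Foo k; have [mG Gk] := Goo k.
split.
  rewrite -[X in measurable X]setTI; apply: measurable_unsnoc => //.
  exact: measurableX.
rewrite /snoc_measure /pushforward -comp_preimage (_ : _ \o _ = id); last first.
  by apply/funext => p; exact: snocK.
by rewrite preimage_id product_measure1E// lte_mul_pinfty// ge0_fin_numE.
Qed.

HB.instance Definition _ (R : realType) n
    (m : {sigma_finite_measure set 'rV[R]_n -> \bar R}) :=
  Measure_isSigmaFinite.Build _ _ _ (snoc_measure m)
    (snoc_measure_sigma_finite m).

Fixpoint leb (R : realType) n : {sigma_finite_measure set 'rV[R]_n -> \bar R} :=
  match n with
  | 0 => \d_(0 : 'rV[R]_0)
  | k.+1 => snoc_measure (leb R k)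
  end.

Definition dotp (R : realType) n (x y : 'rV[R]_n) : R :=
  \sum_(i < n) x ord0 i * y ord0 i.

(* Euclidean norm; the library norm `|x| on row vectors is the sup norm *)
Definition enorm (R : realType) n (x : 'rV[R]_n) : R := Num.sqrt (dotp x x).

Definition cabs (R : realType) (z : R[i]) : R := Normc.normc z.

Definition cexpi (R : realType) (t : R) : R[i] := cos t +i* sin t.

Definition cmeasurable (R : realType) n (D : set 'rV[R]_n)
    (f : 'rV[R]_n -> R[i]) : Prop :=
  measurable_fun D (fun x => complex.Re (f x)) /\
  measurable_fun D (fun x => complex.Im (f x)).

Definition cintegrable (R : realType) n (D : set 'rV[R]_n)
    (f : 'rV[R]_n -> R[i]) : Prop :=
  (leb R n).-integrable D (EFin \o (fun x => complex.Re (f x))) /\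
  (leb R n).-integrable D (EFin \o (fun x => complex.Im (f x))).

Definition cint (R : realType) n (D : set 'rV[R]_n)
    (f : 'rV[R]_n -> R[i]) : R[i] :=
  (\int[leb R n]_(x in D) complex.Re (f x)) +i*
  (\int[leb R n]_(x in D) complex.Im (f x)).

Definition cLnorm (R : realType) n (D : set 'rV[R]_n) (p : \bar R)
    (f : 'rV[R]_n -> R[i]) : \bar R :=
  ('N[leb R n]_p[(fun x => (cabs (f x))%:E) \_ D])%E.

Definition evec (R : realType) n (i : 'I_n) : 'rV[R]_n := delta_mx ord0 i.

Definition pderiv (R : realType) n (s : seq 'I_n) (f : 'rV[R]_n -> R) :
    'rV[R]_n -> R :=
  foldr (fun i g => (fun x => 'D_(evec R i) g x)) f s.

Definition smooth (R : realType) n (f : 'rV[R]_n -> R) : Prop :=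
  forall s : seq 'I_n, continuous (pderiv s f) /\
    forall (i : 'I_n) (x : 'rV[R]_n), derivable (pderiv s f) x (evec R i).

(* C_c^oo(U), extended by 0 *)
Definition test_fun (R : realType) n (U : set 'rV[R]_n) (f : 'rV[R]_n -> R) :
    Prop :=
  smooth f /\ exists K : set 'rV[R]_n,
    [/\ compact K, K `<=` U & forall x, ~ K x -> f x = 0].

Definition ctest_fun (R : realType) n (U : set 'rV[R]_n)
    (f : 'rV[R]_n -> R[i]) : Prop :=
  test_fun U (fun x => complex.Re (f x)) /\
  test_fun U (fun x => complex.Im (f x)).

Definition cpartial (R : realType) n (i : 'I_n) (f : 'rV[R]_n -> R[i])
    (x : 'rV[R]_n) : R[i] :=
  pderiv [:: i] (fun y => complex.Re (f y)) x +i*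
  pderiv [:: i] (fun y => complex.Im (f y)) x.

Definition schwartz (R : realType) n (f : 'rV[R]_n -> R) : Prop :=
  smooth f /\ forall (k : nat) (s : seq 'I_n), exists M : R,
    forall x, enorm x ^+ k * `|pderiv s f x| <= M.

Definition cschwartz (R : realType) n (f : 'rV[R]_n -> R[i]) : Prop :=
  schwartz (fun x => complex.Re (f x)) /\
  schwartz (fun x => complex.Im (f x)).

Definition fourier (R : realType) n (f : 'rV[R]_n -> R[i]) (xi : 'rV[R]_n) :
    R[i] :=
  cint setT (fun x => cexpi (- dotp x xi) * f x).

Definition inv_fourier (R : realType) n (f : 'rV[R]_n -> R[i])
    (x : 'rV[R]_n) : R[i] :=
  (((2 * pi) ^- n)%:C : R[i]) * cint setT (fun xi => cexpi (dotp x xi) * f xi).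

Definition frac_lap_schwartz (R : realType) n (f : 'rV[R]_n -> R[i]) :
    'rV[R]_n -> R[i] :=
  inv_fourier (fun xi => (Num.sqrt (enorm xi))%:C * fourier f xi).

(* F = (-Delta)^{1/4} f. The multiplier |xi|^{1/2} is even, so the operator is
   its own transpose and extends by duality with Schwartz functions, like the
   Fourier transform itself; it must act on bounded functions, whose Fourier
   transform need not be a function. *)
Definition frac_lap (R : realType) n (f F : 'rV[R]_n -> R[i]) : Prop :=
  [/\ cmeasurable setT f, cmeasurable setT F &
    forall phi : 'rV[R]_n -> R[i], cschwartz phi ->
      [/\ cintegrable setT (fun x => f x * frac_lap_schwartz phi x),
          cintegrable setT (fun x => F x * phi x) &
          cint setT (fun x => f x * frac_lap_schwartz phi x) =
          cint setT (fun x => F x * phi x)]].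

(* || (-Delta)^{1/4} f ||_{L^p}: F is unique almost everywhere, so this is the
   infimum of at most one value; +oo when (-Delta)^{1/4} f is not a function *)
Definition frac_lap_Lnorm (R : realType) n (p : \bar R)
    (f : 'rV[R]_n -> R[i]) : \bar R :=
  ereal_inf [set cLnorm setT p F | F in [set F | frac_lap f F]].

(* the function h is the Fourier transform of the tempered function f *)
Definition is_fourier (R : realType) n (f h : 'rV[R]_n -> R[i]) : Prop :=
  [/\ cmeasurable setT f, cmeasurable setT h &
    forall phi : 'rV[R]_n -> R[i], cschwartz phi ->
      [/\ cintegrable setT (fun x => f x * fourier phi x),
          cintegrable setT (fun xi => h xi * phi xi) &
          cint setT (fun x => f x * fourier phi x) =
          cint setT (fun xi => h xi * phi xi)]].

(* homogeneous Sobolev space \dot H^{1/2}(R^n); for n >= 2 its elements are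
   functions, since 1/2 < n/2 *)
Definition hom_sobolev_half (R : realType) n (f : 'rV[R]_n -> R[i]) : Prop :=
  exists h : 'rV[R]_n -> R[i], is_fourier f h /\
    (cLnorm setT 2%:E (fun xi => (Num.sqrt (enorm xi))%:C * h xi)%R < +oo)%E.

(* From here on d = n - 1 is the dimension of the boundary; this is
   2^* = 2(n-1)/(n-2) *)
Definition two_star (R : realType) (d : nat) : \bar R :=
  ((2 * d)%:R / d.-1%:R)%:E.

Definition kato_ponce_const (R : realType) (d : nat) : set R :=
  [set C | forall f g : 'rV[R]_d -> R[i],
    cmeasurable setT f -> cmeasurable setT g ->
    (cLnorm setT +oo f < +oo)%E ->
    (frac_lap_Lnorm 2%:E g < +oo)%E ->
    (frac_lap_Lnorm (2 * d)%:R%:E f < +oo)%E ->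
    (cLnorm setT (two_star R d) g < +oo)%E ->
    (frac_lap_Lnorm 2%:E (fun x => f x * g x)%R
     <= C%:E * (cLnorm setT +oo f * frac_lap_Lnorm 2%:E g
        + frac_lap_Lnorm (2 * d)%:R%:E f * cLnorm setT (two_star R d) g))%E].

Definition sobolev_const (R : realType) (d : nat) : set R :=
  [set S | forall f : 'rV[R]_d -> R[i], hom_sobolev_half f ->
    (cLnorm setT (two_star R d) f <= S%:E * frac_lap_Lnorm 2%:E f)%E].

Arguments kato_ponce_const : clear implicits.
Arguments sobolev_const : clear implicits.

Definition is_smallest (R : realType) (A : set R) (c : R) : Prop :=
  A c /\ lbound A c.

Definition half_space (R : realType) d : set 'rV[R]_d.+1 :=
  [set x | 0 < x ord0 ord_max].
Arguments half_space : clear implicits.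

Definition boundary_pt (R : realType) d (x' : 'rV[R]_d) : 'rV[R]_d.+1 :=
  snoc (x', 0).

(* u is in H^1(Omega) with weak gradient g *)
Definition in_H1 (R : realType) d (u : 'rV[R]_d.+1 -> R[i])
    (g : 'I_d.+1 -> 'rV[R]_d.+1 -> R[i]) : Prop :=
  let Om := half_space R d in
  [/\ cmeasurable Om u, (cLnorm Om 2%:E u < +oo)%E,
      forall i, cmeasurable Om (g i) /\ (cLnorm Om 2%:E (g i) < +oo)%E &
      forall (i : 'I_d.+1) (phi : 'rV[R]_d.+1 -> R), test_fun Om phi ->
        cint Om (fun x => u x * (pderiv [:: i] phi x)%:C) =
        - cint Om (fun x => g i x * (phi x)%:C)].

(* t is the trace of u (with weak gradient g) on the boundary: the trace is
   the continuous extension to H^1(Omega) of the restriction of the smooth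
   functions with compact support in the closure of Omega *)
Definition is_trace (R : realType) d (u : 'rV[R]_d.+1 -> R[i])
    (g : 'I_d.+1 -> 'rV[R]_d.+1 -> R[i]) (t : 'rV[R]_d -> R[i]) : Prop :=
  let Om := half_space R d in
  [/\ cmeasurable setT t, (cLnorm setT 2%:E t < +oo)%E &
    exists phi : nat -> 'rV[R]_d.+1 -> R[i],
      [/\ forall k, ctest_fun setT (phi k),
          cLnorm Om 2%:E (fun x => phi k x - u x) @[k --> \oo] --> 0%E,
          forall i, cLnorm Om 2%:E (fun x => cpartial i (phi k) x - g i x)
                    @[k --> \oo] --> 0%E &
          cLnorm setT 2%:E (fun x' => phi k (boundary_pt x') - t x')
          @[k --> \oo] --> 0%E]].

(* u is in the domain of the Robin Laplacian and is mapped to w *)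
Definition robin_laplacian (R : realType) d (alpha : 'rV[R]_d -> R[i])
    (u w : 'rV[R]_d.+1 -> R[i]) : Prop :=
  let Om := half_space R d in
  [/\ cmeasurable Om w, (cLnorm Om 2%:E w < +oo)%E &
    exists (gu : 'I_d.+1 -> 'rV[R]_d.+1 -> R[i]) (tu : 'rV[R]_d -> R[i]),
      [/\ in_H1 u gu, is_trace u gu tu &
        forall (v : 'rV[R]_d.+1 -> R[i])
               (gv : 'I_d.+1 -> 'rV[R]_d.+1 -> R[i]) (tv : 'rV[R]_d -> R[i]),
          in_H1 v gv -> is_trace v gv tv ->
          cint Om (fun x => \sum_(i < d.+1) gu i x * (gv i x)^*) +
          cint setT (fun x' => alpha x' * tu x' * (tv x')^*) =
          cint Om (fun x => w x * (v x)^*)]].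

(* Main.v *)
(** Of the hypotheses on [alpha], only [|x'| |alpha| <= b1] and [Re alpha >= |Im alpha|] enter.

    If [Re lambda <= |Im lambda|], testing the equation with [u] and combining its real and
    imaginary parts bounds the Dirichlet integral, and Hardy's inequality concludes.

    Otherwise let [mu] have the same real part as [lambda] and a nonzero, slightly larger imaginary
    part [e] in absolute value. For smooth [w] vanishing near the origin, with zero Neumann data, a
    Morawetz-type multiplier identity for the modulated gradient [grad w - i k (x / |x|) w],
    [k = sqrt (Re mu)], bounds [w / r] in [L^2], [|x'|^(-1/2) w] in [L^2] of the boundary and
    [|e| |w|^2] by [r (- Delta - mu) w], uniformly in [mu]. Cosine polynomials on large boxes and
    cutoffs show that [r (- Delta - mu) w] ranges over a dense set.

    Taking [(- Delta - conj mu) w] close to [u / r^2] and testing the equation of [u] with [w] gives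
    [u / r] up to the boundary term [int alpha u conj w], which is at most the geometric mean of
    [int |alpha| |u|^2] and [b1 int |w|^2 / |x'|]. To bound [int Re alpha |u|^2], take instead
    [(- Delta - mu) w] close to [f] and test with a function that has the boundary values of [u - w],
    and whose tangential Fourier modes solve the homogeneous Helmholtz equation and decay away from
    the boundary: since the decay rates have positive real part, the Helmholtz form of [u - w]
    against it has nonnegative real part, and [int alpha u conj w] is absorbed as before. *)

Require Import Defs.
From HB Require Import structures.
From mathcomp Require Import all_boot all_order all_algebra.
From mathcomp Require Import complex.
From mathcomp Require Import all_classical all_reals all_analysis.
From mathcomp Require Import measurable_realfun ess_sup_inf ring lra.

Set Implicit Arguments.
Unset Strict Implicit.
Unset Printing Implicit Defensive.

Import Order.TTheory GRing.Theory Num.Theory.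
Import numFieldNormedType.Exports.

Local Open Scope classical_set_scope.
Local Open Scope ring_scope.
Local Open Scope complex_scope.

(** * Integration by parts on boxes *)

(** [u] is only in [H^1] and [alpha] only bounded, so no multiplier can be applied to [u] itself: it
    acts on smooth functions, and its estimates reach [u] through the weak equation. For
    [Re lambda > |Im lambda|] the form of [u] with itself has no sign, so the test with [u] does not
    control the boundary integral; the decaying extension of the trace of [u - w] is chosen because
    it restores a sign.

    A nonzero [e] makes every cosine mode of a box invertible and gives every tangential mode a
    positive decay rate. The price is the mismatch [eps = |e - Im lambda|], which multiplies norms
    of [w] and of the decaying test functions that may be large when [e] is small. The limit
    therefore depends on which constants are fixed before [eps], and on the uniform bound for
    [|e| |w|^2].

    The origin is singular for the weights [r] and [1 / r]. Functions vanishing near it make all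
    integrations by parts legitimate, and nothing is lost by density: in dimension at least 3 a
    small neighbourhood of the origin can be cut out at small energy cost. All complex quantities
    are pairs of real functions, [(p, q)] standing for [p + i q]. *)

Section RowVectors.
Variable R : realType.

Lemma snoc_lift n (p : 'rV[R]_n * measurableTypeR R) (i : 'I_n) :
  snoc p ord0 (lift ord_max i) = p.1 ord0 i.
Proof. by rewrite mxE liftK. Qed.

Lemma snoc_max n (p : 'rV[R]_n * measurableTypeR R) : snoc p ord0 ord_max = p.2.
Proof. by rewrite mxE unlift_none. Qed.

Lemma ball_rV n (x y : 'rV[R]_n) (e : R) : 0 < e ->
  (forall i, `|x ord0 i - y ord0 i| < e) -> ball x e y.
Proof. by move=> e0 h; split => // i j; rewrite (ord1 i); exact: h. Qed.

(** The sigma-algebra is generated by the coordinates, so an open set is first written as a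
    countable union of cubes with rational centres and half-widths [k.+1%:R^-1]. *)
Lemma open_measurable_rV n (U : set 'rV[R]_n) : open U -> measurable U.
Proof.
move=> oU.
pose B (p : 'rV[rat]_n * nat) : set 'rV[R]_n :=
  [set y | forall i, `|y ord0 i - ratr (p.1 ord0 i)| < p.2.+1%:R^-1].
pose F p := if `[< B p `<=` U >] then B p else set0.
have -> : U = \bigcup_p F p.
  apply/seteqP; split => [x Ux|x [p _]]; last first.
    by rewrite /F; case: ifPn => // /asboolP; exact.
  have : nbhs x U by exact: open_nbhs_nbhs.
  move=> /nbhs_ballP[e /= e0 xeU].
  have [k ke] : exists k : nat, (k.+1%:R^-1 : R) < e / 2.
    exists (Num.truncn (e / 2)^-1); rewrite -[ltRHS]invrK ltf_pV2 ?posrE ?invr_gt0 ?divr_gt0//.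
    by rewrite truncnS_gt// num_real.
  have kgt0 : 0 < (k.+1%:R^-1 : R) by rewrite invr_gt0.
  have qP i : {q : rat | `|x ord0 i - ratr q| < k.+1%:R^-1}.
    apply: cid; have [|q] := @rat_in_itvoo R (x ord0 i - k.+1%:R^-1) (x ord0 i + k.+1%:R^-1).
      by rewrite ltrD2l (lt_trans _ kgt0)// oppr_lt0.
    by rewrite in_itv/= => qi; exists q; rewrite distrC ltr_distl.
  pose q : 'rV[rat]_n := \row_i sval (qP i).
  exists (q, k) => //; rewrite /F.
  have -> : `[< B (q, k) `<=` U >].
    apply/asboolP => y yB; apply: xeU; apply: ball_rV => // i.
    have := yB i; have := svalP (qP i); rewrite /= /q mxE => h1 h2.
    rewrite (le_lt_trans (ler_distD (ratr (sval (qP i))) _ _))//.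
    by rewrite [ltRHS]splitr ltrD// ?(lt_trans h1)// distrC (lt_trans h2).
  by move=> i /=; rewrite /q mxE; exact: svalP (qP i).
apply: countable_bigcupT_measurable; first exact: countableP.
move=> p; rewrite /F; case: ifP => _; last exact: measurable0.
have -> : B p = \big[setI/setT]_(i < n)
    (@rV_coord R n i @^-1` [set t | `|t - ratr (p.1 ord0 i)| < p.2.+1%:R^-1]).
  rewrite -bigcap_seq; apply/seteqP; split => [x Bx i _|x Bx i]; first exact: Bx.
  by apply: (Bx i) => /=; rewrite mem_index_enum.
apply: bigsetI_measurable => i _; rewrite -[X in measurable X]setTI.
apply: measurable_rV_coord => //.
have -> : [set t | `|t - ratr (p.1 ord0 i)| < p.2.+1%:R^-1] =
    ball (ratr (p.1 ord0 i) : R) p.2.+1%:R^-1.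
  by apply/seteqP; split=> t; rewrite /ball/= distrC.
by apply: measurable_realfun.open_measurable; apply: ball_open; rewrite invr_gt0.
Qed.

Lemma continuous_measurable_rV n (f : 'rV[R]_n -> R) :
  continuous f -> measurable_fun setT f.
Proof.
move=> cf; apply: (measurability _ (RGenOInfty.measurableE R)).
move=> /= _ [_ [a ->]] <-; rewrite setTI; apply: open_measurable_rV.
by apply: open_comp => // x _; exact: cf.
Qed.

Lemma coord_cont n (i : 'I_n) : continuous (fun x : 'rV[R]_n => x ord0 i).
Proof. by move=> x; exact: coord_continuous. Qed.

Definition box n (a b : 'I_n -> R) : set 'rV[R]_n :=
  [set x | forall i, a i < x ord0 i < b i].

Lemma boxE n (a b : 'I_n -> R) : box a b = \big[setI/setT]_(i < n)
    (@rV_coord R n i @^-1` `]a i, b i[%classic).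
Proof.
rewrite -bigcap_seq; apply/seteqP; split => [x Bx i _|x Bx i].
  by rewrite /= in_itv/=; exact: Bx.
by have := Bx i; rewrite /= mem_index_enum in_itv/=; exact.
Qed.

Lemma measurable_box n (a b : 'I_n -> R) : measurable (box a b).
Proof.
rewrite boxE; apply: bigsetI_measurable => i _; rewrite -[X in measurable X]setTI.
by apply: measurable_rV_coord => //; exact: measurable_itv.
Qed.

Lemma box_snoc n (a b : 'I_n.+1 -> R) p :
  box a b (snoc p) = (box (a \o lift ord_max) (b \o lift ord_max) p.1 /\
                      `]a ord_max, b ord_max[%classic p.2).
Proof.
rewrite /box/= in_itv/=; apply/propext; split => [h|[h1 h2] i].
  by split => [i|]; [have := h (lift ord_max i); rewrite snoc_lift|
    have := h ord_max; rewrite snoc_max].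
by case: (unliftP ord_max i) => [j|] ->; rewrite ?snoc_lift ?snoc_max//; exact: h1.
Qed.

Lemma leb_box_fin n (a b : 'I_n -> R) : (leb R n (box a b) < +oo)%E.
Proof.
elim: n a b => [|n IH] a b /=; first by rewrite diracE; case: (_ \in _); rewrite ltry.
rewrite /snoc_measure /pushforward.
have -> : @snoc R n @^-1` box a b =
    box (a \o lift ord_max) (b \o lift ord_max) `*` `]a ord_max, b ord_max[%classic.
  by apply/seteqP; split => p; rewrite /preimage/= box_snoc.
rewrite product_measure1E//; [|exact: measurable_box].
apply: lte_mul_pinfty => //; first by rewrite ge0_fin_numE//; exact: IH.
rewrite [X in (X < _)%E](_ : _ = lebesgue_measure [set` `]a ord_max, b ord_max[])//.
by rewrite lebesgue_measure_itv/=; case: ifP => _; rewrite ltry.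
Qed.

Lemma bounded_integrable n (D : set 'rV[R]_n) (f : 'rV[R]_n -> R) (M : R) :
  measurable D -> (leb R n D < +oo)%E -> measurable_fun D f ->
  (forall x, D x -> `|f x| <= M) -> (leb R n).-integrable D (EFin \o f).
Proof.
move=> mD fD mf bf; apply: measurable_bounded_integrable => //.
exists M; split; first exact: num_real.
by move=> N MN x Dx; apply: (le_trans (bf x Dx)); exact: ltW.
Qed.

Section FubiniBox.
Variables (n : nat) (a b : 'I_n.+1 -> R) (f : 'rV[R]_n.+1 -> R) (M : R).
Hypotheses (mf : measurable_fun setT f) (bf : forall x, box a b x -> `|f x| <= M).
Let a' := a \o lift ord_max.
Let b' := b \o lift ord_max.
Let g : 'rV[R]_n.+1 -> R := f \_ (box a b).

Let mg : measurable_fun setT g.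
Proof. apply/(measurable_restrictT _ _).1; [exact: measurable_box|exact: measurable_funS mf]. Qed.

Let ig : (leb R n.+1).-integrable setT (EFin \o g).
Proof.
rewrite /g -restrict_EFin; apply/integrable_restrict => //.
  exact: measurable_box.
rewrite setTI; apply: (@bounded_integrable _ _ _ M); rewrite ?leb_box_fin//.
- exact: measurable_box.
- exact: measurable_funS mf.
Qed.

Let igs : (leb R n \x lebesgue_measure)%E.-integrable setT ((EFin \o g) \o @snoc R n).
Proof.
have mgs : measurable_fun setT ((EFin \o g) \o @snoc R n).
  apply: measurableT_comp; first exact/measurable_EFinP.
  exact: measurable_snoc.
apply/integrableP; split => //.
have /integrableP[_] := ig; rewrite /= /snoc_measure ge0_integral_pushforward//.
  exact: measurable_snoc.
have h : measurable_fun setT (abse \o (EFin \o g)).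
  by apply: measurableT_comp => //; exact/measurable_EFinP.
exact: h.
Qed.

Let intE : (\int[leb R n.+1]_(x in box a b) (f x)%:E =
  \int[leb R n \x lebesgue_measure]_p (g (snoc p))%:E)%E.
Proof.
rewrite integral_mkcond restrict_EFin /= /snoc_measure integral_pushforward//.
- exact: measurable_snoc.
- exact/measurable_EFinP.
Qed.

Let gE p : (g (snoc p))%:E = (((fun t => ((f (snoc (p.1, t)))%:E)) \_ `]a ord_max, b ord_max[%classic) \_ (fun _ => box a' b' p.1)) p.2.
Proof.
rewrite /g /patch; case: p => x t /=.
have [h|h] := boolP (snoc (x, t) \in box a b).
  move: (h); rewrite inE box_snoc => -[h1 h2].
  by rewrite !mem_set.
have [h1|//] := boolP (_ \in _); have [h2|//] := boolP (_ \in _).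
exfalso; move/negP: h; apply; rewrite inE box_snoc.
by rewrite !inE in h1 h2.
Qed.

Lemma int_box_snoc : (\int[leb R n.+1]_(x in box a b) (f x)%:E =
  \int[leb R n]_(x in box a' b')
     \int[lebesgue_measure]_(t in `]a ord_max, b ord_max[) (f (snoc (x, t)))%:E)%E.
Proof.
rewrite intE; have <- := integral12_prod_meas1 igs.
rewrite [RHS]integral_mkcond.
apply: eq_integral => x _; rewrite /fubini_F/=.
under eq_integral do rewrite gE/=.
rewrite /patch; case: ifPn => xB.
  rewrite [RHS]integral_mkcond; apply: eq_integral => t _.
  by rewrite mem_set//; exact: set_mem.
rewrite integral0_eq// => t _; rewrite memNset//.
by move=> h; move/negP: xB; apply; exact: mem_set.
Qed.

(** Keeping the last coordinate outside is what the induction on the dimension in [ibp_box] and the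
    slicing by height in [strip_le] need. *)
Lemma int_box_snocC : (\int[leb R n.+1]_(x in box a b) (f x)%:E =
  \int[lebesgue_measure]_(t in `]a ord_max, b ord_max[)
     \int[leb R n]_(x in box a' b') (f (snoc (x, t)))%:E)%E.
Proof.
rewrite intE; have <- := integral21_prod_meas1 igs.
rewrite [RHS]integral_mkcond.
apply: eq_integral => t _; rewrite /fubini_G/=.
under eq_integral do rewrite gE/=.
rewrite /patch; case: ifPn => tB; last first.
  by apply: integral0_eq => x _; case: ifP.
rewrite [RHS]integral_mkcond; apply: eq_integral => x _.
rewrite [in RHS]/patch; case: (boolP (x \in box a' b')) => xB.
  by rewrite mem_set//; exact: set_mem.
by rewrite memNset// => h; move/negP: xB; apply; exact: mem_set.
Qed.

End FubiniBox.


Lemma continuous_rV (T : topologicalType) n (f : T -> 'rV[R]_n) :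
  (forall i, continuous (fun x => f x ord0 i)) -> continuous f.
Proof.
move=> cf x; apply/cvg_ballP => e e0.
have : \forall y \near x, forall i, `|f x ord0 i - f y ord0 i| < e.
  apply: filter_forall => i; have /cvgrPdist_lt := cf i x.
  by apply.
by apply: filterS => y hy; exact: ball_rV.
Qed.

Lemma continuous_snocl n (t : R) : continuous (fun x : 'rV[R]_n => snoc (x, t)).
Proof.
apply: continuous_rV => i; case: (unliftP ord_max i) => [j|] ->.
  by under eq_fun do rewrite snoc_lift; exact: coord_cont.
by under eq_fun do rewrite snoc_max; exact: cst_continuous.
Qed.

Lemma continuous_snocr n (x : 'rV[R]_n) : continuous (fun t : R => snoc (x, t)).
Proof.
apply: continuous_rV => i; case: (unliftP ord_max i) => [j|] ->.
  by under eq_fun do rewrite snoc_lift; exact: cst_continuous.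
by under eq_fun do rewrite snoc_max; move=> ?; exact: cvg_id.
Qed.

Lemma cont_bounded_box n (a b : 'I_n -> R) (f : 'rV[R]_n -> R) :
  continuous f -> exists M, forall x, box a b x -> `|f x| <= M.
Proof.
move=> cf.
have cB : compact [set v : 'rV[R]_n | forall i, v ord0 i \in `[a i, b i]].
  by apply: (@rV_compact _  _ (fun i => `[a i, b i]%classic)) => i; exact: segment_compact.
have /compact_bounded[M [_ hM]] := continuous_compact (continuous_subspaceT cf) cB.
exists (M + 1) => x Bx; apply: hM; first by rewrite ltrDl.
by exists x => // i; rewrite in_itv/=; have /andP[/ltW -> /ltW ->] := Bx i.
Qed.

(** A directional derivative sees only the restriction to a line, so it can be computed from any
    other function with the same restriction: a slice, a function of one coordinate, a composition
    with a projection. *)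
Lemma is_derive_line (V W : normedModType R) (f : V -> R) (g : W -> R) x v y w df :
  (forall h : R, f (h *: v + x) = g (h *: w + y)) ->
  is_derive x v f df -> is_derive y w g df.
Proof.
move=> fg [].
have fg0 : f x = g y by have := fg 0; rewrite !scale0r !add0r.
have E : (fun h : R => h^-1 *: ((f \o shift x) (h *: v) - f x)) =
    (fun h : R => h^-1 *: ((g \o shift y) (h *: w) - g y)).
  by apply/funext => h /=; rewrite fg fg0.
by rewrite /derivable /derive /= E => h1 h2; split.
Qed.

Definition has_pd n (i : 'I_n) (G dG : 'rV[R]_n -> R) :=
  forall x, is_derive x (evec R i) G (dG x).

Lemma snoc_line_lift n (j : 'I_n) (x : 'rV[R]_n) t h :
  snoc (h *: evec R j + x, t) = h *: evec R (lift ord_max j) + snoc (x, t).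
Proof.
apply/rowP => k; rewrite [RHS]mxE; case: (unliftP ord_max k) => [l|] ->.
  by rewrite !snoc_lift/= !mxE/= (inj_eq lift_inj).
by rewrite !snoc_max/= !mxE/= (negbTE (neq_lift _ _)) mulr0 add0r.
Qed.

Lemma snoc_line_max n (x : 'rV[R]_n) (t h : R) :
  snoc (x, h *: (1 : R) + t) = h *: evec R ord_max + snoc (x, t).
Proof.
apply/rowP => k; rewrite [RHS]mxE; case: (unliftP ord_max k) => [l|] ->.
  by rewrite !snoc_lift/= !mxE/= eq_sym (negbTE (neq_lift _ _)) mulr0 add0r.
by rewrite !snoc_max/= [in RHS]mxE mxE !eqxx/= mulr1 /GRing.scale/= mulr1.
Qed.

Lemma has_pd_snocl n (j : 'I_n) G dG t : has_pd (lift ord_max j) G dG ->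
  has_pd j (fun x => G (snoc (x, t))) (fun x => dG (snoc (x, t))).
Proof.
by move=> h x; apply: is_derive_line (h _) => k; rewrite snoc_line_lift.
Qed.

Lemma has_pd_snocr n (x : 'rV[R]_n) G dG (t : R) : has_pd ord_max G dG ->
  is_derive t (1 : R) (fun t : R => G (snoc (x, t))) (dG (snoc (x, t))).
Proof.
by move=> h; apply: is_derive_line (h _) => k; rewrite snoc_line_max.
Qed.

Lemma continuous_FTCoo (f F : R -> R) (a b : R) : a < b ->
  continuous f -> (forall t : R, is_derive t (1 : R) F (f t)) ->
  (\int[lebesgue_measure]_(x in `]a, b[) (f x)%:E = (F b - F a)%:E)%E.
Proof.
move=> ab cf dF.
have dF1 t : derivable F t 1 by case: (dF t).
have cF : continuous F by move=> t; apply: differentiable_continuous; exact/derivable1_diffP.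
rewrite -(@integral_itv_bndoo _ _ _ _ true false); last first.
  by apply/measurable_EFinP; apply: measurable_funTS; exact: continuous_measurable_fun.
rewrite (@continuous_FTC2 _ f F)//.
- exact: continuous_subspaceT.
- split => [t _ //||]; [exact/cvg_at_right_filter/cF|exact/cvg_at_left_filter/cF].
- by move=> t _; rewrite derive1E; case: (dF t).
Qed.

(** Values are assumed to vanish on the top face only; the bottom face stays as a boundary term and
    later becomes the boundary of the half-space. *)
Lemma ibp_max_box n (a b : 'I_n.+1 -> R) (G dG : 'rV[R]_n.+1 -> R) :
  a ord_max < b ord_max -> continuous G -> continuous dG -> has_pd ord_max G dG ->
  (forall x : 'rV[R]_n.+1, x ord0 ord_max = b ord_max -> G x = 0) ->
  (\int[leb R n.+1]_(x in box a b) (dG x)%:E =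
   \int[leb R n]_(x in box (a \o lift ord_max) (b \o lift ord_max))
      (- G (snoc (x, a ord_max)))%:E)%E.
Proof.
move=> ab cG cdG pG Gb.
have [M hM] := cont_bounded_box a b cdG.
rewrite (int_box_snoc (M := M))//; last exact: continuous_measurable_rV.
apply: eq_integral => x _.
have cdx : continuous (fun t : R => dG (snoc (x, t))).
  by move=> t; apply: continuous_comp; [exact: continuous_snocr|exact: cdG].
have -> := continuous_FTCoo ab cdx (fun t => has_pd_snocr x t pG).
by rewrite (Gb (snoc (x, b ord_max))) ?snoc_max// sub0r.
Qed.

Lemma ibp_box n (i : 'I_n) (a b : 'I_n -> R) (G dG : 'rV[R]_n -> R) :
  a i < b i -> continuous G -> continuous dG -> has_pd i G dG ->
  (forall x : 'rV[R]_n, x ord0 i = a i \/ x ord0 i = b i -> G x = 0) ->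
  (\int[leb R n]_(x in box a b) (dG x)%:E = 0)%E.
Proof.
elim: n i a b G dG => [[]//|n IH] i a b G dG ab cG cdG pG G0.
case: (unliftP ord_max i) => [j|] ij; rewrite ij in ab pG G0; last first.
  rewrite (ibp_max_box ab cG cdG pG); last by move=> x xb; apply: G0; right.
  apply: integral0_eq => x _; rewrite G0 ?oppr0//.
  by left; rewrite snoc_max.
have [M hM] := cont_bounded_box a b cdG.
rewrite (int_box_snocC (M := M))//; last exact: continuous_measurable_rV.
apply: integral0_eq => t _.
apply: (IH j _ _ (fun x => G (snoc (x, t)))) => //.
- by move=> x; apply: continuous_comp; [exact: continuous_snocl|exact: cG].
- by move=> x; apply: continuous_comp; [exact: continuous_snocl|exact: cdG].
- exact: has_pd_snocl.
- by move=> x h; apply: G0; rewrite snoc_lift.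
Qed.

End RowVectors.

(** * Real square-integrable functions *)

Section L2.
Context d (T : measurableType d) (R : realType) (mu : {measure set T -> \bar R}).
Variable D : set T.
Hypothesis mD : measurable D.
Implicit Types f g h : T -> R.

Definition L2 f := measurable_fun D f /\ mu.-integrable D (EFin \o (fun x => f x ^+ 2)).

Definition nrm f : R := Num.sqrt (\int[mu]_(x in D) (f x ^+ 2)).

Lemma le_integrableR f g : measurable_fun D f -> (forall x, D x -> `|f x| <= g x) ->
  mu.-integrable D (EFin \o g) -> mu.-integrable D (EFin \o f).
Proof.
move=> mf fg; apply: le_integrable => //; first exact/measurable_EFinP.
move=> x Dx; rewrite /= lee_fin (le_trans (fg x Dx))// ler_norm//.
Qed.

Lemma integrableDR f g : mu.-integrable D (EFin \o f) -> mu.-integrable D (EFin \o g) ->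
  mu.-integrable D (EFin \o (fun x => f x + g x)).
Proof. by move=> h1 h2; have := integrableD mD h1 h2. Qed.

Lemma integrableBR f g : mu.-integrable D (EFin \o f) -> mu.-integrable D (EFin \o g) ->
  mu.-integrable D (EFin \o (fun x => f x - g x)).
Proof. by move=> h1 h2; have := integrableB mD h1 h2. Qed.

Lemma integrableZR k f : mu.-integrable D (EFin \o f) ->
  mu.-integrable D (EFin \o (fun x => k * f x)).
Proof. by move=> h1; have := integrableZl mD k h1. Qed.

Lemma integrable_sumR (I : Type) (s : seq I) (F : I -> T -> R) :
  (forall i, mu.-integrable D (EFin \o F i)) ->
  mu.-integrable D (EFin \o (fun x => \sum_(i <- s) F i x)).
Proof.
move=> h; elim: s => [|i s IH].
  by under eq_fun do rewrite big_nil; exact: integrable0.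
by under eq_fun do rewrite big_cons; exact: integrableDR.
Qed.

Lemma Rintegral_sum (I : Type) (s : seq I) (F : I -> T -> R) :
  (forall i, mu.-integrable D (EFin \o F i)) ->
  \int[mu]_(x in D) (\sum_(i <- s) F i x) = \sum_(i <- s) \int[mu]_(x in D) F i x.
Proof.
move=> h; elim: s => [|i s IH].
  by under eq_Rintegral do rewrite big_nil; rewrite big_nil /Rintegral integral0.
under eq_Rintegral do rewrite big_cons.
by rewrite RintegralD// ?big_cons ?IH//; exact: integrable_sumR.
Qed.

Lemma L2_sq f : L2 f -> mu.-integrable D (EFin \o (fun x => f x ^+ 2)).
Proof. by case. Qed.

Lemma L2_mul f g : L2 f -> L2 g -> mu.-integrable D (EFin \o (fun x => f x * g x)).
Proof.
move=> [mf if2] [mg ig2].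
apply: (@le_integrableR _ (fun x => f x ^+ 2 + g x ^+ 2)).
- exact: measurable_funM.
- move=> x _; rewrite ler_norml; nra.
- exact: integrableDR.
Qed.

Lemma L2_le f g : measurable_fun D f -> (forall x, D x -> `|f x| <= `|g x|) -> L2 g -> L2 f.
Proof.
move=> mf fg [mg ig]; split => //.
apply: (le_integrableR _ _ ig); first exact: measurable_funX.
by move=> x Dx; rewrite normrX -[leRHS]real_normK ?num_real// lerXn2r ?nnegrE ?fg//.
Qed.

Lemma L2Z k f : L2 f -> L2 (fun x => k * f x).
Proof.
move=> [mf if2]; split; first exact: measurable_funM.
have := integrableZR (k ^+ 2) if2; congr (_.-integrable _ _).
by apply/funext => x /=; rewrite exprMn.
Qed.

Lemma L2N f : L2 f -> L2 (fun x => - f x).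
Proof. by move=> /(L2Z (-1)); under eq_fun do rewrite mulN1r. Qed.

Lemma L2D f g : L2 f -> L2 g -> L2 (fun x => f x + g x).
Proof.
move=> Lf Lg; split; first by apply: measurable_funD; [case: Lf|case: Lg].
have E : (fun x => (f x + g x) ^+ 2) = (fun x => f x ^+ 2 + 2 * (f x * g x) + g x ^+ 2).
  by apply/funext => x; ring.
by rewrite E; apply: integrableDR; [apply: integrableDR|]; [exact: L2_sq|
  apply: integrableZR; exact: L2_mul|exact: L2_sq].
Qed.

Lemma L2B f g : L2 f -> L2 g -> L2 (fun x => f x - g x).
Proof. by move=> Lf /L2N; exact: L2D. Qed.

Lemma L2_bd c h f : measurable_fun D h -> (forall x, D x -> `|h x| <= c) -> L2 f ->
  L2 (fun x => h x * f x).
Proof.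
move=> mh hc Lf; apply: (@L2_le _ (fun x => c * f x)); last exact: L2Z.
  by apply: measurable_funM => //; case: Lf.
by move=> x Dx; rewrite !normrM ler_wpM2r// (le_trans (hc x Dx))// ler_norm.
Qed.

Lemma nrm_ge0 f : 0 <= nrm f. Proof. exact: sqrtr_ge0. Qed.

Lemma nrm0 : nrm (fun=> 0) = 0.
Proof. by rewrite /nrm /Rintegral integral0_eq ?sqrtr0// => x _ /=; rewrite expr0n. Qed.

Lemma nrm_sq f : nrm f ^+ 2 = \int[mu]_(x in D) (f x ^+ 2).
Proof. by rewrite sqr_sqrtr// Rintegral_ge0// => x _; exact: sqr_ge0. Qed.

Lemma CauchySchwarz f g : L2 f -> L2 g ->
  `|\int[mu]_(x in D) (f x * g x)| <= nrm f * nrm g.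
Proof.
move=> Lf Lg.
have Ifg := L2_mul Lf Lg.
set B := \int[mu]_(x in D) _.
have key s : 0 <= s ^+ 2 * nrm f ^+ 2 + 2 * s * B + nrm g ^+ 2.
  rewrite !nrm_sq -RintegralZl//; last exact: L2_sq.
  rewrite -RintegralZl// -RintegralD//; last 2 first.
    by apply: integrableZR; exact: L2_sq.
    exact: integrableZR.
  rewrite -RintegralD//; last 2 first.
    by apply: integrableDR; apply: integrableZR => //; exact: L2_sq.
    exact: L2_sq.
  apply: Rintegral_ge0 => x _.
  by rewrite (_ : _ + _ = (s * f x + g x) ^+ 2) ?sqr_ge0//; ring.
have := nrm_ge0 f; have := nrm_ge0 g; move: (nrm f) (nrm g) key => F G key G0 F0.
rewrite -(@ler_pXn2r _ 2)// ?nnegrE ?mulr_ge0// real_normK ?num_real//.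
(* If [nrm f = 0] the quadratic [key] is affine in [s]; unless [B = 0] it takes the value [-1] at
   the point chosen below. *)
have [F00|Fn0] := eqVneq F 0.
  have [->|Bn0] := eqVneq B 0; first by rewrite expr0n/= sqr_ge0.
  have := key (- (G ^+ 2 + 1) / (2 * B)); rewrite F00.
  have -> : 2 * (- (G ^+ 2 + 1) / (2 * B)) * B = - (G ^+ 2 + 1) by field.
  by nra.
have := key (- B / F ^+ 2).
have -> : (- B / F ^+ 2) ^+ 2 * F ^+ 2 + 2 * (- B / F ^+ 2) * B + G ^+ 2 =
  ((F * G) ^+ 2 - B ^+ 2) / F ^+ 2 by field.
by rewrite pmulr_lge0 ?subr_ge0// invr_gt0 exprn_gt0// lt_neqAle eq_sym Fn0.
Qed.

Lemma nrmD f g : L2 f -> L2 g -> nrm (fun x => f x + g x) <= nrm f + nrm g.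
Proof.
move=> Lf Lg; rewrite -(@ler_pXn2r _ 2)// ?nnegrE ?addr_ge0 ?nrm_ge0//.
rewrite nrm_sq.
have -> : \int[mu]_(x in D) (f x + g x) ^+ 2 =
    nrm f ^+ 2 + 2 * \int[mu]_(x in D) (f x * g x) + nrm g ^+ 2.
  rewrite !nrm_sq -RintegralZl//; last exact: L2_mul.
  rewrite -RintegralD//; last 2 first.
    exact: L2_sq.
    by apply: integrableZR; exact: L2_mul.
  rewrite -RintegralD//; last 2 first.
    by apply: integrableDR; [exact: L2_sq|apply: integrableZR; exact: L2_mul].
    exact: L2_sq.
  by apply: eq_Rintegral => x _; ring.
have := CauchySchwarz Lf Lg; rewrite ler_norml => /andP[_ h].
by nra.
Qed.

Lemma nrmN f : nrm (fun x => - f x) = nrm f.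
Proof. by rewrite /nrm; congr Num.sqrt; apply: eq_Rintegral => x _; rewrite sqrrN. Qed.

Lemma nrmZ k f : L2 f -> nrm (fun x => k * f x) = `|k| * nrm f.
Proof.
move=> Lf; rewrite /nrm; under eq_Rintegral do rewrite exprMn.
by rewrite RintegralZl//; [rewrite sqrtrM ?sqr_ge0// sqrtr_sqr|exact: L2_sq].
Qed.

Lemma nrmB f g : L2 f -> L2 g -> nrm (fun x => f x - g x) <= nrm f + nrm g.
Proof. by move=> Lf Lg; rewrite -(nrmN g); apply: nrmD => //; exact: L2N. Qed.

Lemma nrm_le f g : L2 f -> L2 g -> (forall x, D x -> `|f x| <= `|g x|) -> nrm f <= nrm g.
Proof.
move=> Lf Lg fg; apply: ler_wsqrtr; apply: le_Rintegral => //; try exact: L2_sq.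
move=> x Dx; rewrite -[leLHS]real_normK ?num_real// -[leRHS]real_normK ?num_real//.
by rewrite lerXn2r ?nnegrE ?fg.
Qed.

(** Dominated convergence along an exhausting sequence of sets. These will be the levels [|g| <= m]
    in [cos_dense] and annuli around the origin in [truncate]. *)
Lemma L2_tail f (A : nat -> set T) : L2 f -> (forall m, measurable (A m)) ->
  (forall x, D x -> \forall m \near \oo, A m x) -> forall e, 0 < e ->
  exists m, \int[mu]_(x in D) ((f x - \1_(A m) x * f x) ^+ 2) < e.
Proof.
move=> Lf mA cA e e0.
pose F m x := (f x - \1_(A m) x * f x) ^+ 2.
have mF m : measurable_fun D (EFin \o F m).
  apply/measurable_EFinP; apply: measurable_funX; apply: measurable_funB; first by case: Lf.
  by apply: measurable_funM; [exact: measurable_indic|case: Lf].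
have cF : {ae mu, forall x, D x -> EFin (F m x) @[m --> \oo] --> (0 : \bar R)}.
  apply: aeW => x Dx; apply: cvg_near_cst.
  apply: filterS (cA x Dx) => m Amx.
  by rewrite /F indicE mem_set// mul1r subrr expr0n.
have bF : {ae mu, forall x m, D x -> (`|EFin (F m x)| <= EFin (f x ^+ 2)%R)%E}.
  apply: aeW => x m Dx; rewrite /= lee_fin ger0_norm ?sqr_ge0// /F indicE.
  by case: (_ \in _); rewrite ?mul1r ?subrr ?mul0r ?subr0 ?expr0n//= sqr_ge0.
have [_ _ h] := dominated_convergence mD mF (measurable_cst 0%E) cF (L2_sq Lf) bF.
rewrite integral0 in h.
have := h => /fine_cvgP[_ /cvgrPdist_lt/(_ e e0)[N _ /(_ N)]] /= hN.
exists N; have := hN (leqnn N); rewrite sub0r normrN; apply: le_lt_trans.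
exact: ler_norm.
Qed.

End L2.

Section HalfSpace.
Variable R : realType.

Lemma contM (T : topologicalType) (f g : T -> R) : continuous f -> continuous g ->
  continuous (fun x => f x * g x).
Proof. by move=> cf cg x; exact: (cvgM (cf x) (cg x)). Qed.

Lemma contD (T : topologicalType) (f g : T -> R) : continuous f -> continuous g ->
  continuous (fun x => f x + g x).
Proof. by move=> cf cg x; exact: (cvgD (cf x) (cg x)). Qed.

Lemma contN (T : topologicalType) (f : T -> R) : continuous f ->
  continuous (fun x => - f x).
Proof. by move=> cf x; exact: (cvgN (cf x)). Qed.

Lemma contB (T : topologicalType) (f g : T -> R) : continuous f -> continuous g ->
  continuous (fun x => f x - g x).
Proof. by move=> cf /contN; exact: contD. Qed.

Lemma cont_sum (T : topologicalType) (I : Type) (s : seq I) (F : I -> T -> R) :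
  (forall i, continuous (F i)) -> continuous (fun x => \sum_(i <- s) F i x).
Proof.
move=> h; elim: s => [|i s IH].
  by under eq_fun do rewrite big_nil; exact: cst_continuous.
by under eq_fun do rewrite big_cons; exact: contD.
Qed.

(** Bounded support phrased through the coordinates, to fit boxes; [bsuppP] relates it to compact
    support. *)
Definition bsupp n (f : 'rV[R]_n -> R) :=
  exists M : R, forall (x : 'rV[R]_n) (i : 'I_n), M < `|x ord0 i| -> f x = 0.

Lemma bsuppMl n (f g : 'rV[R]_n -> R) : bsupp f -> bsupp (fun x => f x * g x).
Proof. by move=> [M h]; exists M => x i /h ->; rewrite mul0r. Qed.

Lemma bsuppMr n (f g : 'rV[R]_n -> R) : bsupp f -> bsupp (fun x => g x * f x).
Proof. by move=> [M h]; exists M => x i /h ->; rewrite mulr0. Qed.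

Lemma bsuppD n (f g : 'rV[R]_n -> R) : bsupp f -> bsupp g -> bsupp (fun x => f x + g x).
Proof.
move=> [M h] [N k]; exists (Num.max M N) => x i; rewrite gt_max => /andP[h1 h2].
by rewrite (h x i)// (k x i)// addr0.
Qed.

Lemma bsuppN n (f : 'rV[R]_n -> R) : bsupp f -> bsupp (fun x => - f x).
Proof. by move=> [M h]; exists M => x i /h ->; rewrite oppr0. Qed.

Lemma bsupp_sum (I : Type) (s : seq I) n (F : I -> 'rV[R]_n -> R) :
  (forall i, bsupp (F i)) -> bsupp (fun x => \sum_(i <- s) F i x).
Proof.
move=> h; elim: s => [|i s IH].
  by exists 0 => x j _; rewrite big_nil.
by under eq_fun do rewrite big_cons; exact: bsuppD.
Qed.

Lemma bsupp_pd n (i : 'I_n) (G dG : 'rV[R]_n -> R) : bsupp G -> has_pd i G dG -> bsupp dG.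
Proof.
move=> [M h] pG; exists M => x j xj.
have [_ <-] := pG x.
have : {near x, G =1 cst 0}.
  have : \forall y \near x, M < `|(y : 'rV[R]_n) ord0 j|.
    have /cvgrPdist_lt/(_ (`|x ord0 j| - M)) := @coord_cont R n j x.
    rewrite subr_gt0 => /(_ xj); apply: filterS => y hy.
    have := ler_normB (x ord0 j) (x ord0 j - y ord0 j).
    rewrite opprB addrCA subrr addr0.
    have := lerB_dist (x ord0 j) (y ord0 j).
    by lra.
  by apply: filterS => y; exact: h.
move=> /near_eq_derive => /(_ (evec R i)) ->; first by rewrite derive_cst.
Qed.

Lemma cc_integrable n (D : set 'rV[R]_n) (f : 'rV[R]_n -> R) : measurable D ->
  continuous f -> bsupp f -> (leb R n).-integrable D (EFin \o f).
Proof.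
move=> mD cf [M sf]; apply: (@integrableS _ _ _ _ setT) => //.
pose a (i : 'I_n) := - (`|M| + 1); pose b (i : 'I_n) := `|M| + 1.
have -> : EFin \o f = (EFin \o f) \_ (box a b).
  apply/funext => x; rewrite patchE; case: ifPn => // xB /=.
  have [i xi] : exists i, M < `|x ord0 i|.
    apply/existsP; rewrite -[X in is_true X]negbK; apply/negP => /existsPn h.
    move/negP: xB; apply; apply: mem_set => i.
    have := h i; rewrite -leNgt => h1.
    by rewrite /a /b -ltr_norml; have := ler_norm M; lra.
  by rewrite (sf x i).
apply/integrable_restrict => //; first exact: measurable_box.
rewrite setTI; have [N hN] := cont_bounded_box a b cf.
apply: (bounded_integrable (M := N)) => //; [exact: measurable_box|exact: leb_box_fin|].
by apply: measurable_funTS; exact: continuous_measurable_rV.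
Qed.

Lemma cc_L2 n (D : set 'rV[R]_n) (f : 'rV[R]_n -> R) : measurable D ->
  continuous f -> bsupp f -> L2 (leb R n) D f.
Proof.
move=> mD cf sf; split; first by apply: measurable_funTS; exact: continuous_measurable_rV.
apply: cc_integrable => //; last first.
  by under eq_fun do rewrite expr2; exact: bsuppMl.
by under eq_fun do rewrite expr2; exact: contM.
Qed.

Lemma measurable_half d : measurable (half_space R d).
Proof.
apply: open_measurable_rV.
have -> : half_space R d = (fun x : 'rV[R]_d.+1 => x ord0 ord_max) @^-1` `]0, +oo[%classic.
  by apply/seteqP; split => x; rewrite /half_space/= in_itv/= andbT.
by apply: open_comp => [x _|]; [exact: coord_cont|exact: interval_open].
Qed.

(** The bottom face lies on the boundary of the half-space. The other faces lie at distance
    [|M| + 1] rather than [M], so that functions supported in [|x_i| <= M] vanish on them and the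
    box is non-empty for every real [M]. *)
Definition bigbox (M : R) d : ('I_d.+1 -> R) * ('I_d.+1 -> R) :=
  (fun i => if i == ord_max then 0 else - (`|M| + 1), fun=> `|M| + 1).

Lemma half_boxE d (f : 'rV[R]_d.+1 -> R) M : (forall (x : 'rV[R]_d.+1) (i : 'I_d.+1), M < `|x ord0 i| -> f x = 0) ->
  f \_ (half_space R d) = f \_ (box (bigbox M d).1 (bigbox M d).2).
Proof.
move=> sf; apply/funext => x; rewrite !patchE /=.
have Mge := ler_norm M.
have [h|h] := boolP (x \in box _ _).
  rewrite mem_set//; move/set_mem: h => /(_ ord_max).
  by rewrite /bigbox/= eqxx /half_space/= => /andP[].
case: ifPn => // xO; move/set_mem: xO; rewrite /half_space/= => x0.
have [i xi] : exists i, M < `|x ord0 i|.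
  apply/existsP; rewrite -[X in is_true X]negbK; apply/negP => /existsPn hi.
  move/negP: h; apply; apply: mem_set => i; rewrite /bigbox/=.
  have := hi i; rewrite -leNgt ler_norml => /andP[h1 h2].
  by case: eqP => [ii|_]; [move: ii h2 => -> h2|]; lra.
by rewrite (sf x i).
Qed.

Lemma ibp_half d (i : 'I_d.+1) (G dG : 'rV[R]_d.+1 -> R) : i != ord_max ->
  continuous G -> continuous dG -> bsupp G -> has_pd i G dG ->
  \int[leb R d.+1]_(x in half_space R d) dG x = 0.
Proof.
move=> im cG cdG sG pG; have [N sdG] := bsupp_pd sG pG; have [M sG'] := sG.
pose K := Num.max M N.
rewrite Rintegral_mkcond (@half_boxE _ _ K); last first.
  by move=> x j; rewrite gt_max => /andP[_]; exact: sdG.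
rewrite -Rintegral_mkcond /Rintegral (@ibp_box _ _ i _ _ G)//.
  rewrite /bigbox/= (negbTE im); have := normr_ge0 K; lra.
move=> x xi; apply: (sG' _ i); have Kge := ler_norm K; have K0 := normr_ge0 K.
have MK : M <= K by rewrite le_max lexx.
move: xi; rewrite /bigbox/= (negbTE im) => -[] ->; rewrite ?normrN gtr0_norm; lra.
Qed.

Lemma ibp_half_max d (G dG : 'rV[R]_d.+1 -> R) :
  continuous G -> continuous dG -> bsupp G -> has_pd ord_max G dG ->
  \int[leb R d.+1]_(x in half_space R d) dG x =
  - \int[leb R d]_x G (boundary_pt x).
Proof.
move=> cG cdG sG pG; have [N sdG] := bsupp_pd sG pG; have [M sG'] := sG.
pose K := Num.max M N.
have MK : M <= K by rewrite le_max lexx.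
have Kge := ler_norm K; have K0 := normr_ge0 K.
rewrite Rintegral_mkcond (@half_boxE _ _ K); last first.
  by move=> x j; rewrite gt_max => /andP[_]; exact: sdG.
rewrite -Rintegral_mkcond {1}/Rintegral (@ibp_max_box _ _ _ _ G)//; last 2 first.
- by rewrite /bigbox/= eqxx; have := normr_ge0 K; lra.
- move=> x xi; apply: (sG' _ ord_max); rewrite xi /bigbox/= gtr0_norm; lra.
rewrite -[X in fine X = _]/(_) -/(Rintegral _ _ _).
have cGb : continuous (fun x : 'rV[R]_d => G (boundary_pt x)).
  by move=> x; apply: continuous_comp; [exact: continuous_snocl|exact: cG].
have sGb : bsupp (fun x : 'rV[R]_d => G (boundary_pt x)).
  exists M => x i xi; apply: (sG' _ (lift ord_max i)).
  by rewrite /boundary_pt snoc_lift.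
transitivity (\int[leb R d]_x (- G (boundary_pt x))).
  rewrite Rintegral_mkcond; congr Rintegral; apply/funext => x.
  rewrite patchE; case: ifPn => xB.
    by rewrite /boundary_pt /bigbox/= eqxx.
  suff -> : G (boundary_pt x) = 0 by rewrite oppr0.
  have [i xi] : exists i, M < `|x ord0 i|.
    apply/existsP; rewrite -[X in is_true X]negbK; apply/negP => /existsPn hi.
    move/negP: xB; apply; apply: mem_set => i; rewrite /bigbox/= eq_sym.
    rewrite (negbTE (neq_lift _ _)).
    by have := hi i; rewrite -leNgt ler_norml => /andP[h1 h2]; lra.
  by apply: (sG' _ (lift ord_max i)); rewrite /boundary_pt snoc_lift.
have -> : (fun x => - G (boundary_pt x)) = (fun x => -1 * G (boundary_pt x)).
  by apply/funext => x; rewrite mulN1r.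
by rewrite RintegralZl ?mulN1r//; exact: cc_integrable.
Qed.

End HalfSpace.

(** * Smooth functions and bumps *)

Section Derivation.
Variable R : realType.

Section Rules.
Variables (V : normedModType R).
Implicit Types (f g : V -> R) (x v : V).

Lemma dvD f g x v a b : is_derive x v f a -> is_derive x v g b ->
  is_derive x v (fun y => f y + g y) (a + b).
Proof. by move=> h1 h2; exact: is_deriveD. Qed.

Lemma dvM f g x v a b : is_derive x v f a -> is_derive x v g b ->
  is_derive x v (fun y => f y * g y) (a * g x + f x * b).
Proof.
move=> h1 h2; apply: is_derive_eq (is_deriveM h1 h2) _.
by rewrite /GRing.scale/= addrC [g x * a]mulrC.
Qed.

Lemma dvN f x v a : is_derive x v f a -> is_derive x v (fun y => - f y) (- a).
Proof. by move=> h1; exact: is_deriveN. Qed.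

Lemma dvB f g x v a b : is_derive x v f a -> is_derive x v g b ->
  is_derive x v (fun y => f y - g y) (a - b).
Proof. by move=> h1 /dvN; exact: dvD. Qed.

Lemma dvC (c : R) x v : is_derive x v (fun _ => c) 0.
Proof. exact: is_derive_cst. Qed.

Lemma dvZ c f x v a : is_derive x v f a -> is_derive x v (fun y => c * f y) (c * a).
Proof. by move=> h; apply: is_derive_eq (dvM (dvC c x v) h) _; rewrite mul0r add0r. Qed.

Lemma dvX2 f x v a : is_derive x v f a ->
  is_derive x v (fun y => f y ^+ 2) (2 * (f x * a)).
Proof.
move=> h; under eq_fun do rewrite expr2.
by apply: is_derive_eq (dvM h h) _; ring.
Qed.

Lemma dv_sum (I : Type) (s : seq I) (F : I -> V -> R) (a : I -> R) x v :
  (forall i, is_derive x v (F i) (a i)) ->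
  is_derive x v (fun y => \sum_(i <- s) F i y) (\sum_(i <- s) a i).
Proof.
move=> h; elim: s => [|i s IH].
  by under eq_fun do rewrite big_nil; rewrite big_nil; exact: dvC.
by under eq_fun do rewrite big_cons; rewrite big_cons; exact: dvD.
Qed.

Lemma dv_comp (F : R -> R) f x v a b : is_derive (f x) (1 : R) F a -> is_derive x v f b ->
  is_derive x v (fun y => F (f y)) (a * b).
Proof.
move=> hF hf.
have h0 : is_derive (0 : R) (1 : R) (fun h : R => f (h *: v + x)) b.
  by apply: is_derive_line hf => h; rewrite addr0 /GRing.scale/= mulr1.
have hF0 : is_derive (f (0 *: v + x)) (1 : R) F a by rewrite scale0r add0r.
have := @is_derive1_comp _ F (fun h : R => f (h *: v + x)) 0 a b hF0 h0.
by apply: is_derive_line => h; rewrite /= addr0 /GRing.scale/= mulr1.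
Qed.

End Rules.

Lemma dvV (V : normedModType R) (f : V -> R) x v a : f x != 0 -> is_derive x v f a ->
  is_derive x v (fun y => (f y)^-1) (- (f x)^-1 ^+ 2 * a).
Proof.
move=> fx0 hf; apply: dv_comp hf.
apply: is_derive_eq (is_deriveV fx0 (is_derive_id (f x) (1 : R))) _.
by rewrite /GRing.scale/= mulr1 exprVn.
Qed.

(** Smoothness in coinductive form: membership in some family closed under differentiation. A proof
    exhibits the family, and no iterated derivative is ever written down. *)
Definition smooth1 (f : R -> R) := exists A : set (R -> R), A f /\
  forall g, A g -> exists2 g', A g' & forall t : R, is_derive t (1 : R) g (g' t).

Lemma smooth1_der f : smooth1 f ->
  exists2 f', smooth1 f' & forall t : R, is_derive t (1 : R) f (f' t).
Proof. by move=> [A [Af cA]]; have [f' Af' df] := cA f Af; exists f' => //; exists A. Qed.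

Lemma smooth1_cst c : smooth1 (fun _ => c).
Proof.
exists [set f | exists c, f = fun _ => c]; split; first by exists c.
by move=> _ [k ->]; exists (fun _ => 0); [exists 0|move=> t; exact: dvC].
Qed.

(** One witness family for sums, products and inverses: the algebra generated by the smooth
    functions and [1 / D], closed under differentiation because [(1 / D)' = - D' / D^2]. Sums and
    products take [D = 1]. *)
Inductive gen1 (D : R -> R) : (R -> R) -> Prop :=
| gen1_base f : smooth1 f -> gen1 D f
| gen1_add f g : gen1 D f -> gen1 D g -> gen1 D (fun t => f t + g t)
| gen1_mul f g : gen1 D f -> gen1 D g -> gen1 D (fun t => f t * g t)
| gen1_inv : gen1 D (fun t => (D t)^-1).

Lemma gen1_smooth D f : smooth1 D -> (forall t, D t != 0) -> gen1 D f -> smooth1 f.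
Proof.
move=> sD D0 gf; exists (gen1 D); split => // g; elim => {f gf g}.
- by move=> f /smooth1_der[f' sf' df]; exists f' => //; exact: gen1_base.
- move=> f g _ [f' gf' df] _ [g' gg' dg]; exists (fun t => f' t + g' t).
    exact: gen1_add.
  by move=> t; exact: dvD.
- move=> f g gf [f' gf' df] gg [g' gg' dg]; exists (fun t => f' t * g t + f t * g' t).
    by apply: gen1_add; exact: gen1_mul.
  by move=> t; exact: dvM.
- have [D' sD' dD] := smooth1_der sD.
  exists (fun t => (-1 * ((D t)^-1 * (D t)^-1)) * D' t).
    apply: gen1_mul; last exact: gen1_base.
    apply: gen1_mul; first by apply: gen1_base; exact: smooth1_cst.
    by apply: gen1_mul; exact: gen1_inv.
  by move=> t; apply: is_derive_eq (dvV (D0 t) (dD t)) _; rewrite mulN1r expr2.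
Qed.

Let one0 (t : R) : (fun _ : R => 1 : R) t != 0. Proof. exact: oner_neq0. Qed.

Lemma smooth1D f g : smooth1 f -> smooth1 g -> smooth1 (fun t => f t + g t).
Proof.
move=> sf sg; apply: (gen1_smooth (smooth1_cst 1) one0).
by apply: gen1_add; exact: gen1_base.
Qed.

Lemma smooth1M f g : smooth1 f -> smooth1 g -> smooth1 (fun t => f t * g t).
Proof.
move=> sf sg; apply: (gen1_smooth (smooth1_cst 1) one0).
by apply: gen1_mul; exact: gen1_base.
Qed.

Lemma smooth1V f : smooth1 f -> (forall t, f t != 0) -> smooth1 (fun t => (f t)^-1).
Proof. by move=> sf f0; apply: (gen1_smooth sf f0); exact: gen1_inv. Qed.

Lemma smooth1_aff f a b : smooth1 f -> smooth1 (fun t => f (a * t + b)).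
Proof.
move=> sf; exists [set g | exists c h, smooth1 h /\ g = (fun t => c * h (a * t + b))].
split; first by exists 1, f; split => //; apply/funext => t; rewrite mul1r.
move=> _ [c [h [sh ->]]]; have [h' sh' dh] := smooth1_der sh.
exists (fun t => (c * a) * h' (a * t + b)); first by exists (c * a), h'.
move=> t; have d : is_derive t (1 : R) (fun t => a * t + b) a.
  apply: is_derive_eq (dvD (dvZ a (is_derive_id t (1 : R))) (dvC b t 1)) _.
  by rewrite mulr1 addr0.
by apply: is_derive_eq (dvZ c (dv_comp (dh _) d)) _; ring.
Qed.

Lemma smooth1_expR : smooth1 expR.
Proof.
exists [set expR]; split => // _ ->; exists expR => // t.
exact: is_derive_expR.
Qed.

Lemma smooth1_sincos : smooth1 sin /\ smooth1 cos.
Proof.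
pose A : set (R -> R) := [set f | exists c, f = (fun t => c * sin t) \/ f = (fun t => c * cos t)].
have cA g : A g -> exists2 g', A g' & forall t : R, is_derive t (1 : R) g (g' t).
  move=> [c [->|->]].
    exists (fun t => c * cos t); first by exists c; right.
    by move=> t; apply: dvZ; exact: is_derive_sin.
  exists (fun t => (- c) * sin t); first by exists (- c); left.
  move=> t; apply: is_derive_eq (dvZ c (is_derive_cos t)) _.
  by rewrite mulrN mulNr.
split; exists A; split => //; exists 1; [left|right]; apply/funext => t; by rewrite mul1r.
Qed.

(** The polynomial in [1 / t] makes the family closed under differentiation: deriving replaces [p]
    by [X^2 (p - p')]. *)
Definition flat (p : {poly R}) (t : R) : R :=
  if 0 < t then p.[t^-1] * expR (- t^-1) else 0.

Lemma poly_exp_bound (p : {poly R}) : exists2 C, 0 <= C &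
  forall s, 0 <= s -> `|p.[s]| * expR (- s) <= C.
Proof.
elim/poly_ind: p => [|p c _].
  by exists 0 => // s _; rewrite horner0 normr0 mul0r.
set q := p * 'X + c%:P.
exists (\sum_(i < size q) `|q`_i| * (i`!)%:R) => [|s s0].
  by apply: sumr_ge0 => i _; rewrite mulr_ge0.
rewrite horner_coef (le_trans (ler_wpM2r (expR_ge0 _) (ler_norm_sum _ _ _)))//.
rewrite mulr_suml ler_sum// => i _; rewrite normrM -mulrA ler_wpM2l//.
rewrite expRN ler_pdivrMr ?expR_gt0// ger0_norm ?exprn_ge0//.
case: (nat_of_ord i) => [|k].
  by rewrite expr0 fact0 mul1r; have := expR_ge1Dx s; lra.
have /= := expR_ge1Dxn k s0; set F := _`!%:R => h.
have F0 : (0 : R) < F by rewrite ltr0n fact_gt0.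
rewrite mulrC -ler_pdivrMr//; lra.
Qed.

(** Applying the bound to [p X^2] gains the factor [t^2], which gives derivative 0 at the junction
    point by [is_derive_sq0]. *)
Lemma flat_bound p : exists2 C, 0 <= C & forall t, `|flat p t| <= C * t ^+ 2.
Proof.
have [C C0 hC] := poly_exp_bound (p * 'X^2); exists C => // t.
rewrite /flat; case: ifPn => t0; last by rewrite normr0 mulr_ge0// sqr_ge0.
have /= := hC t^-1; rewrite invr_ge0 (ltW t0) => /(_ isT).
rewrite hornerM hornerXn normrM [`|_ ^+ 2|]ger0_norm ?sqr_ge0// exprVn.
rewrite [`|_ * expR _|]normrM [`|expR _|]gtr0_norm ?expR_gt0//.
rewrite mulrAC ler_pdivrMr ?exprn_gt0//.
Qed.

Lemma is_derive_sq0 (f : R -> R) C : (forall t, `|f t| <= C * t ^+ 2) ->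
  is_derive (0 : R) (1 : R) f 0.
Proof.
move=> fC.
have f0 : f 0 = 0.
  by apply/eqP; rewrite -normr_le0 (le_trans (fC 0))// expr0n/= mulr0.
have C0 : 0 <= C by have := fC 1; rewrite expr1n mulr1; apply: le_trans.
suff h : h^-1 *: ((f \o shift (0 : R)) (h *: (1 : R)) - f 0) @[h --> 0^'] --> (0 : R).
  split; first by apply/cvg_ex; exists 0.
  exact: cvg_lim h.
apply/cvgrPdist_lt => e e0.
have dC : 0 < e / (C + 1) by rewrite divr_gt0// ltr_wpDl.
near=> h; rewrite sub0r normrN /= addr0 f0 subr0 /GRing.scale/= mulr1 normrM normfV.
have hn0 : h != 0 by near: h; exact: nbhs_dnbhs_neq.
have h0 : 0 < `|h| by rewrite normr_gt0.
rewrite ltr_pdivrMl//.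
apply: (le_lt_trans (fC h)).
have hh : `|h| < e / (C + 1).
  near: h; apply: dnbhs0_lt => //.
have -> : C * h ^+ 2 = `|h| * (C * `|h|) by rewrite -[in LHS]real_normK ?num_real//; ring.
rewrite ltr_pM2l//; move: hh; rewrite ltr_pdivlMr ?ltr_wpDl// => hh.
by nra.
Unshelve. all: by end_near. Qed.

Lemma smooth1_flat p : smooth1 (flat p).
Proof.
exists (range flat); split; first by exists p.
move=> _ [q _ <-]; exists (flat ('X^2 * (q - q^`()))); first by exists ('X^2 * (q - q^`())).
move=> t; have [t0|t0|->] := ltgtP t 0.
- have E : {near t, flat q =1 cst 0}.
    have : \forall y \near t, y < 0 by exact: lt_nbhsl.
    by apply: filterS => y y0; rewrite /flat ltNge (ltW y0).
  rewrite {2}/flat ltNge (ltW t0)/=.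
  by apply: near_eq_is_derive (is_derive_cst _ _ _); apply: filterS E => y ->.
- have E : \forall y \near t, (fun y => q.[y^-1] * expR (- y^-1)) y = flat q y.
    have : \forall y \near t, 0 < y by exact: lt_nbhsr.
    by apply: filterS => y y0; rewrite /flat y0.
  apply: near_eq_is_derive E _.
  rewrite /flat t0.
  have tn0 : t != 0 by rewrite gt_eqF.
  have dV := dvV tn0 (is_derive_id t (1 : R)).
  have dq : is_derive t^-1 (1 : R) (fun y => q.[y]) (q^`()).[t^-1].
    by have := is_derive_poly q t^-1.
  have de : is_derive t (1 : R) (fun y : R => expR (- y^-1)) (expR (- t^-1) * - (- t^-1 ^+ 2 * 1)).
    by apply: (@dv_comp _ expR (fun y : R => - y^-1)) (dvN dV); exact: is_derive_expR.
  have dq' : is_derive t (1 : R) (fun y : R => q.[y^-1]) ((q^`()).[t^-1] * (- t^-1 ^+ 2 * 1)).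
    by apply: (@dv_comp _ (horner q) (fun y : R => y^-1)) dV.
  apply: is_derive_eq (dvM dq' de) _.
  rewrite !hornerE /=; ring.
- rewrite {2}/flat ltxx.
  have [C _ hC] := flat_bound q; exact: is_derive_sq0 hC.
Qed.

Definition bump_step (t : R) : R := flat 1 t / (flat 1 t + flat 1 (1 - t)).

Lemma flat1_ge0 t : 0 <= flat 1 t.
Proof. by rewrite /flat; case: ifP => // _; rewrite hornerE mul1r expR_ge0. Qed.

Lemma flat1_gt0 t : 0 < t -> 0 < flat 1 t.
Proof. by rewrite /flat => ->; rewrite hornerE mul1r expR_gt0. Qed.

Lemma bump_den_gt0 t : 0 < flat 1 t + flat 1 (1 - t).
Proof.
have [t0|t0] := ltP 0 t; first by rewrite ltr_pwDl// ?flat1_gt0 ?flat1_ge0.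
by rewrite ltr_wpDl// ?flat1_ge0// flat1_gt0//; lra.
Qed.

Lemma smooth1_step : smooth1 bump_step.
Proof.
have s1 : smooth1 (fun t => flat 1 (1 - t)).
  have := smooth1_aff (-1) 1 (smooth1_flat 1).
  by congr smooth1; apply/funext => t; congr flat; ring.
apply: smooth1M; first exact: smooth1_flat.
apply: smooth1V; first by apply: smooth1D => //; exact: smooth1_flat.
by move=> t; rewrite gt_eqF// bump_den_gt0.
Qed.

Definition bump (t : R) : R := bump_step (2 - t) * bump_step (2 + t).

Lemma smooth1_bump : smooth1 bump.
Proof.
apply: smooth1M.
  have := smooth1_aff (-1) 2 smooth1_step.
  by congr smooth1; apply/funext => t; congr bump_step; ring.
have := smooth1_aff 1 2 smooth1_step.
by congr smooth1; apply/funext => t; congr bump_step; ring.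
Qed.

Lemma bump_step0 t : t <= 0 -> bump_step t = 0.
Proof. by move=> t0; rewrite /bump_step {1}/flat ltNge t0 mul0r. Qed.

Lemma bump_step1 t : 1 <= t -> bump_step t = 1.
Proof.
move=> t1; rewrite /bump_step [flat 1 (1 - t)]/flat ltNge (_ : 1 - t <= 0) ?subr_le0//.
by rewrite addr0 divff// gt_eqF// flat1_gt0//; lra.
Qed.

Lemma bump_step01 t : 0 <= bump_step t <= 1.
Proof.
rewrite /bump_step divr_ge0 ?flat1_ge0 ?(ltW (bump_den_gt0 _))//=.
by rewrite ler_pdivrMr ?bump_den_gt0// mul1r lerDl flat1_ge0.
Qed.

Lemma bump1 t : `|t| <= 1 -> bump t = 1.
Proof. by rewrite ler_norml => /andP[h1 h2]; rewrite /bump !bump_step1 ?mulr1//; lra. Qed.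

Lemma bump0 t : 2 <= `|t| -> bump t = 0.
Proof.
rewrite ler_normr => /orP[h|h]; rewrite /bump.
  by rewrite bump_step0 ?mul0r//; lra.
by rewrite [X in _ * X]bump_step0 ?mulr0//; lra.
Qed.

Lemma bump01 t : 0 <= bump t <= 1.
Proof.
have /andP[a0 a1] := bump_step01 (2 - t); have /andP[b0 b1] := bump_step01 (2 + t).
by rewrite /bump mulr_ge0//= mulr_ile1.
Qed.

End Derivation.

Section Nice.
Variable R : realType.

(* Locked, since unifying two directional derivatives by unfolding is very slow. *)
Fact pd_key : unit. Proof. exact: tt. Qed.
Definition pd n (i : 'I_n) (f : 'rV[R]_n -> R) : 'rV[R]_n -> R :=
  locked_with pd_key (fun x => 'D_(evec R i) f x).

Lemma pdE n (i : 'I_n) (f : 'rV[R]_n -> R) : pd i f = fun x => 'D_(evec R i) f x.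
Proof. by rewrite /pd unlock. Qed.

Lemma has_pdE n (i : 'I_n) (f df : 'rV[R]_n -> R) : has_pd i f df -> pd i f = df.
Proof. by move=> h; rewrite pdE; apply/funext => x; have [_] := h x. Qed.

Lemma has_pd_ext n (i : 'I_n) (f df df' : 'rV[R]_n -> R) : has_pd i f df -> df =1 df' -> has_pd i f df'.
Proof. by move=> h /funext <-. Qed.

Lemma has_pdD n (i : 'I_n) (f g df dg : 'rV[R]_n -> R) : has_pd i f df -> has_pd i g dg ->
  has_pd i (fun x => f x + g x) (fun x => df x + dg x).
Proof. by move=> h1 h2 x; exact: dvD. Qed.

Lemma has_pdB n (i : 'I_n) (f g df dg : 'rV[R]_n -> R) : has_pd i f df -> has_pd i g dg ->
  has_pd i (fun x => f x - g x) (fun x => df x - dg x).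
Proof. by move=> h1 h2 x; exact: dvB. Qed.

Lemma has_pdM n (i : 'I_n) (f g df dg : 'rV[R]_n -> R) : has_pd i f df -> has_pd i g dg ->
  has_pd i (fun x => f x * g x) (fun x => df x * g x + f x * dg x).
Proof. by move=> h1 h2 x; exact: dvM. Qed.

Lemma has_pdC n (i : 'I_n) (c : R) : @has_pd R n i (fun=> c) (fun=> 0).
Proof. by move=> x; exact: dvC. Qed.

Lemma has_pdZ n (i : 'I_n) (c : R) (f df : 'rV[R]_n -> R) : has_pd i f df ->
  has_pd i (fun x => c * f x) (fun x => c * df x).
Proof. by move=> h1 x; exact: dvZ. Qed.

Lemma has_pd_sum (I : Type) (s : seq I) n (i : 'I_n) (F dF : I -> 'rV[R]_n -> R) :
  (forall k, has_pd i (F k) (dF k)) ->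
  has_pd i (fun x => \sum_(k <- s) F k x) (fun x => \sum_(k <- s) dF k x).
Proof. by move=> h x; apply: dv_sum => k; exact: h. Qed.

Lemma line_coord n (i j : 'I_n) (h : R) (x : 'rV[R]_n) :
  (h *: evec R i + x) ord0 j = h * (j == i)%:R + x ord0 j.
Proof. by rewrite !mxE. Qed.

Lemma has_pd_coord n (i : 'I_n) (f f' : R -> R) : (forall t : R, is_derive t (1 : R) f (f' t)) ->
  has_pd i (fun x : 'rV[R]_n => f (x ord0 i)) (fun x => f' (x ord0 i)).
Proof.
move=> df x; apply: is_derive_line (df _) => h.
by rewrite line_coord eqxx.
Qed.

Lemma has_pd0 n (i : 'I_n) (f : 'rV[R]_n -> R) :
  (forall (h : R) (x : 'rV[R]_n), f (h *: evec R i + x) = f x) -> has_pd i f (fun=> 0).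
Proof.
move=> fi x; have H : is_derive (0 : R) (1 : R) (fun _ : R => f x) 0 by exact: dvC.
by apply: is_derive_line H => h; rewrite fi.
Qed.

Lemma has_pd_coord_neq n (i j : 'I_n) (f : R -> R) : j != i ->
  has_pd i (fun x : 'rV[R]_n => f (x ord0 j)) (fun=> 0).
Proof.
by move=> ij; apply: has_pd0 => h x; rewrite line_coord (negbTE ij) mulr0 add0r.
Qed.

(** An algebra generated by smooth functions of one coordinate, large enough for the cutoffs, the
    cosine products and the decaying modes. Derivatives, continuity and the symmetry of second
    derivatives all follow by structural induction. *)
Inductive nice n : ('rV[R]_n -> R) -> Prop :=
| nice_cst c : nice (fun=> c)
| nice_coord i f : smooth1 f -> nice (fun x => f (x ord0 i))
| niceD f g : nice f -> nice g -> nice (fun x => f x + g x)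
| niceM f g : nice f -> nice g -> nice (fun x => f x * g x).

Lemma nice_der n (i : 'I_n) (f : 'rV[R]_n -> R) : nice f -> nice (pd i f) /\ has_pd i f (pd i f).
Proof.
elim=> {f}.
- by move=> c; rewrite (has_pdE (has_pdC i c)); split; [exact: nice_cst|exact: has_pdC].
- move=> j f sf; have [f' sf' df] := smooth1_der sf.
  have [->|ij] := eqVneq j i.
    rewrite (has_pdE (has_pd_coord _ df)).
    by split; [exact: nice_coord|exact: has_pd_coord].
  rewrite (has_pdE (has_pd_coord_neq _ ij)).
  by split; [exact: nice_cst|exact: has_pd_coord_neq].
- move=> f g nf [nf' df] ng [ng' dg]; rewrite (has_pdE (has_pdD df dg)).
  by split; [exact: niceD|exact: has_pdD].
- move=> f g nf [nf' df] ng [ng' dg]; rewrite (has_pdE (has_pdM df dg)).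
  by split; [apply: niceD; exact: niceM|exact: has_pdM].
Qed.

Lemma nice_pd n (i : 'I_n) f : nice f -> nice (pd i f).
Proof. by case/(nice_der i). Qed.

Lemma nice_has n (i : 'I_n) f : nice f -> has_pd i f (pd i f).
Proof. by case/(nice_der i). Qed.

Lemma smooth1_cont (f : R -> R) : smooth1 f -> continuous f.
Proof.
move=> /smooth1_der[f' _ df] t; apply: differentiable_continuous.
by apply/derivable1_diffP; case: (df t).
Qed.

Lemma nice_cont n f : @nice n f -> continuous f.
Proof.
elim=> {f}; first by move=> c; exact: cst_continuous.
- move=> i f /smooth1_cont cf x; apply: continuous_comp; [exact: coord_cont|exact: cf].
- by move=> f g _ cf _ cg; exact: contD.
- by move=> f g _ cf _ cg; exact: contM.
Qed.

(** The multiplier identity needs this symmetry to cancel its commutator. On a generator a mixed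
    derivative is 0, and the Leibniz rule carries the symmetry to products. *)
Lemma pd_sym n (i j : 'I_n) f : nice f -> pd i (pd j f) = pd j (pd i f).
Proof.
elim=> {f}.
- by move=> c; rewrite !(has_pdE (has_pdC _ c)) !(has_pdE (has_pdC _ 0)).
- move=> k f sf; have [f' sf' df] := smooth1_der sf.
  have [f2 _ df2] := smooth1_der sf'.
  have E (a b : 'I_n) : a != b -> pd a (pd b (fun x => f (x ord0 k))) = fun=> 0.
    move=> ab; have [->|kb] := eqVneq k b.
      by rewrite (has_pdE (has_pd_coord _ df)) (has_pdE (has_pd_coord_neq _ _)) // eq_sym.
    by rewrite (has_pdE (has_pd_coord_neq _ kb)) (has_pdE (has_pdC _ 0)).
  by have [->//|ij] := eqVneq i j; rewrite !E// eq_sym.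
- move=> f g nf IHf ng IHg.
  rewrite (has_pdE (has_pdD (nice_has j nf) (nice_has j ng))).
  rewrite (has_pdE (has_pdD (nice_has i nf) (nice_has i ng))).
  rewrite (has_pdE (has_pdD (nice_has i (nice_pd j nf)) (nice_has i (nice_pd j ng)))).
  rewrite (has_pdE (has_pdD (nice_has j (nice_pd i nf)) (nice_has j (nice_pd i ng)))).
  by rewrite IHf IHg.
- move=> f g nf IHf ng IHg.
  have H (a b : 'I_n) : pd a (pd b (fun x => f x * g x)) = fun x =>
      pd a (pd b f) x * g x + pd b f x * pd a g x + (pd a f x * pd b g x + f x * pd a (pd b g) x).
    rewrite (has_pdE (has_pdM (nice_has b nf) (nice_has b ng))).
    exact: has_pdE (has_pdD (has_pdM (nice_has a (nice_pd b nf)) (nice_has a ng)) (has_pdM (nice_has a nf) (nice_has a (nice_pd b ng)))).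
  rewrite (H i j) (H j i) IHf IHg {H IHf IHg}; apply/funext => x.
  by rewrite addrACA.
Qed.

Lemma niceZ n c f : @nice n f -> nice (fun x => c * f x).
Proof. by move=> nf; apply: niceM => //; exact: nice_cst. Qed.

Lemma niceN n f : @nice n f -> nice (fun x => - f x).
Proof. by move=> /(niceZ (-1)); under eq_fun do rewrite mulN1r. Qed.

Lemma niceB n f g : @nice n f -> nice g -> nice (fun x => f x - g x).
Proof. by move=> nf /niceN; exact: niceD. Qed.

Lemma nice_sum (I : Type) (s : seq I) n (F : I -> 'rV[R]_n -> R) :
  (forall i, nice (F i)) -> nice (fun x => \sum_(i <- s) F i x).
Proof.
move=> h; elim: s => [|i s IH].
  by under eq_fun do rewrite big_nil; exact: nice_cst.
by under eq_fun do rewrite big_cons; exact: niceD.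
Qed.

Lemma nice_prod (I : Type) (s : seq I) (P : pred I) n (F : I -> 'rV[R]_n -> R) :
  (forall i, nice (F i)) -> nice (fun x => \prod_(i <- s | P i) F i x).
Proof.
move=> h; elim: s => [|i s IH].
  by under eq_fun do rewrite big_nil; exact: nice_cst.
under eq_fun do rewrite big_cons; case: (P i) => //; exact: niceM.
Qed.

Lemma nice_pderiv n (s : seq 'I_n) f : nice f -> nice (pderiv s f).
Proof. by move=> nf; elim: s => [//|i s IH]; rewrite /= -pdE; exact: nice_pd. Qed.

Lemma nice_smooth n f : @nice n f -> smooth f.
Proof.
move=> nf s; have ns := nice_pderiv s nf; split; first exact: nice_cont.
by move=> i x; case: (nice_has i ns x).
Qed.

Lemma smooth_cont n (f : 'rV[R]_n -> R) : smooth f -> continuous f.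
Proof. by move=> sf; case: (sf [::]). Qed.

Lemma smooth_has n (i : 'I_n) (f : 'rV[R]_n -> R) : smooth f -> has_pd i f (pd i f).
Proof. by move=> sf x; rewrite pdE; apply: derivableP; case: (sf [::]) => _; exact. Qed.

Lemma smooth_pd_cont n (i : 'I_n) (f : 'rV[R]_n -> R) : smooth f -> continuous (pd i f).
Proof. by move=> sf; rewrite pdE; case: (sf [:: i]). Qed.

Lemma smoothB n (f g : 'rV[R]_n -> R) : smooth f -> smooth g ->
  smooth (fun x => f x - g x).
Proof.
move=> sf sg.
have E s : pderiv s (fun x => f x - g x) = fun x => pderiv s f x - pderiv s g x.
  elim: s => [//|i s IH] /=; apply/funext => x; rewrite IH.
  by apply: deriveB; [exact: (sf s).2|exact: (sg s).2].
move=> s; rewrite E; split; first by apply: contB; [exact: (sf s).1|exact: (sg s).1].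
by move=> i x; apply: derivableB; [exact: (sf s).2|exact: (sg s).2].
Qed.

Lemma bsuppP n (f : 'rV[R]_n -> R) : bsupp f <->
  exists K, compact K /\ forall x, ~ K x -> f x = 0.
Proof.
split=> [[M h]|[K [cK hK]]].
  exists [set v : 'rV[R]_n | forall i, v ord0 i \in `[- M, M]]; split.
    by apply: (@rV_compact _ _ (fun=> `[- M, M]%classic)) => i; exact: segment_compact.
  move=> x xK; have [i xi] : exists i, M < `|x ord0 i|; last exact: h xi.
  apply/existsP; rewrite -[X in is_true X]negbK; apply/negP => /existsPn hi.
  by apply: xK => i; rewrite in_itv/= -ler_norml leNgt.
have [M [_ hM]] := compact_bounded cK; exists (M + 1) => x i xi.
apply: hK => /(hM (M + 1)); rewrite ltrDl ltr01 => /(_ isT) xM.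
have : `|x ord0 i| <= `|x|.
  rewrite -[leRHS]/(mx_norm x) mx_normrE.
  by apply/bigmax_geP; right => /=; exists (ord0, i).
by move: xM xi; rewrite /=; lra.
Qed.

Lemma test_fun_smooth n (U : set 'rV[R]_n) f : test_fun U f -> smooth f /\ bsupp f.
Proof. by move=> [sf [K [cK _ hK]]]; split => //; apply/bsuppP; exists K. Qed.

Lemma test_funT n f : @smooth R n f -> bsupp f -> test_fun setT f.
Proof. by move=> sf /bsuppP[K [cK hK]]; split => //; exists K. Qed.

Definition tp n (f : 'I_n -> R -> R) (x : 'rV[R]_n) : R := \prod_(i < n) f i (x ord0 i).

Lemma nice_tp n (f : 'I_n -> R -> R) : (forall i, smooth1 (f i)) -> nice (tp f).
Proof. by move=> sf; apply: nice_prod => i; exact: nice_coord. Qed.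

Lemma tpD1 n (f : 'I_n -> R -> R) i x :
  tp f x = f i (x ord0 i) * \prod_(j < n | j != i) f j (x ord0 j).
Proof. by rewrite /tp (bigD1 i). Qed.

Definition upd n (f : 'I_n -> R -> R) i g := fun j => if j == i then g else f j.

Lemma has_pd_tp n (f : 'I_n -> R -> R) i f' :
  (forall t : R, is_derive t (1 : R) (f i) (f' t)) ->
  has_pd i (tp f) (tp (upd f i f')).
Proof.
move=> df; have E : tp f = fun x => f i (x ord0 i) * \prod_(j < n | j != i) f j (x ord0 j).
  by apply/funext => x; exact: tpD1.
rewrite E; apply: has_pd_ext (has_pdM (has_pd_coord _ df) _) _.
  apply: has_pd0 => h x; apply: eq_bigr => j ji.
  by rewrite line_coord (negbTE ji) mulr0 add0r.
move=> x; rewrite /= mulr0 addr0 (tpD1 _ i) /upd eqxx; congr (_ * _).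
by apply: eq_bigr => j /negbTE ->.
Qed.

Lemma bump_der : exists b1 b2 (C : R), [/\ 0 <= C,
  (forall t : R, is_derive t (1 : R) (@bump R) (b1 t)),
  (forall t : R, is_derive t (1 : R) b1 (b2 t)),
  smooth1 b1 /\ smooth1 b2 &
  forall t, [/\ `|b1 t| <= C, `|b2 t| <= C, 2 < `|t| -> b1 t = 0 & 2 < `|t| -> b2 t = 0]].
Proof.
have [b1 s1 d1] := smooth1_der (@smooth1_bump R).
have [b2 s2 d2] := smooth1_der s1.
have out (f f' : R -> R) : (forall t, 2 < `|t| -> f t = 0) ->
    (forall t : R, is_derive t (1 : R) f (f' t)) -> forall t, 2 < `|t| -> f' t = 0.
  move=> f0 df t t2; have [_ <-] := df t.
  have : \forall y \near t, (fun=> 0) y = f y.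
    have : \forall y \near t, 2 < `|y : R|.
      have := @norm_continuous _ R^o t => /cvgrPdist_lt/(_ (`|t| - 2)).
      rewrite subr_gt0 => /(_ t2); apply: filterS => y hy.
      by have := ler_norm (`|t| - `|y|); lra.
    by apply: filterS => y /f0 ->.
  by move=> /near_eq_derive <-; rewrite derive_cst.
have o1 : forall t, 2 < `|t| -> b1 t = 0.
  by apply: (out _ _ _ d1) => t /ltW; exact: bump0.
have o2 := out _ _ o1 d2.
have bd f : smooth1 f -> (forall t, 2 < `|t| -> f t = 0) ->
    exists C, 0 <= C /\ forall t : R, `|f t| <= C.
  move=> /smooth1_cont cf f0.
  have /compact_bounded[M [_ hM]] := continuous_compact (continuous_subspaceT cf) (@segment_compact R (-2) 2).
  exists (`|M| + 1); split => [|t]; first by rewrite addr_ge0.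
  have [/f0 ->|t2] := ltP 2 `|t|; first by rewrite normr0 addr_ge0.
  by apply: hM; [rewrite ltr_pwDr// ler_norm|exists t => //=; rewrite in_itv/= -ler_norml].
have [C1 [C10 h1]] := bd _ s1 o1; have [C2 [C20 h2]] := bd _ s2 o2.
exists b1, b2, (C1 + C2); split => //; first exact: addr_ge0.
by move=> t; split; [apply: (le_trans (h1 t)); rewrite lerDl|apply: (le_trans (h2 t)); rewrite lerDr|exact: o1|exact: o2].
Qed.

End Nice.

(** * Functions vanishing near the origin *)

Section EuclideanNorm.
Variables (R : realType) (n : nat).
Implicit Types (x : 'rV[R]_n) (f g : 'rV[R]_n -> R).

Definition invr x : R := (enorm x)^-1.

Lemma dotp_ge0 x : 0 <= dotp x x.
Proof. by apply: sumr_ge0 => i _; rewrite -expr2 sqr_ge0. Qed.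

Lemma enorm_sq x : enorm x ^+ 2 = \sum_(i < n) x ord0 i ^+ 2.
Proof. by rewrite sqr_sqrtr ?dotp_ge0//; apply: eq_bigr => i _; rewrite expr2. Qed.

Lemma enorm_ge0 x : 0 <= enorm x. Proof. exact: sqrtr_ge0. Qed.

Lemma coord_le_enorm x i : `|x ord0 i| <= enorm x.
Proof.
rewrite -(@ler_pXn2r _ 2)// ?nnegrE ?enorm_ge0// enorm_sq (bigD1 i)//=.
by rewrite real_normK ?num_real// lerDl; apply: sumr_ge0 => j _; exact: sqr_ge0.
Qed.

Lemma enorm_eq0 x : enorm x = 0 -> x = 0.
Proof.
move=> x0; apply/rowP => i; rewrite mxE; apply/eqP; rewrite -normr_le0.
by rewrite -x0 coord_le_enorm.
Qed.

Lemma enorm_gt0 x : x != 0 -> 0 < enorm x.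
Proof.
by move=> x0; rewrite lt_neqAle enorm_ge0 andbT eq_sym; apply: contra_neq x0; exact: enorm_eq0.
Qed.

Lemma dotp_gt0 x : x != 0 -> 0 < dotp x x.
Proof. by move=> /enorm_gt0; rewrite /enorm sqrtr_gt0. Qed.

Lemma enorm_le x (M : R) : 0 <= M -> (forall i, `|x ord0 i| <= M) -> enorm x <= n%:R * M.
Proof.
move=> M0 h; case: (posnP n) => [n0|n0].
  rewrite /enorm /dotp big1 ?sqrtr0 ?mulr_ge0// => i _.
  by have := ltn_ord i; rewrite [X in (_ < X)%N]n0.
rewrite -(@ler_pXn2r _ 2)// ?nnegrE ?enorm_ge0 ?mulr_ge0// enorm_sq.
apply: (@le_trans _ _ (\sum_(i < n) M ^+ 2)).
  apply: ler_sum => i _; rewrite -[leLHS]real_normK ?num_real//.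
  by rewrite lerXn2r ?nnegrE.
rewrite sumr_const card_ord -[leLHS]mulr_natl exprMn ler_wpM2r ?sqr_ge0//.
by rewrite expr2 ler_peMr ?ler1n.
Qed.

Lemma dotp_cont : continuous (fun x => dotp x x).
Proof. by apply: cont_sum => i; apply: contM; exact: coord_cont. Qed.

Lemma enorm_cont : continuous (fun x => enorm x).
Proof. by move=> x; exact: continuous_comp (@dotp_cont x) (@sqrt_continuous R _). Qed.

Lemma dotp_pd (i : 'I_n) : has_pd i (fun x => dotp x x) (fun x => 2 * x ord0 i).
Proof.
move=> x; rewrite /dotp.
have H j : is_derive x (evec R i) (fun y : 'rV[R]_n => y ord0 j * y ord0 j)
    (2 * (x ord0 i * (j == i)%:R)).
  have H1 : is_derive x (evec R i) (fun y : 'rV[R]_n => y ord0 j) (j == i)%:R.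
    have [->|ij] := eqVneq j i; last exact: (has_pd_coord_neq (@id R) ij x).
    exact: (@has_pd_coord R n i id (fun=> 1) (fun t => is_derive_id t (1 : R)) x).
  apply: is_derive_eq (dvM H1 H1) _.
  by have [->|ij] := eqVneq j i; rewrite ?mulr0 ?mul0r ?addr0 ?mulr1 ?mul1r ?mulr2n ?mulrDl ?mul1r.
apply: is_derive_eq (dv_sum (index_enum _) H) _.
rewrite -mulr_sumr (bigD1 i)//= eqxx mulr1 big1 ?addr0// => j /negbTE ->.
by rewrite mulr0.
Qed.

Lemma enorm_dv (i : 'I_n) x : x != 0 ->
  is_derive x (evec R i) (fun y => enorm y) (x ord0 i * invr x).
Proof.
move=> x0.
have h : is_derive x (evec R i) (fun y : 'rV[R]_n => Num.sqrt (dotp y y))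
    ((2 * Num.sqrt (dotp x x))^-1 * (2 * x ord0 i)).
  apply: (dv_comp (F := Num.sqrt)) (dotp_pd i x).
  exact: is_derive1_sqrt (dotp_gt0 x0).
apply: is_derive_eq h _.
rewrite /invr /enorm; set e := Num.sqrt _.
have e0 : e != 0 by rewrite gt_eqF// enorm_gt0.
by field.
Qed.

Lemma invr_dv (i : 'I_n) x : x != 0 ->
  is_derive x (evec R i) (fun y => invr y) (- (x ord0 i * invr x ^+ 3)).
Proof.
move=> x0; have e0 : enorm x != 0 by rewrite gt_eqF// enorm_gt0.
apply: is_derive_eq (dvV e0 (enorm_dv i x0)) _.
by rewrite -/(invr x); ring.
Qed.

Lemma invr_ge0' x : 0 <= invr x. Proof. by rewrite invr_ge0 enorm_ge0. Qed.

Lemma mul_enorm_invr x : x != 0 -> enorm x * invr x = 1.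
Proof. by move=> x0; rewrite divff// gt_eqF// enorm_gt0. Qed.

Definition Cz f := forall x, x != 0 -> {for x, continuous f}.

Lemma CzE f : continuous f -> Cz f. Proof. by move=> cf x _; exact: cf. Qed.
Lemma CzD f g : Cz f -> Cz g -> Cz (fun x => f x + g x).
Proof. by move=> cf cg x x0; exact: (cvgD (cf x x0) (cg x x0)). Qed.
Lemma CzM f g : Cz f -> Cz g -> Cz (fun x => f x * g x).
Proof. by move=> cf cg x x0; exact: (cvgM (cf x x0) (cg x x0)). Qed.
Lemma CzN f : Cz f -> Cz (fun x => - f x).
Proof. by move=> cf x x0; exact: (cvgN (cf x x0)). Qed.
Lemma CzX f m : Cz f -> Cz (fun x => f x ^+ m).
Proof.
move=> cf; elim: m => [|m IH]; first by apply: CzE; exact: cst_continuous.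
by under eq_fun do rewrite exprS; exact: CzM.
Qed.
Lemma Cz_sum (I : Type) (s : seq I) (F : I -> 'rV[R]_n -> R) :
  (forall i, Cz (F i)) -> Cz (fun x => \sum_(i <- s) F i x).
Proof.
move=> h; elim: s => [|i s IH].
  by under eq_fun do rewrite big_nil; apply: CzE; exact: cst_continuous.
by under eq_fun do rewrite big_cons; exact: CzD.
Qed.
Lemma Cz_invr : Cz invr.
Proof.
move=> x x0; apply: continuousV; last exact: enorm_cont.
by rewrite gt_eqF// enorm_gt0.
Qed.

Definition vz f := exists2 t : R, 0 < t & forall x, (forall i, `|x ord0 i| < t) -> f x = 0.

Lemma vzMl f g : vz f -> vz (fun x => f x * g x).
Proof. by move=> [t t0 h]; exists t => // x /h ->; rewrite mul0r. Qed.
Lemma vzMr f g : vz f -> vz (fun x => g x * f x).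
Proof. by move=> [t t0 h]; exists t => // x /h ->; rewrite mulr0. Qed.
Lemma vzD f g : vz f -> vz g -> vz (fun x => f x + g x).
Proof.
move=> [t t0 h] [u u0 k]; exists (Num.min t u); first by rewrite lt_min t0.
move=> x hx; rewrite h ?k ?addr0// => i.
  by have := hx i; rewrite lt_min => /andP[].
by have := hx i; rewrite lt_min => /andP[].
Qed.
Lemma vz0 : vz (fun=> 0).
Proof. by exists 1. Qed.

Let V : normedModType R := 'rV[R]_n.

Lemma near0_box (x : V) (t : R) : (forall i, `|(x : 'rV[R]_n) ord0 i| < t) ->
  \forall y \near x, forall i, `|(y : 'rV[R]_n) ord0 i| < t.
Proof.
move=> xt; apply: (@filter_forall _ _ _ _ (nbhs_filter x)) => i.
have /cvgrPdist_lt/(_ (t - `|x ord0 i|)) := @coord_cont R n i x.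
rewrite subr_gt0 => /(_ (xt i)); apply: filterS => y hy.
have := lerB_dist (y ord0 i) (x ord0 i); rewrite distrC.
by lra.
Qed.

Lemma vz_pd (i : 'I_n) f df : vz f -> has_pd i f df -> vz df.
Proof.
move=> [t t0 h] df1; exists t => // x xt; have [_ <-] := df1 x.
have : \forall y \near (x : V), f y = (fun=> 0) y.
  by apply: filterS (near0_box xt) => y; exact: h.
by move=> /near_eq_derive ->; rewrite derive_cst.
Qed.

Lemma vz_cont f : Cz f -> vz f -> continuous f.
Proof.
move=> cf [t t0 h] x; have [->|x0] := eqVneq x 0; last exact: cf.
have z0 i : `|(0 : 'rV[R]_n) ord0 i| < t by rewrite mxE normr0.
rewrite /continuous_at (h 0)//; apply: (@cvg_near_cst _ _ _ _ (nbhs (0 : V))).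
by apply: filterS (near0_box z0) => y /h ->.
Qed.

Lemma vz_has_pd (i : 'I_n) f df : vz f -> vz df ->
  (forall x, x != 0 -> is_derive x (evec R i) f (df x)) -> has_pd i f df.
Proof.
move=> [t t0 h] [u u0 h'] d x; have [->|x0] := eqVneq x 0; last exact: d.
have z0 (s : R) : 0 < s -> forall i, `|(0 : 'rV[R]_n) ord0 i| < s.
  by move=> s0 j; rewrite mxE normr0.
rewrite (h' 0); last exact: z0.
have : \forall y \near (0 : V), (fun=> 0) y = f y.
  by apply: filterS (near0_box (z0 _ t0)) => y /h ->.
by move=> /near_eq_is_derive; apply; exact: dvC.
Qed.

(** The class of integrands of the multiplier method. A factor vanishing near the origin makes the
    product with any function continuous off the origin, such as [enorm] or a power of [invr],
    continuous everywhere, so membership can be checked syntactically. *)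
Definition Zc f := [/\ Cz f, vz f & bsupp f].

Lemma ZcD f g : Zc f -> Zc g -> Zc (fun x => f x + g x).
Proof. by move=> [? ? ?] [? ? ?]; split; [exact: CzD|exact: vzD|exact: bsuppD]. Qed.
Lemma ZcMl f g : Zc f -> Cz g -> Zc (fun x => f x * g x).
Proof. by move=> [? ? ?] ?; split; [exact: CzM|exact: vzMl|exact: bsuppMl]. Qed.
Lemma ZcMr f g : Zc f -> Cz g -> Zc (fun x => g x * f x).
Proof. by move=> [? ? ?] ?; split; [exact: CzM|exact: vzMr|exact: bsuppMr]. Qed.
Lemma ZcN f : Zc f -> Zc (fun x => - f x).
Proof.
move=> [cf [t t0 h] sf]; split; [exact: CzN| |exact: bsuppN].
by exists t => // x /h ->; rewrite oppr0.
Qed.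
Lemma Zc0 : Zc (fun=> 0).
Proof. by split; [apply: CzE; exact: cst_continuous|exact: vz0|exists 0]. Qed.
Lemma Zc_sum (I : Type) (s : seq I) (F : I -> 'rV[R]_n -> R) :
  (forall i, Zc (F i)) -> Zc (fun x => \sum_(i <- s) F i x).
Proof.
move=> h; elim: s => [|i s IH].
  by under eq_fun do rewrite big_nil; exact: Zc0.
by under eq_fun do rewrite big_cons; exact: ZcD.
Qed.
Lemma Zc_Cz f : Zc f -> Cz f. Proof. by case. Qed.
Lemma ZcX f m : Zc f -> Zc (fun x => f x ^+ m.+1).
Proof.
by move=> zf; under eq_fun do rewrite exprS; apply: ZcMl => //; apply: CzX; exact: Zc_Cz.
Qed.

Lemma Zc_int f D : measurable D -> Zc f -> (leb R n).-integrable D (EFin \o f).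
Proof. by move=> mD [cf vf sf]; apply: cc_integrable => //; exact: vz_cont. Qed.

Lemma nice_Zc f : nice f -> vz f -> bsupp f -> Zc f.
Proof. by move=> nf vf sf; split => //; apply: CzE; exact: nice_cont. Qed.

Lemma nice_vz_pd (i : 'I_n) f : nice f -> vz f -> vz (pd i f).
Proof. by move=> nf vf; exact: vz_pd vf (nice_has i nf). Qed.

Lemma nice_bsupp_pd (i : 'I_n) f : nice f -> bsupp f -> bsupp (pd i f).
Proof. by move=> nf vf; exact: bsupp_pd vf (nice_has i nf). Qed.

End EuclideanNorm.

Section Divergence.
Variables (R : realType) (d : nat).

(** Derivatives are computed off the origin only; at the origin both the field and its derivative
    vanish identically nearby ([vz_has_pd]). On the boundary only the normal component survives. *)
Lemma div_half (Y dY : 'I_d.+1 -> 'rV[R]_d.+1 -> R) :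
  (forall j, Zc (Y j)) -> (forall j, Zc (dY j)) ->
  (forall j x, x != 0 -> is_derive x (evec R j) (Y j) (dY j x)) ->
  \int[leb R d.+1]_(x in half_space R d) (\sum_j dY j x) =
  - \int[leb R d]_x Y ord_max (boundary_pt x).
Proof.
move=> zY zdY dYd; have mO := @measurable_half R d.
rewrite Rintegral_sum//; last by move=> j; exact: Zc_int.
have H j : has_pd j (Y j) (dY j).
  have [_ v1 _] := zY j; have [_ v2 _] := zdY j; exact: vz_has_pd v1 v2 (dYd j).
have cY j : continuous (Y j) by apply: vz_cont; case: (zY j).
have cdY j : continuous (dY j) by apply: vz_cont; case: (zdY j).
have sY j : bsupp (Y j) by case: (zY j).
rewrite (bigD1 ord_max)//= big1 ?addr0 => [|j jm]; last exact: (@ibp_half _ _ j (Y j)).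
exact: ibp_half_max.
Qed.

End Divergence.

Lemma sum_lin (R : comNzRingType) (N : nat) (f1 f2 f3 f4 f5 f6 f7 f8 f9 f10 f11 : 'I_N -> R)
    (c1 c2 c3 c4 c5 c6 c7 c8 c9 c10 c11 z w : R) :
  \sum_j (f1 j * c1 + f2 j * c2 + c3 * f3 j + c4 * f4 j + c5 * f5 j + c6 * f6 j + c7 * f7 j
    + z + c8 * f8 j + w + c9 * f9 j + c10 * f10 j + c11 * f11 j) =
  (\sum_j f1 j) * c1 + (\sum_j f2 j) * c2 + c3 * (\sum_j f3 j) + c4 * (\sum_j f4 j)
    + c5 * (\sum_j f5 j) + c6 * (\sum_j f6 j) + c7 * (\sum_j f7 j) + N%:R * z
    + c8 * (\sum_j f8 j) + N%:R * w + c9 * (\sum_j f9 j) + c10 * (\sum_j f10 j)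
    + c11 * (\sum_j f11 j).
Proof.
by rewrite !big_split/= -!mulr_suml -!mulr_sumr !sumr_const card_ord !mulr_natl.
Qed.

(** * The multiplier identity *)

(* The commutator terms cancel because the phase gradient k x / r is curl free. *)
Section Algebra.
Variables (R : realFieldType) (N : nat) (X A B : 'I_N -> R) (AA BB : 'I_N -> 'I_N -> R).
Variables (a b r s k e c : R).
Hypotheses (AAs : forall i j, AA i j = AA j i) (BBs : forall i j, BB i j = BB j i).
Hypotheses (rs : r * s = 1) (r2 : \sum_i X i ^+ 2 = r ^+ 2) (ck : c * k = e).

Let p i := A i + k * (X i * s) * b.
Let q i := B i - k * (X i * s) * a.
Let P i j := AA i j + k * (((j == i)%:R * s - X i * X j * s ^+ 3) * b + X i * s * B j).
Let Q i j := BB i j - k * (((j == i)%:R * s - X i * X j * s ^+ 3) * a + X i * s * A j).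
Let Mp := 2 * (\sum_i X i * p i) + (N%:R - 1) * a + c * r * a.
Let Mq := 2 * (\sum_i X i * q i) + (N%:R - 1) * b + c * r * b.
Let dMp j := 2 * (p j + \sum_i X i * P i j) + (N%:R - 1) * A j + c * (X j * s * a + r * A j).
Let dMq j := 2 * (q j + \sum_i X i * Q i j) + (N%:R - 1) * B j + c * (X j * s * b + r * B j).
Let Z := \sum_i (p i ^+ 2 + q i ^+ 2).
Let W := a ^+ 2 + b ^+ 2.

(** For [w = a + i b], [p + i q] is the modulated gradient [grad w - i k (x / r) w], with Jacobian
    [P + i Q], and [Mp + i Mq = 2 x . (p + i q) + (N - 1) w + c r w] is the multiplier. The left
    side is the divergence of the field [Y] of the section on the multiplier. The choice [c = e / k]
    is the one for which the terms in [e] combine with those of [c r w] into the bracket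
    [r Z - (N - 1) / 2 s W], whose integral is nonnegative. *)
Lemma multiplier_algebra :
  \sum_j (- (P j j * Mp + p j * dMp j + (Q j j * Mq + q j * dMq j)) +
     (Z + X j * \sum_i 2 * (p i * P i j + q i * Q i j)) +
     c / 2 * ((s - X j ^+ 2 * s ^+ 3) * W + X j * s * (2 * (a * A j + b * B j)))) =
  (- (\sum_j AA j j) - k ^+ 2 * a + e * b) * Mp +
  (- (\sum_j BB j j) - k ^+ 2 * b - e * a) * Mq -
  (Z + c * (r * Z - (N%:R - 1) / 2 * (s * W))).
Proof.
pose Sp := \sum_i X i * p i; pose Sq := \sum_i X i * q i.
set LA := \sum_j AA j j; set LB := \sum_j BB j j.
have s2 : s ^+ 2 * r ^+ 2 = 1 by rewrite -exprMn mulrC rs expr1n.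
have XA : \sum_j X j * A j = Sp - k * r * b.
  have -> : Sp = \sum_j X j * A j + k * s * b * (\sum_j X j ^+ 2).
    by rewrite mulr_sumr -big_split; apply: eq_bigr => i _ /=; rewrite /p; ring.
  rewrite r2 (_ : k * s * b * r ^+ 2 = k * r * b * (r * s)); last by ring.
  by rewrite rs; ring.
have XB : \sum_j X j * B j = Sq + k * r * a.
  have -> : Sq = \sum_j X j * B j - k * s * a * (\sum_j X j ^+ 2).
    by rewrite mulr_sumr -sumrB; apply: eq_bigr => i _ /=; rewrite /q; ring.
  rewrite r2 (_ : k * s * a * r ^+ 2 = k * r * a * (r * s)); last by ring.
  by rewrite rs; ring.
have pA : \sum_j (p j * A j + q j * B j) = Z - k * s * b * Sp + k * s * a * Sq.
  rewrite /Z /Sp /Sq !mulr_sumr -sumrB -big_split; apply: eq_bigr => i _ /=.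
  by rewrite /p /q; ring.
have trP : \sum_j P j j = LA + k * ((N%:R - 1) * s * b + s * (\sum_j X j * B j)).
  have -> : \sum_j P j j = LA + (k * s * b * \sum_(j < N) 1 - k * s ^+ 3 * b * (\sum_j X j ^+ 2)
      + k * s * \sum_j X j * B j).
    rewrite !mulr_sumr -sumrB -!big_split; apply: eq_bigr => i _ /=.
    by rewrite /P eqxx /=; ring.
  rewrite r2 sumr_const card_ord (_ : k * s ^+ 3 * b * r ^+ 2 = k * s * b * (s ^+ 2 * r ^+ 2)); last by ring.
  by rewrite s2; ring.
have trQ : \sum_j Q j j = LB - k * ((N%:R - 1) * s * a + s * (\sum_j X j * A j)).
  have -> : \sum_j Q j j = LB - (k * s * a * \sum_(j < N) 1 - k * s ^+ 3 * a * (\sum_j X j ^+ 2)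
      + k * s * \sum_j X j * A j).
    rewrite !mulr_sumr -sumrB -big_split -sumrB; apply: eq_bigr => i _ /=.
    by rewrite /Q eqxx /=; ring.
  rewrite r2 sumr_const card_ord (_ : k * s ^+ 3 * a * r ^+ 2 = k * s * a * (s ^+ 2 * r ^+ 2)); last by ring.
  by rewrite s2; ring.
pose DD := \sum_j (p j * (\sum_i X i * P i j) + q j * (\sum_i X i * Q i j)).
have DE : \sum_j X j * (\sum_i (p i * P i j + q i * Q i j)) = DD.
  apply/eqP; rewrite -subr_eq0; apply/eqP.
  have -> : \sum_j X j * (\sum_i (p i * P i j + q i * Q i j)) =
      \sum_j \sum_i X i * (p j * P j i + q j * Q j i).
    by rewrite exchange_big; apply: eq_bigr => i _; rewrite mulr_sumr.
  rewrite /DD -sumrB.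
  (* After exchanging the indices only the antisymmetric parts of the Jacobians remain, such as
     [k s (X_j B_i - X_i B_j)]; the double sum then factors as [k s (Sp Sq - Sq Sp)]. *)
  transitivity (\sum_j \sum_i (k * s * (p j * X j * (X i * q i) - q j * X j * (X i * p i)))).
    apply: eq_bigr => j _; rewrite !mulr_sumr -big_split -sumrB; apply: eq_bigr => i _ /=.
    rewrite /P /Q (AAs j i) (BBs j i) (eq_sym j i) /p /q.
    by ring.
  transitivity (k * s * (Sp * Sq - Sq * Sp)); last by ring.
  rewrite /Sp /Sq mulrBr !mulr_suml !mulr_sumr -sumrB; apply: eq_bigr => j _.
  by rewrite !mulr_sumr -sumrB; apply: eq_bigr => i _; ring.
transitivity (\sum_j (P j j * (- Mp) + Q j j * (- Mq) + (-2) * (p j ^+ 2 + q j ^+ 2)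
    + (-2) * (p j * (\sum_i X i * P i j) + q j * (\sum_i X i * Q i j))
    + (- (N%:R - 1 + c * r)) * (p j * A j + q j * B j)
    + (- (c * s * a)) * (X j * p j) + (- (c * s * b)) * (X j * q j)
    + Z + 2 * (X j * \sum_i (p i * P i j + q i * Q i j))
    + c / 2 * W * s + (- (c / 2 * W * s ^+ 3)) * X j ^+ 2
    + c * s * a * (X j * A j) + c * s * b * (X j * B j))).
  apply: eq_bigr => j _; rewrite -mulr_sumr /dMp /dMq.
  set SP := \sum_i X i * P i j; set SQ := \sum_i X i * Q i j.
  set SS := \sum_i (p i * P i j + q i * Q i j).
  move: (P j j) (Q j j) (p j) (q j) Mp Mq => Pj Qj pj qj mp mq.
  by field.
apply: etrans (sum_lin (fun j => P j j) (fun j => Q j j) (fun j => p j ^+ 2 + q j ^+ 2)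
  (fun j => p j * (\sum_i X i * P i j) + q j * (\sum_i X i * Q i j))
  (fun j => p j * A j + q j * B j) (fun j => X j * p j) (fun j => X j * q j)
  (fun j => X j * \sum_i (p i * P i j + q i * Q i j)) (fun j => X j ^+ 2)
  (fun j => X j * A j) (fun j => X j * B j) _ _ _ _ _ _ _ _ _ _ _ Z (c / 2 * W * s)) _.
rewrite -[\sum_j (p j ^+ 2 + q j ^+ 2)]/Z -/DD -/Sp -/Sq.
rewrite DE trP trQ pA XA XB r2 /Mp /Mq -/Sp -/Sq.
have r0 : r != 0 by apply/eqP => r0; move: rs; rewrite r0 mul0r => /eqP; rewrite eq_sym oner_eq0.
have -> : s = r^-1 by apply: (mulfI r0); rewrite rs divff.
rewrite -ck; field.
exact: r0.
Qed.

End Algebra.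

Ltac fun_head t := lazymatch t with ?h _ => fun_head h | _ => constr:(t) end.

Ltac zc_hyp := lazymatch goal with
  | |- Zc (fun x => ?f x) => change (Zc f); zc_hyp_eta
  | |- _ => zc_hyp_eta
  end
with zc_hyp_eta := lazymatch goal with |- Zc ?f =>
  match goal with
  | H : Zc ?g |- _ => constr_eq g f; exact H
  | H : forall i, Zc (pd i ?g) |- _ => lazymatch f with pd _ g => exact: H end
  | H : forall i j, Zc (pd j (pd i ?g)) |- _ => lazymatch f with pd _ (pd _ g) => exact: H end
  | H : forall i, Zc (?g i) |- _ => let h := fun_head f in constr_eq g h; exact: H
  | H : forall i j, Zc (?g i j) |- _ => let h := fun_head f in constr_eq g h; exact: H
  end end.

Ltac cz := match goal with
  | |- Cz (fun x => _ + _) => apply: CzD; cz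
  | |- Cz (fun x => - _) => apply: CzN; cz
  | |- Cz (fun x => _ * _) => apply: CzM; cz
  | |- Cz (fun x => _ ^+ _) => apply: CzX; cz
  | |- Cz (fun x => \sum_(i <- _) _) => apply: Cz_sum => ?; cz
  | |- Cz (fun x => ?c) => by apply: CzE; exact: cst_continuous
  | |- Cz (fun x => fun_of_matrix x _ _) => by apply: CzE; exact: coord_cont
  | |- Cz (fun x => invr x) => exact: Cz_invr
  | |- Cz (@invr _ _) => exact: Cz_invr
  | |- Cz (fun x => enorm x) => by apply: CzE; exact: enorm_cont
  | |- Cz (@enorm _ _) => by apply: CzE; exact: enorm_cont
  | |- Cz _ => first [ by apply: Zc_Cz; zc_hyp | exact: Cz_invr | by apply: CzE; exact: cst_continuous
      | by apply: CzE; exact: coord_cont | by apply: CzE; exact: enorm_cont ]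
  end.

Ltac zc := lazymatch goal with
  | |- Zc (fun x => _ + _) => apply: ZcD; zc
  | |- Zc (fun x => - _) => apply: ZcN; zc
  | |- Zc (fun x => \sum_(i <- _) _) => apply: Zc_sum => ?; zc
  | |- Zc (fun x => _ ^+ _) => apply: ZcX; zc
  | |- Zc (fun x => _ * _) =>
      first [ by apply: ZcMl; [zc|cz] | by apply: ZcMr; [zc|cz] ]
  | |- Zc _ => zc_hyp
  end.

Definition lap (R : realType) n (f : 'rV[R]_n -> R) x := \sum_i pd i (pd i f) x.

Lemma energy_algebra (R : comNzRingType) (A B la lb k e : R) :
  B * (- la - k ^+ 2 * A + e * B) - A * (- lb - k ^+ 2 * B - e * A) =
  A * lb - B * la + e * (A ^+ 2 + B ^+ 2).
Proof. by ring. Qed.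

(** The terms in [z], [h] and [c^2 w] each absorb a quarter of [z]: [h <= 4 z], and
    [c^2 w / 4 <= (F + h / 4) / 4]. What remains is [z / 4 <= (21 / 4 + 4 D^2) F], the origin of the
    constant [21 + 16 D^2]. *)
Lemma estimate_algebra (R : realFieldType) (D F z h w c e T fm : R) :
  fm <= (5 + 4 * D ^+ 2) * F + 4^-1 * z + 16^-1 * h + c ^+ 2 / 4 * w -> z <= fm ->
  h <= 4 * z -> `|e| * w <= F + 4^-1 * h -> c ^+ 2 * w <= `|e| * w -> T <= 2 * h + z ->
  [/\ h <= 4 * (21 + 16 * D ^+ 2) * F, T <= 9 * (21 + 16 * D ^+ 2) * F &
      `|e| * w <= ((21 + 16 * D ^+ 2) + 1) * F /\ z <= (21 + 16 * D ^+ 2) * F].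
Proof.
move=> h1 h2 h3 h4 h5 h6.
have hz : z <= (21 + 16 * D ^+ 2) * F by lra.
by split; [lra|lra|split; lra].
Qed.

Lemma bracket_algebra (R : realFieldType) (t w m z v : R) : 1 <= t -> 0 <= w ->
  2 * t * w = - 2 * m -> 0 <= z + 2 * t * m + t ^+ 2 * w -> z <= v -> t * w <= v.
Proof.
move=> t1 w0 e h zv.
have -> : t * w = t ^+ 2 * w - (t - 1) * (t * w) by ring.
have h1 : 0 <= (t - 1) * (t * w).
  by apply: mulr_ge0; [rewrite subr_ge0|apply: mulr_ge0 => //; apply: le_trans t1].
have m1 : m = - (t * w) by lra.
have h2 : 2 * t * m = - 2 * (t ^+ 2 * w) by rewrite m1; ring.
by lra.
Qed.

Section Multiplier.
Variables (R : realType) (d : nat).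
Hypothesis d2 : (2 <= d)%N.
Local Notation N := (d.+1%:R : R).
Local Notation Om := (half_space R d).
Local Notation mu := (leb R d.+1).
Variables (a b : 'rV[R]_d.+1 -> R) (k e c : R).
Hypotheses (na : nice a) (nb : nice b) (va : vz a) (vb : vz b) (sa : bsupp a) (sb : bsupp b).
Hypotheses (a0 : forall x : 'rV[R]_d.+1, x ord0 ord_max = 0 -> pd ord_max a x = 0).
Hypotheses (b0 : forall x : 'rV[R]_d.+1, x ord0 ord_max = 0 -> pd ord_max b x = 0).
Hypotheses (k0 : k != 0) (c0 : 0 < c) (ck : c * k = e) (ek : `|e| <= k ^+ 2).

Let p i (x : 'rV[R]_d.+1) := pd i a x + k * (x ord0 i * invr x) * b x.
Let q i (x : 'rV[R]_d.+1) := pd i b x - k * (x ord0 i * invr x) * a x.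
Let F1 x := - lap a x - k ^+ 2 * a x + e * b x.
Let F2 x := - lap b x - k ^+ 2 * b x - e * a x.
Let Sp (x : 'rV[R]_d.+1) := \sum_i x ord0 i * p i x.
Let Sq (x : 'rV[R]_d.+1) := \sum_i x ord0 i * q i x.
Let Mp x := 2 * Sp x + (N - 1) * a x + c * enorm x * a x.
Let Mq x := 2 * Sq x + (N - 1) * b x + c * enorm x * b x.
Let Z x := \sum_i (p i x ^+ 2 + q i x ^+ 2).
Let W x := a x ^+ 2 + b x ^+ 2.

Let mO : measurable Om := @measurable_half R d.
Let za : Zc a := nice_Zc na va sa.
Let zb : Zc b := nice_Zc nb vb sb.
Let zda i : Zc (pd i a) := nice_Zc (nice_pd i na) (nice_vz_pd i na va) (nice_bsupp_pd i na sa).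
Let zdb i : Zc (pd i b) := nice_Zc (nice_pd i nb) (nice_vz_pd i nb vb) (nice_bsupp_pd i nb sb).
Let zdda i j : Zc (pd j (pd i a)) := nice_Zc (nice_pd j (nice_pd i na))
  (nice_vz_pd j (nice_pd i na) (nice_vz_pd i na va))
  (nice_bsupp_pd j (nice_pd i na) (nice_bsupp_pd i na sa)).
Let zddb i j : Zc (pd j (pd i b)) := nice_Zc (nice_pd j (nice_pd i nb))
  (nice_vz_pd j (nice_pd i nb) (nice_vz_pd i nb vb))
  (nice_bsupp_pd j (nice_pd i nb) (nice_bsupp_pd i nb sb)).

Let zp i : Zc (p i). Proof. by rewrite /p; zc. Qed.
Let zq i : Zc (q i). Proof. by rewrite /q; zc. Qed.
Let zSp : Zc Sp. Proof. by rewrite /Sp; zc. Qed.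
Let zSq : Zc Sq. Proof. by rewrite /Sq; zc. Qed.
Let zMp : Zc Mp. Proof. by rewrite /Mp; zc. Qed.
Let zMq : Zc Mq. Proof. by rewrite /Mq; zc. Qed.
Let zZ : Zc Z. Proof. by rewrite /Z; zc. Qed.
Let zW : Zc W. Proof. by rewrite /W; zc. Qed.
Let zF1 : Zc F1. Proof. by rewrite /F1 /lap; zc. Qed.
Let zF2 : Zc F2. Proof. by rewrite /F2 /lap; zc. Qed.

Let P i j (x : 'rV[R]_d.+1) := pd j (pd i a) x + k * (((j == i)%:R * invr x -
  x ord0 i * x ord0 j * invr x ^+ 3) * b x + x ord0 i * invr x * pd j b x).
Let Q i j (x : 'rV[R]_d.+1) := pd j (pd i b) x - k * (((j == i)%:R * invr x -
  x ord0 i * x ord0 j * invr x ^+ 3) * a x + x ord0 i * invr x * pd j a x).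

Let zP i j : Zc (P i j). Proof. by rewrite /P; zc. Qed.
Let zQ i j : Zc (Q i j). Proof. by rewrite /Q; zc. Qed.

Lemma coord_dv (i j : 'I_d.+1) (x : 'rV[R]_d.+1) :
  is_derive x (evec R j) (fun y : 'rV[R]_d.+1 => y ord0 i) (j == i)%:R.
Proof.
have [->|ij] := eqVneq j i.
  exact: (@has_pd_coord R _ i id (fun=> 1) (fun t => is_derive_id t (1 : R)) x).
by rewrite eq_sym in ij; exact: (has_pd_coord_neq (@id R) ij x).
Qed.

Let dvxs i j x : x != 0 -> is_derive x (evec R j)
  (fun y : 'rV[R]_d.+1 => y ord0 i * invr y)
  ((j == i)%:R * invr x - x ord0 i * x ord0 j * invr x ^+ 3).
Proof.
by move=> x0; apply: is_derive_eq (dvM (coord_dv i j x) (invr_dv j x0)) _; ring.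
Qed.

Let dvp i j x : x != 0 -> is_derive x (evec R j) (p i) (P i j x).
Proof.
move=> x0; have h1 := dvM (dvZ k (dvxs i j x0)) (nice_has j nb x).
by apply: is_derive_eq (dvD (nice_has j (nice_pd i na) x) h1) _; rewrite /P; ring.
Qed.

Let dvq i j x : x != 0 -> is_derive x (evec R j) (q i) (Q i j x).
Proof.
move=> x0; have h1 := dvM (dvZ k (dvxs i j x0)) (nice_has j na x).
by apply: is_derive_eq (dvB (nice_has j (nice_pd i nb) x) h1) _; rewrite /Q; ring.
Qed.

Let dvW j x : is_derive x (evec R j) W (2 * (a x * pd j a x + b x * pd j b x)).
Proof.
by apply: is_derive_eq (dvD (dvX2 (nice_has j na x)) (dvX2 (nice_has j nb x))) _; ring.
Qed.

Let dvS (f : 'I_d.+1 -> 'rV[R]_d.+1 -> R) (df : 'I_d.+1 -> R) j x :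
  (forall i, is_derive x (evec R j) (f i) (df i)) ->
  is_derive x (evec R j) (fun y : 'rV[R]_d.+1 => \sum_i y ord0 i * f i y)
    (f j x + \sum_i x ord0 i * df i).
Proof.
move=> h; have h1 i := dvM (coord_dv i j x) (h i).
apply: is_derive_eq (dv_sum (index_enum _) h1) _.
rewrite big_split/=; congr (_ + _); rewrite (bigD1 j)//= eqxx mul1r big1 ?addr0// => i ij.
by rewrite eq_sym (negbTE ij) mul0r.
Qed.

Let dM (x : 'rV[R]_d.+1) (f : 'rV[R]_d.+1 -> R) (pj : R) (S : R) j :=
  2 * (pj + S) + (N - 1) * pd j f x + c * (x ord0 j * invr x * f x + enorm x * pd j f x).

Let dvMp j x : x != 0 ->
  is_derive x (evec R j) Mp (dM x a (p j x) (\sum_i x ord0 i * P i j x) j).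
Proof.
move=> x0; have h1 := dvZ 2 (dvS (fun i => dvp i j x0)).
have h2 := dvZ (N - 1) (nice_has j na x).
have h3 := dvM (dvZ c (enorm_dv j x0)) (nice_has j na x).
by apply: is_derive_eq (dvD (dvD h1 h2) h3) _; rewrite /dM; ring.
Qed.

Let dvMq j x : x != 0 ->
  is_derive x (evec R j) Mq (dM x b (q j x) (\sum_i x ord0 i * Q i j x) j).
Proof.
move=> x0; have h1 := dvZ 2 (dvS (fun i => dvq i j x0)).
have h2 := dvZ (N - 1) (nice_has j nb x).
have h3 := dvM (dvZ c (enorm_dv j x0)) (nice_has j nb x).
by apply: is_derive_eq (dvD (dvD h1 h2) h3) _; rewrite /dM; ring.
Qed.

Let zSP j : Zc (fun x : 'rV[R]_d.+1 => \sum_i x ord0 i * P i j x). Proof. by zc. Qed.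
Let zSQ j : Zc (fun x : 'rV[R]_d.+1 => \sum_i x ord0 i * Q i j x). Proof. by zc. Qed.
Let zdMa j : Zc (fun x : 'rV[R]_d.+1 => dM x a (p j x) (\sum_i x ord0 i * P i j x) j).
Proof. by rewrite /dM; zc. Qed.
Let zdMb j : Zc (fun x : 'rV[R]_d.+1 => dM x b (q j x) (\sum_i x ord0 i * Q i j x) j).
Proof. by rewrite /dM; zc. Qed.

Let Y j (x : 'rV[R]_d.+1) := - (p j x * Mp x + q j x * Mq x) + x ord0 j * Z x
  + c / 2 * (x ord0 j * invr x * W x).

Let dY j (x : 'rV[R]_d.+1) := - (P j j x * Mp x + p j x * dM x a (p j x) (\sum_i x ord0 i * P i j x) j +
     (Q j j x * Mq x + q j x * dM x b (q j x) (\sum_i x ord0 i * Q i j x) j)) +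
     (Z x + x ord0 j * \sum_i 2 * (p i x * P i j x + q i x * Q i j x)) +
     c / 2 * ((invr x - x ord0 j ^+ 2 * invr x ^+ 3) * W x +
        x ord0 j * invr x * (2 * (a x * pd j a x + b x * pd j b x))).

Let dvY j x : x != 0 -> is_derive x (evec R j) (Y j) (dY j x).
Proof.
move=> x0.
have h1 := dvD (dvM (dvp j j x0) (dvMp j x0)) (dvM (dvq j j x0) (dvMq j x0)).
have h2 i := dvD (dvX2 (dvp i j x0)) (dvX2 (dvq i j x0)).
have h3 := dvM (coord_dv j j x) (dv_sum (index_enum _) h2).
have h4 := dvZ (c / 2) (dvM (dvxs j j x0) (dvW j x)).
apply: is_derive_eq (dvD (dvD (dvN h1) h3) h4) _.
rewrite /dY eqxx /= mul1r; congr (_ + (_ + _ * _) + _ * (_ + _)).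
  by apply: eq_bigr => i _; ring.
by ring.
Qed.

Let boundary0 (x : 'rV[R]_d) : (boundary_pt x : 'rV[R]_d.+1) ord0 ord_max = 0.
Proof. by rewrite /boundary_pt snoc_max. Qed.

Let pm0 x : p ord_max (boundary_pt x) = 0.
Proof. by rewrite /p a0 ?boundary0// !mul0r mulr0 mul0r addr0. Qed.

Let qm0 x : q ord_max (boundary_pt x) = 0.
Proof. by rewrite /q b0 ?boundary0// !mul0r mulr0 mul0r subr0. Qed.

Let Om0 (x : 'rV[R]_d.+1) : Om x -> x != 0.
Proof.
by rewrite /half_space/= => x0; apply/eqP => x00; move: x0; rewrite x00 mxE ltxx.
Qed.

Let I (f : 'rV[R]_d.+1 -> R) := \int[mu]_(x in Om) f x.

Let IE (f g : 'rV[R]_d.+1 -> R) : (forall x, Om x -> f x = g x) -> I f = I g.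
Proof. by move=> h; apply: eq_Rintegral => x /set_mem; exact: h. Qed.

Let ID f g : Zc f -> Zc g -> I (fun x => f x + g x) = I f + I g.
Proof. by move=> zf zg; rewrite /I RintegralD//; exact: Zc_int. Qed.

Let IZ t f : Zc f -> I (fun x => t * f x) = t * I f.
Proof. by move=> zf; rewrite /I RintegralZl//; exact: Zc_int. Qed.

Let Ile f g : Zc f -> Zc g -> (forall x, Om x -> f x <= g x) -> I f <= I g.
Proof. by move=> zf zg h; apply: le_Rintegral => //; exact: Zc_int. Qed.

Let divI (V dV : 'I_d.+1 -> 'rV[R]_d.+1 -> R) : (forall j, Zc (V j)) -> (forall j, Zc (dV j)) ->
  (forall j x, x != 0 -> is_derive x (evec R j) (V j) (dV j x)) ->
  (forall x, V ord_max (boundary_pt x) = 0) -> I (fun x => \sum_j dV j x) = 0.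
Proof.
move=> zV zdV dvV' V0; rewrite /I (div_half zV zdV dvV').
by under eq_Rintegral do rewrite V0; rewrite /Rintegral integral0 oppr0.
Qed.

(** No boundary term appears: the fields [x] and [x / r] are tangential at [x_n = 0], so the Neumann
    condition makes the normal components of [p] and [q] vanish, and the other parts of [Y] carry
    the factor [x_n]. *)
Lemma multiplier_identity : I (fun x => F1 x * Mp x + F2 x * Mq x) =
  I Z + c * (I (fun x => enorm x * Z x) - (N - 1) / 2 * I (fun x => invr x * W x)).
Proof.
have zY j : Zc (Y j) by rewrite /Y; zc.
have zdY j : Zc (dY j).
  rewrite /dY; apply: ZcD; last by zc.
  apply: ZcD; last by zc.
  by apply: ZcN; apply: ZcD; apply: ZcD; (apply: ZcMl; [by auto|by apply: Zc_Cz; auto]).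
have Y0 x : Y ord_max (boundary_pt x) = 0.
  by rewrite /Y pm0 qm0 boundary0 !mul0r mulr0 !addr0 oppr0.
have h := divI zY zdY dvY Y0.
have zrZ : Zc (fun x => enorm x * Z x) by zc.
have zsW : Zc (fun x => invr x * W x) by zc.
have zFM : Zc (fun x => F1 x * Mp x + F2 x * Mq x) by zc.
have : I (fun x => \sum_j dY j x) = I (fun x => (F1 x * Mp x + F2 x * Mq x) +
    -1 * (Z x + c * (enorm x * Z x + - ((N - 1) / 2) * (invr x * W x)))).
  apply: IE => x Ox; have x0 := Om0 Ox.
  have := @multiplier_algebra R d.+1 (fun i => x ord0 i) (fun i => pd i a x) (fun i => pd i b x)
    (fun i j => pd j (pd i a) x) (fun i j => pd j (pd i b) x) (a x) (b x) (enorm x) (invr x) k e c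
    (fun i j => congr1 (fun f => f x) (pd_sym j i na)) (fun i j => congr1 (fun f => f x) (pd_sym j i nb))
    (mul_enorm_invr x0) (esym (enorm_sq x)) ck.
  rewrite -/(p _ x) -/(q _ x) => ->.
  by rewrite mulN1r mulNr.
rewrite h; do ![rewrite ID; [|zc|zc] | rewrite IZ; [|zc]].
by lra.
Qed.

Let sumx2 (x : 'rV[R]_d.+1) : \sum_i x ord0 i ^+ 2 = enorm x ^+ 2.
Proof. by rewrite enorm_sq. Qed.

(** The phase drops out of [Re (conj w grad w)]. Hence derivatives of [|w|^2] are controlled by the
    modulated gradient, and Hardy-type inequalities hold with [Z] in place of [|grad w|^2], with no
    dependence on [k]. *)
Let radial (x : 'rV[R]_d.+1) : \sum_i x ord0 i * (a x * pd i a x + b x * pd i b x) = a x * Sp x + b x * Sq x.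
Proof.
by rewrite /Sp /Sq !mulr_sumr -big_split; apply: eq_bigr => i _; rewrite /p /q /=; ring.
Qed.

Let zsW : Zc (fun x => invr x * W x). Proof. by zc. Qed.
Let zs2W : Zc (fun x => invr x ^+ 2 * W x). Proof. by zc. Qed.
Let zaS : Zc (fun x => a x * Sp x + b x * Sq x). Proof. by zc. Qed.
Let zsS : Zc (fun x => invr x * (a x * Sp x + b x * Sq x)). Proof. by zc. Qed.
Let zs2S : Zc (fun x => invr x ^+ 2 * (a x * Sp x + b x * Sq x)). Proof. by zc. Qed.
Let zrZ : Zc (fun x => enorm x * Z x). Proof. by zc. Qed.

Let dvWs j x : x != 0 -> is_derive x (evec R j) (fun y => invr y * W y)
  (- (x ord0 j * invr x ^+ 3) * W x + invr x * (2 * (a x * pd j a x + b x * pd j b x))).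
Proof. by move=> x0; exact: (dvM (invr_dv j x0) (dvW j x)). Qed.

Let zW1 j : Zc (fun x => a x * pd j a x + b x * pd j b x). Proof. by zc. Qed.
Let zdWs j : Zc (fun x : 'rV[R]_d.+1 => - (x ord0 j * invr x ^+ 3) * W x +
  invr x * (2 * (a x * pd j a x + b x * pd j b x))).
Proof.
apply: ZcD; first by apply: ZcMr; [|cz].
by apply: ZcMr; [apply: ZcMr; [|cz]|cz].
Qed.

Lemma weight_identity : (N - 1) * I (fun x => invr x * W x) =
  - 2 * I (fun x => invr x * (a x * Sp x + b x * Sq x)).
Proof.
pose V j (x : 'rV[R]_d.+1) := x ord0 j * invr x * W x.
pose dV j (x : 'rV[R]_d.+1) := ((j == j)%:R * invr x - x ord0 j * x ord0 j * invr x ^+ 3) * W x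
  + x ord0 j * invr x * (2 * (a x * pd j a x + b x * pd j b x)).
have zV j : Zc (V j) by apply: ZcMr; [|cz].
have zdV j : Zc (dV j).
  by apply: ZcD; [apply: ZcMr; [|cz]|apply: ZcMr; [apply: ZcMr; [|cz]|cz]].
have dvV' j x : x != 0 -> is_derive x (evec R j) (V j) (dV j x).
  by move=> x0; exact: (dvM (dvxs j j x0) (dvW j x)).
have V0 x : V ord_max (boundary_pt x) = 0 by rewrite /V boundary0 !mul0r.
have h := divI zV zdV dvV' V0.
have : I (fun x => \sum_j dV j x) = I (fun x => (N - 1) * (invr x * W x) +
    2 * (invr x * (a x * Sp x + b x * Sq x))).
  apply: IE => x Ox; have rs := mul_enorm_invr (Om0 Ox).
  rewrite -radial /dV; under eq_bigr do rewrite eqxx/= mul1r.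
  rewrite big_split/= -mulr_suml sumrB sumr_const card_ord.
  have -> : \sum_(i < d.+1) x ord0 i * x ord0 i * invr x ^+ 3 = invr x.
    rewrite -mulr_suml (eq_bigr (fun i => x ord0 i ^+ 2)) ?sumx2 => [|i _]; last by rewrite expr2.
    have -> : enorm x ^+ 2 * invr x ^+ 3 = (enorm x * invr x) ^+ 2 * invr x by ring.
    by rewrite rs expr1n mul1r.
  rewrite -mulr_natl; congr (_ + _); first by ring.
  by rewrite !mulr_sumr; apply: eq_bigr => i _; ring.
rewrite h ID; [|by apply: ZcMr; [|cz]..]; rewrite !IZ//; lra.
Qed.

Lemma hardy_identity : (N - 2) * I (fun x => invr x ^+ 2 * W x) =
  - 2 * I (fun x => invr x ^+ 2 * (a x * Sp x + b x * Sq x)).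
Proof.
pose V j (x : 'rV[R]_d.+1) := x ord0 j * invr x * (invr x * W x).
pose dV j (x : 'rV[R]_d.+1) :=
  ((j == j)%:R * invr x - x ord0 j * x ord0 j * invr x ^+ 3) * (invr x * W x)
  + x ord0 j * invr x * (- (x ord0 j * invr x ^+ 3) * W x +
     invr x * (2 * (a x * pd j a x + b x * pd j b x))).
have zV j : Zc (V j) by apply: ZcMr; [|cz].
have zdV j : Zc (dV j) by apply: ZcD; apply: ZcMr; [|cz| |cz].
have dvV' j x : x != 0 -> is_derive x (evec R j) (V j) (dV j x).
  by move=> x0; exact: (dvM (dvxs j j x0) (dvWs j x0)).
have V0 x : V ord_max (boundary_pt x) = 0 by rewrite /V boundary0 !mul0r.
have h := divI zV zdV dvV' V0.
have : I (fun x => \sum_j dV j x) = I (fun x => (N - 2) * (invr x ^+ 2 * W x) +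
    2 * (invr x ^+ 2 * (a x * Sp x + b x * Sq x))).
  apply: IE => x Ox; have rs := mul_enorm_invr (Om0 Ox).
  rewrite -radial /dV.
  transitivity (\sum_j (invr x ^+ 2 * W x + (- 2 * (invr x ^+ 4 * W x)) * x ord0 j ^+ 2
     + (2 * invr x ^+ 2) * (x ord0 j * (a x * pd j a x + b x * pd j b x)))).
    by apply: eq_bigr => j _; rewrite eqxx /=; ring.
  rewrite !big_split/= -!mulr_sumr sumx2 sumr_const card_ord.
  rewrite -[W x *+ d.+1]mulr_natl.
  have -> : - 2 * (invr x ^+ 4 * W x) * enorm x ^+ 2 =
    - 2 * (invr x ^+ 2 * W x) * (enorm x * invr x) ^+ 2 by ring.
  by rewrite rs; ring.
rewrite h ID; [|by apply: ZcMr; [|cz]..]; rewrite !IZ//; lra.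
Qed.

(** Minus the imaginary part of the equation paired with [w]: the gradient term is real and the
    Neumann condition removes the boundary flux. *)
Lemma energy_identity : e * I W = I (fun x => b x * F1 x - a x * F2 x).
Proof.
pose V j (x : 'rV[R]_d.+1) := a x * pd j b x - b x * pd j a x.
pose dV j (x : 'rV[R]_d.+1) := (pd j a x * pd j b x + a x * pd j (pd j b) x)
  - (pd j b x * pd j a x + b x * pd j (pd j a) x).
have zV j : Zc (V j) by rewrite /V; zc.
have zdV j : Zc (dV j) by rewrite /dV; zc.
have dvV' j x : x != 0 -> is_derive x (evec R j) (V j) (dV j x).
  move=> x0; exact: (dvB (dvM (nice_has j na x) (nice_has j (nice_pd j nb) x))
    (dvM (nice_has j nb x) (nice_has j (nice_pd j na) x))).
have V0 x : V ord_max (boundary_pt x) = 0.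
  by rewrite /V a0 ?boundary0// b0 ?boundary0// !mulr0 subr0.
have h := divI zV zdV dvV' V0.
have : I (fun x => b x * F1 x - a x * F2 x) = I (fun x => \sum_j dV j x + e * W x).
  apply: IE => x Ox; rewrite /F1 /F2 /lap /dV /W.
  have -> : \sum_j (pd j a x * pd j b x + a x * pd j (pd j b) x -
    (pd j b x * pd j a x + b x * pd j (pd j a) x)) =
    a x * (\sum_j pd j (pd j b) x) - b x * (\sum_j pd j (pd j a) x).
    rewrite !mulr_sumr -sumrB; apply: eq_bigr => j _.
    by move: (pd j (pd j a) x) (pd j (pd j b) x) (pd j a x) (pd j b x) => *; ring.
  exact: energy_algebra.
have zs : Zc (fun x => \sum_j dV j x) by exact: Zc_sum.
have ze : Zc (fun x => e * W x) by apply: ZcMr => //; cz.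
by move=> ->; rewrite (ID zs ze) h add0r IZ.
Qed.

Lemma trace_identity : \int[leb R d]_x (invr (boundary_pt x) * W (boundary_pt x)) =
  - I (fun x => - (x ord0 ord_max * invr x ^+ 3) * W x +
    invr x * (2 * (a x * pd ord_max a x + b x * pd ord_max b x))).
Proof.
have [c1 v1 s1] := zsW; have [c2 v2 s2] := zdWs ord_max.
rewrite /I (@ibp_half_max R d (fun x => invr x * W x)) ?opprK//; try exact: vz_cont.
by apply: vz_has_pd => // x; exact: dvWs.
Qed.

Lemma sum_CS (I0 : finType) (x y : I0 -> R) :
  (\sum_i x i * y i) ^+ 2 <= (\sum_i x i ^+ 2) * (\sum_i y i ^+ 2).
Proof.
rewrite -subr_ge0 -(pmulr_rge0 _ (ltr0n R 2)).
have -> : 2%:R * ((\sum_i x i ^+ 2) * (\sum_i y i ^+ 2) - (\sum_i x i * y i) ^+ 2) =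
    \sum_i \sum_j (x i * y j - x j * y i) ^+ 2.
  have E (f g : I0 -> R) : (\sum_i f i) * (\sum_j g j) = \sum_i \sum_j f i * g j.
    by rewrite mulr_suml; apply: eq_bigr => i _; rewrite mulr_sumr.
  rewrite expr2 mulrBr mulr_natl mulr2n {1}(mulrC (\sum_i x i ^+ 2)) !E mulr_natl mulr2n.
  rewrite -!big_split -!sumrB; apply: eq_bigr => i _.
  rewrite -!big_split -!sumrB; apply: eq_bigr => j _ /=; ring.
by apply: sumr_ge0 => i _; apply: sumr_ge0 => j _; exact: sqr_ge0.
Qed.

Let SZ x : Sp x ^+ 2 + Sq x ^+ 2 <= enorm x ^+ 2 * Z x.
Proof.
rewrite /Z big_split/= mulrDr -sumx2; apply: lerD; exact: sum_CS.
Qed.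


Let Phi := I (fun x => enorm x ^+ 2 * (F1 x ^+ 2 + F2 x ^+ 2)).
Let K : R := 21 + 16 * d%:R ^+ 2.

Let zPhi : Zc (fun x => enorm x ^+ 2 * (F1 x ^+ 2 + F2 x ^+ 2)). Proof. by zc. Qed.
Let zsS2 : Zc (fun x => invr x * (Sp x ^+ 2 + Sq x ^+ 2)). Proof. by zc. Qed.
Let zFM : Zc (fun x => F1 x * Mp x + F2 x * Mq x). Proof. by zc. Qed.
Let zbF : Zc (fun x => b x * F1 x - a x * F2 x). Proof. by zc. Qed.

Let Z0 x : 0 <= Z x.
Proof. by apply: sumr_ge0 => i _; rewrite addr_ge0 ?sqr_ge0. Qed.

Let W0 x : 0 <= W x. Proof. by rewrite addr_ge0 ?sqr_ge0. Qed.

Let radial_CS x : Om x -> - (2 * (invr x ^+ 2 * (a x * Sp x + b x * Sq x))) <=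
  2^-1 * (invr x ^+ 2 * W x) + 2 * Z x.
Proof.
move=> Ox; have rs := mul_enorm_invr (Om0 Ox); have h := SZ x.
rewrite /W; move: (invr x) (enorm x) (Sp x) (Sq x) (Z x) (a x) (b x) rs h => s r S1 S2 z A B rs h.
have h2 : s ^+ 2 * (S1 ^+ 2 + S2 ^+ 2) <= z.
  have -> : z = s ^+ 2 * (r ^+ 2 * z) by rewrite mulrA -exprMn (mulrC s) rs expr1n mul1r.
  by rewrite ler_wpM2l// sqr_ge0.
have := sqr_ge0 (s * A + 2 * (s * S1)); have := sqr_ge0 (s * B + 2 * (s * S2)).
by nra.
Qed.

(** [hardy_identity] and Young's inequality give [(N - 2) h <= h / 2 + 2 z]; the factor 4 comes from
    [N >= 3]. *)
Let hardy4 : I (fun x => invr x ^+ 2 * W x) <= 4 * I Z.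
Proof.
have h := hardy_identity.
have : I (fun x => - (2 * (invr x ^+ 2 * (a x * Sp x + b x * Sq x)))) <=
    I (fun x => 2^-1 * (invr x ^+ 2 * W x) + 2 * Z x).
  apply: Ile radial_CS; last by apply: ZcD; apply: ZcMr => //; cz.
  by apply: ZcN; apply: ZcMr => //; cz.
rewrite ID; [|by apply: ZcMr => //; cz..].
have -> : (fun x => - (2 * (invr x ^+ 2 * (a x * Sp x + b x * Sq x)))) =
  (fun x => (- 2) * (invr x ^+ 2 * (a x * Sp x + b x * Sq x))).
  by apply/funext => x; rewrite mulNr.
rewrite !IZ// -h => h1.
have h0 : 0 <= I (fun x => invr x ^+ 2 * W x).
  by apply: Rintegral_ge0 => x _; rewrite mulr_ge0 ?sqr_ge0.
have N3 : 3 <= N by rewrite ler_nat.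
by nra.
Qed.

(** The square of [S + t w], divided by [r], is nonnegative for [t = (N - 1) / 2], where
    [S = Sp + i Sq]; [weight_identity] evaluates its cross term, and [t >= 1] reduces [t^2] to [t].
    This makes the [c]-term of [multiplier_identity] nonnegative. *)
Let bracket : (N - 1) / 2 * I (fun x => invr x * W x) <= I (fun x => enorm x * Z x).
Proof.
have h := weight_identity; pose t : R := (N - 1) / 2.
have zl : Zc (fun x => invr x * (Sp x ^+ 2 + Sq x ^+ 2) +
   (2 * t) * (invr x * (a x * Sp x + b x * Sq x)) + t ^+ 2 * (invr x * W x)).
  by apply: ZcD; [apply: ZcD => //|]; apply: ZcMr => //; cz.
have h1 : 0 <= I (fun x => invr x * (Sp x ^+ 2 + Sq x ^+ 2) +
   (2 * t) * (invr x * (a x * Sp x + b x * Sq x)) + t ^+ 2 * (invr x * W x)).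
  apply: Rintegral_ge0 => x _.
  have -> : invr x * (Sp x ^+ 2 + Sq x ^+ 2) + 2 * t * (invr x * (a x * Sp x + b x * Sq x)) +
    t ^+ 2 * (invr x * W x) = invr x * ((Sp x + t * a x) ^+ 2 + (Sq x + t * b x) ^+ 2).
    by rewrite /W; move: (Sp x) (Sq x) => *; ring.
  by rewrite mulr_ge0 ?invr_ge0'// addr_ge0 ?sqr_ge0.
have h2 : I (fun x => invr x * (Sp x ^+ 2 + Sq x ^+ 2)) <= I (fun x => enorm x * Z x).
  apply: Ile => // x Ox; have rs := mul_enorm_invr (Om0 Ox).
  have -> : enorm x * Z x = invr x * (enorm x ^+ 2 * Z x).
    by rewrite expr2 -mulrA mulrA (mulrC (invr x)) rs mul1r.
  by rewrite ler_wpM2l ?invr_ge0'.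
rewrite ID ?ID ?IZ// in h1; try by [|apply: ZcD => //; apply: ZcMr => //; cz|apply: ZcMr => //; cz].
have h0 : 0 <= I (fun x => invr x * W x).
  by apply: Rintegral_ge0 => x _; rewrite mulr_ge0 ?invr_ge0'.
have N3 : 3 <= N by rewrite ler_nat.
have t1 : 1 <= t by rewrite /t; lra.
have E : N - 1 = 2 * t by rewrite /t mulrC divfK.
rewrite E in h *.
have -> : 2 * t / 2 = t by rewrite mulrAC divff// mul1r.
exact: (bracket_algebra t1 h0 h h1 h2).
Qed.

(** Weighted Young inequalities in the form of an explicit sum of squares. The weight [r] goes to
    the right-hand side and [1 / r] to the multiplier; the small coefficients are those that
    [estimate_algebra] absorbs. *)
Let FM_le x : Om x -> F1 x * Mp x + F2 x * Mq x <=
  (5 + 4 * d%:R ^+ 2) * (enorm x ^+ 2 * (F1 x ^+ 2 + F2 x ^+ 2)) + 4^-1 * Z x +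
  16^-1 * (invr x ^+ 2 * W x) + c ^+ 2 / 4 * W x.
Proof.
move=> Ox; have rs := mul_enorm_invr (Om0 Ox); have h := SZ x.
rewrite /Mp /Mq /W; have -> : N - 1 = d%:R by rewrite -natr1 addrK.
move: (invr x) (enorm x) (Sp x) (Sq x) (Z x) (a x) (b x) (F1 x) (F2 x) (d%:R : R) rs h
  => s r S1 S2 z A B f g D rs h.
have h2 : (s * S1) ^+ 2 + (s * S2) ^+ 2 <= z.
  have -> : z = s ^+ 2 * (r ^+ 2 * z) by rewrite mulrA -exprMn (mulrC s) rs expr1n mul1r.
  by rewrite !exprMn -mulrDr ler_wpM2l// sqr_ge0.
have e1 (y v : R) : y * v = (r * y) * (s * v).
  by rewrite mulrACA rs mul1r.
have -> : f * (2 * S1 + D * A + c * r * A) + g * (2 * S2 + D * B + c * r * B) =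
  2 * ((r * f) * (s * S1) + (r * g) * (s * S2)) + D * ((r * f) * (s * A) + (r * g) * (s * B))
  + c * ((r * f) * A + (r * g) * B).
  by rewrite -!e1; ring.
have -> : r ^+ 2 * (f ^+ 2 + g ^+ 2) = (r * f) ^+ 2 + (r * g) ^+ 2 by ring.
have -> : s ^+ 2 * (A ^+ 2 + B ^+ 2) = (s * A) ^+ 2 + (s * B) ^+ 2 by ring.
move: (s * S1) (s * S2) (s * A) (s * B) (r * f) (r * g) h2 => u1 u2 v1 v2 f1 f2 h2.
rewrite -subr_ge0.
have -> : (5 + 4 * D ^+ 2) * (f1 ^+ 2 + f2 ^+ 2) + 4^-1 * z + 16^-1 * (v1 ^+ 2 + v2 ^+ 2)
   + c ^+ 2 / 4 * (A ^+ 2 + B ^+ 2) - (2 * (f1 * u1 + f2 * u2) + D * (f1 * v1 + f2 * v2)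
   + c * (f1 * A + f2 * B)) = 4^-1 * (z - (u1 ^+ 2 + u2 ^+ 2)) +
   ((2 * f1 - u1 / 2) ^+ 2 + (2 * f2 - u2 / 2) ^+ 2 + (2 * D * f1 - v1 / 4) ^+ 2
    + (2 * D * f2 - v2 / 4) ^+ 2 + (f1 - c / 2 * A) ^+ 2 + (f2 - c / 2 * B) ^+ 2) by field.
by rewrite addr_ge0 ?mulr_ge0 ?subr_ge0// !addr_ge0 ?sqr_ge0.
Qed.

(** From [c^2 k^2 = e^2 <= |e| k^2]. The error [c^2 W] of the damping part of the multiplier is
    thereby controlled by the energy [|e| W]. *)
Let c2e : c ^+ 2 <= `|e|.
Proof.
have k2 : 0 < k ^+ 2 by rewrite exprn_even_gt0.
rewrite -(ler_pM2r k2) -exprMn ck -real_normK ?num_real// expr2 ler_wpM2l//.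
Qed.

Let bF_le x : Om x -> `|b x * F1 x - a x * F2 x| <=
  enorm x ^+ 2 * (F1 x ^+ 2 + F2 x ^+ 2) + 4^-1 * (invr x ^+ 2 * W x).
Proof.
move=> Ox; have rs := mul_enorm_invr (Om0 Ox); rewrite /W.
move: (invr x) (enorm x) (a x) (b x) (F1 x) (F2 x) rs => s r A B f g rs.
have e1 (y v : R) : y * v = (r * v) * (s * y).
  by rewrite mulrACA rs mul1r mulrC.
rewrite (e1 A) (e1 B).
have -> : r ^+ 2 * (f ^+ 2 + g ^+ 2) = (r * f) ^+ 2 + (r * g) ^+ 2 by ring.
have -> : s ^+ 2 * (A ^+ 2 + B ^+ 2) = (s * A) ^+ 2 + (s * B) ^+ 2 by ring.
move: (r * f) (r * g) (s * A) (s * B) => u v y z.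
have := sqr_ge0 (u - z / 2); have := sqr_ge0 (u + z / 2).
have := sqr_ge0 (v - y / 2); have := sqr_ge0 (v + y / 2).
by rewrite ler_norml => *; apply/andP; split; nra.
Qed.

Let eW_le : `|e| * I W <= Phi + 4^-1 * I (fun x => invr x ^+ 2 * W x).
Proof.
have IW0 : 0 <= I W by apply: Rintegral_ge0 => x _; exact: W0.
rewrite -(ger0_norm IW0) -normrM energy_identity.
apply: le_trans (le_normr_Rintegral mO (Zc_int mO zbF)) _.
rewrite -IZ// -ID//; last by apply: ZcMr => //; cz.
have i2 : mu.-integrable Om (EFin \o (fun x => enorm x ^+ 2 * (F1 x ^+ 2 + F2 x ^+ 2) +
    4^-1 * (invr x ^+ 2 * W x))).
  by apply: Zc_int => //; apply: ZcD => //; apply: ZcMr => //; cz.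
exact: (le_Rintegral mO (integrable_norm (Zc_int mO zbF)) i2 bF_le).
Qed.

Let dZW_le x : Om x -> - (- (x ord0 ord_max * invr x ^+ 3) * W x +
    invr x * (2 * (a x * pd ord_max a x + b x * pd ord_max b x))) <=
  2 * (invr x ^+ 2 * W x) + Z x.
Proof.
move=> Ox; have rs := mul_enorm_invr (Om0 Ox); have xm := coord_le_enorm x ord_max.
have hz : p ord_max x ^+ 2 + q ord_max x ^+ 2 <= Z x.
  rewrite /Z (bigD1 ord_max)//= lerDl; apply: sumr_ge0 => i _.
  by rewrite addr_ge0 ?sqr_ge0.
have -> : a x * pd ord_max a x + b x * pd ord_max b x = a x * p ord_max x + b x * q ord_max x.
  by rewrite /p /q; move: (pd _ a x) (pd _ b x) => *; ring.
rewrite /W in hz *; have s0 := invr_ge0' x.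
move: (invr x) (enorm x) (x ord0 ord_max) (p _ x) (q _ x) (a x) (b x) (Z x) rs hz xm s0
  => s r y p1 q1 A B z rs hz xm s0.
have ys : y * s <= 1.
  by rewrite -rs ler_wpM2r// (le_trans (ler_norm _)).
have h1 : y * s ^+ 3 * (A ^+ 2 + B ^+ 2) <= s ^+ 2 * (A ^+ 2 + B ^+ 2).
  rewrite ler_wpM2r ?addr_ge0 ?sqr_ge0//.
  have -> : y * s ^+ 3 = y * s * s ^+ 2 by ring.
  by rewrite ler_piMl// sqr_ge0.
have := sqr_ge0 (s * A + p1); have := sqr_ge0 (s * B + q1); move=> *.
by nra.
Qed.

Let grad_le x : Om x -> \sum_i (pd i a x ^+ 2 + pd i b x ^+ 2) <= 2 * Z x + 2 * k ^+ 2 * W x.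
Proof.
move=> Ox; have rs := mul_enorm_invr (Om0 Ox).
have -> : 2 * Z x + 2 * k ^+ 2 * W x =
    \sum_i (2 * (p i x ^+ 2 + q i x ^+ 2) + 2 * k ^+ 2 * invr x ^+ 2 * W x * x ord0 i ^+ 2).
  rewrite big_split/= -!mulr_sumr sumx2 -/(Z x); congr (_ + _).
  move: (W x) (invr x) (enorm x) rs => w s r rs.
  have -> : 2 * k ^+ 2 * s ^+ 2 * w * r ^+ 2 = 2 * k ^+ 2 * w * (r * s) ^+ 2 by ring.
  by rewrite rs expr1n mulr1.
apply: ler_sum => i _; rewrite /W /p /q.
move: (pd i a x) (pd i b x) (a x) (b x) (invr x) (x ord0 i) => u v A B s y.
rewrite -subr_ge0.
have -> : 2 * ((u + k * (y * s) * B) ^+ 2 + (v - k * (y * s) * A) ^+ 2) + 2 * k ^+ 2 * s ^+ 2 *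
  (A ^+ 2 + B ^+ 2) * y ^+ 2 - (u ^+ 2 + v ^+ 2) =
  (u + 2 * (k * (y * s) * B)) ^+ 2 + (v - 2 * (k * (y * s) * A)) ^+ 2 by ring.
by rewrite addr_ge0 ?sqr_ge0.
Qed.

(** The first three constants depend on the dimension only, hence are uniform in [k] and [e]. The
    gradient bound does involve [k]; later it only has to stay finite at a fixed frequency. *)
Lemma neumann_estimate :
  [/\ I (fun x => invr x ^+ 2 * W x) <= 4 * K * Phi,
      \int[leb R d]_x (invr (boundary_pt x) * W (boundary_pt x)) <= 9 * K * Phi,
      `|e| * I W <= (K + 1) * Phi &
      I (fun x => \sum_i (pd i a x ^+ 2 + pd i b x ^+ 2)) <= 2 * K * Phi + 2 * k ^+ 2 * I W].
Proof.
have hI := multiplier_identity.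
have hF : I (fun x => F1 x * Mp x + F2 x * Mq x) <=
    (5 + 4 * d%:R ^+ 2) * Phi + 4^-1 * I Z + 16^-1 * I (fun x => invr x ^+ 2 * W x) +
    c ^+ 2 / 4 * I W.
  have z1 : Zc (fun x => (5 + 4 * d%:R ^+ 2) * (enorm x ^+ 2 * (F1 x ^+ 2 + F2 x ^+ 2))).
    by apply: ZcMr => //; cz.
  have z2 : Zc (fun x => 4^-1 * Z x) by apply: ZcMr => //; cz.
  have z3 : Zc (fun x => 16^-1 * (invr x ^+ 2 * W x)) by apply: ZcMr => //; cz.
  have z4 : Zc (fun x => c ^+ 2 / 4 * W x) by apply: ZcMr => //; cz.
  rewrite -!IZ// -!ID//; [|by repeat apply: ZcD..].
  by apply: Ile FM_le => //; repeat apply: ZcD.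
have hb := bracket; have h4 := hardy4; have he := eW_le.
have IW0 : 0 <= I W by apply: Rintegral_ge0 => x _; exact: W0.
have hce : c ^+ 2 * I W <= `|e| * I W by rewrite ler_wpM2r ?c2e.
have hT : \int[leb R d]_x (invr (boundary_pt x) * W (boundary_pt x)) <=
    2 * I (fun x => invr x ^+ 2 * W x) + I Z.
  rewrite trace_identity -IZ// -ID//; last by apply: ZcMr => //; cz.
  rewrite -mulN1r -IZ//; apply: Ile => [| |x Ox].
  - by apply: ZcMr => //; cz.
  - by apply: ZcD => //; apply: ZcMr => //; cz.
  - by rewrite mulN1r; exact: dZW_le.
have hZ : I Z <= I (fun x => F1 x * Mp x + F2 x * Mq x).
  rewrite hI lerDl mulr_ge0 ?(ltW c0)// subr_ge0//.
have [r1 r2 [r3 r4]] := estimate_algebra hF hZ h4 he hce hT.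
split => //; apply: (@le_trans _ _ (2 * I Z + 2 * k ^+ 2 * I W)); last first.
  by rewrite lerD2r -mulrA ler_wpM2l.
rewrite -!IZ// -ID//; [|by apply: ZcMr => //; cz..].
apply: Ile => //; last by apply: ZcD; apply: ZcMr => //; cz.
by apply: Zc_sum => i; apply: ZcD; apply: ZcX.
Qed.

End Multiplier.


(** * Density of cosine polynomials *)

Section Threshold.
Variable R : realType.

Lemma bernoulli_sub (x : R) N : 0 <= x -> x <= 1 -> 1 - N%:R * x <= (1 - x) ^+ N.
Proof.
move=> x0 x1; elim: N => [|N IH]; first by rewrite mul0r subr0 expr0.
rewrite exprS; apply: (@le_trans _ _ ((1 - x) * (1 - N%:R * x))).
  rewrite -natr1; have := mulr_ge0 (ler0n R N) (sqr_ge0 x); nra.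
by rewrite ler_wpM2l// subr_ge0.
Qed.

Lemma bernoulli_add (x : R) N : 0 <= x -> 1 + N%:R * x <= (1 + x) ^+ N.
Proof.
move=> x0; elim: N => [|N IH]; first by rewrite mul0r addr0 expr0.
rewrite exprS; apply: (@le_trans _ _ ((1 + x) * (1 + N%:R * x))).
  rewrite -natr1; have := mulr_ge0 (ler0n R N) (sqr_ge0 x); nra.
by rewrite ler_wpM2l// addr_ge0.
Qed.

Lemma bernoulli_inv (x : R) N : 0 <= x -> x <= 1 -> (1 - x) ^+ N <= (1 + N%:R * x)^-1.
Proof.
move=> x0 x1; have h := bernoulli_add N x0.
have p0 : 0 < 1 + N%:R * x by rewrite ltr_pwDl// mulr_ge0.
rewrite -[leRHS]mul1r ler_pdivlMr//.
apply: (@le_trans _ _ ((1 - x) ^+ N * (1 + x) ^+ N)).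
  by rewrite ler_wpM2l// exprn_ge0// subr_ge0.
rewrite -exprMn exprn_ile1//.
  by rewrite mulr_ge0 ?subr_ge0// addr_ge0.
by have := sqr_ge0 x; nra.
Qed.

(** Polynomials in [z] tending to the indicator of [[0, 1/2)]: by Bernoulli's inequalities the limit
    is decided by [m 2^m z^m = m (2 z)^m], and the extra factor [m] settles the value 0 at
    [z = 1/2]. *)
Definition thr (m : nat) (z : R) : R := (1 - z ^+ m) ^+ (m * 2 ^ m).

Lemma thr01 m z : 0 <= z -> z <= 1 -> 0 <= thr m z <= 1.
Proof.
move=> z0 z1; have zm : 0 <= z ^+ m by rewrite exprn_ge0.
have zm1 : z ^+ m <= 1 by rewrite exprn_ile1.
by rewrite exprn_ge0 ?exprn_ile1 ?subr_ge0// lerBlDr lerDl.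
Qed.

Lemma nat_pow_bound (s : R) m : 0 <= s -> s < 1 -> m%:R * s ^+ m * (1 - s) <= 1.
Proof.
move=> s0 s1; apply: (@le_trans _ _ (1 - s ^+ m)); last first.
  by rewrite lerBlDr lerDl exprn_ge0.
elim: m => [|m IH]; first by rewrite !mul0r expr0 subrr.
have sm : 0 <= s ^+ m by rewrite exprn_ge0.
rewrite -natr1 exprS.
have : s * (m%:R * s ^+ m * (1 - s)) <= 1 * (1 - s ^+ m).
  apply: ler_pM => //; last exact: ltW.
  by rewrite !mulr_ge0// subr_ge0 ltW.
have := mulr_ge0 sm (sqr_ge0 (1 - s)).
by move: (s ^+ m) (m%:R) => p q; nra.
Qed.

Lemma thr_hi (z : R) : 2^-1 <= z -> z <= 1 -> thr m z @[m --> \oo] --> (0 : R).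
Proof.
move=> z2 z1; have z0 : 0 <= z by lra.
apply: (@squeeze_cvgr _ _ _ _ (fun=> 0) (fun m => m.+1%:R^-1)).
- apply: nearW => m; have /andP[-> _] /= := thr01 m z0 z1.
  have zm : 0 <= z ^+ m by rewrite exprn_ge0.
  have zm1 : z ^+ m <= 1 by rewrite exprn_ile1.
  apply: (le_trans (bernoulli_inv _ zm zm1)).
  rewrite lef_pV2 ?posrE ?ltr0n//; last by rewrite ltr_pwDl// mulr_ge0.
  rewrite -nat1r lerD2l natrM natrX -mulrA -exprMn ler_peMr//.
  by rewrite exprn_ege1// mulrC -ler_pdivrMr// div1r.
- exact: cvg_cst.
- exact: (@cvg_harmonic R).
Qed.

Lemma thr_lo (z : R) : 0 <= z -> z < 2^-1 -> thr m z @[m --> \oo] --> (1 : R).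
Proof.
move=> z0 z2; have z1 : z <= 1 by lra.
(* With [(2 z)^m = s^m s^m], one factor absorbs [m] through [nat_pow_bound] and the other still
   tends to 0. *)
pose s := Num.sqrt (2 * z).
have s0 : 0 <= s by exact: sqrtr_ge0.
have ss : s ^+ 2 = 2 * z by rewrite sqr_sqrtr// mulr_ge0.
have s1 : s < 1.
  rewrite -(@ltr_pXn2r _ 2)// ?nnegrE// ss expr1n; lra.
apply: (@squeeze_cvgr _ _ _ _ (fun m => 1 - (1 - s)^-1 * s ^+ m) (fun=> 1)).
- apply: nearW => m; have /andP[_ ->] /= := thr01 m z0 z1; rewrite andbT.
  have zm : 0 <= z ^+ m by rewrite exprn_ge0.
  have zm1 : z ^+ m <= 1 by rewrite exprn_ile1.
  apply: le_trans (bernoulli_sub _ zm zm1); rewrite lerD2l lerN2.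
  rewrite natrM natrX -mulrA -exprMn -ss -exprM mulnC exprM expr2 mulrA ler_wpM2r ?exprn_ge0//.
  rewrite -[leRHS]mul1r ler_pdivlMr ?subr_gt0//.
  exact: nat_pow_bound.
- rewrite -[X in _ --> X]subr0; apply: cvgB; first exact: cvg_cst.
  rewrite -[X in _ --> X](mulr0 (1 - s)^-1); apply: cvgMr.
  by apply: cvg_expr; rewrite ger0_norm.
- exact: cvg_cst.
Qed.

End Threshold.

Lemma cvg_prodR (R : realType) (I : Type) (s : seq I) (F : nat -> I -> R) (l : I -> R) :
  (forall i, F m i @[m --> \oo] --> l i) ->
  \prod_(i <- s) F m i @[m --> \oo] --> \prod_(i <- s) l i.
Proof.
move=> h; elim: s => [|i s IH].
  by rewrite big_nil; under eq_fun do rewrite big_nil; exact: cvg_cst.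
by rewrite big_cons; under eq_fun do rewrite big_cons; exact: cvgM.
Qed.

Section CosBasis.
Variables (R : realType) (n : nat) (a b : 'I_n -> R).
Hypothesis ab : forall i, a i < b i.
Local Notation mu := (leb R n).
Local Notation Q := (box a b).
Implicit Types f g : 'rV[R]_n -> R.

Definition om i : R := pi / (b i - a i).
Definition cs i (k : nat) (t : R) : R := cos (k%:R * om i * (t - a i)).
(** The Neumann eigenfunctions of the box. *)
Definition ek (k : 'I_n -> nat) : 'rV[R]_n -> R := tp (fun i => cs i (k i)).
Definition Sp f := exists s : seq (R * ('I_n -> nat)),
  forall x, f x = \sum_(p <- s) p.1 * ek p.2 x.

Lemma SpE f g : f =1 g -> Sp f -> Sp g.
Proof. by move=> fg [s h]; exists s => x; rewrite -fg. Qed.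

Lemma SpD f g : Sp f -> Sp g -> Sp (fun x => f x + g x).
Proof. by move=> [s h] [t k]; exists (s ++ t) => x; rewrite h k big_cat. Qed.

Lemma SpZ c f : Sp f -> Sp (fun x => c * f x).
Proof.
move=> [s h]; exists [seq (c * p.1, p.2) | p <- s] => x.
by rewrite h mulr_sumr big_map; apply: eq_bigr => p _; rewrite mulrA.
Qed.

Lemma Sp_ek k : Sp (ek k).
Proof. by exists [:: (1, k)] => x; rewrite big_seq1 mul1r. Qed.

Lemma Sp0 : Sp (fun=> 0).
Proof. by exists [::] => x; rewrite big_nil. Qed.

Lemma Sp1 : Sp (fun=> 1).
Proof.
apply: SpE (Sp_ek (fun=> 0%N)) => x; rewrite /ek /tp big1// => i _.
by rewrite /cs !mul0r cos0.
Qed.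

Lemma Sp_ind (P : ('rV[R]_n -> R) -> Prop) : (forall f g, f =1 g -> P f -> P g) ->
  P (fun=> 0) -> (forall c k f, P f -> P (fun x => c * ek k x + f x)) ->
  forall f, Sp f -> P f.
Proof.
move=> PE P0 PS f [s h]; apply: (PE _ _ (fun x => esym (h x))).
elim: s {f h} => [|[c k] s IH]; first by apply: (PE _ _ _ P0) => x; rewrite big_nil.
by apply: (PE _ _ _ (PS c k _ IH)) => x; rewrite big_cons.
Qed.

Definition updk (k : 'I_n -> nat) i m := fun j => if j == i then m else k j.

Lemma ek_updk k i m x :
  ek (updk k i m) x = cs i m (x ord0 i) * \prod_(j < n | j != i) cs j (k j) (x ord0 j).
Proof.
rewrite /ek (tpD1 _ i) /updk eqxx; congr (_ * _).
by apply: eq_bigr => j /negbTE ->.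
Qed.

(** Product-to-sum formula: the frequency [k i] goes to [k i + 1] and [k i - 1]. At [k i = 0] the
    second frequency is [-1], which is 1 since the cosine is even. *)
Lemma Sp_cos i f : Sp f -> Sp (fun x => cs i 1 (x ord0 i) * f x).
Proof.
move: f; apply: Sp_ind.
- by move=> f g fg; apply: SpE => x; rewrite fg.
- by apply: SpE Sp0 => x; rewrite mulr0.
move=> c k f IH; have E (x : 'rV[R]_n) : cs i 1 (x ord0 i) * ek k x =
   2^-1 * ek (updk k i (k i).+1) x + 2^-1 * ek (updk k i (if k i is m.+1 then m else 1%N)) x.
  rewrite !ek_updk {1}/ek (tpD1 _ i) -[2^-1]/(2^-1 : R).
  set p := \prod_(j < n | _) _; rewrite !mulrA -mulrDl; congr (_ * _).
  rewrite /cs; case: (k i) => [|m]; first by rewrite !mul0r cos0 mulr1; field.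
  set y := om i * (x ord0 i - a i).
  have -> : 1%:R * om i * (x ord0 i - a i) = y by rewrite mul1r.
  have -> : m.+1%:R * om i * (x ord0 i - a i) = m%:R * y + y by rewrite -natr1 /y; ring.
  have -> : m.+2%:R * om i * (x ord0 i - a i) = m%:R * y + y + y by rewrite -!natr1 /y; ring.
  have -> : m%:R * om i * (x ord0 i - a i) = (m%:R * y + y) - y by rewrite /y; ring.
  by rewrite [cos (_ + y + y)]cosD cosB; field.
apply: SpE (SpD (SpD (SpZ (c / 2) (Sp_ek (updk k i (k i).+1)))
  (SpZ (c / 2) (Sp_ek (updk k i (if k i is m.+1 then m else 1%N))))) IH) => x.
by rewrite [RHS]mulrDr [in RHS]mulrCA E; ring.
Qed.

(** Working with multipliers of [Sp] makes closure under products immediate, while a product of two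
    sums would have to be expanded; every multiplier lies in [Sp] because 1 does. *)
Definition Mu f := forall g, Sp g -> Sp (fun x => f x * g x).

Lemma MuE f g : f =1 g -> Mu f -> Mu g.
Proof. by move=> fg Mf h /Mf; apply: SpE => x; rewrite fg. Qed.
Lemma Mu_cst c : Mu (fun=> c). Proof. by move=> g; exact: SpZ. Qed.
Lemma Mu_cos i : Mu (fun x => cs i 1 (x ord0 i)). Proof. exact: Sp_cos. Qed.
Lemma MuD f g : Mu f -> Mu g -> Mu (fun x => f x + g x).
Proof.
move=> Mf Mg h Sh; apply: SpE (SpD (Mf _ Sh) (Mg _ Sh)) => x.
by rewrite mulrDl.
Qed.
Lemma MuM f g : Mu f -> Mu g -> Mu (fun x => f x * g x).
Proof. by move=> Mf Mg h /Mg/Mf; apply: SpE => x; rewrite mulrA. Qed.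
Lemma MuX f m : Mu f -> Mu (fun x => f x ^+ m).
Proof.
move=> Mf; elim: m => [|m IH]; first exact: Mu_cst.
by apply: MuE (MuM Mf IH) => x; rewrite exprS.
Qed.
Lemma Mu_prod (s : seq 'I_n) (F : 'I_n -> 'rV[R]_n -> R) : (forall i, Mu (F i)) ->
  Mu (fun x => \prod_(i <- s) F i x).
Proof.
move=> h; elim: s => [|i s IH]; first by apply: MuE (Mu_cst 1) => x; rewrite big_nil.
by apply: MuE (MuM (h i) IH) => x; rewrite big_cons.
Qed.
Lemma Mu_Sp f : Mu f -> Sp f.
Proof. by move=> /(_ _ Sp1); apply: SpE => x; rewrite mulr1. Qed.

Lemma smooth1_cs i k : smooth1 (cs i k).
Proof.
have := smooth1_aff (k%:R * om i) (- (k%:R * om i * a i)) (@smooth1_sincos R).2.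
by congr smooth1; apply/funext => t; congr cos; ring.
Qed.

Lemma nice_ek k : nice (ek k).
Proof. by apply: nice_tp => i; exact: smooth1_cs. Qed.

Lemma nice_Sp f : Sp f -> nice f.
Proof.
move: f; apply: Sp_ind; first by move=> f g /funext ->.
  exact: nice_cst.
by move=> c k f; apply: niceD; apply: niceZ; exact: nice_ek.
Qed.

Let mQ : measurable Q := measurable_box a b.

Lemma box_L2 f M : measurable_fun Q f -> (forall x, Q x -> `|f x| <= M) -> L2 mu Q f.
Proof.
move=> mf bf; split => //; apply: (bounded_integrable (M := M ^+ 2)) => //.
- exact: leb_box_fin.
- exact: measurable_funX.
- move=> x Qx; rewrite normrX lerXn2r ?nnegrE ?bf//.
  by rewrite (le_trans _ (bf x Qx)).
Qed.

Lemma cont_box_L2 f : continuous f -> L2 mu Q f.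
Proof.
move=> cf; have [M bf] := cont_bounded_box a b cf; apply: (box_L2 (M := M)) => //.
by apply: measurable_funTS; exact: continuous_measurable_rV.
Qed.

Lemma Sp_L2 f : Sp f -> L2 mu Q f.
Proof. by move=> /nice_Sp/nice_cont; exact: cont_box_L2. Qed.

Definition appr f := L2 mu Q f /\
  forall e, 0 < e -> exists2 P, Sp P & nrm mu Q (fun x => f x - P x) <= e.

Lemma appr_Sp f : Sp f -> appr f.
Proof.
move=> Sf; split; first exact: Sp_L2.
move=> e e0; exists f => //; under eq_fun do rewrite subrr.
by rewrite nrm0 ltW.
Qed.

Lemma apprD f g : appr f -> appr g -> appr (fun x => f x + g x).
Proof.
move=> [Lf hf] [Lg hg]; split; first exact: L2D.
move=> e e0; have e2 : 0 < e / 2 by rewrite divr_gt0.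
have [P SP hP] := hf _ e2; have [P' SP' hP'] := hg _ e2.
exists (fun x => P x + P' x); first exact: SpD.
have -> : (fun x => f x + g x - (P x + P' x)) = (fun x => (f x - P x) + (g x - P' x)).
  by apply/funext => x; ring.
have L1 := L2B mQ Lf (Sp_L2 SP); have L2' := L2B mQ Lg (Sp_L2 SP').
by apply: (le_trans (nrmD mQ L1 L2')); rewrite (splitr e) lerD.
Qed.

Lemma apprZ c f : appr f -> appr (fun x => c * f x).
Proof.
move=> [Lf hf]; split; first exact: L2Z.
move=> e e0; have c0 : 0 < `|c| + 1 by rewrite ltr_wpDl.
have [P SP hP] := hf (e / (`|c| + 1)) (divr_gt0 e0 c0).
exists (fun x => c * P x); first exact: SpZ.
have -> : (fun x => c * f x - c * P x) = (fun x => c * (f x - P x)).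
  by apply/funext => x; ring.
rewrite (nrmZ mQ c (L2B mQ Lf (Sp_L2 SP))).
apply: (@le_trans _ _ (`|c| * (e / (`|c| + 1)))); first by rewrite ler_wpM2l.
by rewrite mulrCA ler_piMr ?(ltW e0)// ler_pdivrMr// mul1r lerDl.
Qed.

Lemma appr_close f : L2 mu Q f ->
  (forall e, 0 < e -> exists2 g, appr g & nrm mu Q (fun x => f x - g x) <= e) -> appr f.
Proof.
move=> Lf h; split => // e e0; have e2 : 0 < e / 2 by rewrite divr_gt0.
have [g [Lg hg] fg] := h _ e2; have [P SP gP] := hg _ e2; exists P => //.
have -> : (fun x => f x - P x) = (fun x => (f x - g x) + (g x - P x)).
  by apply/funext => x; ring.
have L1 := L2B mQ Lf Lg; have L2' := L2B mQ Lg (Sp_L2 SP).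
by apply: (le_trans (nrmD mQ L1 L2')); rewrite (splitr e) lerD.
Qed.

Lemma appr_lim (F : nat -> 'rV[R]_n -> R) f M : measurable_fun Q f ->
  (forall m, appr (F m)) -> (forall m x, Q x -> `|F m x| <= M) ->
  (forall x, Q x -> F m x @[m --> \oo] --> f x) -> appr f.
Proof.
move=> mf aF bF cF.
have bf x : Q x -> `|f x| <= M.
  move=> Qx; have /cvg_norm cn := cF x Qx.
  rewrite -(cvg_lim _ cn)//; apply: limr_le; first by apply/cvg_ex; eexists; exact: cn.
  by apply: nearW => m; exact: bF.
have Lf : L2 mu Q f by exact: (box_L2 (M := M)).
apply: appr_close => // e e0.
pose G m x := (f x - F m x) ^+ 2.
have mG m : measurable_fun Q (EFin \o G m).
  apply/measurable_EFinP; apply: measurable_funX; apply: measurable_funB => //.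
  by case: (aF m) => -[].
have cG : {ae mu, forall x, Q x -> EFin (G m x) @[m --> \oo] --> (0 : \bar R)}.
  apply: aeW => x Qx; apply: cvg_EFin; first exact: nearW.
  have c0 : f x - F m x @[m --> \oo] --> (0 : R).
    by rewrite -[X in _ --> X](subrr (f x)); apply: cvgB (cF x Qx); exact: cvg_cst.
  have c2 : (fun m => (f x - F m x) * (f x - F m x)) @ \oo --> (0 : R).
    by rewrite -[X in _ --> X](mulr0 0); exact: (cvgM c0 c0).
  by rewrite (_ : (fine \o _) = (fun m => (f x - F m x) * (f x - F m x))).
have bG : {ae mu, forall x m, Q x -> (`|EFin (G m x)| <= EFin ((2 * M) ^+ 2)%R)%E}.
  apply: aeW => x m Qx; rewrite /= lee_fin ger0_norm ?sqr_ge0// /G.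
  rewrite -[leLHS]real_normK ?num_real// lerXn2r ?nnegrE//.
    by rewrite mulr_ge0// (le_trans _ (bf x Qx)).
  by rewrite mulr_natl mulr2n (le_trans (ler_normB _ _))// lerD ?bf ?bF.
have iM : mu.-integrable Q (EFin \o (fun=> (2 * M) ^+ 2)).
  by apply: (bounded_integrable (M := (2 * M) ^+ 2)) => //; [exact: leb_box_fin|
    move=> x _; rewrite ger0_norm ?sqr_ge0].
have [_ _ h] := dominated_convergence mQ mG (measurable_cst 0%E) cG iM bG.
rewrite integral0 in h.
have e2 : 0 < e ^+ 2 by rewrite exprn_gt0.
have := h => /fine_cvgP[_ /cvgrPdist_lt/(_ _ e2)[N _ /(_ N)]] /= hN.
exists (F N) => //; rewrite -(@ler_pXn2r _ 2)// ?nnegrE ?nrm_ge0 ?(ltW e0)// nrm_sq.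
have := hN (leqnn N); rewrite sub0r normrN => /ltW; apply: le_trans.
exact: ler_norm.
Qed.

(** Infinite entries leave a coordinate free or make the orthant empty, so the family contains the
    whole space and every coordinate half-space, and is stable under intersection as Dynkin's
    argument requires. *)
Definition hl (c : 'I_n -> \bar R) : set 'rV[R]_n :=
  [set x | forall i, ((x ord0 i)%:E < c i)%E].

(** On a side of the box the first cosine is strictly decreasing, so [t < c] means
    [cs i 1 c < cs i 1 t]. The affine map sends the difference of cosines into [[0, 1]] with sign
    change at [1/2], the jump of [thr]. *)
Let th1 (c : \bar R) i (m : nat) (t : R) : R :=
  match c with
  | +oo%E => 1
  | -oo%E => 0
  | EFin c' => if c' <= a i then 0 else if b i <= c' then 1 else
      thr m (2^-1 + 4^-1 * (cs i 1 c' - cs i 1 t))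
  end.

Let om_gt0 i : 0 < om i. Proof. by rewrite /om divr_gt0 ?pi_gt0// subr_gt0. Qed.

Let ang i t : a i < t < b i -> om i * (t - a i) \in `[0, pi].
Proof.
move=> /andP[h1 h2]; rewrite in_itv/= mulr_ge0 ?(ltW (om_gt0 i)) ?subr_ge0 ?(ltW h1)//=.
by rewrite /om mulrAC ler_pdivrMr ?subr_gt0// ler_wpM2l ?pi_ge0// lerB// ltW.
Qed.

Let cs_lt i c t : a i < c < b i -> a i < t < b i -> (cs i 1 c < cs i 1 t) = (t < c).
Proof.
move=> hc ht; rewrite /cs mul1r ltr_cos ?ang// ltr_pM2l ?om_gt0//.
by rewrite ltrD2r.
Qed.

Let cs1 i k t : -1 <= cs i k t <= 1.
Proof. by rewrite -ler_norml cos_max. Qed.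

Let th1_01 c i m t : 0 <= th1 c i m t <= 1.
Proof.
case: c => [c| |] /=; rewrite ?ler01 ?lexx//.
case: ifP => _; rewrite ?ler01 ?lexx//; case: ifP => _; rewrite ?ler01 ?lexx//.
have /andP[h1 h2] := cs1 i 1 c; have /andP[h3 h4] := cs1 i 1 t.
by apply: thr01; lra.
Qed.

Let th1_cvg c i t : a i < t < b i -> th1 c i m t @[m --> \oo] --> ((t%:E < c)%E%:R : R).
Proof.
move=> tQ; have /andP[t1 t2] := tQ; case: c => [c| |] /=; first last.
- exact: cvg_cst.
- by rewrite ltry; exact: cvg_cst.
rewrite lte_fin; case: (leP c (a i)) => ca.
  by rewrite ltNge (le_trans ca (ltW t1)); exact: cvg_cst.
case: (leP (b i) c) => cb.
  by rewrite (lt_le_trans t2 cb); exact: cvg_cst.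
have cQ : a i < c < b i by rewrite ca.
have /andP[h1 h2] := cs1 i 1 c; have /andP[h3 h4] := cs1 i 1 t.
rewrite -(cs_lt cQ tQ); have [h|h] := ltP (cs i 1 c) (cs i 1 t).
  by apply: thr_lo; lra.
by apply: thr_hi; lra.
Qed.

Let th1_Mu c i m : Mu (fun x => th1 c i m (x ord0 i)).
Proof.
case: c => [c| |] /=; try exact: Mu_cst.
case: (c <= a i); first exact: Mu_cst.
case: (b i <= c); first exact: Mu_cst.
rewrite /thr; apply: MuX; apply: MuD; first exact: Mu_cst.
set f := fun x : 'rV[R]_n => 2^-1 + 4^-1 * (cs i 1 c - cs i 1 (x ord0 i)).
have Mf : Mu f.
  apply: MuD; first exact: Mu_cst.
  apply: MuM; first exact: Mu_cst.
  apply: MuD; first exact: Mu_cst.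
  by apply: MuE (MuM (Mu_cst (-1)) (Mu_cos i)) => x; rewrite mulN1r.
by apply: MuE (MuM (Mu_cst (-1)) (MuX m Mf)) => x; rewrite mulN1r.
Qed.

Lemma measurable_hl c : measurable (hl c).
Proof.
have -> : hl c = \bigcap_(i in [set: 'I_n])
    (@rV_coord R n i @^-1` [set t | (t%:E < c i)%E]).
  by apply/seteqP; split => x h => [i _|i]; exact: h.
apply: fin_bigcap_measurable => // i _; rewrite -[X in measurable X]setTI.
apply: measurable_rV_coord => //.
case: (c i) => [r| |].
- have -> : [set t : R | (t%:E < r%:E)%E] = `]-oo, r[%classic.
    by apply/seteqP; split => t; rewrite /= in_itv/= lte_fin.
  exact: measurable_itv.
- by have -> : [set t : R | (t%:E < +oo)%E] = setT by apply/seteqP; split => t //= _; rewrite ltry.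
- by have -> : [set t : R | (t%:E < -oo)%E] = set0 by apply/seteqP; split.
Qed.

Lemma appr_hl c : appr (\1_(hl c)).
Proof.
apply: (@appr_lim (fun m x => \prod_(i < n) th1 (c i) i m (x ord0 i)) _ 1).
- by apply: measurable_indic; exact: measurable_hl.
- by move=> m; apply: appr_Sp; apply: Mu_Sp; apply: Mu_prod => i; exact: th1_Mu.
- move=> m x _; rewrite ger0_norm; last by apply: prodr_ge0 => i _; case/andP: (th1_01 (c i) i m (x ord0 i)).
  by apply: prodr_ile1 => i _; exact: th1_01.
move=> x Qx; have -> : \1_(hl c) x = \prod_(i < n) ((((x ord0 i)%:E < c i)%E)%:R : R).
  rewrite indicE; case: (boolP (x \in hl c)) => [/set_mem h|/negP h].
    by rewrite big1// => i _; rewrite h.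
  have [i hi] : exists i, ~~ ((x ord0 i)%:E < c i)%E.
    by apply/not_existsP => h'; apply: h; apply/mem_set => i; apply: contrapT => /negP/(h' i).
  by rewrite (bigD1 i)//= (negbTE hi) mul0r.
by apply: cvg_prodR => i; exact: th1_cvg (Qx i).
Qed.

(** Dynkin's theorem: the orthants are a pi-system generating the measurable sets, and
    approximability passes to proper differences by linearity and to increasing unions by
    [appr_lim]. *)
Lemma appr_ind (A : set 'rV[R]_n) : measurable A -> appr (\1_A).
Proof.
move=> mA; pose G := range hl.
pose H := [set A : set 'rV[R]_n | measurable A /\ appr (\1_A)].
suff sub : <<s G>> `<=` H.
  have : <<s G>> A; last by move/sub => [].
  have : @measurable _ 'rV[R]_n `<=` <<s G>>; last exact.
  apply: smallest_sub; first exact: smallest_sigma_algebra.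
  rewrite -bigcup_seq/=; apply: bigcup_sub => i _ _ [B mB <-]; rewrite setTI.
  have : <<s @RGenInftyO.G R>> B by move: mB; rewrite -[X in X -> _]/((@ocitv R).-sigma.-measurable B) RGenInftyO.measurableE.
  have sS := smallest_sigma_algebra setT G.
  have : <<s @RGenInftyO.G R>> `<=` [set B | <<s G>> (@rV_coord R n i @^-1` B)].
    apply: smallest_sub; first split => /=.
    - by rewrite preimage_set0; case: sS.
    - by move=> C; rewrite setTD preimage_setC -setTD; case: sS => _ + _; exact.
    - by move=> F hF; rewrite preimage_bigcup; case: sS => _ _; exact.
    move=> _ [c ->] /=; apply: sub_sigma_algebra.
    exists (fun j => if j == i then c%:E else +oo%E) => //.
    apply/seteqP; split => x; rewrite /hl /rV_coord /= in_itv/=.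
      by move=> /(_ i); rewrite eqxx lte_fin.
    by move=> h j; case: eqP => [->|_]; rewrite ?lte_fin ?ltry.
  by move=> h1 h2; exact: h1.
apply: lambda_system_subset => //.
- move=> _ _ [c _ <-] [c' _ <-]; exists (fun i => mine (c i) (c' i)) => //.
  apply/seteqP; split => x.
    by move=> h; split => i; have := h i; rewrite lt_min => /andP[].
  by move=> [h1 h2] i; rewrite lt_min h1 h2.
- split => //.
  + split => //; have := appr_hl (fun=> +oo%E); congr appr; congr (\1_ _).
    by apply/seteqP; split => // x _ i; rewrite ltry.
  + move=> A' B BA [mA' aA] [mB aB]; split; first exact: measurableD.
    have -> : \1_(A' `\` B) = (fun x => \1_A' x + (-1) * \1_B x) :> ('rV[R]_n -> R).
      apply/funext => x; rewrite !indicE in_setD.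
      case: (boolP (x \in B)) => xB; last by rewrite mulr0 addr0 andbT.
      by rewrite (mem_set (BA _ (set_mem xB))) /= mulr1 subrr.
    by apply: apprD => //; exact: apprZ.
  + move=> F ndF hF; have mF k : measurable (F k) by case: (hF k).
    split; first exact: bigcupT_measurable.
    apply: (@appr_lim (fun m => \1_(F m)) _ 1).
    * by apply: measurable_indic; exact: bigcupT_measurable.
    * by move=> m; case: (hF m).
    * by move=> m x _; rewrite indicE ger0_norm// lern1 leq_b1.
    move=> x _; rewrite indicE; case: (boolP (x \in _)) => [/set_mem[k _ Fk]|/negP xF].
      apply: cvg_near_cst; exists k => // m /= km; rewrite indicE mem_set//.
      by have := ndF _ _ km; rewrite subsetEset; exact.
    apply: cvg_near_cst; apply: nearW => m; rewrite indicE memNset// => Fx.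
    by apply: xF; apply/mem_set; exists m.
- by move=> _ [c _ <-]; split; [exact: measurable_hl|exact: appr_hl].
Qed.

Lemma layer_cake (h y : R) J : 0 < h -> 0 <= y -> y <= J%:R * h ->
  `|y - \sum_(j < J) h * (j.+1%:R * h <= y)%R%:R| <= h.
Proof.
move=> h0; elim: J y => [|J IH] y y0 yJ.
  by rewrite big_ord0 subr0 (_ : y = 0) ?normr0 ?ltW//; lra.
rewrite big_ord_recr/=; case: (leP (J.+1%:R * h) y) => hy.
  have -> : \sum_(i < J) h * (i.+1%:R * h <= y)%R%:R = J%:R * h.
    rewrite (eq_bigr (fun=> h)); last first.
      move=> i _; rewrite (le_trans _ hy) ?mulr1//.
      by rewrite ler_wpM2r ?(ltW h0)// ler_nat ltnW// ltnS.
    by rewrite sumr_const card_ord mulr_natl.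
  by move: yJ hy; rewrite -natr1 => *; rewrite mulr1 ler_norml; apply/andP; split; lra.
rewrite mulr0 addr0; case: (leP y (J%:R * h)) => hJ; first exact: IH.
have -> : \sum_(i < J) h * (i.+1%:R * h <= y)%R%:R = J%:R * h.
  rewrite (eq_bigr (fun=> h)); last first.
    move=> i _; rewrite (le_trans _ (ltW hJ)) ?mulr1//.
    by rewrite ler_wpM2r ?(ltW h0)// ler_nat.
  by rewrite sumr_const card_ord mulr_natl.
by move: hy; rewrite -natr1 => *; rewrite ler_norml; apply/andP; split; lra.
Qed.

Lemma appr_sum (I : Type) (s : seq I) (F : I -> 'rV[R]_n -> R) : (forall i, appr (F i)) ->
  appr (fun x => \sum_(i <- s) F i x).
Proof.
move=> h; elim: s => [|i s IH].
  by under eq_fun do rewrite big_nil; apply: appr_Sp; exact: Sp0.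
by under eq_fun do rewrite big_cons; exact: apprD.
Qed.

Lemma appr_bounded f M : measurable_fun setT f -> (forall x, `|f x| <= M) -> appr f.
Proof.
move=> mf bf; have M0 : 0 <= M by apply: le_trans (bf 0).
have aM c : appr (fun=> c).
  by apply: appr_Sp; apply: SpE (SpZ c Sp1) => x; rewrite mulr1.
suff : appr (fun x => (f x + M) + (- M)).
  by congr appr; apply/funext => x; rewrite addrK.
apply: apprD => //; set g := fun x => f x + M.
have g0 x : 0 <= g x by have := bf x; rewrite ler_norml /g => /andP[]; lra.
have gM x : g x <= 2 * M by have := bf x; rewrite ler_norml /g => /andP[]; lra.
have mg : measurable_fun setT g by apply: measurable_funD.
pose h (m : nat) : R := m.+1%:R^-1.
(* [J m] levels of height [h m] exhaust the range [[0, 2 M]] of [g]. *)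
pose J (m : nat) := (Num.trunc (2 * M * m.+1%:R)).+1.
have h0 m : 0 < h m by rewrite invr_gt0.
have hJ m : 2 * M <= (J m)%:R * h m.
  rewrite ler_pdivlMr// ltW//.
  have : 0 <= 2 * M * m.+1%:R by rewrite !mulr_ge0.
  by move=> /truncn_itv/andP[].
pose F m x := \sum_(j < J m) h m * \1_[set x | j.+1%:R * h m <= g x] x.
have FE m x : F m x = \sum_(j < J m) h m * (j.+1%:R * h m <= g x)%R%:R.
  apply: eq_bigr => j _; rewrite indicE; congr (_ * _%:R).
    case: (boolP (j.+1%:R * h m <= g x)) => h1; first by rewrite (mem_set (A := [set x0 | j.+1%:R * h m <= g x0]) h1).
    by rewrite (memNset (A := [set x0 | j.+1%:R * h m <= g x0])) //=; apply/negP.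
have gF m x : `|g x - F m x| <= h m.
  by rewrite FE; apply: layer_cake => //; exact: le_trans (hJ m).
apply: (@appr_lim F _ (2 * M + 1)).
- exact: measurable_funTS.
- move=> m; apply: appr_sum => j; apply: apprZ; apply: appr_ind.
  rewrite -[X in measurable X]setTI.
  have := measurable_fun_le measurableT (measurable_cst (j.+1%:R * h m)) mg.
  exact.
- move=> m x _; have := gF m x; rewrite distrC => /(le_trans (lerB_dist _ _)).
  rewrite lerBlDr => /le_trans; apply; rewrite addrC lerD ?ger0_norm ?gM//.
  by rewrite invf_le1 ?ler1n.
- move=> x _; apply/cvgrPdist_le => e e0.
  have := @cvg_harmonic R => /cvgrPdist_le/(_ e e0); apply: filterS => m.
  rewrite sub0r normrN ger0_norm ?invr_ge0// => hm.
  by apply: le_trans hm; exact: gF.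
Qed.

Lemma cos_dense f : L2 mu Q f -> forall e, 0 < e ->
  exists2 P, Sp P & nrm mu Q (fun x => f x - P x) <= e.
Proof.
move=> Lf; suff : appr f by case.
have [mf _] := Lf.
pose g := f \_ Q; have mg : measurable_fun setT g by apply/(measurable_restrictT f mQ).
pose A m := [set x | `|g x| <= m%:R].
have mA m : measurable (A m).
  rewrite -[X in measurable X]setTI.
  have := measurable_fun_le measurableT (measurableT_comp (@normr_measurable R setT) mg) (measurable_cst (m%:R : R)).
  exact.
apply: appr_close => // e e0; have e2 : 0 < e ^+ 2 by rewrite exprn_gt0.
have [|m hm] := @L2_tail _ _ _ mu Q mQ f A Lf mA _ _ e2.
  move=> x Qx; exists (Num.trunc `|g x|).+1 => // m /= hm.
  have /truncn_itv/andP[_ h] : 0 <= `|g x| by [].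
  by rewrite /A/= (le_trans (ltW h))// ler_nat.
exists (fun x => \1_(A m) x * g x).
  apply: (@appr_bounded _ m%:R).
    by apply: measurable_funM => //; exact: measurable_indic.
  move=> x; rewrite indicE; case: (boolP (x \in A m)) => [/set_mem|_].
    by rewrite mul1r.
  by rewrite mul0r normr0.
rewrite -(@ler_pXn2r _ 2)// ?nnegrE ?nrm_ge0 ?(ltW e0)// nrm_sq ltW//.
apply: le_lt_trans hm; rewrite le_eqVlt; apply/orP; left; apply/eqP.
by apply: eq_Rintegral => x xQ; rewrite /g patchE xQ.
Qed.

End CosBasis.

Lemma weighted_energy_algebra1 (R : comNzRingType) (r m e A B la lb s g : R) :
  r * ((- la - m * A + e * B) * A + (- lb - m * B - e * A) * B) + (s + r * (g + A * la + B * lb)) =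
  r * g + s + - m * (r * (A ^+ 2 + B ^+ 2)).
Proof. by ring. Qed.

Lemma weighted_energy_algebra2 (R : comNzRingType) (r m e A B la lb s : R) :
  r * (B * (- la - m * A + e * B) - A * (- lb - m * B - e * A)) + (s + r * (B * la - A * lb)) =
  e * (r * (A ^+ 2 + B ^+ 2)) + s.
Proof. by ring. Qed.

(** * The Neumann problem on a box *)

Section BoxEnergy.
Variables (R : realType) (n : nat) (a b : 'I_n -> R).
Hypothesis ab : forall i, a i < b i.
Local Notation mu := (leb R n).
Local Notation Q := (box a b).

(** The normal derivative vanishes on the whole hyperplanes carrying the faces, which is the form
    that [ibp_box] uses. *)
Definition Neu (f : 'rV[R]_n -> R) := nice f /\
  forall (i : 'I_n) (x : 'rV[R]_n), x ord0 i = a i \/ x ord0 i = b i -> pd i f x = 0.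

Definition hk (k : 'I_n -> nat) : R := \sum_i ((k i)%:R * om a b i) ^+ 2.

Let sn i (k : nat) (t : R) := - (k%:R * om a b i) * sin (k%:R * om a b i * (t - a i)).

Lemma cs_dv i k (t : R) : is_derive t (1 : R) (cs a b i k) (sn i k t).
Proof.
have h : is_derive t (1 : R) (fun t => k%:R * om a b i * (t - a i)) (k%:R * om a b i).
  by apply: is_derive_eq (dvZ _ (dvB (is_derive_id t (1 : R)) (dvC (a i) _ _))) _; rewrite subr0 mulr1.
by apply: is_derive_eq (dv_comp (is_derive_cos _) h) _; rewrite /sn; ring.
Qed.

Lemma sn_dv i k (t : R) : is_derive t (1 : R) (sn i k) (- (k%:R * om a b i) ^+ 2 * cs a b i k t).
Proof.
have h : is_derive t (1 : R) (fun t => k%:R * om a b i * (t - a i)) (k%:R * om a b i).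
  by apply: is_derive_eq (dvZ _ (dvB (is_derive_id t (1 : R)) (dvC (a i) _ _))) _; rewrite subr0 mulr1.
by apply: is_derive_eq (dvZ _ (dv_comp (is_derive_sin _) h)) _; rewrite /cs; ring.
Qed.

Lemma ek_pd i k : pd i (ek a b k) = tp (upd (fun i => cs a b i (k i)) i (sn i (k i))).
Proof. by apply: has_pdE; apply: has_pd_tp => t; exact: cs_dv. Qed.

Lemma ek_pd2 i k x : pd i (pd i (ek a b k)) x = - ((k i)%:R * om a b i) ^+ 2 * ek a b k x.
Proof.
rewrite ek_pd (has_pdE (f := tp _) (df := tp (upd (upd (fun i => cs a b i (k i)) i (sn i (k i))) i
  (fun t => - ((k i)%:R * om a b i) ^+ 2 * cs a b i (k i) t)))).
  rewrite /ek (tpD1 _ i) [in RHS](tpD1 _ i) /upd eqxx [RHS]mulrA; congr (_ * _).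
  by apply: eq_bigr => j /negbTE ->.
apply: has_pd_tp => t; rewrite /upd eqxx; exact: sn_dv.
Qed.

Lemma lapD (f g : 'rV[R]_n -> R) x : nice f -> nice g ->
  lap (fun x => f x + g x) x = lap f x + lap g x.
Proof.
move=> nf ng; rewrite /lap -big_split; apply: eq_bigr => i _ /=.
rewrite (has_pdE (has_pdD (nice_has i nf) (nice_has i ng))).
by rewrite (has_pdE (has_pdD (nice_has i (nice_pd i nf)) (nice_has i (nice_pd i ng)))).
Qed.

Lemma lapZ c (f : 'rV[R]_n -> R) x : nice f -> lap (fun x => c * f x) x = c * lap f x.
Proof.
move=> nf; rewrite /lap mulr_sumr; apply: eq_bigr => i _ /=.
rewrite (has_pdE (has_pdZ c (nice_has i nf))).
by rewrite (has_pdE (has_pdZ c (nice_has i (nice_pd i nf)))).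
Qed.

Lemma lap_ek k x : lap (ek a b k) x = - hk k * ek a b k x.
Proof.
rewrite /lap /hk -sumrN mulr_suml; apply: eq_bigr => i _.
by rewrite ek_pd2.
Qed.

Lemma sin_nat_pi k : sin (k%:R * pi : R) = 0.
Proof.
elim: k => [|k IH]; first by rewrite mul0r sin0.
by rewrite -natr1 mulrDl mul1r sinDpi IH oppr0.
Qed.

Lemma Neu_ek k : Neu (ek a b k).
Proof.
split; first exact: nice_ek.
move=> i x xi; rewrite ek_pd (tpD1 _ i) /upd eqxx /sn.
have -> : sin ((k i)%:R * om a b i * (x ord0 i - a i)) = 0; last by rewrite mulr0 mul0r.
case: xi => ->; first by rewrite subrr mulr0 sin0.
by rewrite /om -mulrA divfK ?sin_nat_pi// subr_eq0 gt_eqF.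
Qed.

Lemma NeuD f g : Neu f -> Neu g -> Neu (fun x => f x + g x).
Proof.
move=> [nf hf] [ng hg]; split; first exact: niceD.
by move=> i x xi; rewrite (has_pdE (has_pdD (nice_has i nf) (nice_has i ng))) hf ?hg ?addr0.
Qed.

Lemma NeuZ c f : Neu f -> Neu (fun x => c * f x).
Proof.
move=> [nf hf]; split; first exact: niceZ.
by move=> i x xi; rewrite (has_pdE (has_pdZ c (nice_has i nf))) hf ?mulr0.
Qed.

Lemma Neu_Sp f : Sp a b f -> Neu f.
Proof.
move: f; apply: Sp_ind; first by move=> f g /funext ->.
  split; first exact: nice_cst.
  by move=> i x _; rewrite (has_pdE (has_pdC i 0)).
by move=> c k f Nf; apply: NeuD => //; apply: NeuZ; exact: Neu_ek.
Qed.

(* [res1] and [res2] are the real and imaginary parts of (-Delta - (m + i e))(f + i g). *)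
Definition res1 (m e : R) (f g : 'rV[R]_n -> R) x := - lap f x - m * f x + e * g x.
Definition res2 (m e : R) (f g : 'rV[R]_n -> R) x := - lap g x - m * g x - e * f x.

(** On the mode [k] the operator is multiplication by [hk k - m - i e], which is invertible because
    [e] is nonzero. A finite sum of modes is thus solved by a finite sum with no boundary error. *)
Lemma solve_Sp m e P1 P2 : e != 0 -> Sp a b P1 -> Sp a b P2 ->
  exists A B, [/\ Sp a b A, Sp a b B, res1 m e A B =1 P1 & res2 m e A B =1 P2].
Proof.
move=> e0.
have D0 k : (hk k - m) ^+ 2 + e ^+ 2 != 0.
  by rewrite gt_eqF// ltr_wpDl ?sqr_ge0// exprn_even_gt0.
have H1 P : Sp a b P -> exists A B,
    [/\ Sp a b A, Sp a b B, res1 m e A B =1 P & res2 m e A B =1 (fun=> 0)].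
  move: P; apply: Sp_ind.
  - by move=> f g fg [A [B [h1 h2 h3 h4]]]; exists A, B; split => // x; rewrite h3 fg.
  - exists (fun=> 0), (fun=> 0); split; try exact: Sp0;
      move=> x; rewrite /res1 /res2 /lap big1 ?mulr0 ?oppr0 ?subr0 ?addr0// => i _;
      by rewrite !(has_pdE (has_pdC i 0)).
  move=> c k f [A [B [SA SB hA hB]]].
  pose D := (hk k - m) ^+ 2 + e ^+ 2.
  exists (fun x => (hk k - m) * c / D * ek a b k x + A x), (fun x => e * c / D * ek a b k x + B x).
  have nk := nice_ek a b k; have nA := nice_Sp SA; have nB := nice_Sp SB.
  split; try by apply: SpD => //; apply: SpZ; exact: Sp_ek.
    move=> x; rewrite -hA /res1 lapD ?lapZ ?lap_ek//; last exact: niceZ.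
    by move: (lap A x) => l; rewrite /D; field; exact: D0.
  move=> x; rewrite -(hB x) /res2 lapD ?lapZ ?lap_ek//; last exact: niceZ.
  by move: (lap B x) => l; rewrite /D; field; exact: D0.
move=> S1 S2; have [A [B [SA SB hA hB]]] := H1 _ S1; have [A' [B' [SA' SB' hA' hB']]] := H1 _ S2.
have nA := nice_Sp SA; have nB := nice_Sp SB; have nA' := nice_Sp SA'; have nB' := nice_Sp SB'.
(* A right-hand side [i P2] is solved by [i (A' + i B') = - B' + i A']. *)
exists (fun x => A x + (-1) * B' x), (fun x => B x + A' x); split.
- by apply: SpD => //; apply: SpZ.
- exact: SpD.
- move=> x; rewrite -hA /res1 lapD ?lapZ//; last exact: niceZ.
  by have := hB' x; rewrite /res2; move: (lap A x) (lap B' x) => *; lra.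
- move=> x; rewrite -hA' -[RHS]addr0 -(hB x) /res2 /res1 lapD//.
  by move: (lap A' x) (lap B x) => *; ring.
Qed.

Let mQ : measurable Q := measurable_box a b.

Lemma box_int f : continuous f -> mu.-integrable Q (EFin \o f).
Proof.
move=> cf; have [M hM] := cont_bounded_box a b cf.
apply: (bounded_integrable (M := M)) => //; first exact: leb_box_fin.
by apply: measurable_funTS; exact: continuous_measurable_rV.
Qed.

Lemma box_div (V dV : 'I_n -> 'rV[R]_n -> R) :
  (forall i, continuous (V i)) -> (forall i, continuous (dV i)) ->
  (forall i, has_pd i (V i) (dV i)) ->
  (forall i (x : 'rV[R]_n), x ord0 i = a i \/ x ord0 i = b i -> V i x = 0) ->
  \int[mu]_(x in Q) (\sum_i dV i x) = 0.
Proof.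
move=> cV cdV pV V0; rewrite Rintegral_sum//; last by move=> i; exact: box_int.
rewrite big1// => i _; rewrite /Rintegral (@ibp_box _ _ i _ _ (V i))// => x xi.
exact: V0.
Qed.

Variables (m e r0 : R).
(** The weight matches the factor [r] in front of the residual. Since [2 |x| <= rho / r0], the terms
    produced by differentiating it are small for large [r0]. *)
Let rho (x : 'rV[R]_n) := r0 ^+ 2 + \sum_i x ord0 i ^+ 2.

Lemma rho_pd i : has_pd i rho (fun x => 2 * x ord0 i).
Proof.
have -> : rho = fun x => r0 ^+ 2 + dotp x x.
  by apply/funext => x; congr (_ + _); apply: eq_bigr => j _; rewrite expr2.
apply: has_pd_ext (has_pdD (has_pdC i (r0 ^+ 2)) (dotp_pd i)) _ => x.
by rewrite add0r.
Qed.

Lemma rho_cont : continuous rho.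
Proof.
apply: contD; first exact: cst_continuous.
by apply: cont_sum => i; under eq_fun do rewrite expr2; apply: contM; exact: coord_cont.
Qed.

Section Pair.
Variables (A B : 'rV[R]_n -> R).
Hypotheses (NA : Neu A) (NB : Neu B).
Let nA : nice A := NA.1.
Let nB : nice B := NB.1.
Let P1 := res1 m e A B.
Let P2 := res2 m e A B.
Let W x := A x ^+ 2 + B x ^+ 2.
Let G x := \sum_i (pd i A x ^+ 2 + pd i B x ^+ 2).
Let I (f : 'rV[R]_n -> R) := \int[mu]_(x in Q) f x.

Let cA : continuous A := nice_cont nA.
Let cB : continuous B := nice_cont nB.
Let cdA i : continuous (pd i A) := nice_cont (nice_pd i nA).
Let cdB i : continuous (pd i B) := nice_cont (nice_pd i nB).
Let cddA i : continuous (pd i (pd i A)) := nice_cont (nice_pd i (nice_pd i nA)).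
Let cddB i : continuous (pd i (pd i B)) := nice_cont (nice_pd i (nice_pd i nB)).
Let cx i : continuous (fun x : 'rV[R]_n => x ord0 i) := @coord_cont R n i.

Let cX2 (f : 'rV[R]_n -> R) : continuous f -> continuous (fun x : 'rV[R]_n => f x ^+ 2 : R).
Proof. by move=> cf; under eq_fun do rewrite expr2; exact: contM. Qed.

Let cW : continuous W. Proof. by apply: contD; exact: cX2. Qed.
Let cG : continuous G. Proof. by apply: cont_sum => i; apply: contD; exact: cX2. Qed.
Let clA : continuous (fun x => lap A x). Proof. by apply: cont_sum => i; exact: cddA. Qed.
Let clB : continuous (fun x => lap B x). Proof. by apply: cont_sum => i; exact: cddB. Qed.

Let contZ c (f : 'rV[R]_n -> R) : continuous f -> continuous (fun x => c * f x).
Proof. by move=> cf; apply: contM => //; exact: cst_continuous. Qed.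

Let cP1 : continuous P1.
Proof.
exact: (contD (contB (contN clA) (@contZ m _ cA)) (@contZ e _ cB)). Qed.
Let cP2 : continuous P2.
Proof. exact: (contB (contB (contN clB) (@contZ m _ cB)) (@contZ e _ cA)). Qed.

Let cT1 : continuous (fun x : 'rV[R]_n => \sum_i 2 * x ord0 i * (A x * pd i A x + B x * pd i B x)).
Proof.
by apply: cont_sum => i; apply: contM; [exact: contZ|apply: contD; exact: contM].
Qed.
Let cT2 : continuous (fun x : 'rV[R]_n => \sum_i 2 * x ord0 i * (B x * pd i A x - A x * pd i B x)).
Proof.
by apply: cont_sum => i; apply: contM; [exact: contZ|apply: contB; exact: contM].
Qed.

Let ID f g : continuous f -> continuous g -> I (fun x => f x + g x) = I f + I g.
Proof. by move=> zf zg; rewrite /I RintegralD//; exact: box_int. Qed.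
Let IZ (t : R) (f : 'rV[R]_n -> R) : continuous f -> I (fun x => t * f x) = t * I f.
Proof. by move=> zf; rewrite /I RintegralZl//; exact: box_int. Qed.
Let Ile f g : continuous f -> continuous g -> (forall x, f x <= g x) -> I f <= I g.
Proof. by move=> zf zg h; apply: le_Rintegral => //; exact: box_int. Qed.

Let energy1 : I (fun x => rho x * (P1 x * A x + P2 x * B x)) =
  I (fun x => rho x * G x + \sum_i 2 * x ord0 i * (A x * pd i A x + B x * pd i B x)
     + (- m) * (rho x * W x)).
Proof.
pose V i x := rho x * (A x * pd i A x + B x * pd i B x).
pose dV i (x : 'rV[R]_n) := 2 * x ord0 i * (A x * pd i A x + B x * pd i B x) +
  rho x * ((pd i A x * pd i A x + A x * pd i (pd i A) x) + (pd i B x * pd i B x + B x * pd i (pd i B) x)).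
have cV i : continuous (V i).
  by apply: contM; [exact: rho_cont|apply: contD; exact: contM].
have cdV i : continuous (dV i).
  apply: contD; first by apply: contM; [exact: contZ|apply: contD; exact: contM].
  by apply: contM; [exact: rho_cont|apply: contD; apply: contD; exact: contM].
have pV i : has_pd i (V i) (dV i).
  exact: (has_pdM (rho_pd i) (has_pdD (has_pdM (nice_has i nA) (nice_has i (nice_pd i nA)))
    (has_pdM (nice_has i nB) (nice_has i (nice_pd i nB))))).
have V0 i (x : 'rV[R]_n) : x ord0 i = a i \/ x ord0 i = b i -> V i x = 0.
  by move=> xi; rewrite /V NA.2// NB.2// !mulr0 addr0 mulr0.
have h := box_div cV cdV pV V0.
have c1 : continuous (fun x => rho x * (P1 x * A x + P2 x * B x)).
  by apply: contM; [exact: rho_cont|apply: contD; exact: contM].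
have c2 : continuous (fun x => \sum_i dV i x) by exact: cont_sum.
rewrite -[LHS]addr0 -[X in _ + X = _]h -/(I _) -ID//; congr I; apply/funext => x.
rewrite /dV /P1 /P2 /res1 /res2 /W /G big_split/= -mulr_sumr.
have -> : \sum_i (pd i A x * pd i A x + A x * pd i (pd i A) x + (pd i B x * pd i B x + B x * pd i (pd i B) x)) =
   \sum_i (pd i A x ^+ 2 + pd i B x ^+ 2) + A x * lap A x + B x * lap B x.
  rewrite /lap !mulr_sumr -!big_split; apply: eq_bigr => i _ /=.
  by move: (pd i (pd i A) x) (pd i (pd i B) x) (pd i A x) (pd i B x) => *; ring.
exact: weighted_energy_algebra1.
Qed.

Let energy2 : I (fun x => rho x * (B x * P1 x - A x * P2 x)) =
  I (fun x => e * (rho x * W x) + \sum_i 2 * x ord0 i * (B x * pd i A x - A x * pd i B x)).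
Proof.
pose V i x := rho x * (B x * pd i A x - A x * pd i B x).
pose dV i (x : 'rV[R]_n) := 2 * x ord0 i * (B x * pd i A x - A x * pd i B x) +
  rho x * ((pd i B x * pd i A x + B x * pd i (pd i A) x) - (pd i A x * pd i B x + A x * pd i (pd i B) x)).
have cV i : continuous (V i).
  by apply: contM; [exact: rho_cont|apply: contB; exact: contM].
have cdV i : continuous (dV i).
  apply: contD; first by apply: contM; [exact: contZ|apply: contB; exact: contM].
  by apply: contM; [exact: rho_cont|apply: contB; apply: contD; exact: contM].
have pV i : has_pd i (V i) (dV i).
  exact: (has_pdM (rho_pd i) (has_pdB (has_pdM (nice_has i nB) (nice_has i (nice_pd i nA)))
    (has_pdM (nice_has i nA) (nice_has i (nice_pd i nB))))).
have V0 i (x : 'rV[R]_n) : x ord0 i = a i \/ x ord0 i = b i -> V i x = 0.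
  by move=> xi; rewrite /V NA.2// NB.2// !mulr0 subr0 mulr0.
have h := box_div cV cdV pV V0.
have c1 : continuous (fun x => rho x * (B x * P1 x - A x * P2 x)).
  by apply: contM; [exact: rho_cont|apply: contB; exact: contM].
have c2 : continuous (fun x => \sum_i dV i x) by exact: cont_sum.
rewrite -[LHS]addr0 -[X in _ + X = _]h -/(I _) -ID//; congr I; apply/funext => x.
rewrite /dV /P1 /P2 /res1 /res2 /W big_split/= -mulr_sumr.
have -> : \sum_i (pd i B x * pd i A x + B x * pd i (pd i A) x - (pd i A x * pd i B x + A x * pd i (pd i B) x)) =
   B x * lap A x - A x * lap B x.
  rewrite /lap !mulr_sumr -sumrB; apply: eq_bigr => i _ /=.
  by move: (pd i (pd i A) x) (pd i (pd i B) x) (pd i A x) (pd i B x) => *; ring.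
exact: weighted_energy_algebra2.
Qed.

Hypothesis r00 : 0 < r0.

Let rho_ge (x : 'rV[R]_n) : 0 < rho x.
Proof. by rewrite ltr_pwDl ?exprn_gt0// sumr_ge0// => i _; exact: sqr_ge0. Qed.

Let cross (C : 'rV[R]_n -> R) (D : 'I_n -> 'rV[R]_n -> R) (x : 'rV[R]_n) :
  `|\sum_i 2 * x ord0 i * (C x * D i x)| <= rho x / r0 * (C x ^+ 2 + \sum_i D i x ^+ 2).
Proof.
apply: le_trans (ler_norm_sum _ _ _) _.
apply: (@le_trans _ _ (\sum_i (x ord0 i ^+ 2 * (C x ^+ 2 / r0) + r0 * D i x ^+ 2))).
  apply: ler_sum => i _.
  have -> : x ord0 i ^+ 2 * (C x ^+ 2 / r0) + r0 * D i x ^+ 2 =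
    ((x ord0 i * C x) ^+ 2 + (r0 * D i x) ^+ 2) / r0 by field; rewrite gt_eqF.
  rewrite ler_pdivlMr// -[X in _ * X]gtr0_norm// -normrM.
  move: (x ord0 i) (C x) (D i x) => y c t; rewrite ler_norml.
  have := sqr_ge0 (y * c - r0 * t); have := sqr_ge0 (y * c + r0 * t) => *.
  by apply/andP; split; nra.
rewrite big_split/= -mulr_suml -mulr_sumr mulrDr; apply: lerD.
  rewrite -mulrA (mulrC r0^-1) ler_wpM2r ?divr_ge0 ?sqr_ge0 ?(ltW r00)//.
  by rewrite /rho lerDr sqr_ge0.
rewrite ler_wpM2r ?sumr_ge0// => [i _|]; first exact: sqr_ge0.
rewrite ler_pdivlMr// -expr2 /rho lerDl sumr_ge0// => i _; exact: sqr_ge0.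
Qed.

Let cross1 (x : 'rV[R]_n) : `|\sum_i 2 * x ord0 i * (A x * pd i A x + B x * pd i B x)| <= rho x / r0 * (W x + G x).
Proof.
under eq_bigr do rewrite mulrDr.
rewrite big_split/=; apply: le_trans (ler_normD _ _) _.
apply: le_trans (lerD (cross A (fun i => pd i A) x) (cross B (fun i => pd i B) x)) _.
by rewrite -mulrDr /W /G big_split/= addrACA.
Qed.

Let cross2 (x : 'rV[R]_n) : `|\sum_i 2 * x ord0 i * (B x * pd i A x - A x * pd i B x)| <= rho x / r0 * (W x + G x).
Proof.
under eq_bigr do rewrite mulrBr.
rewrite sumrB/=; apply: le_trans (ler_normB _ _) _.
apply: le_trans (lerD (cross B (fun i => pd i A) x) (cross A (fun i => pd i B) x)) _.
by rewrite -mulrDr /W /G big_split/= addrACA (addrC (B x ^+ 2)).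
Qed.

Let p := I (fun x => rho x * (P1 x ^+ 2 + P2 x ^+ 2)).
Let X := I (fun x => rho x * W x).
Let Y := I (fun x => rho x * G x).

Let crW : continuous (fun x => rho x * W x). Proof. by apply: contM => //; exact: rho_cont. Qed.
Let crG : continuous (fun x => rho x * G x). Proof. by apply: contM => //; exact: rho_cont. Qed.
Let crP : continuous (fun x => rho x * (P1 x ^+ 2 + P2 x ^+ 2)).
Proof. by apply: contM; [exact: rho_cont|apply: contD; exact: cX2]. Qed.

(** The equation is paired with [rho conj w]. The real part controls the gradient and, in the next
    lemma, the imaginary part controls [w] through [e]; the derivative of the weight costs
    [(X + Y) / r0] each time. *)
Lemma box_energy1 : Y <= `|m| * X + (X + p) / 2 + (X + Y) / r0.
Proof.
have c1 : continuous (fun x => rho x * (P1 x * A x + P2 x * B x)).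
  by apply: contM; [exact: rho_cont|apply: contD; exact: contM].
have E : Y + I (fun x => \sum_i 2 * x ord0 i * (A x * pd i A x + B x * pd i B x)) + (- m) * X =
    I (fun x => rho x * (P1 x * A x + P2 x * B x)).
  rewrite energy1 ID ?ID ?IZ//; [exact: contD|exact: contZ].
have h1 : - I (fun x => \sum_i 2 * x ord0 i * (A x * pd i A x + B x * pd i B x)) <= (X + Y) / r0.
  rewrite -mulN1r -IZ// mulrC -ID// -IZ//; last exact: contD.
  apply: Ile => [| |x]; [exact: contZ|by apply: contZ; exact: contD|].
  rewrite mulN1r -mulrDr mulrA (mulrC r0^-1); apply: le_trans (cross1 x).
  by rewrite -normrN ler_norm.
have h2 : I (fun x => rho x * (P1 x * A x + P2 x * B x)) <= (X + p) / 2.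
  rewrite mulrC -ID// -IZ//; last exact: contD.
  apply: Ile => // [|x]; first by apply: contZ; exact: contD.
  rewrite -mulrDr mulrCA ler_wpM2l ?(ltW (rho_ge x))// /W.
  move: (A x) (B x) (P1 x) (P2 x) => A' B' p1 p2.
  by have := sqr_ge0 (A' - p1); have := sqr_ge0 (B' - p2) => *; nra.
have X0 : 0 <= X by apply: Rintegral_ge0 => x _; rewrite mulr_ge0 ?(ltW (rho_ge x))// addr_ge0 ?sqr_ge0.
have h3 : m * X <= `|m| * X by rewrite ler_wpM2r// ler_norm.
by lra.
Qed.

Lemma box_energy2 : e != 0 -> `|e| * X <= `|e| / 4 * X + p / `|e| + (X + Y) / r0.
Proof.
move=> e0; have e0' : 0 < `|e| by rewrite normr_gt0.
have c1 : continuous (fun x => rho x * (B x * P1 x - A x * P2 x)).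
  by apply: contM; [exact: rho_cont|apply: contB; exact: contM].
have X0 : 0 <= X by apply: Rintegral_ge0 => x _; rewrite mulr_ge0 ?(ltW (rho_ge x))// addr_ge0 ?sqr_ge0.
pose s := Num.sg e.
have -> : `|e| * X = I (fun x => s * (rho x * (B x * P1 x - A x * P2 x)) +
    (- s) * \sum_i 2 * x ord0 i * (B x * pd i A x - A x * pd i B x)).
  rewrite ID; [|exact: contZ..]; rewrite !IZ// energy2 ID ?IZ//; last exact: contZ.
  by rewrite normrEsg -/s -/X; ring.
have -> : `|e| / 4 * X + p / `|e| + (X + Y) / r0 = I (fun x => `|e| / 4 * (rho x * W x) +
    `|e|^-1 * (rho x * (P1 x ^+ 2 + P2 x ^+ 2)) + r0^-1 * (rho x * W x + rho x * G x)).
  have c2 : continuous (fun x => rho x * W x + rho x * G x) by exact: contD.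
  rewrite ID ?ID ?IZ ?ID//; try exact: contZ; last by apply: contD; exact: contZ.
  by rewrite -/X -/Y -/p (mulrC p) (mulrC (X + Y)).
have s1 : `|s| <= 1 by rewrite /s normr_sg; case: (e != 0).
apply: Ile => [| |x].
- by apply: contD; exact: contZ.
- by apply: contD; [apply: contD; exact: contZ|apply: contZ; exact: contD].
apply: lerD; last first.
  rewrite -mulrDr mulrA (mulrC r0^-1); apply: le_trans (cross2 x).
  apply: le_trans (ler_norm _) _; rewrite normrM normrN ler_piMl//.
apply: le_trans (ler_norm _) _; rewrite normrM; apply: (@le_trans _ _ `|rho x * (B x * P1 x - A x * P2 x)|).
  by rewrite ler_piMl.
rewrite normrM (gtr0_norm (rho_ge x)) (mulrCA (`|e| / 4)) (mulrCA `|e|^-1) -mulrDr ler_wpM2l ?(ltW (rho_ge x))// /W.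
move: (A x) (B x) (P1 x) (P2 x) => A' B' p1 p2.
rewrite -(ler_pM2l e0') mulrDr mulrA mulVKf ?gt_eqF//.
move: `|e| e0' => q q0.
rewrite -[X in X * `|_|]gtr0_norm// -normrM ler_norml.
have := sqr_ge0 (q / 2 * A' - p2); have := sqr_ge0 (q / 2 * B' - p1).
have := sqr_ge0 (q / 2 * A' + p2); have := sqr_ge0 (q / 2 * B' + p1) => *.
by apply/andP; split; nra.
Qed.

End Pair.
End BoxEnergy.

Lemma energy_constants (R : realType) (m e : R) : e != 0 ->
  exists r0 C : R, [/\ 0 < r0, 0 <= C & forall X Y p : R, 0 <= X -> 0 <= Y -> 0 <= p ->
    Y <= `|m| * X + (X + p) / 2 + (X + Y) / r0 ->
    `|e| * X <= `|e| / 4 * X + p / `|e| + (X + Y) / r0 -> X <= C * p /\ Y <= C * p].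
Proof.
move=> e0; have q0 : 0 < `|e| by rewrite normr_gt0.
have M0 : 0 <= `|m| by [].
move: `|m| `|e| M0 q0 => M q M0 q0.
(* [r0 >= 2] absorbs half of [Y] in the first inequality; then [X + Y <= (2 M + 3) X + p], and the
   second summand makes [(2 M + 3) / r0] at most [q / 4]. *)
pose r0 := 2 + 4 * (2 * M + 3) / q.
have r2 : 2 <= r0 by rewrite lerDl divr_ge0// ?(ltW q0)//; lra.
have rp : 0 < r0 by lra.
have q' : 0 < q^-1 by rewrite invr_gt0.
pose C1 := 2 / q * (q^-1 + 1).
have C10 : 0 <= C1 by rewrite mulr_ge0 ?divr_ge0 ?addr_ge0 ?(ltW q0) ?(ltW q').
exists r0, (C1 + ((2 * M + 2) * C1 + 1)); split => //.
  by rewrite !addr_ge0 ?mulr_ge0//; lra.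
move=> X Y p X0 Y0 p0 h1 h2.
pose t := r0^-1; have t0 : 0 < t by rewrite invr_gt0.
have t2 : t <= 2^-1 by rewrite lef_pV2 ?posrE.
have tq : t * (2 * M + 3) <= q / 4.
  rewrite -(ler_pM2l rp) mulrA divff ?gt_eqF// mul1r /r0.
  have -> : (2 + 4 * (2 * M + 3) / q) * (q / 4) = q / 2 + (2 * M + 3).
    by field; rewrite gt_eqF.
  by rewrite lerDr divr_ge0// ltW.
have hY : Y <= (2 * M + 2) * X + p.
  have : (X + Y) / r0 <= (X + Y) / 2 by rewrite ler_wpM2l ?addr_ge0.
  by lra.
have hX : q * X / 2 <= p * (q^-1 + 1).
  have e1 : (X + Y) / r0 <= t * (2 * M + 3) * X + t * p.
    by rewrite mulrC -/t -mulrA -mulrDr ler_wpM2l ?(ltW t0)//; lra.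
  have e2 : t * (2 * M + 3) * X <= q / 4 * X by rewrite ler_wpM2r.
  have e3 : t * p <= p by rewrite ler_piMl//; lra.
  by move: h2; rewrite (mulrC p) => h2; lra.
have hX' : X <= C1 * p.
  rewrite /C1 -mulrA -(ler_pM2l q0).
  have -> : q * (2 / q * ((q^-1 + 1) * p)) = 2 * (p * (q^-1 + 1)).
    by field; rewrite gt_eqF.
  by lra.
have s1 : C1 * p <= (C1 + ((2 * M + 2) * C1 + 1)) * p.
  rewrite ler_wpM2r// lerDl addr_ge0// mulr_ge0//; lra.
split; first exact: le_trans s1.
apply: (le_trans hY); rewrite !mulrDl mul1r.
have : (2 * M + 2) * X <= (2 * M + 2) * (C1 * p) by rewrite ler_wpM2l//; lra.
by have := mulr_ge0 C10 p0; lra.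
Qed.

Definition rho (R : realType) n (r0 : R) (x : 'rV[R]_n) := r0 ^+ 2 + \sum_i x ord0 i ^+ 2.

(** [r0] and [C] are independent of the box, so its size may be chosen afterwards, from the energy
    bound itself. *)
Lemma box_energy (R : realType) n (m e : R) : e != 0 ->
  exists r0 C : R, [/\ 0 < r0, 0 <= C & forall (a b : 'I_n -> R), (forall i, a i < b i) ->
   forall A B, Neu a b A -> Neu a b B ->
   \int[leb R n]_(x in box a b) (rho r0 x * (A x ^+ 2 + B x ^+ 2 +
      \sum_i (pd i A x ^+ 2 + pd i B x ^+ 2))) <=
   C * \int[leb R n]_(x in box a b) (rho r0 x * (res1 m e A B x ^+ 2 + res2 m e A B x ^+ 2))].
Proof.
move=> e0; have [r0 [C [r00 C0 h]]] := energy_constants m e0.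
exists r0, (2 * C); split => //; first by rewrite mulr_ge0.
move=> a b ab A B NA NB; have := box_energy2 ab m NA NB r00 e0.
have := box_energy1 ab m e NA NB r00.
have rp (x : 'rV[R]_n) : 0 <= rho r0 x.
  by rewrite addr_ge0 ?sqr_ge0// sumr_ge0// => i _; exact: sqr_ge0.
have cr : continuous (@rho R n r0) by exact: rho_cont.
have cX2 (f : 'rV[R]_n -> R) : continuous f -> continuous (fun x : 'rV[R]_n => f x ^+ 2 : R).
  by move=> cf; under eq_fun do rewrite expr2; exact: contM.
have cW : continuous (fun x => rho r0 x * (A x ^+ 2 + B x ^+ 2)).
  by apply: contM => //; apply: contD; apply: cX2; apply: nice_cont; [exact: NA.1|exact: NB.1].
have cG : continuous (fun x => rho r0 x * \sum_i (pd i A x ^+ 2 + pd i B x ^+ 2)).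
  apply: contM => //; apply: cont_sum => i; apply: contD; apply: cX2; apply: nice_cont; apply: nice_pd;
    [exact: NA.1|exact: NB.1].
have -> : \int[leb R n]_(x in box a b) (rho r0 x * (A x ^+ 2 + B x ^+ 2 +
      \sum_i (pd i A x ^+ 2 + pd i B x ^+ 2))) =
    \int[leb R n]_(x in box a b) (rho r0 x * (A x ^+ 2 + B x ^+ 2)) +
    \int[leb R n]_(x in box a b) (rho r0 x * \sum_i (pd i A x ^+ 2 + pd i B x ^+ 2)).
  rewrite -RintegralD//; [|exact: measurable_box|exact: box_int..].
  by apply: eq_Rintegral => x _; rewrite mulrDr.
move=> h1 h2; have [||| h3 h4] := h _ _ _ _ _ _ h1 h2; last by rewrite mulr_natl mulr2n mulrDl lerD.
- by apply: Rintegral_ge0 => x _; rewrite mulr_ge0// ?rp// addr_ge0 ?sqr_ge0.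
- apply: Rintegral_ge0 => x _; rewrite mulr_ge0// ?rp// sumr_ge0// => i _.
  by rewrite addr_ge0 ?sqr_ge0.
- by apply: Rintegral_ge0 => x _; rewrite mulr_ge0// ?rp// addr_ge0 ?sqr_ge0.
Qed.

(** * Cutoff functions and their commutators with the Laplacian *)

Section Cutoff.
Variables (R : realType) (n : nat).

Lemma tp_le (f : 'I_n -> R -> R) (x : 'rV[R]_n) i (C : R) : 0 <= C ->
  (forall j, j != i -> `|f j (x ord0 j)| <= 1) -> `|f i (x ord0 i)| <= C -> `|tp f x| <= C.
Proof.
move=> C0 h hi; rewrite (tpD1 _ i) normrM -[leRHS]mulr1 ler_pM//.
by rewrite normr_prod; apply: prodr_ile1 => j ji; rewrite normr_ge0 h.
Qed.

Lemma cutoff : exists2 C : R, 0 <= C & forall r : R, 0 < r ->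
  exists chi : 'rV[R]_n -> R, [/\ nice chi,
    (forall x : 'rV[R]_n, (forall i, `|x ord0 i| <= r) -> chi x = 1),
    (forall x : 'rV[R]_n, 0 <= chi x <= 1),
    (forall (x : 'rV[R]_n) j, 2 * r < `|x ord0 j| ->
       [/\ chi x = 0, forall i, pd i chi x = 0 & lap chi x = 0]) &
    [/\ forall i (x : 'rV[R]_n), `|pd i chi x| <= C / r,
        forall x : 'rV[R]_n, `|lap chi x| <= C / r ^+ 2 &
        forall i (x : 'rV[R]_n), x ord0 i = 0 -> pd i chi x = 0]].
Proof.
have [b1 [b2 [C [C0 d1 d2 [s1 s2] bC]]]] := bump_der R.
exists (C + n%:R * C) => [|r r0]; first by rewrite addr_ge0 ?mulr_ge0.
have rn0 : r != 0 by rewrite gt_eqF.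
have dr (t : R) : is_derive t (1 : R) (fun t => t / r) r^-1.
  apply: is_derive_eq (dvM (is_derive_id t (1 : R)) (dvC r^-1 t 1)) _.
  by rewrite mulr0 addr0 div1r.
pose f (i : 'I_n) (t : R) := bump (t / r).
pose f1 (t : R) := b1 (t / r) / r.
pose f2 (t : R) := b2 (t / r) / r ^+ 2.
have df i (t : R) : is_derive t (1 : R) (f i) (f1 t) by exact: dv_comp (d1 _) (dr t).
have df1 (t : R) : is_derive t (1 : R) f1 (f2 t).
  apply: is_derive_eq (dvM (dv_comp (d2 _) (dr t)) (dvC r^-1 t 1)) _.
  by rewrite /f2; field.
have out (t : R) : 2 * r < `|t| -> 2 < `|t / r|.
  by rewrite normrM normfV (gtr0_norm r0) ltr_pdivlMr.
have f01 i t : `|f i t| <= 1.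
  by rewrite /f; have /andP[h1 h2] := bump01 (t / r); rewrite ger0_norm.
have f10 t : 2 * r < `|t| -> f1 t = 0.
  by move=> /out h; rewrite /f1; have [_ _ -> //] := bC (t / r); rewrite mul0r.
have f20 t : 2 * r < `|t| -> f2 t = 0.
  by move=> /out h; rewrite /f2; have [_ _ _ -> //] := bC (t / r); rewrite mul0r.
have f00 i t : 2 * r < `|t| -> f i t = 0.
  by move=> /out h; rewrite /f bump0 ?ltW.
have f1C t : `|f1 t| <= C / r.
  rewrite /f1 normrM normfV (gtr0_norm r0) ler_wpM2r ?invr_ge0 ?(ltW r0)//.
  by have [] := bC (t / r).
have r20 : 0 < r ^+ 2 by rewrite exprn_gt0.
have f2C t : `|f2 t| <= C / r ^+ 2.
  rewrite /f2 normrM normfV (gtr0_norm r20) ler_wpM2r ?invr_ge0 ?(ltW r20)//.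
  by have [] := bC (t / r).
have p1 i : pd i (tp f) = tp (upd f i f1) by apply: has_pdE; exact: has_pd_tp.
have p2 i : pd i (pd i (tp f)) = tp (upd (upd f i f1) i f2).
  by rewrite p1; apply: has_pdE; apply: has_pd_tp => t; rewrite /upd eqxx.
have tp0 (g : 'I_n -> R -> R) (x : 'rV[R]_n) j : g j (x ord0 j) = 0 -> tp g x = 0.
  by move=> g0; rewrite (tpD1 _ j) g0 mul0r.
have Cr : 0 <= C / r by rewrite divr_ge0// ltW.
have Cr2 : 0 <= C / r ^+ 2 by rewrite divr_ge0// ltW.
have p2C i (x : 'rV[R]_n) : `|pd i (pd i (tp f)) x| <= C / r ^+ 2.
  rewrite p2; apply: (@tp_le _ _ i) => //; last by rewrite /upd eqxx.
  by move=> j /negbTE ji; rewrite /upd ji.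
exists (tp f); split.
- apply: nice_tp => i; have := smooth1_aff r^-1 0 (@smooth1_bump R).
  by congr smooth1; apply/funext => t; rewrite addr0 mulrC.
- move=> x h; rewrite /tp big1// => i _; rewrite /f bump1//.
  by rewrite normrM normfV (gtr0_norm r0) ler_pdivrMr// mul1r.
- move=> x; rewrite /tp prodr_ge0/= => [|i _]; last by case/andP: (bump01 (x ord0 i / r)).
  by apply: prodr_ile1 => i _; exact: bump01.
- move=> x j xj; have H2 i : pd i (pd i (tp f)) x = 0.
    rewrite p2; apply: (tp0 _ _ j); rewrite /upd; case: (j == i); first exact: f20.
    exact: f00.
  split; first by apply: (tp0 _ _ j); exact: f00.
    move=> i; rewrite p1; apply: (tp0 _ _ j); rewrite /upd; case: ifP => _; first exact: f10.
    exact: f00.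
  by rewrite /lap big1// => i _; exact: H2.
split.
- move=> i x; apply: (@le_trans _ _ (C / r)); last first.
    by rewrite ler_wpM2r ?invr_ge0 ?(ltW r0)// lerDl mulr_ge0.
  rewrite p1; apply: (@tp_le _ _ i) => //; last by rewrite /upd eqxx.
  by move=> j /negbTE ji; rewrite /upd ji.
- move=> x; apply: (le_trans (ler_norm_sum _ _ _)).
  apply: (@le_trans _ _ (\sum_(i < n) C / r ^+ 2)); first by apply: ler_sum => i _; exact: p2C.
  rewrite sumr_const card_ord [leRHS]mulrDl -[X in _ + X]mulrA mulr_natl lerDr divr_ge0// ltW//.
- move=> i x x0; rewrite p1; apply: (tp0 _ _ i); rewrite /upd eqxx x0 /f1 mul0r.
  suff -> : b1 0 = 0 by rewrite mul0r.
  have [_ <-] := d1 0; have : \forall y \near (0 : R^o), @bump R y = (fun=> 1) y.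
    by exists 1 => //= y h; apply: bump1; rewrite -[y]subr0 distrC; exact: ltW h.
  by move=> /near_eq_derive ->; rewrite ?oner_eq0// derive_cst.
Qed.

Lemma lapM (f g : 'rV[R]_n -> R) x : nice f -> nice g -> lap (fun x => f x * g x) x =
  f x * lap g x + (2 * (\sum_i pd i f x * pd i g x) + g x * lap f x).
Proof.
move=> nf ng; rewrite /lap !mulr_sumr -!big_split; apply: eq_bigr => i _ /=.
have h1 := nice_has i nf; have h2 := nice_has i ng.
rewrite (has_pdE (has_pdM h1 h2)).
rewrite (has_pdE (has_pdD (has_pdM (nice_has i (nice_pd i nf)) h2) (has_pdM h1 (nice_has i (nice_pd i ng))))).
by move: (pd i f x) (pd i g x) (pd i (pd i f) x) (pd i (pd i g) x) (f x) (g x) => *; ring.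
Qed.

(** The commutator of the Laplacian with multiplication by [chi], applied to [A]. *)
Definition cut (chi A : 'rV[R]_n -> R) x := 2 * (\sum_i pd i chi x * pd i A x) + A x * lap chi x.

Lemma res1_cut (m e : R) chi A B x : nice chi -> nice A -> nice B ->
  res1 m e (fun x => chi x * A x) (fun x => chi x * B x) x = chi x * res1 m e A B x - cut chi A x.
Proof.
move=> nc nA nB; rewrite /res1 lapM// -/(cut chi A x).
by move: (cut _ _ _) (lap A x) => *; ring.
Qed.

Lemma res2_cut (m e : R) chi A B x : nice chi -> nice A -> nice B ->
  res2 m e (fun x => chi x * A x) (fun x => chi x * B x) x = chi x * res2 m e A B x - cut chi B x.
Proof.
move=> nc nA nB; rewrite /res2 lapM// -/(cut chi B x).
by move: (cut _ _ _) (lap B x) => *; ring.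
Qed.

Lemma cut_le chi A x (c : R) : 0 <= c -> (forall i, `|pd i chi x| <= c) -> `|lap chi x| <= c ->
  cut chi A x ^+ 2 <= c ^+ 2 * (8 * n%:R + 2) * (A x ^+ 2 + \sum_i pd i A x ^+ 2).
Proof.
move=> c0 h1 h2; set S := \sum_i pd i A x ^+ 2.
have S0 : 0 <= S by apply: sumr_ge0 => i _; exact: sqr_ge0.
have hs : (\sum_i pd i chi x * pd i A x) ^+ 2 <= c ^+ 2 * n%:R * S.
  apply: le_trans (sum_CS _ _) _; rewrite ler_wpM2r//.
  apply: (@le_trans _ _ (\sum_(i < n) c ^+ 2)); last by rewrite sumr_const card_ord mulr_natr.
  apply: ler_sum => i _; rewrite -[leLHS]real_normK ?num_real// lerXn2r ?nnegrE//.
have hl : (A x * lap chi x) ^+ 2 <= c ^+ 2 * A x ^+ 2.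
  rewrite exprMn mulrC ler_wpM2r ?sqr_ge0// -[leLHS]real_normK ?num_real// lerXn2r ?nnegrE//.
rewrite /cut; have : 0 <= c ^+ 2 * n%:R * A x ^+ 2 by apply: mulr_ge0; [apply: mulr_ge0|]; rewrite ?sqr_ge0.
have : 0 <= c ^+ 2 * S by rewrite mulr_ge0 ?sqr_ge0.
move: (\sum_i _) (A x * lap chi x) hs hl => s t hs hl.
have := sqr_ge0 (2 * s - t).
move: (c ^+ 2) (n%:R : R) (A x ^+ 2) S hs hl {S0} => c2 N a2 S hs hl h h3 h4.
have -> : c2 * (8 * N + 2) * (a2 + S) = 8 * (c2 * N * a2) + 8 * (c2 * N * S) + 2 * (c2 * a2) + 2 * (c2 * S) by ring.
by lra.
Qed.

Lemma leb_box (a b : 'I_n -> R) : (forall i, a i <= b i) ->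
  leb R n (box a b) = (\prod_(i < n) (b i - a i))%:E.
Proof.
elim: n a b => [|k IH] a b ab /=.
  by rewrite diracE big_ord0 mem_set//= => -[].
rewrite /snoc_measure /pushforward.
have -> : @snoc R k @^-1` box a b =
    box (a \o lift ord_max) (b \o lift ord_max) `*` `]a ord_max, b ord_max[%classic.
  by apply/seteqP; split => p; rewrite /preimage/= box_snoc.
rewrite product_measure1E//; [|exact: measurable_box].
rewrite [X in (X * _)%E](IH _ _ (fun i => ab (lift ord_max i))).
rewrite [X in (_ * X)%E](_ : _ = lebesgue_measure [set` `]a ord_max, b ord_max[])//.
rewrite lebesgue_measure_itv/= lte_fin big_ord_recr/=.
have -> : \prod_(i < k) (b (lift ord_max i) - a (lift ord_max i)) =
   \prod_(i < k) (b (widen_ord (leqnSn k) i) - a (widen_ord (leqnSn k) i)).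
  apply: eq_bigr => i _; suff -> : lift ord_max i = widen_ord (leqnSn k) i by [].
  by apply/val_inj; rewrite /= /fintype.bump leqNgt ltn_ord.
case: ltP => h; first by rewrite -EFinD -EFinM.
rewrite mule0 (_ : b ord_max - a ord_max = 0) ?mulr0//; have := ab ord_max.
by lra.
Qed.

Lemma int_small_box (D : set 'rV[R]_n) (f : 'rV[R]_n -> R) (t V : R) : 0 < t -> 0 <= V ->
  measurable D -> measurable_fun setT f -> (forall x, 0 <= f x <= V) ->
  (forall (x : 'rV[R]_n) i, t <= `|x ord0 i| -> f x = 0) ->
  \int[leb R n]_(x in D) f x <= V * (2 * t) ^+ n.
Proof.
move=> t0 V0 mD mf fV f0.
pose Q := box (fun _ : 'I_n => - t) (fun=> t).
have mQ : measurable Q by exact: measurable_box.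
have fQ : (f \_ D) = (f \_ D) \_ Q.
  apply/funext => x; rewrite [RHS]patchE; case: ifPn => // /negP xQ.
  rewrite patchE; case: ifP => // _.
  have [i xi] : exists i, t <= `|x ord0 i|.
    apply/not_existsP => h; apply: xQ; apply/mem_set => i; rewrite -ltr_norml ltNge.
    by apply/negP; exact: h.
  exact: f0 xi.
have Qfin : (leb R n Q < +oo)%E by exact: leb_box_fin.
have fD01 x : 0 <= (f \_ D) x <= V.
  by rewrite patchE; case: ifP => _; rewrite ?fV// lexx V0.
rewrite Rintegral_mkcond fQ -Rintegral_mkcond.
apply: (@le_trans _ _ (\int[leb R n]_(x in Q) V)).
  apply: le_Rintegral => //.
  - apply: (bounded_integrable (M := V)) => //.
      by apply: measurable_funTS; apply/(measurable_restrictT f mD); exact: measurable_funTS.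
    by move=> x _; have /andP[h1 h2] := fD01 x; rewrite ger0_norm.
  - by apply: (bounded_integrable (M := V)) => // x _; rewrite ger0_norm.
  - by move=> x _; case/andP: (fD01 x).
rewrite Rintegral_cst// (_ : fine _ = (2 * t) ^+ n)//.
have tt i : (fun _ : 'I_n => - t) i <= (fun=> t) i by lra.
rewrite [X in fine X](leb_box tt) /= prodr_const card_ord opprK.
by rewrite mulr_natl mulr2n.
Qed.

End Cutoff.

Lemma error_split (R : comNzRingType) (r tP c1 c2 h g : R) :
  r * (tP - (c1 - c2)) - h = (r * g - h + (r * tP - r * g)) + (r * c2 - r * c1).
Proof. by ring. Qed.

Lemma unit_sub (R : realDomainType) (s t : R) : 0 <= s <= 1 -> 0 <= t <= 1 -> `|s - t| <= 1.
Proof. by move=> /andP[? ?] /andP[? ?]; rewrite ler_norml; apply/andP; split; lra. Qed.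

(** Accuracy of the cosine approximation on a box where [|x| <= K]: the first bound survives
    multiplication by [|x|], the second is the requirement of [weighted_approx]. *)
Lemma choose_eps (R : realFieldType) (dl K r0 : R) : 0 < dl -> 0 <= K -> 0 < r0 ->
  exists eps : R, [/\ 0 < eps, K * eps <= dl & 4 * (r0 ^+ 2 + K ^+ 2) * eps ^+ 2 <= 1].
Proof.
move=> dl0 K0 r00; pose eps := Num.min dl 1 / (K + 2 * (r0 + K) + 1).
have D0 : 0 < K + 2 * (r0 + K) + 1 by lra.
have mn0 : 0 < Num.min dl 1 by rewrite lt_min dl0 ltr01.
have mn1 : Num.min dl 1 <= dl by rewrite ge_min lexx.
have mn2 : Num.min dl 1 <= 1 by rewrite ge_min lexx orbT.
have eps0 : 0 < eps by rewrite divr_gt0.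
have epsE : eps * (K + 2 * (r0 + K) + 1) = Num.min dl 1 by rewrite divfK ?gt_eqF.
exists eps; split => //.
  apply: le_trans mn1; rewrite -epsE mulrC ler_wpM2l ?(ltW eps0)//; lra.
have s1 : 2 * (r0 + K) * eps <= 1.
  apply: le_trans mn2; rewrite -epsE mulrC ler_wpM2l ?(ltW eps0)//; lra.
apply: (@le_trans _ _ ((2 * (r0 + K) * eps) ^+ 2)); last first.
  rewrite expr_le1//; apply: mulr_ge0; [lra|exact: ltW].
have rk0 : 0 <= r0 * K by rewrite mulr_ge0 ?(ltW r00).
have -> : (2 * (r0 + K) * eps) ^+ 2 = 4 * (r0 ^+ 2 + K ^+ 2) * eps ^+ 2 + 8 * (r0 * K) * eps ^+ 2 by ring.
by rewrite lerDl mulr_ge0 ?sqr_ge0// mulr_ge0.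
Qed.

Lemma choose_radius (R : realFieldType) (dl M v : R) : 0 < dl -> 0 < M -> 0 <= v ->
  exists r : R, [/\ 1 <= r, M <= r & v <= r ^+ 2 * dl ^+ 2].
Proof.
move=> dl0 M0 v0; have dl20 : 0 < dl ^+ 2 by rewrite exprn_gt0.
have w0 : 0 <= v / dl ^+ 2 by rewrite divr_ge0 ?(ltW dl20).
exists (1 + M + v / dl ^+ 2); split; [lra|lra|].
rewrite -ler_pdivrMr//; apply: (@le_trans _ _ (1 + M + v / dl ^+ 2)); first by lra.
by rewrite expr2 ler_peMr//; lra.
Qed.

(** Radius of the inner cutoff. [216 = 6^3] comes from the volume [(6 tau)^3] against a commutator
    of size [tau^-2]; the last bound keeps the cut-out region away from the annulus carrying the
    data. *)
Lemma choose_tau (R : realFieldType) (dl Z M N : R) : 0 < dl -> 0 <= Z -> 0 < M -> 0 <= N ->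
  exists tau : R, [/\ 0 < tau, [/\ tau <= 1, 2 * tau < 2 & 6 * tau <= 1], 216 * Z * tau <= dl ^+ 2 & 2 * N * tau < M^-1].
Proof.
move=> dl0 Z0 M0 N0; have dl20 : 0 < dl ^+ 2 by rewrite exprn_gt0.
pose z := 216 * Z / dl ^+ 2; have z0 : 0 <= z by exact: divr_ge0 (mulr_ge0 (ler0n _ _) Z0) (ltW dl20).
pose y := 2 * N * M; have y0 : 0 <= y by rewrite mulr_ge0 ?(ltW M0)// mulr_ge0.
have D0 : 0 < 6 + z + y + 1 by lra.
pose tau := (6 + z + y + 1)^-1; have tau0 : 0 < tau by rewrite invr_gt0.
have tauE : tau * (6 + z + y + 1) = 1 by rewrite mulVf ?gt_eqF.
have zt : 0 <= tau * z by rewrite mulr_ge0// ltW.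
have yt : 0 <= tau * y by rewrite mulr_ge0// ltW.
exists tau; split => //; first by split; lra.
  have -> : 216 * Z * tau = (tau * z) * dl ^+ 2 by rewrite /z; field; rewrite gt_eqF.
  by rewrite ler_piMl ?(ltW dl20)//; lra.
rewrite -(ltr_pM2r M0) mulVf ?gt_eqF// (_ : 2 * N * tau * M = tau * y); first by lra.
by rewrite /y; ring.
Qed.

(** * Density of the range of the Neumann problem *)

Section NeumannDense.
Variables (R : realType) (d : nat).
Hypothesis d2 : (2 <= d)%N.
Local Notation n := d.+1.
Local Notation Om := (half_space R d).
Local Notation mu := (leb R d.+1).
Let mO : measurable Om := @measurable_half R d.

Definition adm (w : 'rV[R]_d.+1 -> R) := [/\ nice w, vz w, bsupp w &
  forall x : 'rV[R]_d.+1, x ord0 ord_max = 0 -> pd ord_max w x = 0].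

Lemma int_subset (Q D : set 'rV[R]_d.+1) (f : 'rV[R]_d.+1 -> R) : measurable Q -> measurable D ->
  Q `<=` D -> mu.-integrable D (EFin \o f) -> (forall x, D x -> 0 <= f x) ->
  \int[mu]_(x in Q) f x <= \int[mu]_(x in D) f x.
Proof.
move=> mQ mD QD iF f0; rewrite Rintegral_mkcond [leRHS]Rintegral_mkcond.
apply: le_Rintegral => //.
- have -> : EFin \o (f \_ Q) = (EFin \o f) \_ Q.
    by apply/funext => x /=; rewrite !patchE; case: ifP.
  apply/integrable_restrict => //; rewrite setTI; exact: integrableS iF.
- have -> : EFin \o (f \_ D) = (EFin \o f) \_ D.
    by apply/funext => x /=; rewrite !patchE; case: ifP.
  by apply/integrable_restrict => //; rewrite setTI.
move=> x _; rewrite !patchE; case: ifPn => [/set_mem/QD/mem_set -> //|_].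
by case: ifPn => // /set_mem; exact: f0.
Qed.

Lemma nrm_box (f : 'rV[R]_d.+1 -> R) M :
  (forall (x : 'rV[R]_d.+1) (i : 'I_d.+1), M < `|x ord0 i| -> f x = 0) ->
  nrm mu Om f = nrm mu (box (bigbox M d).1 (bigbox M d).2) f.
Proof.
move=> f0; rewrite /nrm; congr Num.sqrt.
rewrite Rintegral_mkcond [RHS]Rintegral_mkcond (@half_boxE _ _ _ M)// => x i xi.
by rewrite (f0 x i)// expr0n.
Qed.

Lemma bigbox_half M : box (bigbox M d).1 (bigbox M d).2 `<=` Om.
Proof. by move=> x /(_ ord_max); rewrite /bigbox/= eqxx => /andP[]. Qed.

Lemma enorm_bigbox M (x : 'rV[R]_d.+1) : box (bigbox M d).1 (bigbox M d).2 x ->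
  enorm x <= n%:R * (`|M| + 1).
Proof.
move=> Qx; apply: enorm_le => [|i]; first by rewrite addr_ge0.
have /andP[h1 h2] := Qx i; rewrite ler_norml; apply/andP; split; last exact: ltW.
move: h1; rewrite /bigbox/=; case: (i == ord_max) => h1; last exact: ltW.
by rewrite (le_trans _ (ltW h1))// oppr_le0 addr_ge0.
Qed.

Lemma bigbox_lt (M : R) (i : 'I_d.+1) : (bigbox M d).1 i < (bigbox M d).2 i.
Proof.
have h := normr_ge0 M; rewrite /bigbox/=; case: (i == ord_max); lra.
Qed.

(** [H] is the target for [r] times the residual. Restricting [H / r] to an annulus gives a
    square-integrable target [G] for the residual itself, supported away from the origin and from
    infinity. *)
Lemma truncate (H : 'rV[R]_d.+1 -> R) (e : R) : L2 mu Om H -> 0 < e ->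
  exists M G, [/\ 1 <= M, measurable_fun setT G,
    nrm mu Om (fun x => enorm x * G x - H x) <= e,
    (forall x, G x != 0 -> M^-1 <= enorm x <= M) &
    (forall x, Om x -> `|G x| <= M * `|H x|) /\ (forall x, Om x -> `|enorm x * G x| <= `|H x|)].
Proof.
move=> LH e0; have [mH _] := LH.
have me : measurable_fun setT (@enorm R n).
  by apply: continuous_measurable_rV; exact: enorm_cont.
pose A m := [set x : 'rV[R]_n | (m.+1%:R)^-1 <= enorm x] `&` [set x : 'rV[R]_n | enorm x <= m.+1%:R].
have mA m : measurable (A m).
  apply: measurableI; rewrite -[X in measurable X]setTI.
    exact: (measurable_fun_le measurableT (measurable_cst ((m.+1%:R)^-1 : R)) me).
  exact: (measurable_fun_le measurableT me (measurable_cst (m.+1%:R : R))).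
have x0 (x : 'rV[R]_n) : Om x -> 0 < enorm x.
  move=> Ox; apply: enorm_gt0; apply/eqP => x0; move: Ox.
  by rewrite /half_space/= x0 mxE ltxx.
have e2 : 0 < e ^+ 2 by rewrite exprn_gt0.
have [|m hm] := @L2_tail _ _ _ mu Om mO H A LH mA _ _ e2.
  move=> x Ox; have ex := x0 x Ox.
  exists (maxn (Num.trunc (enorm x)) (Num.trunc (enorm x)^-1)) => // m /=.
  rewrite geq_max => /andP[h1 h2]; split => /=.
    rewrite -[leRHS]invrK lef_pV2 ?posrE ?invr_gt0// ltW//.
    have /truncn_itv/andP[_ h] : 0 <= (enorm x)^-1 by rewrite invr_ge0 ltW.
    by rewrite (lt_le_trans h)// ler_nat ltnS.
  rewrite ltW//; have /truncn_itv/andP[_ h] := ltW ex.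
  by rewrite (lt_le_trans h)// ler_nat ltnS.
have M1 : 1 <= (m.+1%:R : R) by rewrite ler1n.
pose G x := \1_(A m) x * (invr x * (H \_ Om) x).
have GE x : Om x -> enorm x * G x = \1_(A m) x * H x.
  move=> Ox; rewrite /G patchE (mem_set Ox) mulrCA; congr (_ * _).
  by rewrite mulrA divff ?mul1r// gt_eqF// x0.
have ind x : 0 <= (\1_(A m) x : R) <= 1 by rewrite indicE ler0n lern1 leq_b1.
exists m.+1%:R, G; split => //.
- apply: measurable_funM; first exact: measurable_indic.
  apply: measurable_funM; last by apply/(measurable_restrictT H mO).
  have -> : @invr R n = (fun x => enorm x `^ (-1)).
    by apply/funext => x; rewrite powR_inv1 ?enorm_ge0.
  exact: (@measurableT_comp _ _ _ _ _ _ (fun y : R => y `^ (-1)) _ _ (measurable_powR (-1)) me).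
- rewrite -(@ler_pXn2r _ 2)// ?nnegrE ?nrm_ge0 ?(ltW e0)// nrm_sq ltW//.
  apply: le_lt_trans hm; rewrite le_eqVlt; apply/orP; left; apply/eqP.
  by apply: eq_Rintegral => x /set_mem Ox; rewrite GE// -sqrrN opprB.
- move=> x; rewrite /G indicE; case: (boolP (x \in A m)) => [/set_mem[h1 h2] _|_].
    by rewrite h1.
  by rewrite mul0r eqxx.
split=> x Ox; last first.
  by rewrite GE// normrM; have /andP[h1 h2] := ind x; rewrite ger0_norm// ler_piMl.
rewrite /G patchE (mem_set Ox) indicE; case: (boolP (x \in A m)) => [/set_mem[h1 h2]|_]; last first.
  by rewrite mul0r normr0 mulr_ge0.
rewrite mul1r normrM ler_wpM2r// ger0_norm ?invr_ge0'// /invr -[leRHS]invrK lef_pV2 ?posrE//.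
  exact: x0.
Qed.

Lemma adm_Zc w : adm w -> Zc w.
Proof. by case=> nw vw sw _; exact: nice_Zc. Qed.

Variables (m e : R).
Hypothesis e0 : e != 0.

Let cX2 (f : 'rV[R]_n -> R) : continuous f -> continuous (fun x : 'rV[R]_n => f x ^+ 2 : R).
Proof. by move=> cf; under eq_fun do rewrite expr2; exact: contM. Qed.

Let rho_cont' r0 : continuous (@rho R n r0). Proof. exact: rho_cont. Qed.

Let rho_ge0 r0 (x : 'rV[R]_n) : 0 <= rho r0 x.
Proof. by rewrite addr_ge0 ?sqr_ge0// sumr_ge0// => i _; exact: sqr_ge0. Qed.

Let rhoE r0 (x : 'rV[R]_n) : rho r0 x = r0 ^+ 2 + enorm x ^+ 2.
Proof. by rewrite /rho enorm_sq. Qed.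

Let cut_cont (chi A : 'rV[R]_n -> R) : nice chi -> nice A -> continuous (cut chi A).
Proof.
move=> nc nA; have h i := nice_cont (nice_pd i nc); have k i := nice_cont (nice_pd i nA).
have l : continuous (fun x => lap chi x).
  by apply: cont_sum => i; exact: (nice_cont (nice_pd i (nice_pd i nc))).
apply: contD; last by apply: contM => //; exact: nice_cont.
by apply: contM; [exact: cst_continuous|apply: cont_sum => i; exact: contM].
Qed.

Section Box.
Variables (M : R).
Let a := (bigbox M d).1.
Let b := (bigbox M d).2.
Local Notation Q := (box a b).
Let ab i : a i < b i := bigbox_lt M i.
Let mQ : measurable Q := measurable_box a b.
Let K : R := n%:R * (`|M| + 1).

(* [K] is independent of the approximation, so the weight costs only a constant. *)
Lemma weighted_approx (G P : 'rV[R]_n -> R) (r0 g eps : R) : L2 mu Q G -> continuous P ->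
  nrm mu Q (fun x => G x - P x) <= eps -> 4 * (r0 ^+ 2 + K ^+ 2) * eps ^+ 2 <= 1 ->
  mu.-integrable Q (EFin \o (fun x => rho r0 x * G x ^+ 2)) ->
  \int[mu]_(x in Q) (rho r0 x * G x ^+ 2) <= g ->
  \int[mu]_(x in Q) (rho r0 x * P x ^+ 2) <= 2 * g + 1 / 2.
Proof.
move=> LG cP hP he iG hG.
have LP := cont_box_L2 a b cP.
have LGP := L2B mQ LG LP.
pose k := r0 ^+ 2 + K ^+ 2.
have k0 : 0 <= k by rewrite addr_ge0 ?sqr_ge0.
have eps0 : 0 <= eps by apply: le_trans hP; exact: nrm_ge0.
apply: (@le_trans _ _ (\int[mu]_(x in Q) (2 * (rho r0 x * G x ^+ 2) + (2 * k) * (G x - P x) ^+ 2))).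
  apply: le_Rintegral => //.
  - by apply: box_int; apply: contM => //; exact: cX2.
  - apply: integrableDR => //; first exact: integrableZR.
    by apply: integrableZR => //; exact: L2_sq.
  move=> x Qx; have rk : rho r0 x <= k.
    rewrite rhoE lerD2l -/(_ ^+ 2) lerXn2r ?nnegrE ?enorm_ge0//.
      by rewrite mulr_ge0// addr_ge0.
    exact: enorm_bigbox.
  have h1 : rho r0 x * (G x - P x) ^+ 2 <= k * (G x - P x) ^+ 2 by rewrite ler_wpM2r ?sqr_ge0.
  have h2 : rho r0 x * P x ^+ 2 <= rho r0 x * (2 * G x ^+ 2 + 2 * (G x - P x) ^+ 2).
    rewrite ler_wpM2l//; have := sqr_ge0 (2 * G x - P x).
    by move: (G x) (P x) => g' p' *; nra.
  by apply: (le_trans h2); rewrite mulrDr; move: h1; lra.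
rewrite RintegralD//; [|exact: integrableZR|by apply: integrableZR => //; exact: L2_sq].
rewrite !RintegralZl//; last exact: L2_sq.
rewrite -nrm_sq; have : nrm mu Q (fun x => G x - P x) ^+ 2 <= eps ^+ 2.
  by rewrite lerXn2r ?nnegrE ?nrm_ge0.
move: (nrm _ _ _ ^+ 2) (eps ^+ 2) he => N2 E2 he hN.
have : k * N2 <= k * E2 by rewrite ler_wpM2l.
by rewrite -/k in he; lra.
Qed.

End Box.

Lemma cut_sub (chi psi D : 'rV[R]_n -> R) x : nice chi -> nice psi ->
  cut (fun x => chi x - psi x) D x = cut chi D x - cut psi D x.
Proof.
move=> nchi npsi; rewrite /cut /lap.
have E i := has_pdE (has_pdB (nice_has i nchi) (nice_has i npsi)).
have E2 i := has_pdE (has_pdB (nice_has i (nice_pd i nchi)) (nice_has i (nice_pd i npsi))).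
under eq_bigr do rewrite E mulrBl.
under [X in _ + _ * X = _]eq_bigr do rewrite E E2.
by rewrite !sumrB !mulrBr opprD addrACA.
Qed.

(** The order of the choices is essential. The weighted energy bound [C * p0] does not depend on the
    box, so the outer radius is fixed first; then the box, the cosine approximation and its exact
    solution; the inner radius comes last, because it depends on the size of that solution near the
    origin. *)
Lemma neumann_dense (H1 H2 : 'rV[R]_n -> R) (delta : R) : L2 mu Om H1 -> L2 mu Om H2 -> 0 < delta ->
  exists u v, [/\ adm u, adm v,
    nrm mu Om (fun x => enorm x * res1 m e u v x - H1 x) <= delta &
    nrm mu Om (fun x => enorm x * res2 m e u v x - H2 x) <= delta].
Proof.
move=> LH1 LH2 delta0; pose dl := delta / 4; have dl0 : 0 < dl by rewrite divr_gt0.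
have [M1 [G1 [M11 mG1 hG1 sG1 [bG1 cG1]]]] := truncate LH1 dl0.
have [M2 [G2 [M21 mG2 hG2 sG2 [bG2 cG2]]]] := truncate LH2 dl0.
have [r0 [C [r00 C0 hE]]] := @box_energy R n m e e0.
have [Cc Cc0 hcut] := cutoff R n.
pose M := M1 + M2; have M_1 : M1 <= M by rewrite lerDl; lra.
have M_2 : M2 <= M by rewrite lerDr; lra.
have M0 : 0 < M by rewrite /M; lra.
pose h1 := \int[mu]_(x in Om) (H1 x ^+ 2); pose h2 := \int[mu]_(x in Om) (H2 x ^+ 2).
pose g1 := (r0 ^+ 2 + M ^+ 2) * M ^+ 2 * h1; pose g2 := (r0 ^+ 2 + M ^+ 2) * M ^+ 2 * h2.
(* The sum of the two bounds [2 g + 1 / 2] of [weighted_approx]. *)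
pose p0 := 2 * g1 + 2 * g2 + 1.
have h10 : 0 <= h1 by apply: Rintegral_ge0 => x _; exact: sqr_ge0.
have h20 : 0 <= h2 by apply: Rintegral_ge0 => x _; exact: sqr_ge0.
have kM : 0 <= (r0 ^+ 2 + M ^+ 2) * M ^+ 2 by rewrite mulr_ge0 ?addr_ge0 ?sqr_ge0.
have g10 : 0 <= g1 by exact: mulr_ge0.
have g20 : 0 <= g2 by exact: mulr_ge0.
have p00 : 0 <= p0 by rewrite /p0; lra.
pose N8 : R := 8 * n%:R + 2; have N80 : 0 <= N8 by rewrite addr_ge0 ?mulr_ge0.
have v00 : 0 <= Cc ^+ 2 * N8 * (C * p0) by apply: mulr_ge0; apply: mulr_ge0; rewrite ?sqr_ge0.
(* [rrv] makes the commutator of the outer cutoff at most [dl]: its derivatives are of size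
   [1 / rr], against the weighted energy [C * p0]. *)
have [rr [rr1 rrM rrv]] := choose_radius dl0 M0 v00.
have rr0 : 0 < rr by apply: lt_le_trans rr1.
have [chi [nchi chi1 chi01 chiout [pchi lchi zchi]]] := hcut rr rr0.
pose M2r := 2 * rr.
pose a := (bigbox M2r d).1; pose b := (bigbox M2r d).2.
have ab i : a i < b i by exact: bigbox_lt.
have mQ : measurable (box a b) by exact: measurable_box.
have QO : box a b `<=` Om by exact: bigbox_half.
pose K : R := n%:R * (`|M2r| + 1).
have K0 : 0 <= K by rewrite mulr_ge0// addr_ge0.
have rK (x : 'rV[R]_n) : box a b x -> enorm x <= K by exact: enorm_bigbox.
have [eps [eps0 epsK eps4]] := choose_eps dl0 K0 r00.
have LG (H G : 'rV[R]_n -> R) (Mi : R) : L2 mu Om H -> measurable_fun setT G -> Mi <= M ->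
    1 <= Mi -> (forall x, Om x -> `|G x| <= Mi * `|H x|) -> L2 mu Om G.
  move=> LH mG MiM Mi1 bG; apply: (@L2_le _ _ _ mu Om mO _ (fun x => Mi * H x)) => //.
  - exact: measurable_funTS.
  - move=> x Ox; rewrite normrM (@ger0_norm _ Mi) ?bG//; exact: le_trans Mi1.
  - exact: L2Z.
have L2S (f : 'rV[R]_n -> R) : L2 mu Om f -> L2 mu (box a b) f.
  move=> [mf iF]; split; first by apply: measurable_funS mf.
  exact: integrableS iF.
have wG (H G : 'rV[R]_n -> R) (Mi : R) : L2 mu Om H -> measurable_fun setT G -> Mi <= M ->
    1 <= Mi -> (forall x, Om x -> `|G x| <= Mi * `|H x|) -> (forall x, G x != 0 -> Mi^-1 <= enorm x <= Mi) ->
    mu.-integrable (box a b) (EFin \o (fun x => rho r0 x * G x ^+ 2)) /\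
    \int[mu]_(x in box a b) (rho r0 x * G x ^+ 2) <=
      (r0 ^+ 2 + M ^+ 2) * M ^+ 2 * \int[mu]_(x in Om) (H x ^+ 2).
  move=> LH mG MiM Mi1 bG sG.
  have pt x : Om x -> rho r0 x * G x ^+ 2 <= (r0 ^+ 2 + M ^+ 2) * M ^+ 2 * H x ^+ 2.
    move=> Ox; have [->|Gx] := eqVneq (G x) 0.
      by rewrite expr0n mulr0 mulr_ge0 ?sqr_ge0.
    have /andP[_ xM] := sG x Gx; rewrite -mulrA; apply: ler_pM => //; rewrite ?sqr_ge0//.
      rewrite rhoE lerD2l lerXn2r ?nnegrE ?enorm_ge0 ?(ltW M0)//.
      by rewrite (le_trans xM).
    rewrite -exprMn -[leLHS]real_normK ?num_real// -[leRHS]real_normK ?num_real//.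
    rewrite lerXn2r ?nnegrE// normrM (gtr0_norm M0) (le_trans (bG x Ox))// ler_wpM2r//.
  have iH : mu.-integrable Om (EFin \o (fun x => (r0 ^+ 2 + M ^+ 2) * M ^+ 2 * H x ^+ 2)).
    by apply: integrableZR => //; exact: L2_sq.
  have iG : mu.-integrable Om (EFin \o (fun x => rho r0 x * G x ^+ 2)).
    apply: (@le_integrableR _ _ _ mu Om mO _ (fun x => (r0 ^+ 2 + M ^+ 2) * M ^+ 2 * H x ^+ 2)) => //.
      apply: measurable_funTS; apply: measurable_funM; last exact: measurable_funX.
      exact: continuous_measurable_rV.
    by move=> x Ox; rewrite ger0_norm ?pt// mulr_ge0 ?sqr_ge0.
  split; first exact: integrableS iG.
  apply: le_trans (int_subset mQ mO QO iG _) _ => [x _|]; first by rewrite mulr_ge0 ?sqr_ge0.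
  rewrite -RintegralZl//; last exact: L2_sq.
  exact: le_Rintegral.
have LG1 : L2 mu Om G1 by exact: LG bG1.
have LG2 : L2 mu Om G2 by exact: LG bG2.
have [P1 SP1 aP1] := cos_dense ab (L2S _ LG1) eps0.
have [P2 SP2 aP2] := cos_dense ab (L2S _ LG2) eps0.
have [A [B [SA SB rA rB]]] := solve_Sp m e0 SP1 SP2.
have NA := Neu_Sp ab SA; have NB := Neu_Sp ab SB.
have nA := NA.1; have nB := NB.1.
have cP1 := nice_cont (nice_Sp SP1); have cP2 := nice_cont (nice_Sp SP2).
have [iw1 w1] := wG _ _ _ LH1 mG1 M_1 M11 bG1 sG1.
have [iw2 w2] := wG _ _ _ LH2 mG2 M_2 M21 bG2 sG2.
have q1 := weighted_approx (L2S _ LG1) cP1 aP1 eps4 iw1 w1.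
have q2 := weighted_approx (L2S _ LG2) cP2 aP2 eps4 iw2 w2.
pose WG x := A x ^+ 2 + B x ^+ 2 + \sum_i (pd i A x ^+ 2 + pd i B x ^+ 2).
have cWG : continuous WG.
  apply: contD; first by apply: contD; apply: cX2; exact: nice_cont.
  by apply: cont_sum => i; apply: contD; apply: cX2; apply: nice_cont; exact: nice_pd.
have energy : \int[mu]_(x in box a b) (rho r0 x * WG x) <= C * p0.
  apply: le_trans (hE a b ab A B NA NB) _; rewrite ler_wpM2l//.
  rewrite (_ : \int[mu]_(x in box a b) _ = \int[mu]_(x in box a b) (rho r0 x * P1 x ^+ 2) +
     \int[mu]_(x in box a b) (rho r0 x * P2 x ^+ 2)).
    by move: q1 q2; rewrite /p0 -/g1 -/g2; clear; lra.
  rewrite -RintegralD//; last 2 first.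
  - by apply: box_int; apply: contM => //; exact: cX2.
  - by apply: box_int; apply: contM => //; exact: cX2.
  by apply: eq_Rintegral => x _; rewrite rA rB mulrDr.
have WG_A x : A x ^+ 2 + \sum_i pd i A x ^+ 2 <= WG x.
  by rewrite /WG big_split/= addrACA lerDl addr_ge0 ?sqr_ge0// sumr_ge0// => i _; exact: sqr_ge0.
have WG_B x : B x ^+ 2 + \sum_i pd i B x ^+ 2 <= WG x.
  rewrite /WG big_split/= addrACA lerDr addr_ge0 ?sqr_ge0// sumr_ge0// => i _; exact: sqr_ge0.
(* A bound for the solution and its gradient in a fixed neighbourhood of the origin, before [tau] is
   chosen. *)
have [V hV] := cont_bounded_box (fun _ : 'I_n => - 2) (fun=> 2) cWG.
pose V1 := `|V|.
pose Z0 := 4 * n%:R ^+ 2 * Cc ^+ 2 * N8 * V1.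
have Z00 : 0 <= Z0.
  exact: (mulr_ge0 (mulr_ge0 (mulr_ge0 (mulr_ge0 (ler0n R 4) (sqr_ge0 _)) (sqr_ge0 _)) N80) (normr_ge0 V)).
have [tau [tau0 [tau_1 tau_2 tau6] tauZ tauM]] := choose_tau dl0 Z00 M0 (ler0n R n).
have [psi [npsi psi1 psi01 psiout [ppsi lpsi zpsi]]] := hcut tau tau0.
pose th x := chi x - psi x.
have nth' : nice th by exact: niceB.
have taurr : tau <= rr by exact: le_trans rr1.
have th_out (x : 'rV[R]_n) j : 2 * rr < `|x ord0 j| -> th x = 0.
  move=> xj; have [c0 _ _] := chiout x j xj.
  have [|p0' _ _] := psiout x j; first by apply: le_lt_trans xj; rewrite ler_pM2l.
  by rewrite /th c0 p0' subrr.
(* The combined cutoff equals 1 on the annulus carrying [G], so it changes the approximant [P] but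
   not its target. *)
have th_G (G : 'rV[R]_n -> R) (Mi : R) x : Mi <= M -> 1 <= Mi ->
    (forall x, G x != 0 -> Mi^-1 <= enorm x <= Mi) -> th x * G x = G x.
  move=> MiM Mi1 sG; have [->|Gx] := eqVneq (G x) 0; first by rewrite mulr0.
  have /andP[x1 x2] := sG x Gx.
  have c1 : chi x = 1.
    by apply: chi1 => i; rewrite (le_trans (coord_le_enorm x i))// (le_trans x2)// (le_trans MiM).
  have [i xi] : exists i, 2 * tau < `|x ord0 i|.
    apply/not_existsP => h.
    have : enorm x <= n%:R * (2 * tau).
      by apply: enorm_le => [|i]; [rewrite mulr_ge0// ltW|rewrite leNgt; apply/negP; exact: h].
    apply/negP; rewrite -ltNge; apply: lt_le_trans x1.
    rewrite mulrA (mulrC n%:R); apply: (lt_le_trans tauM).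
    by rewrite lef_pV2 ?posrE//; exact: lt_le_trans Mi1.
  by have [p0' _ _] := psiout x i xi; rewrite /th c1 p0' subr0 mul1r.
have adm_th D : Neu a b D -> adm (fun x => th x * D x).
  move=> [nD zD]; split.
  - exact: niceM.
  - exists tau => // x xt; rewrite /th chi1 ?psi1 ?subrr ?mul0r// => i; first exact: ltW.
    by rewrite (le_trans (ltW (xt i))).
  - by exists (2 * rr) => x i xi; rewrite (th_out x i)// mul0r.
  - move=> x xm; rewrite (has_pdE (has_pdM (nice_has ord_max nth') (nice_has ord_max nD))).
    rewrite (has_pdE (has_pdB (nice_has ord_max nchi) (nice_has ord_max npsi))).
    by rewrite zchi// zpsi// zD ?subrr ?mul0r ?mulr0 ?addr0//; left; rewrite xm /a /bigbox/= eqxx.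
have cutB D x : cut th D x = cut chi D x - cut psi D x by exact: cut_sub.
have cutR D : nice D -> (forall x, D x ^+ 2 + \sum_i pd i D x ^+ 2 <= WG x) ->
    nrm mu Om (fun x => enorm x * cut chi D x) <= dl.
  move=> nD hD; rewrite (@nrm_box _ M2r); last first.
    move=> x i xi; have [_ h3 h4] := chiout x i xi.
    by rewrite /cut h4 big1 ?mulr0 ?addr0 ?mulr0// => j _; rewrite h3 mul0r.
  rewrite -(@ler_pXn2r _ 2)// ?nnegrE ?nrm_ge0 ?(ltW dl0)// nrm_sq.
  apply: (@le_trans _ _ (\int[mu]_(x in box a b) ((Cc / rr) ^+ 2 * N8 * (rho r0 x * WG x)))).
    apply: le_Rintegral => //.
    - by apply: box_int; apply: cX2; apply: contM; [exact: enorm_cont|exact: cut_cont].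
    - by apply: box_int; apply: contM; [exact: cst_continuous|exact: contM].
    move=> x _; rewrite exprMn [leRHS]mulrCA; apply: ler_pM; rewrite ?sqr_ge0//.
      by rewrite rhoE lerDr sqr_ge0.
    apply: le_trans (@cut_le _ _ chi D x (Cc / rr) _ _ _) _.
    - by rewrite divr_ge0// ltW.
    - by move=> i; exact: pchi.
    - apply: (le_trans (lchi x)); rewrite ler_wpM2l// lef_pV2 ?posrE ?exprn_gt0//.
      by rewrite expr2 ler_peMr// ltW.
    by rewrite ler_wpM2l// mulr_ge0 ?sqr_ge0.
  rewrite RintegralZl//; last by apply: box_int; exact: contM.
  apply: (@le_trans _ _ ((Cc / rr) ^+ 2 * N8 * (C * p0))).
    by rewrite ler_wpM2l// mulr_ge0 ?sqr_ge0.
  have -> : (Cc / rr) ^+ 2 * N8 * (C * p0) = Cc ^+ 2 * N8 * (C * p0) / rr ^+ 2 by field; rewrite gt_eqF.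
  by rewrite ler_pdivrMr ?exprn_gt0// [leRHS]mulrC.
have cutT D : nice D -> (forall x, D x ^+ 2 + \sum_i pd i D x ^+ 2 <= WG x) ->
    nrm mu Om (fun x => enorm x * cut psi D x) <= dl.
  move=> nD hD; rewrite -(@ler_pXn2r _ 2)// ?nnegrE ?nrm_ge0 ?(ltW dl0)// nrm_sq.
  have tau20 : 0 < tau ^+ 2 by rewrite exprn_gt0.
  have psi0 (x : 'rV[R]_n) i : 2 * tau < `|x ord0 i| -> cut psi D x = 0.
    move=> xi; have [_ h3 h4] := psiout x i xi.
    by rewrite /cut h4 big1 ?mulr0 ?addr0 ?mulr0// => j _; rewrite h3 mul0r.
  apply: le_trans (@int_small_box _ _ Om _ (3 * tau) (Z0 / tau ^+ 2) _ _ mO _ _ _) _.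
  - by rewrite mulr_gt0.
  - by rewrite divr_ge0 ?(ltW tau20).
  - by apply: continuous_measurable_rV; apply: cX2; apply: contM; [exact: enorm_cont|exact: cut_cont].
  - move=> x; rewrite sqr_ge0/=.
    have [h|/existsNP[i /negP]] := pselect (forall i, `|x ord0 i| <= 2 * tau); last first.
      rewrite -ltNge => xi; rewrite (psi0 x i xi) mulr0 expr0n/= divr_ge0//; exact: ltW.
    have hx : enorm x <= n%:R * (2 * tau) by apply: enorm_le => //; rewrite mulr_ge0// ltW.
    have hW : WG x <= V1.
      have : box (fun _ : 'I_n => - 2) (fun=> 2) x.
        by move=> i; rewrite -ltr_norml (le_lt_trans (h i)).
      by move=> /hV; rewrite /V1 => h'; rewrite (le_trans (ler_norm _))// (le_trans h')// ler_norm.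
    rewrite exprMn; apply: (@le_trans _ _ ((n%:R * (2 * tau)) ^+ 2 * ((Cc / tau ^+ 2) ^+ 2 * N8 * V1))).
      apply: ler_pM; rewrite ?sqr_ge0//.
        by rewrite lerXn2r ?nnegrE ?enorm_ge0// !mulr_ge0// ltW.
      apply: le_trans (@cut_le _ _ psi D x (Cc / tau ^+ 2) _ _ _) _.
      - by rewrite divr_ge0// ltW.
      - move=> i; apply: (le_trans (ppsi i x)); rewrite ler_wpM2l// lef_pV2 ?posrE//.
        by rewrite expr2 ler_piMr ?(ltW tau0).
      - exact: lpsi.
      exact: (ler_wpM2l (mulr_ge0 (sqr_ge0 _) N80) (le_trans (hD x) hW)).
    by rewrite le_eqVlt; apply/orP; left; apply/eqP; rewrite /Z0; field; rewrite gt_eqF.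
  - move=> x i xi; rewrite (psi0 x i) ?mulr0 ?expr0n//.
    by apply: lt_le_trans xi; rewrite ltr_pM2r// ltr_nat.
  (* As the dimension is at least 3 and [6 tau <= 1], the volume is at most [(6 tau)^3], which beats
     the factor [tau^-2] of the commutator. *)
  apply: le_trans tauZ; apply: (@le_trans _ _ (Z0 / tau ^+ 2 * (6 * tau) ^+ 3)).
    rewrite ler_wpM2l ?divr_ge0 ?(ltW tau20)// mulrA (_ : 2 * 3 = 6); last by rewrite -natrM.
    apply: ler_wiXn2l => //; first by rewrite mulr_ge0// ltW.
  by rewrite le_eqVlt; apply/orP; left; apply/eqP; field; rewrite gt_eqF.
have main (H G P D : 'rV[R]_n -> R) (Mi : R) (F : 'rV[R]_n -> R) : Mi <= M -> 1 <= Mi ->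
    L2 mu Om H -> measurable_fun setT G -> L2 mu Om G ->
    (forall x, G x != 0 -> Mi^-1 <= enorm x <= Mi) ->
    (forall x, Om x -> `|enorm x * G x| <= `|H x|) ->
    nrm mu Om (fun x => enorm x * G x - H x) <= dl ->
    continuous P -> nrm mu (box a b) (fun x => G x - P x) <= eps ->
    nice D -> (forall x, D x ^+ 2 + \sum_i pd i D x ^+ 2 <= WG x) ->
    (forall x, F x = th x * P x - cut th D x) ->
    nrm mu Om (fun x => enorm x * F x - H x) <= delta.
  move=> MiM Mi1 LH mG LGi sG cG hG cP hP nD hD hF.
  (* The four errors, each at most [dl = delta / 4]: truncation of the data, cosine approximation,
     and the commutators of the outer and of the inner cutoff. *)
  pose f1 x := enorm x * G x - H x.
  pose f2 x := enorm x * (th x * P x) - enorm x * G x.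
  pose f3 x := enorm x * cut chi D x; pose f4 x := enorm x * cut psi D x.
  have E : (fun x => enorm x * F x - H x) = (fun x => (f1 x + f2 x) + (f4 x - f3 x)).
    by apply/funext => x; rewrite hF cutB; exact: error_split.
  have ce := @enorm_cont R n; have cth := nice_cont nth'.
  have LrG : L2 mu Om (fun x => enorm x * G x).
    apply: (L2_le mO _ cG LH); apply: measurable_funTS; apply: measurable_funM => //.
    exact: continuous_measurable_rV.
  have L1 : L2 mu Om f1 by exact: L2B.
  have L2' : L2 mu Om f2.
    apply: L2B => //; apply: cc_L2 => //; first by apply: contM => //; exact: contM.
    by exists (2 * rr) => x i xi; rewrite (th_out x i)// mul0r mulr0.
  have L3 : L2 mu Om f3.
    apply: cc_L2 => //; first by apply: contM => //; exact: cut_cont.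
    exists (2 * rr) => x i xi; have [_ h3 h4] := chiout x i xi.
    by rewrite /f3 /cut h4 big1 ?mulr0 ?addr0 ?mulr0// => j _; rewrite h3 mul0r.
  have L4 : L2 mu Om f4.
    apply: cc_L2 => //; first by apply: contM => //; exact: cut_cont.
    exists (2 * tau) => x i xi; have [_ h3 h4] := psiout x i xi.
    by rewrite /f4 /cut h4 big1 ?mulr0 ?addr0 ?mulr0// => j _; rewrite h3 mul0r.
  rewrite E; apply: le_trans (nrmD mO (L2D mO L1 L2') (L2B mO L4 L3)) _.
  apply: le_trans (lerD (nrmD mO L1 L2') (nrmB mO L4 L3)) _.
  have n2 : nrm mu Om f2 <= dl.
    rewrite (@nrm_box _ M2r); last first.
      move=> x i xi; rewrite /f2 (th_out x i)// mul0r.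
      have -> : G x = 0; last by rewrite !mulr0 subr0.
      apply: contrapT => /eqP/sG/andP[_ xM]; move: xi; apply/negP; rewrite -leNgt.
      rewrite (le_trans (coord_le_enorm x i))// (le_trans xM)// (le_trans MiM)// (le_trans rrM)//.
      by rewrite /M2r ler_peMl ?ler1n// ltW.
    have LGP := L2B mQ (L2S _ LGi) (cont_box_L2 a b cP).
    apply: (@le_trans _ _ (nrm mu (box a b) (fun x => K * (G x - P x)))).
      apply: nrm_le => //; [exact: L2S|exact: L2Z|].
      move=> x Qx; rewrite /f2 -mulrBr -{1}(th_G G Mi x)// -mulrBr.
      have -> : `|K * (G x - P x)| = K * `|G x - P x| by rewrite normrM (ger0_norm K0).
      have -> : `|enorm x * (th x * (P x - G x))| = enorm x * `|th x| * `|G x - P x|.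
        by rewrite !normrM (ger0_norm (enorm_ge0 x)) mulrA (distrC (P x)).
      rewrite ler_wpM2r//.
      rewrite -[leRHS]mulr1 ler_pM ?enorm_ge0 ?rK//.
      exact: (unit_sub (chi01 x) (psi01 x)).
    rewrite nrmZ// (ger0_norm K0); apply: le_trans epsK; exact: ler_wpM2l.
  have -> : delta = (dl + dl) + (dl + dl).
    by rewrite -!mulr2n -mulrnA -mulr_natr /dl divfK.
  exact: (lerD (lerD hG n2) (lerD (cutT D nD hD) (cutR D nD hD))).
exists (fun x => th x * A x), (fun x => th x * B x); split; try exact: adm_th.
- apply: (main H1 G1 P1 A M1) => // x; rewrite res1_cut// rA//.
- apply: (main H2 G2 P2 B M2) => // x; rewrite res2_cut// rB//.
Qed.

End NeumannDense.

(** * Test functions from decaying modes *)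

Section Orthogonality.
Variables (R : realType) (n : nat) (a b : 'I_n -> R).
Hypothesis ab : forall i, a i < b i.
Local Notation mu := (leb R n).
Local Notation Q := (box a b).
Let mQ : measurable Q := measurable_box a b.
Implicit Types k l : {ffun 'I_n -> nat}.

Let ce (k : 'I_n -> nat) : continuous (ek a b k) := nice_cont (nice_ek a b k).

Definition Nk (k : 'I_n -> nat) : R := \int[mu]_(x in Q) (ek a b k x * ek a b k x).

Lemma Nk_ge0 k : 0 <= Nk k.
Proof. by apply: Rintegral_ge0 => x _; rewrite -expr2 sqr_ge0. Qed.

(** Sturm-Liouville argument: in a coordinate where the frequencies differ, the Wronskian [V]
    vanishes on the faces and its derivative is a nonzero multiple of the product of the two
    modes. *)
Lemma ek_orth k l : k != l -> \int[mu]_(x in Q) (ek a b k x * ek a b l x) = 0.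
Proof.
move=> kl; have [i ikl] : exists i, k i != l i.
  apply/existsP; move: kl; apply: contraNT; rewrite negb_exists => /forallP h.
  by apply/eqP/ffunP => i; apply/eqP; move: (h i); rewrite negbK.
have nk := nice_ek a b k; have nl := nice_ek a b l.
pose V x := ek a b l x * pd i (ek a b k) x - ek a b k x * pd i (ek a b l) x.
pose dV x := (((l i)%:R * om a b i) ^+ 2 - ((k i)%:R * om a b i) ^+ 2) * (ek a b k x * ek a b l x).
have pV : has_pd i V dV.
  apply: has_pd_ext (has_pdB (has_pdM (nice_has i nl) (nice_has i (nice_pd i nk)))
    (has_pdM (nice_has i nk) (nice_has i (nice_pd i nl)))) _ => x.
  by rewrite !ek_pd2 /dV; move: (pd i (ek a b k) x) (pd i (ek a b l) x) => *; ring.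
have ckl : continuous (fun x => ek a b k x * ek a b l x) by exact: contM.
have cV : continuous V.
  by apply: contB; apply: contM => //; apply: nice_cont; exact: nice_pd.
have cdV : continuous dV by apply: contM => //; exact: cst_continuous.
have h : \int[mu]_(x in Q) dV x = 0.
  rewrite /Rintegral (@ibp_box _ _ i _ _ V)// => x xi.
  by rewrite /V (Neu_ek ab k).2// (Neu_ek ab l).2// !mulr0 subrr.
move: h; rewrite /dV RintegralZl//; last exact: box_int.
move=> /eqP; rewrite mulf_eq0 => /orP[|/eqP //].
have w0 : om a b i != 0 by rewrite gt_eqF// /om divr_gt0 ?pi_gt0// subr_gt0.
move: (om a b i) w0 => w w0; rewrite !exprMn -mulrBl mulf_eq0 sqrf_eq0 (negbTE w0) orbF.
rewrite subr_eq0 -!natrX eqr_nat eqn_exp2r// => /eqP E.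
by rewrite E eqxx in ikl.
Qed.

Variable S : seq {ffun 'I_n -> nat}.
Hypothesis uS : uniq S.

Definition comb (A : {ffun 'I_n -> nat} -> R) x : R := \sum_(k <- S) A k * ek a b k x.

Lemma comb_cont A : continuous (comb A).
Proof. by apply: cont_sum => k; apply: contM => //; exact: cst_continuous. Qed.

Lemma comb_nice A : nice (comb A).
Proof. by apply: nice_sum => k; apply: niceZ; exact: nice_ek. Qed.

Lemma comb_pd i A x : pd i (comb A) x = \sum_(k <- S) A k * pd i (ek a b k) x.
Proof.
by rewrite (has_pdE (has_pd_sum S (fun k => has_pdZ (A k) (nice_has i (nice_ek a b k))))).
Qed.

Lemma comb_lap A x : lap (comb A) x = - comb (fun k => hk a b k * A k) x.
Proof.
rewrite /lap /comb -sumrN.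
have E i : pd i (comb A) = fun x => \sum_(k <- S) A k * pd i (ek a b k) x.
  by apply/funext => y; exact: comb_pd.
under eq_bigr => i _ do rewrite -/(comb A) E (has_pdE (has_pd_sum S (fun k =>
  has_pdZ (A k) (nice_has i (nice_pd i (nice_ek a b k)))))).
rewrite exchange_big/=; apply: eq_bigr => k _; rewrite -mulr_sumr -/(lap (ek a b k) x) lap_ek.
by ring.
Qed.

Lemma comb_Neu A : Neu a b (comb A).
Proof.
split; first exact: comb_nice.
by move=> i x xi; rewrite comb_pd big1// => k _; rewrite (Neu_ek ab k).2// mulr0.
Qed.

Lemma parseval A B : \int[mu]_(x in Q) (comb A x * comb B x) = \sum_(k <- S) Nk k * (A k * B k).
Proof.
have E x : comb A x * comb B x = \sum_(k <- S) \sum_(l <- S) (A k * B l) * (ek a b k x * ek a b l x).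
  rewrite /comb mulr_suml; apply: eq_bigr => k _; rewrite mulr_sumr; apply: eq_bigr => l _.
  by rewrite mulrACA.
under eq_Rintegral do rewrite E.
have ckl k l : continuous (fun x => (A k * B l) * (ek a b k x * ek a b l x)).
  by apply: contM; [exact: cst_continuous|exact: contM].
rewrite Rintegral_sum//; last by move=> k; apply: box_int; exact: cont_sum.
apply: eq_big_seq => k kS; rewrite Rintegral_sum//; last by move=> l; exact: box_int.
rewrite (bigD1_seq k)//= big1 ?addr0 => [|l lk].
  by rewrite RintegralZl -/(Nk k) 1?mulrC//; apply: box_int; exact: contM.
rewrite RintegralZl//; last by apply: box_int; exact: contM.
by rewrite ek_orth ?mulr0// eq_sym.
Qed.

Lemma grad_parseval A : \int[mu]_(x in Q) (\sum_i pd i (comb A) x ^+ 2) =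
  \sum_(k <- S) hk a b k * (Nk k * A k ^+ 2).
Proof.
have nA := comb_nice A; have cA := @comb_cont A.
have cdA i := nice_cont (nice_pd i nA).
pose V i x := comb A x * pd i (comb A) x.
pose dV i x := pd i (comb A) x * pd i (comb A) x + comb A x * pd i (pd i (comb A)) x.
have pV i : has_pd i (V i) (dV i) := has_pdM (nice_has i nA) (nice_has i (nice_pd i nA)).
have cV i : continuous (V i) by exact: contM.
have cdV i : continuous (dV i).
  by apply: contD; apply: contM => //; apply: nice_cont; do 2 apply: nice_pd.
have h : \int[mu]_(x in Q) (\sum_i dV i x) = 0.
  by apply: (box_div ab cV) => // i x xi; rewrite /V (comb_Neu A).2// mulr0.
have E x : \sum_i dV i x = \sum_i pd i (comb A) x ^+ 2 + (-1) * (comb A x * comb (fun k => hk a b k * A k) x).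
  rewrite /dV big_split/= -mulr_sumr -/(lap (comb A) x) comb_lap; rewrite mulN1r mulrN.
  by congr (_ - _); apply: eq_bigr => i _; rewrite expr2.
move: h; under eq_Rintegral do rewrite E.
have c1 : continuous (fun x => \sum_i pd i (comb A) x ^+ 2).
  by apply: cont_sum => i; under eq_fun do rewrite expr2; exact: contM.
have c2 : continuous (fun x => comb A x * comb (fun k => hk a b k * A k) x).
  by apply: contM => //; exact: comb_cont.
rewrite RintegralD//; [|exact: box_int|by apply: box_int; apply: contM => //; exact: cst_continuous].
rewrite RintegralZl//; last exact: box_int.
rewrite mulN1r => /eqP; rewrite subr_eq0 => /eqP ->.
by rewrite parseval; apply: eq_bigr => k _; ring.
Qed.

(** If [Nk k] is 0 then so is the coefficient, by Cauchy-Schwarz; this spares the evaluation of the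
    norm of a mode. *)
Lemma Nk_coef (g : 'rV[R]_n -> R) k : L2 mu Q g ->
  Nk k * ((\int[mu]_(x in Q) (g x * ek a b k x)) / Nk k) = \int[mu]_(x in Q) (g x * ek a b k x).
Proof.
move=> Lg; have [N0|N0] := eqVneq (Nk k) 0; last by rewrite mulrC divfK.
have Le : L2 mu Q (ek a b k) by exact: cont_box_L2.
have := CauchySchwarz mQ Lg Le.
have -> : nrm mu Q (ek a b k) = 0.
  by rewrite /nrm -[RHS]sqrtr0 -N0; congr Num.sqrt; apply: eq_Rintegral => x _; rewrite expr2.
by rewrite mulr0 normr_le0 => /eqP ->; rewrite mul0r mulr0.
Qed.

(** Density only provides some coefficients, while the form identity [form_q] requires the Fourier
    coefficients of the boundary values. Orthogonal projection converts one into the other without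
    loss. *)
Lemma best_approx (g : 'rV[R]_n -> R) (D : {ffun 'I_n -> nat} -> R) : L2 mu Q g ->
  nrm mu Q (fun x => g x - comb (fun k => (\int[mu]_(x in Q) (g x * ek a b k x)) / Nk k) x) <=
  nrm mu Q (fun x => g x - comb D x).
Proof.
move=> Lg; set C := fun k => _.
have LC F : L2 mu Q (comb F) by apply: cont_box_L2; exact: comb_cont.
have Le k : L2 mu Q (ek a b k) by exact: cont_box_L2.
have LgC := L2B mQ Lg (LC C); have LCD := L2B mQ (LC C) (LC D).
rewrite -(@ler_pXn2r _ 2)// ?nnegrE ?nrm_ge0// !nrm_sq.
have -> : \int[mu]_(x in Q) ((g x - comb D x) ^+ 2) =
    \int[mu]_(x in Q) ((g x - comb C x) ^+ 2 + 2 * ((g x - comb C x) * (comb C x - comb D x)) +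
      (comb C x - comb D x) ^+ 2).
  by apply: eq_Rintegral => x _; ring.
have i1 := L2_sq LgC; have i2 := L2_sq LCD.
have i3 := integrableZR mQ 2 (L2_mul mQ LgC LCD).
rewrite RintegralD//; last exact: integrableDR.
rewrite RintegralD// RintegralZl//; last exact: (L2_mul mQ LgC LCD).
suff -> : \int[mu]_(x in Q) ((g x - comb C x) * (comb C x - comb D x)) = 0.
  by rewrite mulr0 addr0 lerDl; apply: Rintegral_ge0 => x _; exact: sqr_ge0.
have E x : (g x - comb C x) * (comb C x - comb D x) =
    \sum_(k <- S) (C k - D k) * ((g x - comb C x) * ek a b k x).
  have -> : comb C x - comb D x = \sum_(k <- S) (C k - D k) * ek a b k x.
    by rewrite /comb -sumrB; apply: eq_bigr => k _; rewrite mulrBl.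
  by rewrite mulr_sumr; apply: eq_bigr => k _; rewrite mulrCA.
under eq_Rintegral do rewrite E.
have igk k := L2_mul mQ LgC (Le k).
rewrite Rintegral_sum//; last by move=> k; exact: integrableZR.
rewrite big_seq big1// => k kS; rewrite RintegralZl//.
have -> : \int[mu]_(x in Q) ((g x - comb C x) * ek a b k x) =
   \int[mu]_(x in Q) (g x * ek a b k x - comb C x * comb (fun l => (l == k)%:R) x).
  apply: eq_Rintegral => x _; rewrite mulrBl; congr (_ - _ * _).
  rewrite /comb (bigD1_seq k)//= eqxx mul1r big1 ?addr0// => l /negbTE ->.
  by rewrite mul0r.
rewrite RintegralB//; [|exact: L2_mul|exact: L2_mul].
rewrite parseval (bigD1_seq k)//= eqxx mulr1 big1 ?addr0 => [|l /negbTE ->]; last first.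
  by rewrite !mulr0.
by rewrite Nk_coef// subrr mulr0.
Qed.

End Orthogonality.

(** Repeated frequencies are merged, since Parseval's identity needs distinct modes. *)
Lemma Sp_comb (R : realType) n (a b : 'I_n -> R) f : Sp a b f ->
  exists S D, uniq S /\ f =1 comb a b S D.
Proof.
move: f; apply: Sp_ind.
- by move=> f g fg [S [D [uS h]]]; exists S, D; split => // x; rewrite -fg.
- by exists [::], (fun=> 0); split => // x; rewrite /comb big_nil.
move=> c k f [S [D [uS h]]]; pose k' : {ffun 'I_n -> nat} := finfun k.
have ekk x : ek a b k x = ek a b k' x.
  by congr (ek a b _ x); apply/funext => i; rewrite ffunE.
have [kS|kS] := boolP (k' \in S).
  exists S, (fun l => D l + c * (l == k')%:R); split => // x.
  rewrite h /comb ekk [RHS](eq_bigr (fun l => c * (l == k')%:R * ek a b l x + D l * ek a b l x)); last first.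
    by move=> l _; rewrite mulrDl addrC.
  rewrite big_split/=; congr (_ + _).
  rewrite (bigD1_seq k')//= eqxx mulr1 big1 ?addr0// => l /negbTE ->.
  by rewrite mulr0 mul0r.
exists (k' :: S), (fun l => if l == k' then c else D l); split; first by rewrite /= kS.
move=> x; rewrite h /comb big_cons eqxx ekk; congr (_ + _); apply: eq_big_seq => l lS.
by case: eqP => // E; rewrite -E lS in kS.
Qed.

Section Lift.
Variables (R : realType) (d : nat).

Definition pr (x : 'rV[R]_d.+1) : 'rV[R]_d := \row_(j < d) x ord0 (lift ord_max j).

Lemma pr_snoc (x : 'rV[R]_d) (t : R) : pr (snoc (x, t)) = x.
Proof. by apply/rowP => j; rewrite mxE snoc_lift. Qed.

Lemma nice_pr f : nice f -> nice (fun x => f (pr x)).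
Proof.
elim=> {f}; first by move=> c; exact: nice_cst.
- move=> i f sf; have -> : (fun x : 'rV[R]_d.+1 => f (pr x ord0 i)) = (fun x => f (x ord0 (lift ord_max i))).
    by apply/funext => x; rewrite mxE.
  exact: (nice_coord (lift ord_max i) sf).
- by move=> f g _ nf _ ng; exact: niceD.
- by move=> f g _ nf _ ng; exact: niceM.
Qed.

Lemma has_pd_pr j f df : has_pd j f df ->
  has_pd (lift ord_max j) (fun x => f (pr x)) (fun x => df (pr x)).
Proof.
move=> h x; apply: is_derive_line (h _) => t.
congr f; apply/rowP => i; rewrite !mxE.
by rewrite (inj_eq lift_inj).
Qed.

Lemma has_pd_pr_max (f : 'rV[R]_d -> R) : has_pd ord_max (fun x => f (pr x)) (fun=> 0).
Proof.
apply: has_pd0 => h x; congr f; apply/rowP => i.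
by rewrite !mxE eq_sym (negbTE (neq_lift _ _)) andbF mulr0 add0r.
Qed.

Lemma sum_lift (F : 'I_d.+1 -> R) : \sum_(i < d.+1) F i = F ord_max + \sum_(j < d) F (lift ord_max j).
Proof.
rewrite big_ord_recr/= addrC; congr (_ + _); apply: eq_bigr => j _; congr F.
by apply/val_inj; rewrite /= /fintype.bump leqNgt ltn_ord.
Qed.

End Lift.

Section Green.
Variables (R : realType) (d : nat).
Local Notation Om := (half_space R d).
Local Notation mu := (leb R d.+1).
Let mO : measurable Om := @measurable_half R d.

Definition gradp n (f g : 'rV[R]_n -> R) x := \sum_i pd i f x * pd i g x.

Lemma pd_supp n (i : 'I_n) (f : 'rV[R]_n -> R) (M : R) : smooth f ->
  (forall (x : 'rV[R]_n) j, M < `|x ord0 j| -> f x = 0) ->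
  forall (x : 'rV[R]_n) j, M < `|x ord0 j| -> pd i f x = 0.
Proof.
move=> sf f0 x j xj; have [_ <-] := smooth_has i sf x.
pose V : normedModType R := 'rV[R]_n.
have : \forall y \near (x : V), f y = (fun=> 0) y.
  have /cvgrPdist_lt/(_ (`|x ord0 j| - M)) := @coord_cont R n j x.
  rewrite subr_gt0 => /(_ xj); apply: filterS => y hy; apply: (f0 y j).
  by have := lerB_dist (x ord0 j) (y ord0 j); lra.
by move=> /near_eq_derive ->; rewrite ?derive_cst.
Qed.

Lemma pd_near1 n (i : 'I_n) (chi : 'rV[R]_n -> R) (r : R) : nice chi ->
  (forall x : 'rV[R]_n, (forall i, `|x ord0 i| <= r) -> chi x = 1) ->
  forall x : 'rV[R]_n, (forall i, `|x ord0 i| < r) -> pd i chi x = 0.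
Proof.
move=> nc c1 x xr; have [_ <-] := nice_has i nc x.
pose V : normedModType R := 'rV[R]_n.
have : \forall y \near (x : V), chi y = (fun=> 1) y.
  by apply: filterS (near0_box xr) => y hy; apply: c1 => j; exact: ltW.
by move=> /near_eq_derive ->; rewrite ?derive_cst.
Qed.

Lemma green (f g : 'rV[R]_d.+1 -> R) : smooth f -> bsupp f -> nice g ->
  \int[mu]_(x in Om) gradp f g x = - (\int[mu]_(x in Om) (f x * lap g x)) -
    \int[leb R d]_x (f (boundary_pt x) * pd ord_max g (boundary_pt x)).
Proof.
move=> sf bf ng; have cf := smooth_cont sf; have cdf i := @smooth_pd_cont R d.+1 i f sf.
have cdg i := nice_cont (nice_pd i ng); have cddg i := nice_cont (nice_pd i (nice_pd i ng)).
have bdf i := bsupp_pd bf (smooth_has i sf).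
pose V i x := f x * pd i g x.
pose dV i x := pd i f x * pd i g x + f x * pd i (pd i g) x.
have cV i : continuous (V i) by exact: contM.
have cdV i : continuous (dV i) by apply: contD; exact: contM.
have bV i : bsupp (V i) by exact: bsuppMl.
have pV i : has_pd i (V i) (dV i) := has_pdM (smooth_has i sf) (nice_has i (nice_pd i ng)).
have idV i : mu.-integrable Om (EFin \o dV i).
  by apply: cc_integrable => //; apply: bsuppD; exact: bsuppMl.
have h : \int[mu]_(x in Om) (\sum_i dV i x) = - \int[leb R d]_x V ord_max (boundary_pt x).
  rewrite Rintegral_sum// (bigD1 ord_max)//= big1 ?addr0 => [|j jm].
    exact: ibp_half_max.
  exact: (@ibp_half _ _ j (V j)).
have E x : \sum_i dV i x = gradp f g x + f x * lap g x.
  by rewrite /dV big_split/= -mulr_sumr.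
move: h; under eq_Rintegral do rewrite E.
rewrite RintegralD//; first by rewrite /V => /(canRL (addrK _)) ->; rewrite addrC.
- apply: cc_integrable => //; first by apply: cont_sum => i; exact: contM.
  by apply: bsupp_sum => i; exact: bsuppMl.
- apply: cc_integrable => //; last exact: bsuppMl.
  by apply: contM => //; exact: cont_sum.
Qed.

End Green.

Lemma form_algebra (R : comNzRingType) (g1 g2 l1 l2 d1 d2 x11 x22 x21 x12 s m e : R) :
  g1 = - l1 - d1 -> g2 = - l2 - d2 -> l1 = - m * x11 - e * x12 -> l2 = - m * x22 + e * x21 ->
  s = - d1 - d2 -> (g1 + g2) - m * (x11 + x22) + e * (x21 - x12) = s.
Proof. by move=> -> -> -> -> ->; ring. Qed.

Lemma form_distr1 (R : comNzRingType) (f m e a b : R) :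
  f * (- m * a + - e * b) = - m * (f * a) - e * (f * b).
Proof. by ring. Qed.

Lemma form_distr2 (R : comNzRingType) (f m e a b : R) :
  f * (- m * a + e * b) = - m * (f * a) + e * (f * b).
Proof. by ring. Qed.

Section Strip.
Variables (R : realType) (d : nat) (M : R).
Let aB := (bigbox M d).1.
Let bB := (bigbox M d).2.
Local Notation Q := (box aB bB).
Definition la (j : 'I_d) : R := - (`|M| + 1).
Definition lb (j : 'I_d) : R := `|M| + 1.
Local Notation Q' := (box la lb).
Local Notation mu := (leb R d.+1).
Local Notation mu' := (leb R d).
Let mQ : measurable Q := measurable_box aB bB.
Let mQ' : measurable Q' := measurable_box la lb.

Lemma la_lb j : la j < lb j.
Proof. by rewrite /la /lb; have := normr_ge0 M; lra. Qed.

Let laE : aB \o lift ord_max = la.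
Proof.
by apply/funext => j; rewrite /aB /la /bigbox/= eq_sym (negbTE (neq_lift _ _)).
Qed.

Let lbE : bB \o lift ord_max = lb. Proof. by []. Qed.

(** Slices at height [t] are integrated in [t]; dropping the upper endpoint of the primitive leaves
    the integral of [exp (- 2 ka t)] over the half-line. *)
Lemma strip_le (I : Type) (s : seq I) (f : 'rV[R]_d.+1 -> R) (w ka : I -> R) : continuous f ->
  (forall k, 0 <= w k) -> (forall k, 0 < ka k) ->
  (forall t, 0 < t -> \int[mu']_(x in Q') f (snoc (x, t)) = \sum_(k <- s) w k * expR (- (2 * ka k) * t)) ->
  \int[mu]_(x in Q) f x <= \sum_(k <- s) w k / (2 * ka k).
Proof.
move=> cf w0 k0 hf; have [C hC] := cont_bounded_box aB bB cf.
rewrite /Rintegral (int_box_snocC (continuous_measurable_rV cf) hC) laE lbE.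
have a0 : aB ord_max = 0 by rewrite /aB /bigbox/= eqxx.
have b0 : 0 < bB ord_max by rewrite /bB /bigbox/=; have := normr_ge0 M; lra.
pose g (t : R) := \sum_(k <- s) w k * expR (- (2 * ka k) * t).
pose G (t : R) := \sum_(k <- s) (- (w k / (2 * ka k))) * expR (- (2 * ka k) * t).
have inner t : `]aB ord_max, bB ord_max[%classic t ->
    (\int[mu']_(x in Q') (f (snoc (x, t)))%:E)%E = (g t)%:E.
  rewrite /= in_itv/= a0 => /andP[t0 _]; rewrite /g -hf// fineK//.
  apply: integrable_fin_num => //; apply: (@box_int _ _ _ _ (fun x => f (snoc (x, t)))).
  by move=> x; apply: continuous_comp; [exact: continuous_snocl|exact: cf].
rewrite [X in fine X](_ : _ = \int[lebesgue_measure]_(t in `]aB ord_max, bB ord_max[) (g t)%:E)%E; last first.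
  by apply: eq_integral => t /set_mem; exact: inner.
have dE k (t : R) : is_derive t (1 : R) (fun t => expR (- (2 * ka k) * t)) (- (2 * ka k) * expR (- (2 * ka k) * t)).
  by apply: is_derive_eq (dv_comp (is_derive_expR _) (dvZ (- (2 * ka k)) (is_derive_id t (1 : R)))) _; ring.
have dG (t : R) : is_derive t (1 : R) G (g t).
  apply: is_derive_eq (dv_sum s (fun k => dvZ (- (w k / (2 * ka k))) (dE k t))) _.
  apply: eq_bigr => k _; field; rewrite gt_eqF//.
have cg : continuous g.
  apply: cont_sum => k; apply: contM; first exact: cst_continuous.
  move=> t; apply: differentiable_continuous; apply/derivable1_diffP.
  by case: (dE k t).
rewrite (continuous_FTCoo _ cg dG) ?a0//= /G -sumrB; apply: ler_sum => k _.
rewrite mulr0 expR0 mulr1 opprK -[leRHS]add0r lerD2r mulNr oppr_le0 mulr_ge0 ?expR_ge0//.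
by rewrite divr_ge0// mulr_ge0// ltW.
Qed.

Variable S : seq {ffun 'I_d -> nat}.
Hypothesis uS : uniq S.
Local Notation K := {ffun 'I_d -> nat}.
Local Notation e_ k := (ek la lb k).
Local Notation N_ k := (Nk la lb k).
Local Notation h_ k := (hk la lb k).

(** Separated variables: profiles [G k] in the normal coordinate times tangential cosine modes. *)
Definition qf (G : K -> R -> R) (x : 'rV[R]_d.+1) : R :=
  \sum_(k <- S) G k (x ord0 ord_max) * e_ k (pr x).

Lemma qf_snoc G x t : qf G (snoc (x, t)) = comb la lb S (fun k => G k t) x.
Proof. by apply: eq_bigr => k _; rewrite snoc_max pr_snoc. Qed.

Lemma nice_qf G : (forall k, smooth1 (G k)) -> nice (qf G).
Proof.
move=> sG; apply: nice_sum => k; apply: niceM; first exact: nice_coord.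
by apply: nice_pr; exact: nice_ek.
Qed.

Lemma qf_pd_max G G' : (forall k (t : R), is_derive t (1 : R) (G k) (G' k t)) ->
  pd ord_max (qf G) = qf G'.
Proof.
move=> dG; apply: has_pdE; rewrite /qf; apply: has_pd_sum => k.
apply: has_pd_ext (has_pdM (has_pd_coord _ (dG k)) (has_pd_pr_max _)) _ => x.
by rewrite mulr0 addr0.
Qed.

Lemma qf_pd_lift G j : pd (lift ord_max j) (qf G) =
  fun x => \sum_(k <- S) G k (x ord0 ord_max) * pd j (e_ k) (pr x).
Proof.
apply: has_pdE; rewrite /qf; apply: has_pd_sum => k.
have jm : ord_max != lift ord_max j by exact: neq_lift.
apply: has_pd_ext (has_pdM (has_pd_coord_neq (G k) jm)
  (has_pd_pr (nice_has j (nice_ek la lb k)))) _ => x.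
by rewrite mul0r add0r.
Qed.

Lemma qf_pd2_lift G j : pd (lift ord_max j) (pd (lift ord_max j) (qf G)) =
  fun x => \sum_(k <- S) G k (x ord0 ord_max) * pd j (pd j (e_ k)) (pr x).
Proof.
rewrite qf_pd_lift; apply: has_pdE; apply: has_pd_sum => k.
have jm : ord_max != lift ord_max j by exact: neq_lift.
apply: has_pd_ext (has_pdM (has_pd_coord_neq (G k) jm)
  (has_pd_pr (nice_has j (nice_pd j (nice_ek la lb k))))) _ => x.
by rewrite mul0r add0r.
Qed.

Lemma qf_lap G G' G'' x : (forall k (t : R), is_derive t (1 : R) (G k) (G' k t)) ->
  (forall k (t : R), is_derive t (1 : R) (G' k) (G'' k t)) ->
  lap (qf G) x = qf (fun k t => G'' k t - h_ k * G k t) x.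
Proof.
move=> dG dG'; rewrite /lap sum_lift (qf_pd_max dG) (qf_pd_max dG').
under eq_bigr do rewrite qf_pd2_lift.
rewrite exchange_big/= /qf -big_split; apply: eq_bigr => k _ /=.
by rewrite -mulr_sumr -/(lap (e_ k) (pr x)) lap_ek; ring.
Qed.

Lemma qf_lin G1 G2 G3 (s t : R) x : (forall k u, G3 k u = s * G1 k u + t * G2 k u) ->
  qf G3 x = s * qf G1 x + t * qf G2 x.
Proof.
move=> h; rewrite /qf !mulr_sumr -big_split; apply: eq_bigr => k _ /=.
by rewrite h; ring.
Qed.

Section Decay.
Variables ka kb : K -> R.
Hypothesis ka0 : forall k, 0 < ka k.

(* [g1 + i g2] is [(c1 + i c2) exp (- (ka - i kb) t)]. *)
Definition g1 (c1 c2 : K -> R) k (t : R) :=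
  expR (- ka k * t) * (c1 k * cos (kb k * t) - c2 k * sin (kb k * t)).
Definition g2 (c1 c2 : K -> R) k (t : R) :=
  expR (- ka k * t) * (c1 k * sin (kb k * t) + c2 k * cos (kb k * t)).
(** Deriving a profile multiplies [c1 + i c2] by [- (ka - i kb)]. *)
Definition dc1 (c1 c2 : K -> R) k := - ka k * c1 k - kb k * c2 k.
Definition dc2 (c1 c2 : K -> R) k := - ka k * c2 k + kb k * c1 k.

Let lin_dv (c t : R) : is_derive t (1 : R) (fun t => c * t) c.
Proof. by apply: is_derive_eq (dvZ c (is_derive_id t (1 : R))) _; rewrite mulr1. Qed.

Lemma g1_dv c1 c2 k (t : R) : is_derive t (1 : R) (g1 c1 c2 k) (g1 (dc1 c1 c2) (dc2 c1 c2) k t).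
Proof.
have he := dv_comp (is_derive_expR _) (lin_dv (- ka k) t).
have hc := dv_comp (is_derive_cos _) (lin_dv (kb k) t).
have hs := dv_comp (is_derive_sin _) (lin_dv (kb k) t).
apply: is_derive_eq (dvM he (dvB (dvZ (c1 k) hc) (dvZ (c2 k) hs))) _.
by rewrite /g1 /dc1 /dc2; ring.
Qed.

Lemma g2_dv c1 c2 k (t : R) : is_derive t (1 : R) (g2 c1 c2 k) (g2 (dc1 c1 c2) (dc2 c1 c2) k t).
Proof.
have he := dv_comp (is_derive_expR _) (lin_dv (- ka k) t).
have hc := dv_comp (is_derive_cos _) (lin_dv (kb k) t).
have hs := dv_comp (is_derive_sin _) (lin_dv (kb k) t).
apply: is_derive_eq (dvM he (dvD (dvZ (c1 k) hs) (dvZ (c2 k) hc))) _.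
by rewrite /g2 /dc1 /dc2; ring.
Qed.

Let smooth1_lin f (c : R) : smooth1 f -> smooth1 (fun t => f (c * t)).
Proof. by move=> sf; have := smooth1_aff c 0 sf; under eq_fun do rewrite addr0. Qed.

Let smooth1Z f (c : R) : smooth1 f -> smooth1 (fun t => c * f t).
Proof. by move=> sf; apply: smooth1M => //; exact: smooth1_cst. Qed.

Lemma smooth1_g1 c1 c2 k : smooth1 (g1 c1 c2 k).
Proof.
have [ss sc] := @smooth1_sincos R.
apply: smooth1M; first exact: smooth1_lin (@smooth1_expR R).
apply: smooth1D; first by apply: smooth1Z; exact: smooth1_lin.
have -> : (fun t => - (c2 k * sin (kb k * t))) = (fun t => - c2 k * sin (kb k * t)).
  by apply/funext => t; rewrite mulNr.
by apply: smooth1Z; exact: smooth1_lin.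
Qed.

Lemma smooth1_g2 c1 c2 k : smooth1 (g2 c1 c2 k).
Proof.
have [ss sc] := @smooth1_sincos R.
apply: smooth1M; first exact: smooth1_lin (@smooth1_expR R).
by apply: smooth1D; apply: smooth1Z; exact: smooth1_lin.
Qed.

Lemma g_sq c1 c2 k t : g1 c1 c2 k t ^+ 2 + g2 c1 c2 k t ^+ 2 =
  (c1 k ^+ 2 + c2 k ^+ 2) * expR (- (2 * ka k) * t).
Proof.
have -> : expR (- (2 * ka k) * t) = expR (- ka k * t) ^+ 2.
  by rewrite -expRM_natl; congr expR; ring.
rewrite /g1 /g2; have := cos2Dsin2 (kb k * t).
move: (expR _) (cos _) (sin _) => E C s h.
have -> : (c1 k ^+ 2 + c2 k ^+ 2) * E ^+ 2 = (c1 k ^+ 2 + c2 k ^+ 2) * E ^+ 2 * (C ^+ 2 + s ^+ 2).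
  by rewrite h mulr1.
by ring.
Qed.

Lemma g0 c1 c2 k : g1 c1 c2 k 0 = c1 k /\ g2 c1 c2 k 0 = c2 k.
Proof. by rewrite /g1 /g2 !mulr0 expR0 cos0 sin0; split; ring. Qed.

Variables c1 c2 : K -> R.
Let q1 := qf (g1 c1 c2).
Let q2 := qf (g2 c1 c2).
Lemma nice_q1 : nice q1. Proof. by apply: nice_qf => k; exact: smooth1_g1. Qed.
Lemma nice_q2 : nice q2. Proof. by apply: nice_qf => k; exact: smooth1_g2. Qed.

Let cX2 (f : 'rV[R]_d.+1 -> R) : continuous f -> continuous (fun x : 'rV[R]_d.+1 => f x ^+ 2 : R).
Proof. by move=> cf; under eq_fun do rewrite expr2; exact: contM. Qed.

Lemma strip_sq (b1 b2 : K -> R) : \int[mu]_(x in Q) (qf (g1 b1 b2) x ^+ 2 + qf (g2 b1 b2) x ^+ 2) <=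
  \sum_(k <- S) N_ k * (b1 k ^+ 2 + b2 k ^+ 2) / (2 * ka k).
Proof.
have n1 : nice (qf (g1 b1 b2)) by apply: nice_qf => k; exact: smooth1_g1.
have n2 : nice (qf (g2 b1 b2)) by apply: nice_qf => k; exact: smooth1_g2.
apply: strip_le => //.
- by apply: contD; apply: cX2; exact: nice_cont.
- by move=> k; rewrite mulr_ge0 ?Nk_ge0// addr_ge0 ?sqr_ge0.
move=> t _.
have -> : \int[mu']_(x in Q') (qf (g1 b1 b2) (snoc (x, t)) ^+ 2 + qf (g2 b1 b2) (snoc (x, t)) ^+ 2) =
  \int[mu']_(x in Q') (comb la lb S (fun k => g1 b1 b2 k t) x * comb la lb S (fun k => g1 b1 b2 k t) x +
    comb la lb S (fun k => g2 b1 b2 k t) x * comb la lb S (fun k => g2 b1 b2 k t) x).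
  by apply: eq_Rintegral => x _; rewrite !qf_snoc !expr2.
rewrite RintegralD//; try by apply: box_int; apply: contM; exact: comb_cont.
rewrite !(parseval la_lb uS) -big_split; apply: eq_bigr => k _ /=.
by rewrite -mulrDr -!expr2 g_sq mulrA.
Qed.

Lemma strip_tan : \int[mu]_(x in Q) (\sum_(j < d) (pd (lift ord_max j) q1 x ^+ 2 + pd (lift ord_max j) q2 x ^+ 2)) <=
  \sum_(k <- S) h_ k * (N_ k * (c1 k ^+ 2 + c2 k ^+ 2)) / (2 * ka k).
Proof.
apply: strip_le => //.
- by apply: cont_sum => j; apply: contD; apply: cX2; apply: nice_cont; apply: nice_pd;
    [exact: nice_q1|exact: nice_q2].
- move=> k; rewrite !mulr_ge0 ?Nk_ge0// ?addr_ge0 ?sqr_ge0// /hk.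
  by apply: sumr_ge0 => i _; exact: sqr_ge0.
move=> t _.
have -> : \int[mu']_(x in Q') (\sum_(j < d) (pd (lift ord_max j) q1 (snoc (x, t)) ^+ 2 +
      pd (lift ord_max j) q2 (snoc (x, t)) ^+ 2)) =
  \int[mu']_(x in Q') ((\sum_j pd j (comb la lb S (fun k => g1 c1 c2 k t)) x ^+ 2) +
    (\sum_j pd j (comb la lb S (fun k => g2 c1 c2 k t)) x ^+ 2)).
  apply: eq_Rintegral => x _; rewrite -big_split; apply: eq_bigr => j _ /=.
  rewrite !qf_pd_lift !comb_pd; congr (_ ^+ 2 + _ ^+ 2);
    by apply: eq_bigr => k _; rewrite snoc_max pr_snoc.
have cg A : continuous (fun x => \sum_j pd j (comb la lb S A) x ^+ 2).
  apply: cont_sum => j; under eq_fun do rewrite expr2.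
  by apply: contM; apply: nice_cont; apply: nice_pd; exact: comb_nice.
rewrite RintegralD//; try exact: box_int.
rewrite !(grad_parseval la_lb uS) -big_split; apply: eq_bigr => k _ /=.
by rewrite -!mulrDr g_sq !mulrA.
Qed.

Lemma strip_grad : \int[mu]_(x in Q) (gradp q1 q1 x + gradp q2 q2 x) <=
  \sum_(k <- S) (h_ k + ka k ^+ 2 + kb k ^+ 2) * (N_ k * (c1 k ^+ 2 + c2 k ^+ 2)) / (2 * ka k).
Proof.
have h := lerD strip_tan (strip_sq (dc1 c1 c2) (dc2 c1 c2)).
have nd1 : nice (qf (g1 (dc1 c1 c2) (dc2 c1 c2))) by apply: nice_qf => k; exact: smooth1_g1.
have nd2 : nice (qf (g2 (dc1 c1 c2) (dc2 c1 c2))) by apply: nice_qf => k; exact: smooth1_g2.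
move: h; rewrite -RintegralD//; last 2 first.
- by apply: box_int; apply: cont_sum => j; apply: contD; apply: cX2; apply: nice_cont; apply: nice_pd;
    [exact: nice_q1|exact: nice_q2].
- by apply: box_int; apply: contD; apply: cX2; exact: nice_cont.
rewrite -big_split/= => h; apply: le_trans (le_trans _ h) _; rewrite le_eqVlt; apply/orP; left; apply/eqP.
  apply: eq_Rintegral => x _; rewrite /gradp !sum_lift.
  rewrite (qf_pd_max (g1_dv c1 c2)) (qf_pd_max (g2_dv c1 c2)) big_split/= -!expr2.
  rewrite [RHS]addrC addrACA; congr (_ + (_ + _)); by apply: eq_bigr => j _; rewrite expr2.
apply: eq_bigr => k _; rewrite -mulrDl; congr (_ / _).
by rewrite /dc1 /dc2; ring.
Qed.

Variables (m e : R).
Hypothesis kab : forall k, ka k ^+ 2 - kb k ^+ 2 = h_ k - m.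
Hypothesis kab2 : forall k, 2 * (ka k * kb k) = - e.

(** The conditions on the rates say [(ka - i kb)^2 = hk - m + i e]. Thus [q1 + i q2] solves the
    homogeneous equation at the conjugate frequency [m - i e], as it must because test functions
    enter the form conjugated. *)
Lemma q1_lap x : lap q1 x = - m * q1 x + - e * q2 x.
Proof.
rewrite (qf_lap x (g1_dv c1 c2) (g1_dv _ _)); apply: qf_lin => k t.
have -> : h_ k = ka k ^+ 2 - kb k ^+ 2 + m by rewrite kab; ring.
by rewrite /g1 /g2 /dc1 /dc2 -(kab2 k); ring.
Qed.

Lemma q2_lap x : lap q2 x = - m * q2 x + e * q1 x.
Proof.
rewrite (qf_lap x (g2_dv c1 c2) (g2_dv _ _)); apply: qf_lin => k t.
have -> : h_ k = ka k ^+ 2 - kb k ^+ 2 + m by rewrite kab; ring.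
have -> : e = - (2 * (ka k * kb k)) by rewrite kab2 opprK.
by rewrite /g1 /g2 /dc1 /dc2; ring.
Qed.

Local Notation Om := (half_space R d).
Let mO : measurable Om := @measurable_half R d.
Variables f1 f2 : 'rV[R]_d.+1 -> R.
Hypotheses (sf1 : smooth f1) (sf2 : smooth f2).
Hypothesis supp1 : forall (x : 'rV[R]_d.+1) i, M < `|x ord0 i| -> f1 x = 0.
Hypothesis supp2 : forall (x : 'rV[R]_d.+1) i, M < `|x ord0 i| -> f2 x = 0.
Hypothesis c1E : forall k : K, N_ k * c1 k = \int[mu']_(x in Q') (f1 (boundary_pt x) * e_ k x).
Hypothesis c2E : forall k : K, N_ k * c2 k = \int[mu']_(x in Q') (f2 (boundary_pt x) * e_ k x).

Let bd_int (f : 'rV[R]_d.+1 -> R) (A : K -> R) : smooth f ->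
  (forall (x : 'rV[R]_d.+1) i, M < `|x ord0 i| -> f x = 0) ->
  \int[mu']_x (f (boundary_pt x) * comb la lb S A x) =
  \sum_(k <- S) A k * \int[mu']_(x in Q') (f (boundary_pt x) * e_ k x).
Proof.
move=> sf fs; have cf : continuous (fun x : 'rV[R]_d => f (boundary_pt x)).
  by move=> x; apply: continuous_comp; [exact: continuous_snocl|exact: smooth_cont].
have ce k : continuous (fun x => f (boundary_pt x) * e_ k x).
  by apply: contM => //; apply: nice_cont; exact: nice_ek.
transitivity (\int[mu']_(x in Q') (f (boundary_pt x) * comb la lb S A x)).
  rewrite [RHS]Rintegral_mkcond; apply: eq_Rintegral => x _.
  rewrite patchE; case: ifPn => // /negP xQ.
  have [i xi] : exists i, M < `|x ord0 i|.
    apply/not_existsP => h; apply: xQ; apply/mem_set => i; rewrite /la /lb -ltr_norml.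
    by have := h i; move=> /negP; rewrite -leNgt => /le_lt_trans -> //; have := ler_norm M; lra.
  by rewrite (fs _ (lift ord_max i)) ?mul0r// /boundary_pt snoc_lift.
transitivity (\int[mu']_(x in Q') (\sum_(k <- S) A k * (f (boundary_pt x) * e_ k x))).
  by apply: eq_Rintegral => x _; rewrite mulr_sumr; apply: eq_bigr => k _; rewrite mulrCA.
rewrite Rintegral_sum//; last first.
  by move=> k; apply: box_int; apply: contM => //; exact: cst_continuous.
by apply: eq_bigr => k _; rewrite RintegralZl//; exact: box_int.
Qed.

(** The left side is the real part of the Helmholtz form at [m + i e] of [f] against [q]. Green's
    formula leaves only the boundary flux, and on each mode its real part is the decay rate [ka]
    times the squared coefficient. *)
Lemma form_q : \int[mu]_(x in Om) (gradp f1 q1 x + gradp f2 q2 x) -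
  m * \int[mu]_(x in Om) (f1 x * q1 x + f2 x * q2 x) +
  e * \int[mu]_(x in Om) (f2 x * q1 x - f1 x * q2 x) =
  \sum_(k <- S) ka k * (N_ k * (c1 k ^+ 2 + c2 k ^+ 2)).
Proof.
have b1 : bsupp f1 by exists M. have b2 : bsupp f2 by exists M.
have cf1 := smooth_cont sf1; have cf2 := smooth_cont sf2.
have cq1 := nice_cont nice_q1; have cq2 := nice_cont nice_q2.
have ig f q : smooth f -> bsupp f -> nice q -> mu.-integrable Om (EFin \o gradp f q).
  move=> sf bf nq; apply: cc_integrable => //.
    apply: cont_sum => i; apply: contM; first exact: smooth_pd_cont.
    by apply: nice_cont; exact: nice_pd.
  by apply: bsupp_sum => i; apply: bsuppMl; exact: bsupp_pd bf (smooth_has i sf).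
have ip f q : continuous f -> bsupp f -> continuous q -> mu.-integrable Om (EFin \o (fun x => f x * q x)).
  by move=> cf bf cq; apply: cc_integrable => //; [exact: contM|exact: bsuppMl].
have I11 := ip _ _ cf1 b1 cq1; have I12 := ip _ _ cf1 b1 cq2.
have I21 := ip _ _ cf2 b2 cq1; have I22 := ip _ _ cf2 b2 cq2.
have Ig1 := ig _ _ sf1 b1 nice_q1; have Ig2 := ig _ _ sf2 b2 nice_q2.
have E1 := RintegralD mO Ig1 Ig2; have E2 := RintegralD mO I11 I22; have E3 := RintegralB mO I21 I12.
have L1 : \int[mu]_(x in Om) (f1 x * lap q1 x) =
    - m * \int[mu]_(x in Om) (f1 x * q1 x) - e * \int[mu]_(x in Om) (f1 x * q2 x).
  rewrite -(RintegralZl (- m) mO I11) -(RintegralZl e mO I12).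
  rewrite -RintegralB//; try exact: integrableZR.
  by apply: eq_Rintegral => x _; rewrite q1_lap; exact: form_distr1.
have L2 : \int[mu]_(x in Om) (f2 x * lap q2 x) =
    - m * \int[mu]_(x in Om) (f2 x * q2 x) + e * \int[mu]_(x in Om) (f2 x * q1 x).
  rewrite -(RintegralZl (- m) mO I22) -(RintegralZl e mO I21).
  rewrite -RintegralD//; try exact: integrableZR.
  by apply: eq_Rintegral => x _; rewrite q2_lap; exact: form_distr2.
have B1 : \int[mu']_x (f1 (boundary_pt x) * pd ord_max q1 (boundary_pt x)) =
    \sum_(k <- S) dc1 c1 c2 k * (N_ k * c1 k).
  rewrite (qf_pd_max (g1_dv c1 c2)).
  under eq_bigr do rewrite c1E; rewrite -bd_int//; apply: eq_Rintegral => x _.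
  by rewrite qf_snoc; congr (_ * _); apply: eq_bigr => k _; rewrite (g0 _ _ k).1.
have B2 : \int[mu']_x (f2 (boundary_pt x) * pd ord_max q2 (boundary_pt x)) =
    \sum_(k <- S) dc2 c1 c2 k * (N_ k * c2 k).
  rewrite (qf_pd_max (g2_dv c1 c2)).
  under eq_bigr do rewrite c2E; rewrite -bd_int//; apply: eq_Rintegral => x _.
  by rewrite qf_snoc; congr (_ * _); apply: eq_bigr => k _; rewrite (g0 _ _ k).2.
have B3 : \sum_(k <- S) ka k * (N_ k * (c1 k ^+ 2 + c2 k ^+ 2)) =
    - (\sum_(k <- S) dc1 c1 c2 k * (N_ k * c1 k)) - \sum_(k <- S) dc2 c1 c2 k * (N_ k * c2 k).
  rewrite -!sumrN -big_split; apply: eq_bigr => k _ /=.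
  by rewrite /dc1 /dc2; ring.
rewrite -B1 -B2 in B3; rewrite E1 E2 E3.
exact: (form_algebra (green sf1 b1 nice_q1) (green sf2 b2 nice_q2) L1 L2 B3).
Qed.

End Decay.
End Strip.

(** Real and imaginary parts of the principal square root of [s - i e]. *)
Definition root_re (R : realType) (s e : R) := Num.sqrt ((Num.sqrt (s ^+ 2 + e ^+ 2) + s) / 2).
Definition root_im (R : realType) (s e : R) := - e / (2 * root_re s e).

Lemma complex_root (R : realType) (s e : R) : e != 0 ->
  [/\ 0 < root_re s e, root_re s e ^+ 2 - root_im s e ^+ 2 = s,
      2 * (root_re s e * root_im s e) = - e &
      root_re s e ^+ 2 + root_im s e ^+ 2 <= `|s| + `|e| ].
Proof.
move=> e0; pose r := Num.sqrt (s ^+ 2 + e ^+ 2).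
have e20 : 0 < e ^+ 2 by rewrite exprn_even_gt0.
have r2 : r ^+ 2 = s ^+ 2 + e ^+ 2 by rewrite sqr_sqrtr// addr_ge0 ?sqr_ge0.
have r0 : 0 <= r by exact: sqrtr_ge0.
have sr : `|s| < r.
  by rewrite -(@ltr_pXn2r _ 2)// ?nnegrE// r2 real_normK ?num_real// ltrDl.
have rs : 0 < r + s by move: sr; rewrite ltr_norml => /andP[]; lra.
have a2 : root_re s e ^+ 2 = (r + s) / 2 by rewrite sqr_sqrtr// divr_ge0// ltW.
have a0 : 0 < root_re s e by rewrite sqrtr_gt0 divr_gt0.
have b2 : root_im s e ^+ 2 = (r - s) / 2.
  rewrite /root_im expr_div_n sqrrN exprMn a2.
  have -> : e ^+ 2 = (r - s) * (r + s) by rewrite -subr_sqr r2 addrC addKr.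
  by field; rewrite gt_eqF.
split => //.
- by rewrite a2 b2; field.
- by rewrite /root_im; field; rewrite gt_eqF.
rewrite a2 b2 -mulrDl (_ : r + s + (r - s) = r * 2); last by ring.
rewrite mulfK// -(@ler_pXn2r _ 2)// ?nnegrE ?addr_ge0//.
rewrite r2 sqrrD !real_normK ?num_real// -addrA lerD2l lerDr mulrn_wge0// mulr_ge0.
Qed.

Lemma comb_widen (R : realType) n (a b : 'I_n -> R) (S S' : seq {ffun 'I_n -> nat}) D x :
  uniq S -> uniq S' -> {subset S <= S'} ->
  comb a b S D x = comb a b S' (fun k => if k \in S then D k else 0) x.
Proof.
move=> uS uS' sub; rewrite /comb.
transitivity (\sum_(k <- S' | k \in S) D k * ek a b k x); last first.
  by rewrite big_mkcond; apply: eq_bigr => k _; case: (k \in S) => //; rewrite mul0r.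
rewrite -[RHS]big_filter; apply: perm_big; apply: uniq_perm => //; first exact: filter_uniq.
by move=> k; rewrite mem_filter; case: (boolP (k \in S)) => // /sub ->.
Qed.

Lemma cut_young (R : realDomainType) (p Q c D C : R) : p ^+ 2 <= C -> c ^+ 2 <= 1 ->
  (p * Q + c * D) * (p * Q + c * D) <= 2 * (D * D) + 2 * C * Q ^+ 2.
Proof.
move=> hp hc; apply: (@le_trans _ _ (2 * (c ^+ 2 * (D * D)) + 2 * (p ^+ 2 * Q ^+ 2))).
  by rewrite -subr_ge0 (_ : _ - _ = (p * Q - c * D) ^+ 2) ?sqr_ge0//; ring.
rewrite -mulrA lerD// ler_wpM2l//; last by rewrite ler_wpM2r// sqr_ge0.
by rewrite ler_piMl// -expr2 sqr_ge0.
Qed.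

(** * Decaying extensions of boundary values *)

Section DtN.
Variables (R : realType) (d : nat).
Local Notation Om := (half_space R d).
Local Notation mu := (leb R d.+1).
Local Notation mu' := (leb R d).
Let mO : measurable Om := @measurable_half R d.

Definition dens (f1 f2 : 'rV[R]_d.+1 -> R) x :=
  f1 x ^+ 2 + f2 x ^+ 2 + (gradp f1 f1 x + gradp f2 f2 x).

Lemma int_bigbox (f : 'rV[R]_d.+1 -> R) M :
  (forall (x : 'rV[R]_d.+1) (i : 'I_d.+1), M < `|x ord0 i| -> f x = 0) ->
  \int[mu]_(x in Om) f x = \int[mu]_(x in box (bigbox M d).1 (bigbox M d).2) f x.
Proof. by move=> f0; rewrite Rintegral_mkcond [RHS]Rintegral_mkcond (@half_boxE _ _ _ M). Qed.

Let cX2 (f : 'rV[R]_d.+1 -> R) : continuous f -> continuous (fun x : 'rV[R]_d.+1 => f x ^+ 2 : R).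
Proof. by move=> cf; under eq_fun do rewrite expr2; exact: contM. Qed.

Lemma gradp_cont (f g : 'rV[R]_d.+1 -> R) : smooth f -> smooth g -> continuous (gradp f g).
Proof.
by move=> sf sg; apply: cont_sum => i; apply: contM; exact: smooth_pd_cont.
Qed.

Lemma dens_cont (f g : 'rV[R]_d.+1 -> R) : smooth f -> smooth g -> continuous (dens f g).
Proof.
move=> sf sg; apply: contD; apply: contD; try exact: gradp_cont;
  by apply: cX2; exact: smooth_cont.
Qed.

Lemma form_young (f1 f2 q1 q2 : 'rV[R]_d.+1 -> R) x :
  gradp f1 q1 x + gradp f2 q2 x + (f1 x * q1 x + f2 x * q2 x) <=
  2^-1 * dens f1 f2 x + 2^-1 * dens q1 q2 x.
Proof.
have yg (f q : 'rV[R]_d.+1 -> R) : gradp f q x <= 2^-1 * gradp f f x + 2^-1 * gradp q q x.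
  rewrite /gradp !mulr_sumr -big_split; apply: ler_sum => i _ /=.
  by move: (pd i f x) (pd i q x) => s t; have := sqr_ge0 (s - t); nra.
have yp (s t : R) : s * t <= 2^-1 * s ^+ 2 + 2^-1 * t ^+ 2.
  by have := sqr_ge0 (s - t); nra.
have := yg f1 q1; have := yg f2 q2; have := yp (f1 x) (q1 x); have := yp (f2 x) (q2 x).
rewrite /dens; move: (gradp _ _ _) (gradp _ _ _) (gradp _ _ _) (gradp _ _ _) (gradp _ _ _) (gradp _ _ _) (f1 x) (f2 x) (q1 x) (q2 x) => *; lra.
Qed.

Lemma int_form_young M (f1 f2 q1 q2 : 'rV[R]_d.+1 -> R) :
  smooth f1 -> smooth f2 -> smooth q1 -> smooth q2 ->
  (forall (x : 'rV[R]_d.+1) i, M < `|x ord0 i| -> f1 x = 0) ->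
  (forall (x : 'rV[R]_d.+1) i, M < `|x ord0 i| -> f2 x = 0) ->
  \int[mu]_(x in Om) (gradp f1 q1 x + gradp f2 q2 x) + \int[mu]_(x in Om) (f1 x * q1 x + f2 x * q2 x) <=
  2^-1 * \int[mu]_(x in Om) dens f1 f2 x +
  2^-1 * \int[mu]_(x in box (bigbox M d).1 (bigbox M d).2) dens q1 q2 x.
Proof.
move=> sf1 sf2 sq1 sq2 supp1 supp2.
have b1 : bsupp f1 by exists M. have b2 : bsupp f2 by exists M.
have cf1 := smooth_cont sf1; have cf2 := smooth_cont sf2.
have cq1 := smooth_cont sq1; have cq2 := smooth_cont sq2.
have cP : continuous (fun x => f1 x * q1 x + f2 x * q2 x) := contD (contM cf1 cq1) (contM cf2 cq2).
have cG : continuous (fun x => gradp f1 q1 x + gradp f2 q2 x) :=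
  contD (gradp_cont sf1 sq1) (gradp_cont sf2 sq2).
have bP : bsupp (fun x => f1 x * q1 x + f2 x * q2 x) by apply: bsuppD; exact: bsuppMl.
have bG : bsupp (fun x => gradp f1 q1 x + gradp f2 q2 x).
  apply: bsuppD; apply: bsupp_sum => i; apply: bsuppMl.
    exact: (bsupp_pd b1 (smooth_has i sf1)).
  exact: (bsupp_pd b2 (smooth_has i sf2)).
have F0 (x : 'rV[R]_d.+1) i : M < `|x ord0 i| ->
    gradp f1 q1 x + gradp f2 q2 x + (f1 x * q1 x + f2 x * q2 x) = 0.
  move=> xi; have e1 := pd_supp _ sf1 supp1 xi; have e2 := pd_supp _ sf2 supp2 xi.
  rewrite (supp1 _ _ xi) (supp2 _ _ xi) /gradp !big1 ?mul0r ?addr0// => j _; by rewrite ?e1 ?e2 mul0r.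
have D0 (x : 'rV[R]_d.+1) i : M < `|x ord0 i| -> dens f1 f2 x = 0.
  move=> xi; have e1 := pd_supp _ sf1 supp1 xi; have e2 := pd_supp _ sf2 supp2 xi.
  rewrite /dens (supp1 _ _ xi) (supp2 _ _ xi) /gradp !big1 ?expr0n ?addr0// => j _; by rewrite ?e1 ?e2 mul0r.
have mQ : measurable (box (bigbox M d).1 (bigbox M d).2) by exact: measurable_box.
have cd1 := dens_cont sf1 sf2; have cd2 := dens_cont sq1 sq2.
have I1 := box_int (bigbox M d).1 (bigbox M d).2 cd1.
have I2 := box_int (bigbox M d).1 (bigbox M d).2 cd2.
rewrite -(RintegralD mO (cc_integrable mO cG bG) (cc_integrable mO cP bP)).
have Z1 := integrableZR mQ 2^-1 I1; have Z2 := integrableZR mQ 2^-1 I2.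
rewrite [leLHS](int_bigbox F0) [X in _ <= _ * X + _](int_bigbox D0).
have E := etrans (RintegralD mQ Z1 Z2)
  (congr2 +%R (RintegralZl 2^-1 mQ I1) (RintegralZl 2^-1 mQ I2)).
apply: le_trans (_ : _ <= \int[mu]_(x in box (bigbox M d).1 (bigbox M d).2)
  (2^-1 * dens f1 f2 x + 2^-1 * dens q1 q2 x)) _; last first.
  by rewrite le_eqVlt; apply/orP; left; apply/eqP; exact: E.
apply: le_Rintegral => //; first by apply: box_int; exact: (contD cG cP).
  exact: (integrableDR mQ Z1 Z2).
by move=> x _; exact: form_young.
Qed.

Section Fixed.
Variables (r : R) (f1 f2 : 'rV[R]_d.+1 -> R).
Hypotheses (r1 : 1 <= r) (sf1 : smooth f1) (sf2 : smooth f2).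
Hypothesis supp1 : forall (x : 'rV[R]_d.+1) i, r - 1 < `|x ord0 i| -> f1 x = 0.
Hypothesis supp2 : forall (x : 'rV[R]_d.+1) i, r - 1 < `|x ord0 i| -> f2 x = 0.
Let M := 2 * r.
Local Notation Q := (box (bigbox M d).1 (bigbox M d).2).
Local Notation Q' := (box (@la R d M) (@lb R d M)).
Local Notation K := {ffun 'I_d -> nat}.
Local Notation N_ k := (Nk (@la R d M) (@lb R d M) k).
Local Notation h_ k := (hk (@la R d M) (@lb R d M) k).
Variables (S : seq K) (uS : uniq S).

Let rM : r - 1 <= M. Proof. by rewrite /M; move: r1; lra. Qed.

Let sup_up (f : 'rV[R]_d.+1 -> R) : (forall (x : 'rV[R]_d.+1) i, r - 1 < `|x ord0 i| -> f x = 0) ->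
  forall (x : 'rV[R]_d.+1) i, M < `|x ord0 i| -> f x = 0.
Proof. by move=> h x i xi; apply: (h x i); exact: le_lt_trans xi. Qed.

Definition cf (f : 'rV[R]_d.+1 -> R) (k : K) : R :=
  (\int[mu']_(x in Q') (f (boundary_pt x) * ek (@la R d M) (@lb R d M) k x)) / N_ k.

Let cb (f : 'rV[R]_d.+1 -> R) : smooth f -> continuous (fun x : 'rV[R]_d => f (boundary_pt x)).
Proof.
by move=> sf x; apply: continuous_comp; [exact: continuous_snocl|exact: smooth_cont].
Qed.

Lemma cfE (f : 'rV[R]_d.+1 -> R) (k : K) : smooth f ->
  N_ k * cf f k = \int[mu']_(x in Q') (f (boundary_pt x) * ek (@la R d M) (@lb R d M) k x).
Proof. by move=> sf; apply: Nk_coef; apply: cont_box_L2; exact: cb. Qed.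

Let hk0 (k : K) : 0 <= h_ k.
Proof. by apply: sumr_ge0 => i _; exact: sqr_ge0. Qed.

Let sg (k : K) : R := Num.sqrt (1 + h_ k).
Let sg2 k : sg k ^+ 2 = 1 + h_ k. Proof. by rewrite sqr_sqrtr// addr_ge0. Qed.
Let sg0 k : 0 < sg k. Proof. by rewrite sqrtr_gt0 ltr_pwDl. Qed.
Let sg1 k : 1 <= sg k.
Proof. by rewrite -(@ler_pXn2r _ 2)// ?nnegrE ?(ltW (sg0 k))// sg2 expr1n lerDl. Qed.

(** The squared [H^{1/2}] norm of the projected boundary values, read off from the modes. *)
Definition trace_sum := \sum_(k <- S) sg k * (N_ k * (cf f1 k ^+ 2 + cf f2 k ^+ 2)).

Let En := \int[mu]_(x in Om) dens f1 f2 x.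

(** A trace theorem obtained from the form identity itself, at [m = -1] and [e = 0], where the decay
    rates are [sqrt (1 + hk)]. Then [trace_sum] is the [H^1] product of [f] with its decaying
    extension, whose squared [H^1] norm on the box is at most [trace_sum]; Young's inequality
    absorbs half of it. *)
Lemma trace_le : trace_sum <= En.
Proof.
pose kb := (fun=> 0) : K -> R.
pose q1 := qf M S (g1 sg kb (cf f1) (cf f2)); pose q2 := qf M S (g2 sg kb (cf f1) (cf f2)).
have nq1 : nice q1 by exact: nice_q1. have nq2 : nice q2 by exact: nice_q2.
have h1 k : sg k ^+ 2 - kb k ^+ 2 = h_ k - (-1) by rewrite sg2 /kb; ring.
have h2 k : 2 * (sg k * kb k) = - 0 by rewrite /kb mulr0 mulr0 oppr0.
have H := form_q S h1 h2 sf1 sf2 (sup_up supp1) (sup_up supp2)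
  (fun k => cfE k sf1) (fun k => cfE k sf2).
rewrite mul0r addr0 mulN1r opprK -/q1 -/q2 in H.
have sq1 := nice_smooth nq1; have sq2 := nice_smooth nq2.
have mQ : measurable Q by exact: measurable_box.
have S1 : \int[mu]_(x in Q) dens q1 q2 x <= trace_sum.
  have -> : trace_sum = \sum_(k <- S) N_ k * (cf f1 k ^+ 2 + cf f2 k ^+ 2) / (2 * sg k) +
     \sum_(k <- S) (h_ k + sg k ^+ 2 + kb k ^+ 2) * (N_ k * (cf f1 k ^+ 2 + cf f2 k ^+ 2)) / (2 * sg k).
    rewrite -big_split; apply: eq_bigr => k _ /=.
    have -> : h_ k = sg k ^+ 2 - 1 by rewrite sg2 addrC addKr.
    by rewrite /kb; field; rewrite gt_eqF.
  have A1 := strip_sq M uS kb sg0 (cf f1) (cf f2).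
  have A2 := strip_grad M uS kb sg0 (cf f1) (cf f2).
  apply: le_trans (lerD A1 A2); rewrite -RintegralD//.
  - by apply: box_int; apply: contD; apply: cX2; [exact: smooth_cont sq1|exact: smooth_cont sq2].
  - by apply: box_int; exact: (contD (gradp_cont sq1 sq1) (gradp_cont sq2 sq2)).
have : trace_sum <= 2^-1 * En + 2^-1 * \int[mu]_(x in Q) dens q1 q2 x.
  rewrite {1}/trace_sum -H.
  exact: (int_form_young sf1 sf2 sq1 sq2 (sup_up supp1) (sup_up supp2)).
by move: S1; lra.
Qed.

Variables (m e : R).
Hypothesis e0 : e != 0.
Let Mc := 1 + `|m| + `|e|.
Let ka (k : K) := root_re (h_ k - m) e.
Let kb (k : K) := root_im (h_ k - m) e.
Let Mc1 : 1 <= Mc. Proof. by rewrite /Mc -addrA lerDl addr_ge0. Qed.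

Let ka0 k : 0 < ka k. Proof. by have [] := complex_root (h_ k - m) e0. Qed.

Let kabs k : ka k ^+ 2 + kb k ^+ 2 <= (Mc * sg k) ^+ 2.
Proof.
have [_ _ _ h] := complex_root (h_ k - m) e0; apply: (le_trans h).
have h1 : `|h_ k - m| <= h_ k + `|m|.
  by apply: le_trans (ler_normB _ _) _; rewrite ger0_norm.
rewrite exprMn sg2; apply: (@le_trans _ _ (Mc * (1 + h_ k))); last first.
  by rewrite ler_wpM2r ?addr_ge0// expr2 ler_peMr// (le_trans _ Mc1).
have := mulr_ge0 (normr_ge0 m) (hk0 k); have := mulr_ge0 (normr_ge0 e) (hk0 k).
by rewrite /Mc; have := hk0 k; move: h1; lra.
Qed.

Let Mcs0 k : 0 <= Mc * sg k.
Proof. by rewrite mulr_ge0 ?(ltW (sg0 k))// (le_trans _ Mc1). Qed.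

Let ka_le k : ka k <= Mc * sg k.
Proof.
rewrite -(@ler_pXn2r _ 2)// ?nnegrE ?(ltW (ka0 k))//.
by apply: le_trans (kabs k); rewrite lerDl sqr_ge0.
Qed.

(** Only [e] keeps a decay rate away from 0: since [2 ka kb = - e], the reciprocal of [2 ka] is
    [|kb| / |e|]. *)
Let inv_ka k : (2 * ka k)^-1 <= Mc * sg k / `|e|.
Proof.
have q0 : 0 < `|e| by rewrite normr_gt0.
have k20 : 0 < 2 * ka k by rewrite mulr_gt0.
have -> : (2 * ka k)^-1 = `|kb k| / `|e|.
  have [_ _ h _] := complex_root (h_ k - m) e0.
  have ee : `|e| = 2 * ka k * `|kb k|.
    by rewrite -normrN -h mulrA normrM gtr0_norm.
  have kb0 : `|kb k| != 0 by apply: contraTneq q0 => kb0; rewrite ee kb0 mulr0 ltxx.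
  by rewrite ee; field; rewrite kb0 gt_eqF.
rewrite ler_wpM2r ?invr_ge0 ?(ltW q0)// -(@ler_pXn2r _ 2)// ?nnegrE//.
by apply: le_trans (kabs k); rewrite real_normK ?num_real// lerDr sqr_ge0.
Qed.

Let w (k : K) := N_ k * (cf f1 k ^+ 2 + cf f2 k ^+ 2).
Let w0 k : 0 <= w k.
Proof. by rewrite mulr_ge0 ?Nk_ge0// addr_ge0 ?sqr_ge0. Qed.

Definition dq1 := qf M S (g1 ka kb (cf f1) (cf f2)).
Definition dq2 := qf M S (g2 ka kb (cf f1) (cf f2)).

Lemma dq_sq : \int[mu]_(x in Q) (dq1 x ^+ 2 + dq2 x ^+ 2) <= Mc / `|e| * En.
Proof.
rewrite /dq1 /dq2; apply: le_trans (strip_sq M uS kb ka0 (cf f1) (cf f2)) _.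
have c0 : 0 <= Mc / `|e| by rewrite divr_ge0// (le_trans _ Mc1).
apply: (@le_trans _ _ (Mc / `|e| * trace_sum)); last by rewrite ler_wpM2l// trace_le.
rewrite /trace_sum mulr_sumr; apply: ler_sum => k _; rewrite -/(w k).
apply: (@le_trans _ _ (w k * (Mc * sg k / `|e|))); first exact: ler_wpM2l.
by rewrite le_eqVlt; apply/orP; left; apply/eqP; ring.
Qed.

Lemma dq_grad : \int[mu]_(x in Q) (gradp dq1 dq1 x + gradp dq2 dq2 x) <=
  (Mc + `|m| * Mc / `|e|) * En.
Proof.
rewrite /dq1 /dq2; apply: le_trans (strip_grad M uS kb ka0 (cf f1) (cf f2)) _.
have M0 : 0 <= Mc by apply: le_trans Mc1.
have c0 : 0 <= Mc + `|m| * Mc / `|e| by rewrite addr_ge0// divr_ge0// mulr_ge0.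
apply: (@le_trans _ _ ((Mc + `|m| * Mc / `|e|) * trace_sum)); last by rewrite ler_wpM2l// trace_le.
rewrite /trace_sum mulr_sumr; apply: ler_sum => k _; rewrite -/(w k).
have [_ h _ _] := complex_root (h_ k - m) e0.
have -> : (h_ k + ka k ^+ 2 + kb k ^+ 2) * w k / (2 * ka k) = w k * (ka k + m * (2 * ka k)^-1).
  have -> : h_ k = ka k ^+ 2 - kb k ^+ 2 + m by rewrite h; ring.
  by field; rewrite gt_eqF.
rewrite [leRHS]mulrCA mulrA [leRHS]mulrC ler_wpM2l//.
have h2 : m * (2 * ka k)^-1 <= `|m| * (Mc * sg k / `|e|).
  apply: le_trans (ler_norm _) _; rewrite normrM ler_wpM2l// ger0_norm ?inv_ka//.
  by rewrite invr_ge0 mulr_ge0// ltW.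
apply: le_trans (lerD (ka_le k) h2) _.
by rewrite le_eqVlt; apply/orP; left; apply/eqP; ring.
Qed.

Lemma dq_form : 0 <= \int[mu]_(x in Om) (gradp f1 dq1 x + gradp f2 dq2 x) -
  m * \int[mu]_(x in Om) (f1 x * dq1 x + f2 x * dq2 x) +
  e * \int[mu]_(x in Om) (f2 x * dq1 x - f1 x * dq2 x).
Proof.
have h1 k : ka k ^+ 2 - kb k ^+ 2 = h_ k - m by have [] := complex_root (h_ k - m) e0.
have h2 k : 2 * (ka k * kb k) = - e by have [] := complex_root (h_ k - m) e0.
rewrite (form_q S h1 h2 sf1 sf2 (sup_up supp1) (sup_up supp2)
  (fun k => cfE k sf1) (fun k => cfE k sf2)).
by apply: sumr_ge0 => k _; rewrite mulr_ge0 ?(ltW (ka0 k))//; exact: w0.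
Qed.

Lemma dq_nice : nice dq1 /\ nice dq2.
Proof. by split; [exact: nice_q1|exact: nice_q2]. Qed.

Lemma dq_trace x : dq1 (boundary_pt x) = comb (@la R d M) (@lb R d M) S (cf f1) x /\
  dq2 (boundary_pt x) = comb (@la R d M) (@lb R d M) S (cf f2) x.
Proof.
by split; rewrite /dq1 /dq2 /boundary_pt qf_snoc; apply: eq_bigr => k _;
  [rewrite (g0 ka kb (cf f1) (cf f2) k).1|rewrite (g0 ka kb (cf f1) (cf f2) k).2].
Qed.

End Fixed.

(** The [L^2] bound is explicit in [1 / |e|] because it will be multiplied by the mismatch of
    frequencies, which is at most [|e|]. The gradient constant may depend on [e] in any way: it is
    beaten by an accuracy chosen after [e]. *)
Lemma dtn_test (m e : R) : e != 0 -> exists2 C1 : R, 0 <= C1 &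
  forall f1 f2 : 'rV[R]_d.+1 -> R, smooth f1 -> smooth f2 -> bsupp f1 -> bsupp f2 ->
  forall eta, 0 < eta -> exists v1 v2 : 'rV[R]_d.+1 -> R,
  [/\ [/\ nice v1, nice v2, bsupp v1 & bsupp v2],
      0 <= \int[mu]_(x in Om) (gradp f1 v1 x + gradp f2 v2 x) -
        m * \int[mu]_(x in Om) (f1 x * v1 x + f2 x * v2 x) +
        e * \int[mu]_(x in Om) (f2 x * v1 x - f1 x * v2 x),
      nrm mu' setT (fun x => f1 (boundary_pt x) - v1 (boundary_pt x)) <= eta /\
      nrm mu' setT (fun x => f2 (boundary_pt x) - v2 (boundary_pt x)) <= eta,
      \int[mu]_(x in Om) (v1 x ^+ 2 + v2 x ^+ 2) <=
        (1 + `|m| + `|e|) / `|e| * \int[mu]_(x in Om) dens f1 f2 x &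
      \int[mu]_(x in Om) (gradp v1 v1 x + gradp v2 v2 x) <= C1 * \int[mu]_(x in Om) dens f1 f2 x].
Proof.
move=> e0; have [Cc Cc0 hcut] := cutoff R d.+1.
set Mc := 1 + `|m| + `|e|.
have Mc0 : 0 <= Mc by rewrite !addr_ge0.
pose C1 := 2 * (Mc + `|m| * Mc / `|e|) + 2 * (d.+1%:R * Cc ^+ 2) * (Mc / `|e|).
exists C1.
  by rewrite addr_ge0// !mulr_ge0 ?invr_ge0 ?sqr_ge0// addr_ge0// !mulr_ge0 ?invr_ge0.
move=> f1 f2 sf1 sf2 [M1 s1] [M2 s2] eta eta0.
pose r := `|M1| + `|M2| + 2.
have r1 : 1 <= r by rewrite /r; have := normr_ge0 M1; have := normr_ge0 M2; lra.
have r0 : 0 < r by lra.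
have supp1 (x : 'rV[R]_d.+1) i : r - 1 < `|x ord0 i| -> f1 x = 0.
  move=> xi; apply: (s1 x i); apply: le_lt_trans xi; rewrite /r.
  by have := ler_norm M1; have := normr_ge0 M2; lra.
have supp2 (x : 'rV[R]_d.+1) i : r - 1 < `|x ord0 i| -> f2 x = 0.
  move=> xi; apply: (s2 x i); apply: le_lt_trans xi; rewrite /r.
  by have := ler_norm M2; have := normr_ge0 M1; lra.
have [chi [nchi chi1 chi01 chiout [pchi _ _]]] := hcut r r0.
pose M := 2 * r.
have rr : r - 1 < r by rewrite ltrBlDr ltrDl.
have rM : r - 1 <= M by rewrite /M; move: r1; clear; lra.
pose a := @la R d M; pose b := @lb R d M.
have ab := la_lb M : forall j : 'I_d, a j < b j.
have cb (f : 'rV[R]_d.+1 -> R) : smooth f -> continuous (fun x : 'rV[R]_d => f (boundary_pt x)).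
  by move=> sf x; apply: continuous_comp; [exact: continuous_snocl|exact: smooth_cont].
have Lb (f : 'rV[R]_d.+1 -> R) : smooth f -> L2 mu' (box a b) (fun x : 'rV[R]_d => f (boundary_pt x)).
  by move=> sf; apply: cont_box_L2; exact: cb.
have [P1 SP1 aP1] := cos_dense ab (Lb _ sf1) eta0.
have [P2 SP2 aP2] := cos_dense ab (Lb _ sf2) eta0.
have [S1 [D1 [u1 E1]]] := Sp_comb SP1; have [S2 [D2 [u2 E2]]] := Sp_comb SP2.
(* One set of modes must serve the real and the imaginary part, since the rates couple them. *)
pose S := undup (S1 ++ S2); have uS : uniq S by exact: undup_uniq.
have sub1 : {subset S1 <= S} by move=> k kS; rewrite mem_undup mem_cat kS.
have sub2 : {subset S2 <= S} by move=> k kS; rewrite mem_undup mem_cat kS orbT.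
have bap (f P : 'rV[R]_d.+1 -> R) (Pp : 'rV[R]_d -> R) S' D' : smooth f -> uniq S' -> {subset S' <= S} ->
    Pp =1 comb a b S' D' -> nrm mu' (box a b) (fun x => f (boundary_pt x) - Pp x) <= eta ->
    nrm mu' (box a b) (fun x => f (boundary_pt x) - comb a b S (cf r f) x) <= eta.
  move=> sf uS' sub EP hP; apply: le_trans hP.
  rewrite (_ : (fun x => f (boundary_pt x) - Pp x) = (fun x => f (boundary_pt x) -
     comb a b S (fun k => if k \in S' then D' k else 0) x)); last first.
    by apply/funext => x; rewrite EP (comb_widen _ _ _ _ uS' uS sub).
  exact: (best_approx ab uS _ (Lb _ sf)).
have t1 := bap f1 f1 P1 S1 D1 sf1 u1 sub1 E1 aP1.
have t2 := bap f2 f2 P2 S2 D2 sf2 u2 sub2 E2 aP2.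
pose q1 := dq1 r f1 f2 S m e; pose q2 := dq2 r f1 f2 S m e.
have [nq1 nq2] := dq_nice r f1 f2 S m e.
exists (fun x => chi x * q1 x), (fun x => chi x * q2 x).
have nv1 : nice (fun x => chi x * q1 x) by exact: niceM.
have nv2 : nice (fun x => chi x * q2 x) by exact: niceM.
have pdv q i (x : 'rV[R]_d.+1) : nice q -> pd i (fun x => chi x * q x) x = pd i chi x * q x + chi x * pd i q x.
  by move=> nq; rewrite (has_pdE (has_pdM (nice_has i nchi) (nice_has i nq))).
(* [chi] is 1 on the support of [f1] and [f2], so cutting the modes off to bounded support leaves
   every pairing with [f1], [f2] unchanged. *)
have inside (f q : 'rV[R]_d.+1 -> R) : smooth f -> nice q ->
    (forall (x : 'rV[R]_d.+1) i, r - 1 < `|x ord0 i| -> f x = 0) ->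
    (forall x, f x * (chi x * q x) = f x * q x) /\
    gradp f (fun x => chi x * q x) =1 gradp f q.
  move=> sf nq supp.
  have cases (x : 'rV[R]_d.+1) : (exists i, r - 1 < `|x ord0 i|) \/ (forall i, `|x ord0 i| < r).
    have [h|h] := pselect (exists i, r - 1 < `|x ord0 i|); [by left|right => i].
    rewrite ltNge; apply/negP => h'; apply: h; exists i; apply: lt_le_trans h'.
    by rewrite ltrBlDr ltrDl.
  split=> x; have [[i xi]|xr] := cases x.
  - by rewrite (supp x i xi) !mul0r.
  - by rewrite chi1 ?mul1r// => i; exact: ltW.
  - by apply: eq_bigr => j _; rewrite (pd_supp j sf supp xi) !mul0r.
  - apply: eq_bigr => j _; rewrite pdv// (pd_near1 j nchi chi1 xr) mul0r add0r.
    by rewrite chi1 ?mul1r// => i; exact: ltW.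
have [e11 g11] := inside _ _ sf1 nq1 supp1; have [e12 _] := inside _ _ sf1 nq2 supp1.
have [e21 _] := inside _ _ sf2 nq1 supp2; have [e22 g22] := inside _ _ sf2 nq2 supp2.
have cq1 := nice_cont nq1; have cq2 := nice_cont nq2; have cchi := nice_cont nchi.
have dv0 (x : 'rV[R]_d.+1) i : M < `|x ord0 i| -> chi x = 0 /\ forall j, pd j chi x = 0.
  by move=> xi; have [h1 h2 _] := chiout x i xi.
have mQ : measurable (box (bigbox M d).1 (bigbox M d).2) by exact: measurable_box.
split.
- by split => //; exists M => x i /dv0[-> _]; rewrite mul0r.
- have := dq_form r1 sf1 sf2 supp1 supp2 S m e0; rewrite -/q1 -/q2.
  have -> : \int[mu]_(x in Om) (gradp f1 (fun x => chi x * q1 x) x + gradp f2 (fun x => chi x * q2 x) x) =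
      \int[mu]_(x in Om) (gradp f1 q1 x + gradp f2 q2 x).
    by apply: eq_Rintegral => x _; rewrite g11 g22.
  have -> : \int[mu]_(x in Om) (f1 x * (chi x * q1 x) + f2 x * (chi x * q2 x)) =
      \int[mu]_(x in Om) (f1 x * q1 x + f2 x * q2 x).
    by apply: eq_Rintegral => x _; rewrite e11 e22.
  have -> : \int[mu]_(x in Om) (f2 x * (chi x * q1 x) - f1 x * (chi x * q2 x)) =
      \int[mu]_(x in Om) (f2 x * q1 x - f1 x * q2 x).
    by apply: eq_Rintegral => x _; rewrite e12 e21.
  by [].
- have tr (f q : 'rV[R]_d.+1 -> R) (A : _ -> R) : smooth f -> nice q -> (forall x, f x * (chi x * q x) = f x * q x) ->
      (forall (x : 'rV[R]_d.+1) i, r - 1 < `|x ord0 i| -> f x = 0) ->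
      (forall x, q (boundary_pt x) = comb a b S A x) ->
      nrm mu' (box a b) (fun x => f (boundary_pt x) - comb a b S A x) <= eta ->
      nrm mu' setT (fun x => f (boundary_pt x) - chi (boundary_pt x) * q (boundary_pt x)) <= eta.
    move=> sf nq fq supp qE; apply: le_trans; apply: ler_wsqrtr.
    rewrite [leRHS]Rintegral_mkcond; apply: le_Rintegral => //.
    - have cG : continuous (fun x : 'rV[R]_d => f (boundary_pt x) - chi (boundary_pt x) * q (boundary_pt x)).
        by apply: contB; [exact: cb|apply: contM; apply: cb; exact: nice_smooth].
      apply: cc_integrable => //; first by under eq_fun do rewrite expr2; exact: contM.
      exists M => x i xi; have [c0 _] : chi (boundary_pt x) = 0 /\ forall j, pd j chi (boundary_pt x) = 0.
        by apply: (dv0 _ (lift ord_max i)); rewrite /boundary_pt snoc_lift.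
      rewrite c0 mul0r subr0 (supp _ (lift ord_max i)) ?expr0n// /boundary_pt snoc_lift.
      exact: (le_lt_trans rM xi).
    - have -> : EFin \o ((fun x => (f (boundary_pt x) - comb a b S A x) ^+ 2) \_ (box a b)) =
          (EFin \o (fun x => (f (boundary_pt x) - comb a b S A x) ^+ 2)) \_ (box a b).
        by apply/funext => x /=; rewrite !patchE; case: ifP.
      apply/integrable_restrict => //; first exact: measurable_box.
      rewrite setTI; apply: L2_sq; apply: L2B; [exact: measurable_box|exact: Lb|].
      by apply: cont_box_L2; exact: comb_cont.
    move=> x _; rewrite patchE; case: ifPn => [_|/negP xQ].
      rewrite -qE; have -> : f (boundary_pt x) - chi (boundary_pt x) * q (boundary_pt x) =
          chi (boundary_pt x) * (f (boundary_pt x) - q (boundary_pt x)).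
        rewrite mulrBr; congr (_ - _); have [->|/eqP fx] := pselect (f (boundary_pt x) = 0).
          by rewrite mulr0.
        have xr i : `|(boundary_pt x : 'rV[R]_d.+1) ord0 i| <= r.
          rewrite leNgt; apply/negP => xi; move/eqP: fx; apply; apply: (supp _ i).
          exact: lt_trans rr xi.
        by rewrite chi1 ?mul1r.
      have /andP[c0 c1] := chi01 (boundary_pt x).
      by rewrite exprMn ler_piMl ?sqr_ge0// expr_le1.
    have [i xi] : exists i, M < `|x ord0 i|.
      apply/not_existsP => h; apply: xQ; apply/mem_set => i; rewrite /a /b /la /lb -ltr_norml.
      by have := h i; move=> /negP; rewrite -leNgt => /le_lt_trans -> //; rewrite ltr_pwDr// ler_norm.
    have [c0 _] : chi (boundary_pt x) = 0 /\ forall j, pd j chi (boundary_pt x) = 0.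
      by apply: (dv0 _ (lift ord_max i)); rewrite /boundary_pt snoc_lift.
    rewrite c0 mul0r subr0 (supp _ (lift ord_max i)) ?expr0n// /boundary_pt snoc_lift.
    exact: (le_lt_trans rM xi).
  split; [apply: (tr f1 q1 (cf r f1)) => // x|apply: (tr f2 q2 (cf r f2)) => // x].
    by have [] := dq_trace r f1 f2 S m e x.
  by have [] := dq_trace r f1 f2 S m e x.
- apply: le_trans (dq_sq r1 sf1 sf2 supp1 supp2 uS m e0).
  rewrite (@int_bigbox _ M); last by move=> x i /dv0[-> _]; rewrite !mul0r expr0n addr0.
  apply: le_Rintegral => //.
  + by apply: box_int; apply: contD; apply: cX2; exact: contM.
  + by apply: box_int; apply: contD; exact: cX2.
  move=> x _; have /andP[c0 c1] := chi01 x.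
  by rewrite lerD// exprMn ler_piMl ?sqr_ge0// expr_le1.
have G1 := dq_grad r1 sf1 sf2 supp1 supp2 uS m e0.
have G2 := dq_sq r1 sf1 sf2 supp1 supp2 uS m e0.
rewrite (@int_bigbox _ M); last first.
  move=> x i /dv0[h1 h2]; rewrite /gradp !big1 ?addr0// => j _;
  by rewrite pdv// h1 h2 !mul0r addr0 mul0r.
apply: (@le_trans _ _ (\int[mu]_(x in box (bigbox M d).1 (bigbox M d).2)
   (2 * (gradp q1 q1 x + gradp q2 q2 x) + 2 * (d.+1%:R * Cc ^+ 2) * (q1 x ^+ 2 + q2 x ^+ 2)))).
  have ccst (c : R) (f : 'rV[R]_d.+1 -> R) : continuous f -> continuous (fun x => c * f x).
    by move=> cf; apply: contM => //; exact: cst_continuous.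
  apply: le_Rintegral => //.
  - by apply: box_int; apply: contD; apply: gradp_cont; exact: nice_smooth.
  - apply: box_int; apply: contD; apply: ccst; apply: contD; try exact: cX2;
      by apply: gradp_cont; exact: nice_smooth.
  move=> x _.
  have gq q : nice q -> gradp (fun x => chi x * q x) (fun x => chi x * q x) x <=
      2 * gradp q q x + 2 * (d.+1%:R * Cc ^+ 2) * q x ^+ 2.
    move=> nq; rewrite /gradp mulr_sumr.
    have -> : 2 * (d.+1%:R * Cc ^+ 2) * q x ^+ 2 = \sum_(i < d.+1) (2 * Cc ^+ 2 * q x ^+ 2).
      by rewrite sumr_const card_ord -mulr_natl; ring.
    rewrite -big_split; apply: ler_sum => i _ /=; rewrite pdv//.
    have hp : `|pd i chi x| <= Cc.
      by apply: (le_trans (pchi i x)); rewrite ler_pdivrMr// ler_peMr.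
    have /andP[c0 c1] := chi01 x.
    have hp2 : pd i chi x ^+ 2 <= Cc ^+ 2.
      by rewrite -[leLHS]real_normK ?num_real// lerXn2r ?nnegrE.
    have c2 : chi x ^+ 2 <= 1 by rewrite expr_le1.
    move: (pd i chi x) (q x) (chi x) (pd i q x) (Cc ^+ 2) hp2 c2 => p Q c D C hp2 c2.
    exact: cut_young hp2 c2.
  rewrite !mulrDr addrACA; exact: lerD (gq _ nq1) (gq _ nq2).
rewrite RintegralD//; last 2 first.
- apply: box_int; apply: contM; first exact: cst_continuous.
  by apply: contD; apply: gradp_cont; exact: nice_smooth.
- apply: box_int; apply: contM; first exact: cst_continuous.
  by apply: contD; exact: cX2.
rewrite !RintegralZl//; last 2 first.
- by apply: box_int; apply: contD; exact: cX2.
- by apply: box_int; apply: contD; apply: gradp_cont; exact: nice_smooth.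
rewrite /C1 [leRHS]mulrDl; apply: lerD; rewrite -[leRHS]mulrA ler_wpM2l//.
by rewrite mulr_ge0// mulr_ge0// sqr_ge0.
Qed.

End DtN.

(** * Hardy's inequality *)

Section InnerProduct.
Context d (T : measurableType d) (R : realType) (mu : {measure set T -> \bar R}).
Variable D : set T.
Hypothesis mD : measurable D.
Implicit Types f g h : T -> R.
Local Notation L := (L2 mu D).
Local Notation N := (nrm mu D).

Fact ip_key : unit. Proof. exact: tt. Qed.
Definition ip := locked_with ip_key (fun f g : T -> R => \int[mu]_(x in D) (f x * g x)).
Lemma ipE f g : ip f g = \int[mu]_(x in D) (f x * g x).
Proof. by rewrite /ip unlock. Qed.

Lemma ipC f g : ip f g = ip g f.
Proof. by rewrite !ipE; apply: eq_Rintegral => x _; rewrite mulrC. Qed.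

Lemma eq_ip f g f' g' : (forall x, D x -> f x * g x = f' x * g' x) -> ip f g = ip f' g'.
Proof. by move=> h; rewrite !ipE; apply: eq_Rintegral => x /set_mem; exact: h. Qed.

Lemma ip_diag f : ip f f = N f ^+ 2.
Proof. by rewrite nrm_sq ipE; apply: eq_Rintegral => x _; rewrite expr2. Qed.

Lemma ipDl f g h : L f -> L g -> L h -> ip (fun x => f x + g x) h = ip f h + ip g h.
Proof.
move=> Lf Lg Lh; rewrite !ipE -(RintegralD mD (L2_mul mD Lf Lh) (L2_mul mD Lg Lh)).
by apply: eq_Rintegral => x _; rewrite mulrDl.
Qed.

Lemma ipBl f g h : L f -> L g -> L h -> ip (fun x => f x - g x) h = ip f h - ip g h.
Proof.
move=> Lf Lg Lh; rewrite !ipE -(RintegralB mD (L2_mul mD Lf Lh) (L2_mul mD Lg Lh)).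
by apply: eq_Rintegral => x _; rewrite mulrBl.
Qed.

Lemma ipZl k f h : L f -> L h -> ip (fun x => k * f x) h = k * ip f h.
Proof.
move=> Lf Lh; rewrite !ipE -(RintegralZl k mD (L2_mul mD Lf Lh)).
by apply: eq_Rintegral => x _; rewrite mulrA.
Qed.

Lemma ipZr k f h : L f -> L h -> ip h (fun x => k * f x) = k * ip h f.
Proof. by move=> Lf Lh; rewrite ipC ipZl// [ip _ h]ipC. Qed.

Lemma ip_le f g : L f -> L g -> `|ip f g| <= N f * N g.
Proof. by rewrite ipE; exact: CauchySchwarz. Qed.

Lemma ip_close f f' g : L f -> L f' -> L g ->
  `|ip f g - ip f' g| <= nrm mu D (fun x => f x - f' x) * N g.
Proof. by move=> Lf Lf' Lg; rewrite -ipBl//; apply: ip_le => //; exact: L2B. Qed.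

Lemma nrm_close f f' : L f -> L f' -> N f <= N f' + nrm mu D (fun x => f x - f' x).
Proof.
move=> Lf Lf'; apply: le_trans (nrmD mD Lf' (L2B mD Lf Lf')).
by apply: nrm_le => // [|x _]; [apply: L2D => //; exact: L2B|rewrite addrC subrK].
Qed.

Lemma nrm_sum_sq f g : L f -> L g ->
  \int[mu]_(x in D) (f x ^+ 2 + g x ^+ 2) = N f ^+ 2 + N g ^+ 2.
Proof. by move=> Lf Lg; rewrite !nrm_sq RintegralD//; exact: L2_sq. Qed.

Lemma nrm_sub_diag f : nrm mu D (fun x => f x - f x) = 0.
Proof. by rewrite -[RHS](nrm0 mu D); congr (nrm mu D); apply/funext => x; rewrite subrr. Qed.

End InnerProduct.

Lemma le_eps_lin (R : realFieldType) (A B C : R) : (forall eta, 0 < eta -> eta <= 1 -> A <= B + eta * C) -> A <= B.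
Proof.
move=> h; rewrite leNgt; apply/negP => AB.
pose c := `|C| + 1; have c0 : 0 < c by rewrite ltr_wpDl.
pose t := (A - B) / (2 * c + (A - B)).
have AB0 : 0 < A - B by rewrite subr_gt0.
have D0 : 0 < 2 * c + (A - B) by rewrite addr_gt0// mulr_gt0.
have t0 : 0 < t by rewrite divr_gt0.
have t1 : t <= 1 by rewrite ler_pdivrMr// mul1r lerDr mulr_ge0// ltW.
have := h _ t0 t1; rewrite leNgt => /negP; apply.
rewrite -ltrBrDl; apply: (@le_lt_trans _ _ (t * c)).
  by rewrite ler_wpM2l ?(ltW t0)// (le_trans (ler_norm _))// lerDl.
rewrite /t mulrAC ltr_pdivrMr// ltr_pM2l//.
by move: c0 AB0; clear; move: (A - B) c => y c; lra.
Qed.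

Section Hardy.
Variables (R : realType) (d : nat).
Hypothesis d2 : (2 <= d)%N.
Local Notation Om := (half_space R d).
Local Notation mu := (leb R d.+1).
Let mO : measurable Om := @measurable_half R d.
Notation V := 'rV[R]_d.+1.

(** A regularised [1 / r^2]: the smooth functions approximating an [H^1] function need not vanish at
    the origin. *)
Definition wt (del : R) (x : V) : R := (dotp x x + del)^-1.

Section Weight.
Variable del : R.
Hypothesis del0 : 0 < del.

Let den_gt0 (x : V) : 0 < dotp x x + del. Proof. by rewrite ltr_wpDl// dotp_ge0. Qed.

Lemma wt_gt0 x : 0 < wt del x. Proof. by rewrite invr_gt0. Qed.

Lemma wt_le x : wt del x <= del^-1.
Proof. by rewrite lef_pV2 ?posrE// lerDr dotp_ge0. Qed.

Lemma wt_dotp x : dotp x x * wt del x <= 1.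
Proof. by rewrite ler_pdivrMr// mul1r lerDl ltW. Qed.

Lemma wt_pd (i : 'I_d.+1) : has_pd i (wt del) (fun x => - (2 * x ord0 i) * wt del x ^+ 2).
Proof.
move=> x; have h := dvD (dotp_pd i x) (dvC del x (evec R i)).
have den0 : dotp x x + del != 0 by rewrite gt_eqF.
have := dvV (f := fun y : V => dotp y y + del) den0 h; rewrite -/(wt del) addr0 => h'.
by apply: is_derive_eq h' _; rewrite /wt; field.
Qed.

Lemma wt_cont : continuous (wt del).
Proof.
rewrite (_ : wt del = (fun x => (dotp x x + del)^-1))// => x.
have h : continuous (fun y : V => dotp y y + del).
  by apply: contD; [exact: dotp_cont|exact: cst_continuous].
by apply: (continuousV _ (h x)); rewrite gt_eqF.
Qed.

Lemma hardy_pointwise (w F S g r2 : R) n : (3 <= n)%N -> 0 < w -> r2 * w <= 1 -> S ^+ 2 <= r2 * g ->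
  0 <= g -> 2^-1 * (w * F ^+ 2) - 2 * g <=
  n%:R * (w * F ^+ 2) - 2 * r2 * w ^+ 2 * F ^+ 2 + 2 * w * F * S.
Proof.
move=> n3 w0 rw hS g0.
have wF : 0 <= w * F ^+ 2 by rewrite mulr_ge0 ?sqr_ge0// ltW.
have h1 : 3 * (w * F ^+ 2) <= n%:R * (w * F ^+ 2) by rewrite ler_wpM2r// ler_nat.
have h2 : r2 * w * (w * F ^+ 2) <= w * F ^+ 2 by rewrite ler_piMl.
have h3 : w * S ^+ 2 <= g.
  apply: (@le_trans _ _ (r2 * w * g)); last by rewrite ler_piMl.
  by rewrite [r2 * w]mulrC -mulrA ler_wpM2l// ltW.
have h4 : 0 <= w * (F + 2 * S) ^+ 2 by rewrite mulr_ge0 ?sqr_ge0// ltW.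
have E1 : 2 * r2 * w ^+ 2 * F ^+ 2 = 2 * (r2 * w * (w * F ^+ 2)) by ring.
have E2 : w * (F + 2 * S) ^+ 2 = w * F ^+ 2 + 2 * (2 * w * F * S) + 4 * (w * S ^+ 2) by ring.
move: h4; rewrite E1 E2; move: (2 * w * F * S) (w * S ^+ 2) (r2 * w * (w * F ^+ 2)) h1 h2 h3 => A B C.
move: (n%:R * (w * F ^+ 2)) (w * F ^+ 2) wF => E G; lra.
Qed.

(** Divergence of the field [x wt f^2], which is tangential at the boundary and so leaves no
    boundary term. Pointwise, the dimension at least 3 outweighs the derivative of the weight, and
    the cross term is absorbed by the gradient. *)
Lemma hardy_cc (f : V -> R) : smooth f -> bsupp f ->
  \int[mu]_(x in Om) (wt del x * f x ^+ 2) <= 4 * \int[mu]_(x in Om) gradp f f x.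
Proof.
move=> sf bf; have cf := smooth_cont sf; have cdf i := @smooth_pd_cont R d.+1 i f sf.
have bdf i := bsupp_pd bf (smooth_has i sf).
have cw := wt_cont.
have cx (i : 'I_d.+1) : continuous (fun x : V => x ord0 i) by exact: coord_cont.
have cf2 : continuous (fun x => f x ^+ 2) by under eq_fun do rewrite expr2; exact: contM.
have cw2 : continuous (fun x => wt del x ^+ 2) by under eq_fun do rewrite expr2; exact: contM.
have cc (c : R) : continuous (fun _ : V => c) by exact: cst_continuous.
have bf2 : bsupp (fun x => f x ^+ 2) by under eq_fun do rewrite expr2; exact: bsuppMl.
pose Y i (x : V) := x ord0 i * (wt del x * f x ^+ 2).
pose dY i (x : V) := wt del x * f x ^+ 2 +
  x ord0 i * (- (2 * x ord0 i) * wt del x ^+ 2 * f x ^+ 2 + wt del x * (2 * f x * pd i f x)).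
have hY i : has_pd i (Y i) (dY i).
  have hx : has_pd i (fun x : V => x ord0 i) (fun=> 1).
    exact: (@has_pd_coord R d.+1 i id (fun=> 1) (fun t => is_derive_id t (1 : R))).
  have hf : has_pd i (fun x => f x ^+ 2) (fun x => 2 * f x * pd i f x).
    by move=> x; apply: is_derive_eq (dvX2 (smooth_has i sf x)) _; rewrite mulrA.
  by apply: has_pd_ext (has_pdM hx (has_pdM (wt_pd i) hf)) _ => x; rewrite /dY mul1r.
have cY i : continuous (Y i) by apply: contM => //; exact: contM.
have bY i : bsupp (Y i) by apply: bsuppMr; exact: bsuppMr.
have cdY i : continuous (dY i).
  apply: contD; first exact: contM.
  apply: contM => //; apply: contD.
    by apply: contM => //; apply: contM => //; apply: contN; exact: contM.
  by apply: contM => //; apply: contM => //; exact: contM.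
have bdY i : bsupp (dY i) := bsupp_pd (bY i) (hY i).
have I0 : \int[mu]_(x in Om) (\sum_i dY i x) = 0.
  rewrite Rintegral_sum//; last by move=> i; exact: cc_integrable.
  rewrite big1// => i _; have [->|im] := eqVneq i ord_max; last exact: (@ibp_half _ _ i (Y i)).
  rewrite (ibp_half_max (cY ord_max) (cdY _) (bY _) (hY _)).
  rewrite /Rintegral integral0_eq ?oppr0// => x _.
  by rewrite /Y /boundary_pt snoc_max mul0r.
have dYE x : \sum_i dY i x = d.+1%:R * (wt del x * f x ^+ 2) - 2 * dotp x x * wt del x ^+ 2 * f x ^+ 2 +
    2 * wt del x * f x * (\sum_i x ord0 i * pd i f x).
  rewrite /dY big_split/= sumr_const card_ord -[_ *+ d.+1]mulr_natl -addrA; congr (_ + _).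
  rewrite /dotp mulr_sumr !mulr_suml mulr_sumr -sumrN -big_split; apply: eq_bigr => i _ /=.
  by ring.
have iw : mu.-integrable Om (EFin \o (fun x => wt del x * f x ^+ 2)).
  by apply: cc_integrable => //; [exact: contM|exact: bsuppMr].
have cg : continuous (gradp f f) by apply: gradp_cont.
have ig : mu.-integrable Om (EFin \o gradp f f).
  by apply: cc_integrable => //; apply: bsupp_sum => i; exact: bsuppMl.
have E1 := RintegralZl 2^-1 mO iw; have E2 := RintegralZl 2 mO ig.
have I1 := integrableZR mO 2^-1 iw; have I2 := integrableZR mO 2 ig.
have E3 := RintegralB mO I1 I2.
have : \int[mu]_(x in Om) (2^-1 * (wt del x * f x ^+ 2) - 2 * gradp f f x) <= 0.
  rewrite -I0; apply: le_Rintegral => //.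
  - exact: integrableBR.
  - by apply: cc_integrable => //; [exact: cont_sum|exact: bsupp_sum].
  move=> x _; rewrite dYE; apply: hardy_pointwise => //; [exact: wt_gt0|exact: wt_dotp| |].
    rewrite (_ : gradp f f x = \sum_i pd i f x ^+ 2); last by apply: eq_bigr => i _; rewrite expr2.
    rewrite (_ : dotp x x = \sum_i x ord0 i ^+ 2); first exact: sum_CS.
    by apply: eq_bigr => i _; rewrite expr2.
  by apply: sumr_ge0 => i _; rewrite -expr2 sqr_ge0.
rewrite E3 E1 E2; move: (Rintegral _ _ _) (Rintegral _ _ _) => A B; lra.
Qed.

End Weight.

Lemma measurable_invr : measurable_fun Om (@invr R d.+1).
Proof.
rewrite (_ : @invr R d.+1 = (fun x => (enorm x) `^ (-1))); last first.
  by apply/funext => x; rewrite powR_inv1// enorm_ge0.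
apply: measurable_funTS.
apply: (@measurableT_comp _ _ _ _ _ _ (fun y : R => y `^ (-1))); first exact: measurable_powR.
exact: continuous_measurable_rV (@enorm_cont R d.+1).
Qed.

(** The regularised weights increase to [1 / r^2] as [del] decreases to 0, so monotone convergence
    yields both the integrability and the bound. *)
Lemma hardy_limit (f : V -> R) (B : R) : L2 mu Om f ->
  (forall del, 0 < del -> \int[mu]_(x in Om) (wt del x * f x ^+ 2) <= B) ->
  L2 mu Om (fun x => invr x * f x) /\ nrm mu Om (fun x => invr x * f x) ^+ 2 <= B.
Proof.
move=> Lf hB; have [mf if2] := Lf.
have mif : measurable_fun Om (fun x => invr x * f x).
  by apply: measurable_funM => //; exact: measurable_invr.
pose g (k : nat) (x : V) : R := wt k.+1%:R^-1 x * f x ^+ 2.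
have k0 (k : nat) : 0 < (k.+1%:R^-1 : R) by rewrite invr_gt0.
have mg k : measurable_fun Om (g k).
  apply: measurable_funM; last exact: measurable_funX.
  by apply: measurable_funTS; apply: continuous_measurable_rV; exact: wt_cont.
have g0 k x : 0 <= g k x by rewrite mulr_ge0 ?sqr_ge0// ltW// wt_gt0.
have ig k : mu.-integrable Om (EFin \o g k).
  apply: (@le_integrableR _ _ _ _ _ mO _ (fun x => k.+1%:R * f x ^+ 2)) => //.
    by move=> x _; rewrite ger0_norm// ler_wpM2r ?sqr_ge0// -[leRHS]invrK wt_le.
  exact: integrableZR.
have xlim x : Om x -> (fun k => (g k x)%:E) @ \oo --> ((invr x * f x) ^+ 2)%:E.
  move=> Ox; have x0 : x != 0.
    by apply: contraPneq Ox => ->; rewrite /half_space/= mxE ltxx.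
  apply: cvg_EFin; first by apply: nearW.
  rewrite exprMn; apply: cvgMl.
  have -> : invr x ^+ 2 = (dotp x x + 0)^-1.
    by rewrite addr0 /invr exprVn /enorm sqr_sqrtr// dotp_ge0.
  apply: cvgV; first by rewrite addr0 gt_eqF// dotp_gt0.
  by apply: cvgD; [exact: cvg_cst|exact: cvg_harmonic].
have xinc x : Om x -> {homo (fun k => (g k x)%:E) : n m / (n <= m)%N >-> (n <= m)%E}.
  move=> _ n m nm; rewrite lee_fin ler_wpM2r ?sqr_ge0// /wt lef_pV2 ?posrE ?ltr_wpDl ?dotp_ge0//.
  by rewrite lerD2l lef_pV2 ?posrE// ler_nat.
have C := @cvg_monotone_convergence _ _ _ mu Om mO (fun k x => (g k x)%:E)
  (fun k => (measurable_EFinP _ _).2 (mg k)) (fun k x _ => g0 k x) xinc.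
have E : (\int[mu]_(x in Om) ((invr x * f x) ^+ 2)%:E <= B%:E)%E.
  have -> : (\int[mu]_(x in Om) ((invr x * f x) ^+ 2)%:E =
      \int[mu]_(x in Om) (limn (fun k => (g k x)%:E)))%E.
    by apply: eq_integral => x /set_mem Ox; apply/esym/cvg_lim => //; exact: xlim.
  rewrite -(cvg_lim _ C)//; apply: lime_le; first by apply/cvg_ex; eexists; exact: C.
  apply: nearW => k; rewrite -(fineK (integrable_fin_num mO (ig k))) lee_fin.
  exact: (hB _ (k0 k)).
have i2 : mu.-integrable Om (EFin \o (fun x => (invr x * f x) ^+ 2)).
  apply/integrableP; split; first by apply/measurable_EFinP; exact: measurable_funX.
  rewrite (_ : (\int[mu]_(x in Om) _)%E = (\int[mu]_(x in Om) ((invr x * f x) ^+ 2)%:E)%E).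
    by apply: le_lt_trans E _; rewrite ltry.
  by apply: eq_integral => x _ /=; rewrite ger0_norm// sqr_ge0.
split => //; rewrite nrm_sq -lee_fin /Rintegral fineK//; exact: integrable_fin_num.
Qed.

Lemma gradp_int (f : V -> R) : (forall i, L2 mu Om (pd i f)) ->
  \int[mu]_(x in Om) gradp f f x = \sum_i nrm mu Om (pd i f) ^+ 2.
Proof.
move=> h; rewrite (Rintegral_sum mO); last by move=> i; exact: L2_mul.
by apply: eq_bigr => i _; rewrite -(ip_diag mu Om) ipE.
Qed.

Lemma hardy_eps (g eta : R) : 0 <= g -> 0 < eta -> eta <= 1 -> (g + eta) ^+ 2 <= g ^+ 2 + eta * (2 * g + 1).
Proof. by move=> g0 e0 e1; nra. Qed.

Lemma hardy_eps2 (a x y S T s eta : R) : 0 <= a -> a <= x + y -> 0 <= y -> x ^+ 2 <= 4 * (S + eta * T) -> 0 <= x ->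
  y <= s * eta -> 0 <= S -> 0 <= T -> 0 <= s -> 0 < eta -> eta <= 1 ->
  a ^+ 2 <= 4 * S + eta * (4 * T + 2 * (4 * (S + T) + 1) * s + s ^+ 2).
Proof.
move=> a0 axy y0 x2 x0 ys S0 T0 s0 e0 e1.
have eT : eta * T <= T by rewrite ler_piMl.
have x1 : x <= 4 * (S + T) + 1 by nra.
have xy : x * y <= (4 * (S + T) + 1) * (s * eta) by exact: ler_pM.
have yy : y ^+ 2 <= (s * eta) ^+ 2 by rewrite lerXn2r ?nnegrE// (le_trans y0).
have ss : (s * eta) ^+ 2 <= s ^+ 2 * eta.
  by rewrite exprMn ler_wpM2l ?sqr_ge0// expr2 ler_piMl// ltW.
have : a ^+ 2 <= (x + y) ^+ 2 by rewrite lerXn2r ?nnegrE// addr_ge0.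
rewrite sqrrD mulr2n; move: x2 xy yy ss.
move: (x * y) (y ^+ 2) (x ^+ 2) (a ^+ 2) (s ^+ 2) ((s * eta) ^+ 2) => p q r t v z.
lra.
Qed.

Lemma hardy_H1 (u : V -> R) (G : 'I_d.+1 -> V -> R) : L2 mu Om u -> (forall i, L2 mu Om (G i)) ->
  (forall eta, 0 < eta -> exists phi, [/\ smooth phi, bsupp phi,
     nrm mu Om (fun x => phi x - u x) <= eta &
     forall i, nrm mu Om (fun x => pd i phi x - G i x) <= eta]) ->
  L2 mu Om (fun x => invr x * u x) /\
  nrm mu Om (fun x => invr x * u x) ^+ 2 <= 4 * \sum_i nrm mu Om (G i) ^+ 2.
Proof.
move=> Lu LG AP; apply: hardy_limit => // del del0.
pose s x := Num.sqrt (wt del x); pose s0 := Num.sqrt del^-1.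
have s2 x : s x ^+ 2 = wt del x by rewrite sqr_sqrtr// ltW// wt_gt0.
have ms : measurable_fun Om s.
  apply: measurable_funTS; apply: continuous_measurable_rV => x.
  apply: (@continuous_comp _ _ _ (wt del) Num.sqrt); first exact: wt_cont.
  exact: sqrt_continuous.
have sb x : Om x -> `|s x| <= s0.
  by move=> _; rewrite ger0_norm ?sqrtr_ge0// ler_wsqrtr// wt_le.
have Lsu := L2_bd mO ms sb Lu.
have -> : \int[mu]_(x in Om) (wt del x * u x ^+ 2) = nrm mu Om (fun x => s x * u x) ^+ 2.
  by rewrite nrm_sq; apply: eq_Rintegral => x _; rewrite exprMn s2.
pose S := \sum_i nrm mu Om (G i) ^+ 2; pose T := \sum_i (2 * nrm mu Om (G i) + 1).
have S0 : 0 <= S by apply: sumr_ge0 => i _; exact: sqr_ge0.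
have T0 : 0 <= T by apply: sumr_ge0 => i _; rewrite addr_ge0// mulr_ge0// nrm_ge0.
apply: (@le_eps_lin _ _ _ (4 * T + 2 * (4 * (S + T) + 1) * s0 + s0 ^+ 2)) => eta e0 e1.
have [phi [sp bp h1 h2]] := AP _ e0.
have Lp : L2 mu Om phi by apply: cc_L2 => //; exact: smooth_cont.
have Ldp i : L2 mu Om (pd i phi).
  by apply: cc_L2 => //; [exact: smooth_pd_cont|exact: bsupp_pd bp (smooth_has i sp)].
have Lsp := L2_bd mO ms sb Lp.
have LpB := L2B mO Lp Lu; have LsB := L2_bd mO ms sb LpB.
apply: (@hardy_eps2 _ (nrm mu Om (fun x => s x * phi x)) (nrm mu Om (fun x => s x * (phi x - u x)))) => //;
  rewrite ?nrm_ge0 ?sqrtr_ge0//.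
- apply: le_trans (nrmB mO Lsp LsB); apply: nrm_le => //; first exact: L2B.
  by move=> x _; rewrite (_ : s x * phi x - _ = s x * u x)//; ring.
- have -> : nrm mu Om (fun x => s x * phi x) ^+ 2 = \int[mu]_(x in Om) (wt del x * phi x ^+ 2).
    by rewrite nrm_sq; apply: eq_Rintegral => x _; rewrite exprMn s2.
  apply: le_trans (hardy_cc del0 sp bp) _; rewrite gradp_int// ler_wpM2l//.
  rewrite /S /T mulr_sumr -big_split; apply: ler_sum => i _ /=.
  apply: le_trans (hardy_eps _ e0 e1); rewrite ?nrm_ge0//.
  rewrite lerXn2r ?nnegrE ?addr_ge0 ?nrm_ge0 ?(ltW e0)//.
  by apply: le_trans (nrm_close mO (Ldp i) (LG i)) _; rewrite lerD2l.
apply: (@le_trans _ _ (nrm mu Om (fun x => s0 * (phi x - u x)))).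
  apply: nrm_le => //; first exact: L2Z.
  by move=> x Ox; rewrite !normrM ler_wpM2r// (le_trans (sb x Ox)) ?ler_norm.
by rewrite nrmZ// ger0_norm ?sqrtr_ge0// ler_wpM2l// sqrtr_ge0.
Qed.

End Hardy.

Section CleanEstimate.
Variables (R : realType) (d : nat).
Hypothesis d2 : (2 <= d)%N.
Local Notation Om := (half_space R d).
Local Notation mu := (leb R d.+1).
Local Notation nm := (nrm mu Om).
Let mO : measurable Om := @measurable_half R d.
Notation V := 'rV[R]_d.+1.

Definition Kc : R := 21 + 16 * d%:R ^+ 2.

Lemma Kc_ge1 : 1 <= Kc.
Proof. by rewrite /Kc; have := sqr_ge0 (d%:R : R); lra. Qed.

Lemma Zc_L2 (f : V -> R) : Zc f -> L2 mu Om f.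
Proof. by case=> cf vf bf; apply: cc_L2 => //; exact: vz_cont. Qed.

Lemma adm_nice (p : V -> R) : adm p -> nice p. Proof. by case. Qed.
Lemma adm_bsupp (p : V -> R) : adm p -> bsupp p. Proof. by case. Qed.

Lemma adm_pd_Zc i (p : V -> R) : adm p -> Zc (pd i p).
Proof. by case=> n v s _; exact: (nice_Zc (nice_pd i n) (nice_vz_pd i n v) (nice_bsupp_pd i n s)). Qed.

Lemma adm_lap_Zc (p : V -> R) : adm p -> Zc (lap p).
Proof.
case=> n v s _; apply: Zc_sum => i; apply: (nice_Zc (nice_pd i (nice_pd i n))).
  exact: nice_vz_pd (nice_pd i n) (nice_vz_pd i n v).
exact: nice_bsupp_pd (nice_pd i n) (nice_bsupp_pd i n s).
Qed.

Lemma Zc_scale (c : R) (f : V -> R) : Zc f -> Zc (fun x => c * f x).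
Proof. by move=> zf; apply: ZcMr => //; apply: CzE; exact: cst_continuous. Qed.

Lemma adm_res (m e : R) (p q : V -> R) : adm p -> adm q -> Zc (res1 m e p q) /\ Zc (res2 m e p q).
Proof.
move=> hp hq; have zp := adm_Zc hp; have zq := adm_Zc hq.
have lp := adm_lap_Zc hp; have lq := adm_lap_Zc hq.
have zN (f g : V -> R) : Zc f -> Zc g -> Zc (fun x => f x - g x).
  by move=> h1 h2; apply: ZcD => //; exact: ZcN.
split; rewrite /res1 /res2.
- by apply: ZcD; [apply: (zN (fun x => - lap p x)); [exact: ZcN|exact: Zc_scale]|exact: Zc_scale].
- by apply: (zN (fun x => - lap q x - m * q x));
    [apply: (zN (fun x => - lap q x)); [exact: ZcN|exact: Zc_scale]|exact: Zc_scale].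
Qed.

Lemma Zc_enorm (f : V -> R) : Zc f -> Zc (fun x => enorm x * f x).
Proof. by move=> zf; apply: ZcMr => //; apply: CzE; exact: enorm_cont. Qed.

Lemma Zc_invr (f : V -> R) : Zc f -> Zc (fun x => invr x * f x).
Proof. by move=> zf; apply: ZcMr => //; exact: Cz_invr. Qed.

Lemma neumann_est (m e : R) (p q : V -> R) (Phi := nm (fun x => enorm x * res1 m e p q x) ^+ 2 +
    nm (fun x => enorm x * res2 m e p q x) ^+ 2) :
  e != 0 -> `|e| <= m -> adm p -> adm q ->
  [/\ nm (fun x => invr x * p x) ^+ 2 + nm (fun x => invr x * q x) ^+ 2 <= 4 * Kc * Phi,
      \int[leb R d]_x (invr (boundary_pt x) * (p (boundary_pt x) ^+ 2 + q (boundary_pt x) ^+ 2)) <=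
        9 * Kc * Phi,
      `|e| * (nm p ^+ 2 + nm q ^+ 2) <= (Kc + 1) * Phi &
      \sum_i (nm (pd i p) ^+ 2 + nm (pd i q) ^+ 2) <= 2 * Kc * Phi + 2 * m * (nm p ^+ 2 + nm q ^+ 2)].
Proof.
move=> e0 em hp hq.
have m0 : 0 < m by apply: lt_le_trans em; rewrite normr_gt0.
have sm0 : 0 < Num.sqrt m by rewrite sqrtr_gt0.
(* The phase takes the sign of [e], so that [c k = e] with [c > 0]: the damping term of the
   multiplier then has the right sign for both signs of [e]. *)
pose k := Num.sg e * Num.sqrt m; pose c := `|e| / Num.sqrt m.
have k2 : k ^+ 2 = m by rewrite exprMn sqr_sg e0 mul1r sqr_sqrtr// ltW.
have k0 : k != 0 by rewrite mulf_neq0 ?sgr_eq0// gt_eqF.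
have c0 : 0 < c by rewrite divr_gt0// normr_gt0.
have ck : c * k = e.
  by rewrite /c /k [_ / _ * _]mulrC -mulrA [Num.sqrt m * _]mulrC divfK ?gt_eqF// -numEsg.
have ek : `|e| <= k ^+ 2 by rewrite k2.
have [np vp sp p0] := hp; have [nq vq sq q0] := hq.
have [] := neumann_estimate d2 np nq vp vq sp sq p0 q0 k0 c0 ck ek.
rewrite k2 /= -/Kc.
have [r1 r2] := adm_res m e hp hq.
have Lp := Zc_L2 (adm_Zc hp); have Lq := Zc_L2 (adm_Zc hq).
have PhiE : \int[mu]_(x in Om) (enorm x ^+ 2 * ((- lap p x - m * p x + e * q x) ^+ 2 +
    (- lap q x - m * q x - e * p x) ^+ 2)) = Phi.
  rewrite /Phi -(nrm_sum_sq mO (Zc_L2 (Zc_enorm r1)) (Zc_L2 (Zc_enorm r2))).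
  by apply: eq_Rintegral => x _; rewrite !exprMn -mulrDr.
have iE : \int[mu]_(x in Om) (invr x ^+ 2 * (p x ^+ 2 + q x ^+ 2)) =
    nm (fun x => invr x * p x) ^+ 2 + nm (fun x => invr x * q x) ^+ 2.
  rewrite -(nrm_sum_sq mO (Zc_L2 (Zc_invr (adm_Zc hp))) (Zc_L2 (Zc_invr (adm_Zc hq)))).
  by apply: eq_Rintegral => x _; rewrite !exprMn -mulrDr.
have WE := nrm_sum_sq mO Lp Lq.
have Ldp i := Zc_L2 (adm_pd_Zc i hp); have Ldq i := Zc_L2 (adm_pd_Zc i hq).
have GE : \int[mu]_(x in Om) (\sum_i (pd i p x ^+ 2 + pd i q x ^+ 2)) =
    \sum_i (nm (pd i p) ^+ 2 + nm (pd i q) ^+ 2).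
  rewrite (Rintegral_sum mO); last first.
    by move=> i; apply: integrableDR => //; exact: L2_sq.
  by apply: eq_bigr => i _; exact: nrm_sum_sq.
by rewrite PhiE iE WE GE.
Qed.

End CleanEstimate.

(** * Elementary inequalities for the resolvent estimate *)

Section Estimates.
Variable R : realType.

(** The left side is the real part of [(x + i y) (t + i s) conj (p + i q)]. From [|y| <= x] one gets
    [|x + i y|^2 <= 2 x^2], and this 2 is split between the weights [kap / 2] and [kap^-1]. *)
Lemma bd_young (kap x y p q t s : R) : 0 < kap -> `|y| <= x ->
  (x * t - y * s) * p + (x * s + y * t) * q <=
  kap / 2 * (x * (t ^+ 2 + s ^+ 2)) + kap^-1 * (x * (p ^+ 2 + q ^+ 2)).
Proof.
move=> k0; rewrite ler_norml => /andP[y1 y2].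
pose X := t * p + s * q; pose Y := t * q - s * p.
have -> : (x * t - y * s) * p + (x * s + y * t) * q = x * X + y * Y by rewrite /X /Y; ring.
pose P := p ^+ 2 + q ^+ 2; pose T := t ^+ 2 + s ^+ 2.
have XY : X ^+ 2 + Y ^+ 2 = T * P by rewrite /X /Y /T /P; ring.
have yy : y ^+ 2 <= x ^+ 2 by nra.
have x0 : 0 <= x by lra.
have T0 : 0 <= T by rewrite addr_ge0 ?sqr_ge0.
have P0 : 0 <= P by rewrite addr_ge0 ?sqr_ge0.
have xP : 0 <= kap^-1 * (x * P) by rewrite mulr_ge0 ?mulr_ge0// invr_ge0 ltW.
have xT : 0 <= kap / 2 * (x * T) by rewrite mulr_ge0 ?mulr_ge0 ?invr_ge0// ltW.
apply: (le_trans (ler_norm _)); rewrite -(@ler_pXn2r _ 2)// ?nnegrE ?addr_ge0//.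
rewrite real_normK ?num_real//.
have h1 : (x * X + y * Y) ^+ 2 <= 2 * x ^+ 2 * (T * P).
  rewrite -XY; apply: (@le_trans _ _ ((x ^+ 2 + y ^+ 2) * (X ^+ 2 + Y ^+ 2))).
    by rewrite -subr_ge0 (_ : _ - _ = (x * Y - y * X) ^+ 2) ?sqr_ge0//; ring.
  by rewrite ler_wpM2r ?addr_ge0 ?sqr_ge0// mulr_natl mulr2n lerD2l.
apply: (le_trans h1).
have -> : 2 * x ^+ 2 * (T * P) = 4 * ((kap / 2 * (x * T)) * (kap^-1 * (x * P))).
  by field; rewrite gt_eqF.
move: (kap / 2 * (x * T)) (kap^-1 * (x * P)) => r s'.
by rewrite -subr_ge0 (_ : _ - _ = (r - s') ^+ 2) ?sqr_ge0//; ring.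
Qed.

Lemma sq3 (x y z eta : R) : 0 <= x -> x <= y + z + eta -> 0 <= y -> 0 <= z -> 0 <= eta ->
  x ^+ 2 <= 3 * (y ^+ 2 + z ^+ 2 + eta ^+ 2).
Proof.
move=> x0 h y0 z0 e0; apply: (@le_trans _ _ ((y + z + eta) ^+ 2)).
  by rewrite lerXn2r ?nnegrE// !addr_ge0.
have := sqr_ge0 (y - z); have := sqr_ge0 (y - eta); have := sqr_ge0 (z - eta).
by rewrite !expr2; nra.
Qed.

Lemma form_error (x y z : R) (N : nat) (m e eta B S A0 A1 bb b' u v u' v' s : R) :
  0 <= A1 - m * u' + e * v' - x -> `|A1 - A0| <= N%:R * (2 * (eta * B)) ->
  `|u' - u| <= 2 * (eta * B) -> `|v' - v| <= 2 * (eta * B) -> `|bb - (s - b')| <= 2 * eta * S ->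
  A0 + bb = y + z ->
  s <= b' + (y + z - m * u + e * v - x) + eta * (N%:R * (2 * B) + `|m| * (2 * B) + `|e| * (2 * B) + 2 * S).
Proof.
move=> h hA hu hv hb E.
have hm : - (m * (u' - u)) <= `|m| * (2 * (eta * B)).
  by apply: le_trans (ler_norm _) _; rewrite normrN normrM ler_wpM2l.
have he : e * (v' - v) <= `|e| * (2 * (eta * B)).
  by apply: le_trans (ler_norm _) _; rewrite normrM ler_wpM2l.
have hA' := le_trans (ler_norm _) hA.
have hb' := le_trans (ler_norm _) hb; rewrite distrC in hb; have hb'' := le_trans (ler_norm _) hb.
have -> : eta * (N%:R * (2 * B) + `|m| * (2 * B) + `|e| * (2 * B) + 2 * S) =
  N%:R * (2 * (eta * B)) + `|m| * (2 * (eta * B)) + `|e| * (2 * (eta * B)) + 2 * eta * S by ring.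
move: hm he h; rewrite !mulrBr.
move: (N%:R * _) (`|m| * _) (`|e| * _) (2 * eta * S) (m * u') (m * u) (e * v') (e * v) hA' hb' hb''.
move=> c1 c2 c3 c4 c5 c6 c7 c8 h1 h2 h3 h4 h5 h6; lra.
Qed.

Lemma add_sq3 (x y z x' y' z' c e : R) : x <= 3 * (y + z + e) -> x' <= 3 * (y' + z' + e) ->
  c = 2 * e -> x + x' <= 3 * (y + y' + (z + z') + c).
Proof. by move=> h1 h2 ->; move: h1 h2; lra. Qed.

Lemma energy_sum (N : nat) (X Y Z U W T e : R) : X <= 3 * (Y + Z + 2 * e) ->
  U <= 3 * (W + T + N%:R * (2 * e)) -> (N%:R + 1) * 2 * e <= 1 ->
  X + U <= 3 * (Y + W + (Z + T) + 1).
Proof. by move: (N%:R : R) => n; nra. Qed.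

Lemma sq_bd (x y Z : R) : 0 <= x -> 0 <= y -> x ^+ 2 + y ^+ 2 <= Z -> x <= 1 + Z /\ y <= 1 + Z.
Proof.
move=> x0 y0 h; have := sqr_ge0 (x - 1); have := sqr_ge0 (y - 1).
by rewrite !expr2 in h *; split; nra.
Qed.

Lemma form_alg (l e A' b' y1 y2 c1 c2 c3 c4 c5 c6 c7 c8 : R) :
  0 <= y1 + A' + (y2 + b') - l * (c1 - c2 + (c3 - c4)) + e * (c5 - c6 - (c7 - c8)) ->
  0 <= y1 + y2 - l * (c1 + c3) + e * (c5 - c7) - (- A' - l * c2 + e * c6 + (- b' - l * c4 - e * c8)).
Proof. by move=> h; apply: le_trans h _; rewrite le_eqVlt; apply/orP; left; apply/eqP; ring. Qed.

Lemma test_alg (eta X tau y1 y2 y3 y4 y5 l l' e x : R) : eta * X <= tau ->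
  y1 + (y2 + (l * y3 + l' * (y5 - y4)) - l * y3 + e * (y4 - y5) - x) + eta * X <=
  y1 + (y2 - x) + (e - l') * (y4 - y5) + tau.
Proof.
move=> h; have -> : y1 + (y2 + (l * y3 + l' * (y5 - y4)) - l * y3 + e * (y4 - y5) - x) =
  y1 + (y2 - x) + (e - l') * (y4 - y5) by ring.
by rewrite lerD2l.
Qed.

Lemma phi_bound (n1 n2 g x y : R) : 0 <= x -> 0 <= y -> x <= n1 + 2 * g -> y <= n2 + 2 * g -> 0 <= n1 -> 0 <= n2 ->
  0 < g -> g <= 1 -> x ^+ 2 + y ^+ 2 <= n1 ^+ 2 + n2 ^+ 2 + g * (4 * (n1 + n2) + 8).
Proof.
move=> x0 y0 hx hy m1 m2 g0 g1.
have hx2 : x ^+ 2 <= (n1 + 2 * g) ^+ 2 by rewrite lerXn2r ?nnegrE// (le_trans x0).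
have hy2 : y ^+ 2 <= (n2 + 2 * g) ^+ 2 by rewrite lerXn2r ?nnegrE// (le_trans y0).
have gg : g ^+ 2 <= g by rewrite expr2 ler_piMl// ltW.
apply: le_trans (lerD hx2 hy2) _; rewrite !expr2 in gg *; nra.
Qed.

(** Only [|e| |w|^2] is bounded uniformly, so the energy [E] may grow as [e] tends to 0; but
    [eps <= |e|], and [eps E] stays below a [Q] independent of [eps]. *)
Lemma energy_bound (eps E Eu W Gr K P Phi m ae Q : R) : 0 < eps -> eps <= 1 -> eps <= ae -> 0 <= W -> 0 <= m ->
  1 <= K -> 0 <= Phi -> Phi <= P -> 0 <= Eu ->
  E = 3 * (Eu + (W + Gr) + 1) -> ae * W <= (K + 1) * Phi -> Gr <= 2 * K * Phi + 2 * m * W ->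
  Q = 3 * (Eu + 1 + (1 + 2 * m) * ((K + 1) * P) + 2 * K * P) -> eps * E <= Q.
Proof.
move=> e0 e1 ea W0 m0 K1 F0 FP Eu0 -> hW hG ->.
have h1 : eps * W <= (K + 1) * P.
  apply: (@le_trans _ _ (ae * W)); first by rewrite ler_wpM2r.
  by apply: le_trans hW _; rewrite ler_wpM2l// addr_ge0// (le_trans _ K1).
have h2 : eps * Eu <= Eu by rewrite ler_piMl.
have h3 : eps * Gr <= 2 * K * P + 2 * m * (eps * W).
  apply: (@le_trans _ _ (eps * (2 * K * Phi + 2 * m * W))); first by rewrite ler_wpM2l// ltW.
  have KF0 : 0 <= 2 * K * Phi by rewrite mulr_ge0// mulr_ge0// (le_trans _ K1).
  rewrite mulrDr [eps * (2 * m * W)]mulrCA lerD2r; apply: (@le_trans _ _ (2 * K * Phi)).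
    by rewrite ler_piMl.
  by rewrite ler_wpM2l// mulr_ge0// (le_trans _ K1).
have h4 : 2 * m * (eps * W) <= 2 * m * ((K + 1) * P) by rewrite ler_wpM2l// mulr_ge0.
rewrite mulrCA ler_wpM2l// !mulrDr mulr1; clear -h1 h2 h3 h4 e1.
move: (eps * W) (eps * Eu) (eps * Gr) ((K + 1) * P) (K * P) h1 h2 h3 h4 => x y z w k.
by rewrite [(1 + _) * w]mulrDl mul1r -!mulrA; move: (m * x) (m * w) => c1 c2; lra.
Qed.

Lemma small_v (eps Mc ae E Q m x y : R) : 0 < eps -> eps <= ae -> 0 <= x -> 0 <= y -> x ^+ 2 + y ^+ 2 <= Mc / ae * E ->
  0 <= E -> eps * E <= Q -> 0 <= Mc -> Mc <= m -> eps * x <= 1 + m * Q /\ eps * y <= 1 + m * Q.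
Proof.
move=> e0 ea x0 y0 h E0 EQ M0 Mm.
apply: sq_bd; rewrite ?mulr_ge0 ?(ltW e0)// !exprMn -mulrDr.
have a0 : 0 < ae by apply: lt_le_trans ea.
apply: (@le_trans _ _ (eps ^+ 2 * (Mc / ae * E))); first by rewrite ler_wpM2l ?sqr_ge0.
have -> : eps ^+ 2 * (Mc / ae * E) = (eps / ae) * (Mc * (eps * E)) by rewrite expr2; field; rewrite gt_eqF.
have eE : 0 <= eps * E by rewrite mulr_ge0 ?(ltW e0).
apply: (@le_trans _ _ (Mc * (eps * E))); last by rewrite ler_pM.
by rewrite ler_piMl; [|exact: mulr_ge0|rewrite ler_pdivrMr// mul1r].
Qed.

Lemma trace_final (g b K N2 Y x bd d1 d2' d3 d4 F I0 : R) : x <= bd + (d1 + d2' + (d3 + d4)) + g ->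
  bd <= 1 / 2 * x + 1^-1 * (b * I0) -> I0 <= 9 * K * F -> d1 <= g -> d2' <= g -> d3 <= g -> d4 <= g ->
  0 <= b -> 0 <= K -> F <= N2 + g * Y -> x <= 18 * b * K * N2 + g * (18 * b * K * Y + 10).
Proof.
move=> h1 h2 h3 e1 e2 e3 e4 b0 K0 hF.
have h4 : b * I0 <= b * (9 * K * F) by rewrite ler_wpM2l.
have h5 : b * (9 * K * F) <= b * (9 * K * (N2 + g * Y)).
  by rewrite ler_wpM2l// ler_wpM2l// mulr_ge0.
have E1 : 18 * b * K * N2 + g * (18 * b * K * Y + 10) = 2 * (b * (9 * K * (N2 + g * Y))) + 10 * g by ring.
rewrite E1; move: h2; rewrite invr1 mul1r.
move: (b * I0) (b * (9 * K * F)) (b * (9 * K * (N2 + g * Y))) h4 h5 => y1 y2 y3; clear -h1 e1 e2 e3 e4; lra.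
Qed.

(** The weight [1 / (32 K)] is chosen against the Hardy bound [4 K Phi] of [neumann_est], leaving
    [Phi / 8]. *)
Lemma cross_term (K x A' B' : R) : 1 <= K -> x <= A' * B' ->
  x <= 8 * K * A' ^+ 2 + (32 * K)^-1 * B' ^+ 2.
Proof.
move=> K1 h; apply: (le_trans h); have K0 : 0 < K by apply: lt_le_trans K1.
rewrite -subr_ge0 (_ : _ - _ = (8 * K) * (A' - (16 * K)^-1 * B') ^+ 2); last by field; rewrite gt_eqF.
by rewrite mulr_ge0 ?sqr_ge0// mulr_ge0// ltW.
Qed.

Lemma eps_term (eps ae W K P g U x y : R) : 0 < eps -> eps <= ae -> 0 <= x -> 0 <= y -> x ^+ 2 + y ^+ 2 = W ->
  ae * W <= K * P -> 0 < U -> 0 < g -> eps * (K * P + 1) <= (g / U) ^+ 2 ->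
  eps * x <= g / U /\ eps * y <= g / U.
Proof.
move=> e0 ea x0 y0 <- hW U0 g0 h.
have gU : 0 <= g / U by rewrite divr_ge0// ltW.
have k : eps ^+ 2 * (x ^+ 2 + y ^+ 2) <= (g / U) ^+ 2.
  apply: le_trans h; rewrite expr2 -mulrA ler_wpM2l ?(ltW e0)//.
  apply: (@le_trans _ _ (ae * (x ^+ 2 + y ^+ 2))); first by rewrite ler_wpM2r// addr_ge0 ?sqr_ge0.
  by apply: le_trans hW _; rewrite lerDl.
by split; rewrite -(@ler_pXn2r _ 2)// ?nnegrE ?mulr_ge0 ?(ltW e0)// exprMn;
  apply: le_trans k; rewrite ler_wpM2l ?sqr_ge0// ?lerDl ?lerDr ?sqr_ge0.
Qed.

(** Interior and boundary terms contribute [F / 8] each; since [F] is [V1^2 + V2^2] up to a multiple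
    of [g], a quarter is absorbed on the left, whence the factor [4 / 3]. *)
Lemma duality_final (K V1 V2 n1 n2 x1 x2 bd T I0 F g kap b a' N2 : R) :
  V1 ^+ 2 + V2 ^+ 2 <= x1 + x2 + bd + T + g * (V1 + V2) ->
  x1 <= 8 * K * n1 ^+ 2 + (32 * K)^-1 * I0 -> x2 <= 8 * K * n2 ^+ 2 + (32 * K)^-1 * (4 * K * F - I0) ->
  N2 = n1 ^+ 2 + n2 ^+ 2 -> T <= 2 * g -> a' <= 18 * b * K * N2 ->
  bd <= kap / 2 * a' + 8^-1 * F -> 0 < kap -> 1 <= K ->
  F <= V1 ^+ 2 + V2 ^+ 2 + g * (4 * (V1 + V2) + 8) ->
  V1 ^+ 2 + V2 ^+ 2 <= 4 / 3 * (8 * K + 9 * (kap * (b * K))) * N2 +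
    g * (4 / 3 * (2 + 2 * (V1 + V2) + 2)).
Proof.
move=> h1 h2 h3 EN hT ha hb k0 K1 hF; have K0 : 0 < K by apply: lt_le_trans K1.
have e1 : x1 + x2 <= 8 * K * N2 + 8^-1 * F.
  apply: le_trans (lerD h2 h3) _; rewrite EN le_eqVlt; apply/orP; left; apply/eqP.
  by field; rewrite gt_eqF.
have e2 : kap / 2 * a' <= 9 * (kap * (b * K)) * N2.
  apply: (@le_trans _ _ (kap / 2 * (18 * b * K * N2))); first by rewrite ler_wpM2l// divr_ge0// ltW.
  by rewrite le_eqVlt; apply/orP; left; apply/eqP; field.
move: h1 e1 hb e2 hF hT; rewrite -[4 / 3 * _ * N2]mulrA [(_ + _) * N2]mulrDl.
move: (V1 ^+ 2 + V2 ^+ 2) (8 * K * N2) (9 * (kap * (b * K)) * N2) (kap / 2 * a') => s c1 c2 c3.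
clear; lra.
Qed.

Lemma kap_le (b K : R) : 9 * b * K <= 8^-1 * (72 * b * K + 1).
Proof. by rewrite -!mulrA; move: (b * K) => x; lra. Qed.

Lemma dual_alg (l m e x1 x2 p1 p2 q1 q2 bd f1 f2 r1 r2 : R) :
  - x1 + - x2 + bd = f1 + f2 + m * (p1 + q2) + l * (q1 - p2) ->
  r1 = - x1 - m * p1 + e * q1 -> r2 = - x2 - m * q2 - e * p2 ->
  r1 + r2 = f1 + f2 + (-1) * bd + (l + e) * (q1 - p2).
Proof.
move=> h -> ->; have -> : - x1 = f1 + f2 + m * (p1 + q2) + l * (q1 - p2) + x2 - bd by rewrite -h; ring.
by ring.
Qed.

Lemma energy_alg (S a' B l1 l2 al W sg f11 f22 f21 f12 n1 n2 V1 V2 : R) :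
  S + a' = f11 + f22 + l1 * W -> B = f21 - f12 + l2 * W -> sg * l2 = al -> sg * B <= a' ->
  f11 <= n1 * V1 -> f22 <= n2 * V2 -> - (sg * (f21 - f12)) <= n2 * V1 + n1 * V2 ->
  (l1 - al) * W <= 0 -> 0 <= n1 -> 0 <= n2 -> V1 ^+ 2 + V2 ^+ 2 <= 4 * S ->
  V1 ^+ 2 + V2 ^+ 2 <= 64 * (n1 ^+ 2 + n2 ^+ 2).
Proof.
move=> e1 -> <- h h1 h2 h3 hW n10 n20 hV.
have hS : S <= (n1 + n2) * (V1 + V2).
  have -> : S = f11 + f22 - (sg * (f21 - f12)) + (l1 - sg * l2) * W + (sg * (f21 - f12 + l2 * W) - a').
    by rewrite -[S](addrK a') e1; ring.
  have -> : (n1 + n2) * (V1 + V2) = n1 * V1 + n2 * V2 + (n2 * V1 + n1 * V2) by ring.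
  move: h1 h2 h3 hW h; move: (n1 * V1) (n2 * V2) (n2 * V1 + _) (sg * _) (sg * _) (_ * W) => *; lra.
have := sqr_ge0 (4 * n1 - 4 * n2); have := sqr_ge0 (V1 - V2).
have := sqr_ge0 (8 * (n1 + n2) - (V1 + V2)).
by rewrite !expr2 in hV *; nra.
Qed.

End Estimates.

Opaque nrm.
Local Arguments leb : simpl never.

(** * The resolvent estimate for real and imaginary parts *)

Section Robin.
Variables (R : realType) (d : nat).
Hypothesis d2 : (2 <= d)%N.
Local Notation Om := (half_space R d).
Local Notation mu := (leb R d.+1).
Local Notation mu' := (leb R d).
Let mO : measurable Om := @measurable_half R d.
Let mT : @measurable _ 'rV[R]_d setT := measurableT.
Notation V := 'rV[R]_d.+1.
Local Notation nm := (nrm mu Om).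
Local Notation nb := (nrm mu' setT).
Local Notation L := (L2 mu Om).
Local Notation "<< f , g >>" := (ip mu Om f g).
Local Notation "<| f , g |>" := (ip mu' setT f g).
Local Notation tr v := (fun x : 'rV[R]_d => v (boundary_pt x)).
Variables (l1 l2 A b1 : R) (a b t1 t2 : 'rV[R]_d -> R) (u1 u2 f1 f2 : V -> R) (G1 G2 : 'I_d.+1 -> V -> R).
Hypotheses (Lu1 : L u1) (Lu2 : L u2) (LG1 : forall i, L (G1 i)) (LG2 : forall i, L (G2 i)).
Hypotheses (Lt1 : L2 mu' setT t1) (Lt2 : L2 mu' setT t2) (Lf1 : L f1) (Lf2 : L f2).
Hypotheses (Lrf1 : L (fun x => enorm x * f1 x)) (Lrf2 : L (fun x => enorm x * f2 x)).
Hypotheses (ma : measurable_fun setT a) (mb : measurable_fun setT b).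
Hypotheses (aA : forall x, a x <= A) (ab : forall x, `|b x| <= a x).
Hypotheses (ab1 : forall x, enorm x * a x <= b1).
Let s1 x := a x * t1 x - b x * t2 x.
Let s2 x := a x * t2 x + b x * t1 x.
Hypothesis approx : forall eta, 0 < eta -> exists phi1 phi2 : V -> R,
  [/\ [/\ smooth phi1, bsupp phi1, smooth phi2 & bsupp phi2],
      nm (fun x => phi1 x - u1 x) <= eta /\ nm (fun x => phi2 x - u2 x) <= eta,
      forall i, nm (fun x => pd i phi1 x - G1 i x) <= eta /\ nm (fun x => pd i phi2 x - G2 i x) <= eta &
      nb (fun x => phi1 (boundary_pt x) - t1 x) <= eta /\ nb (fun x => phi2 (boundary_pt x) - t2 x) <= eta].
Hypothesis weak : forall v1 v2 : V -> R, nice v1 -> bsupp v1 -> nice v2 -> bsupp v2 ->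
  \sum_i (<<G1 i, pd i v1>> + <<G2 i, pd i v2>>) + (<|s1, tr v1|> + <|s2, tr v2|>) =
  <<f1, v1>> + <<f2, v2>> + l1 * (<<u1, v1>> + <<u2, v2>>) + l2 * (<<u1, v2>> - <<u2, v1>>).

Let a0 x : 0 <= a x. Proof. exact: le_trans (ab x). Qed.
Let na x : `|a x| <= A. Proof. by rewrite ger0_norm. Qed.
Let nb' x : `|b x| <= A. Proof. exact: le_trans (ab x) (aA x). Qed.

Let Ls1 : L2 mu' setT s1.
Proof. by apply: (L2B mT); exact: (L2_bd mT _ (fun x _ => _)). Qed.

Let Ls2 : L2 mu' setT s2.
Proof. by apply: (L2D mT); exact: (L2_bd mT _ (fun x _ => _)). Qed.

Definition a1 := \int[mu']_x (a x * (t1 x ^+ 2 + t2 x ^+ 2)).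

Lemma a1E : a1 = <|s1, t1|> + <|s2, t2|>.
Proof.
rewrite !ipE -(RintegralD mT (L2_mul mT Ls1 Lt1) (L2_mul mT Ls2 Lt2)).
by apply: eq_Rintegral => x _; rewrite /s1 /s2; ring.
Qed.

Lemma nice_L2 (v : V -> R) : nice v -> bsupp v -> L v.
Proof. by move=> nv bv; apply: cc_L2 => //; exact: nice_cont. Qed.

Lemma nice_pd_L2 i (v : V -> R) : nice v -> bsupp v -> L (pd i v).
Proof. by move=> nv bv; apply: nice_L2; [exact: nice_pd|exact: nice_bsupp_pd]. Qed.

Lemma tr_L2 (v : V -> R) : smooth v -> bsupp v -> L2 mu' setT (tr v).
Proof.
move=> sv [M hM]; apply: cc_L2 => //.
  by move=> x; apply: continuous_comp; [exact: continuous_snocl|exact: smooth_cont].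
by exists M => x i xi; apply: (hM _ (lift ord_max i)); rewrite /boundary_pt snoc_lift.
Qed.

Lemma green_adm (v p : V -> R) : smooth v -> bsupp v -> adm p ->
  \sum_i <<pd i v, pd i p>> = - <<v, lap p>>.
Proof.
move=> sv bv hp; have [np _ _ p0] := hp; have := green sv bv np.
have -> : \int[mu']_x (v (boundary_pt x) * pd ord_max p (boundary_pt x)) = 0.
  rewrite /Rintegral integral0_eq// => x _.
  by rewrite p0 ?mulr0// /boundary_pt snoc_max.
rewrite subr0 -(ipE mu Om) => <-; rewrite (Rintegral_sum mO).
  by apply: eq_bigr => i _; rewrite ipE.
move=> i.
apply: (L2_mul mO); last exact: Zc_L2 (adm_pd_Zc i hp).
by apply: cc_L2 => //; [exact: smooth_pd_cont|exact: bsupp_pd bv (smooth_has i sv)].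
Qed.

Lemma sum_close (x y : 'I_d.+1 -> R) c : (forall i, `|x i - y i| <= c) ->
  `|\sum_i x i - \sum_i y i| <= d.+1%:R * c.
Proof.
move=> h; rewrite -sumrB; apply: le_trans (ler_norm_sum _ _ _) _.
apply: (@le_trans _ _ (\sum_(i < d.+1) c)); first exact: ler_sum.
by rewrite sumr_const card_ord mulr_natl.
Qed.

Let smooth_pd_L2 i (v : V -> R) : smooth v -> bsupp v -> L (pd i v).
Proof.
by move=> sv bv; apply: cc_L2 => //; [exact: smooth_pd_cont|exact: bsupp_pd bv (smooth_has i sv)].
Qed.

Let smooth_L2 (v : V -> R) : smooth v -> bsupp v -> L v.
Proof. by move=> sv bv; apply: cc_L2 => //; exact: smooth_cont. Qed.

(** Green's formula with all derivatives on the smooth factor passes to the limit along the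
    approximants of [u]; the Neumann condition of [p] means that no trace is involved. *)
Lemma green_weak (p : V -> R) : adm p ->
  \sum_i <<G1 i, pd i p>> = - <<u1, lap p>> /\ \sum_i <<G2 i, pd i p>> = - <<u2, lap p>>.
Proof.
move=> hp; pose P := \sum_i nm (pd i p); have Lp i := Zc_L2 (adm_pd_Zc i hp).
have Ll := Zc_L2 (adm_lap_Zc hp).
have Pi i : nm (pd i p) <= P.
  by rewrite /P (bigD1 i)//= lerDl sumr_ge0// => j _; exact: nrm_ge0.
pose C := d.+1%:R * P + nm (lap p).
have key (u : V -> R) (G : 'I_d.+1 -> V -> R) : L u -> (forall i, L (G i)) ->
    (forall eta, 0 < eta -> exists phi, [/\ smooth phi, bsupp phi, nm (fun x => phi x - u x) <= eta &
      forall i, nm (fun x => pd i phi x - G i x) <= eta]) ->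
    \sum_i <<G i, pd i p>> = - <<u, lap p>>.
  move=> Lu LG AP; apply/eqP; rewrite -subr_eq0 opprK -normr_le0.
  apply: (@le_eps_lin _ _ _ C) => eta e0 _; rewrite add0r.
  have [phi [sp bp h1 h2]] := AP _ e0.
  have E := green_adm sp bp hp.
  have c1 : `|\sum_i <<pd i phi, pd i p>> - \sum_i <<G i, pd i p>>| <= d.+1%:R * (eta * P).
    apply: sum_close => i; apply: le_trans (ip_close mO (smooth_pd_L2 i sp bp) (LG i) (Lp i)) _.
    by apply: ler_pM; rewrite ?nrm_ge0.
  have c2 : `|<<phi, lap p>> - <<u, lap p>>| <= eta * nm (lap p).
    apply: le_trans (ip_close mO (smooth_L2 sp bp) Lu Ll) _.
    by rewrite ler_wpM2r ?nrm_ge0.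
  move: c1 c2; rewrite E ?opprK.
  move: (\sum_i <<G i, pd i p>>) (<<phi, lap p>>) (<<u, lap p>>) => x y z c1 c2.
  rewrite -normrN (_ : - (x + z) = (- y - x) + (y - z)); last by ring.
  apply: le_trans (ler_normD _ _) _; apply: le_trans (lerD c1 c2) _.
  by rewrite /C mulrDr mulrCA.
split; apply: key => // eta e0; have [p1 [p2 [[? ? ? ?] [h1 h2] h3 _]]] := approx e0.
  by exists p1; split => // i; have [] := h3 i.
by exists p2; split => // i; have [] := h3 i.
Qed.

Lemma hardy_u : [/\ L (fun x => invr x * u1 x), L (fun x => invr x * u2 x) &
  nm (fun x => invr x * u1 x) ^+ 2 + nm (fun x => invr x * u2 x) ^+ 2 <=
  4 * \sum_i (nm (G1 i) ^+ 2 + nm (G2 i) ^+ 2)].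
Proof.
have [|h1 h2] := @hardy_H1 _ _ d2 u1 G1 Lu1 LG1.
  move=> eta e0; have [p1 [p2 [[? ? ? ?] [h1 h2] h3 _]]] := approx e0.
  by exists p1; split => // i; have [] := h3 i.
have [|h3 h4] := @hardy_H1 _ _ d2 u2 G2 Lu2 LG2.
  move=> eta e0; have [p1 [p2 [[? ? ? ?] [h3 h4] h5 _]]] := approx e0.
  by exists p2; split => // i; have [] := h5 i.
by split => //; rewrite big_split mulrDr; exact: lerD.
Qed.

Lemma hardy_nice (v : V -> R) : nice v -> bsupp v -> L (fun x => invr x * v x) /\
  nm (fun x => invr x * v x) ^+ 2 <= 4 * \sum_i nm (pd i v) ^+ 2.
Proof.
move=> nv bv; apply: hardy_H1 => //; first exact: nice_L2.
  by move=> i; exact: nice_pd_L2.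
move=> eta e0; exists v; split => //; first exact: nice_smooth.
  by rewrite nrm_sub_diag ltW.
by move=> i; rewrite nrm_sub_diag ltW.
Qed.

(** Young's inequality keeps half of [kap] times the weighted trace of [u] and puts the rest on
    [p + i q], where [|x'| a <= b1] turns the coefficient into [b1 / |x'|], the weight of the trace
    estimate. The sign [c] is [1] in [trace_bound] and [-1] in [duality]. *)
Lemma bd_form (c kap : R) (p q : V -> R) : c ^+ 2 = 1 -> 0 < kap -> adm p -> adm q ->
  c * (<|s1, tr p|> + <|s2, tr q|>) <= kap / 2 * a1 + kap^-1 * (b1 *
    \int[mu']_x (invr (boundary_pt x) * (p (boundary_pt x) ^+ 2 + q (boundary_pt x) ^+ 2))).
Proof.
move=> c2 k0 hp hq.
have Lp := L2Z mT c (tr_L2 (nice_smooth (adm_nice hp)) (adm_bsupp hp)).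
have Lq := L2Z mT c (tr_L2 (nice_smooth (adm_nice hq)) (adm_bsupp hq)).
rewrite mulrDr -!ipZr//; try exact: (tr_L2 (nice_smooth (adm_nice hp)) (adm_bsupp hp));
  try exact: (tr_L2 (nice_smooth (adm_nice hq)) (adm_bsupp hq)).
have iat : mu'.-integrable setT (EFin \o (fun x => a x * (t1 x ^+ 2 + t2 x ^+ 2))).
  have h1 := integrableDR mT (L2_mul mT Ls1 Lt1) (L2_mul mT Ls2 Lt2).
  rewrite (_ : (fun x => _) = fun x => s1 x * t1 x + s2 x * t2 x)//.
  by apply/funext => x; rewrite /s1 /s2; ring.
have zW : Zc (fun x => invr x * (p x ^+ 2 + q x ^+ 2)).
  by apply: Zc_invr; apply: ZcD; apply: ZcX; exact: adm_Zc.
have iW : mu'.-integrable setT (EFin \o (fun x => invr (boundary_pt x) *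
    (p (boundary_pt x) ^+ 2 + q (boundary_pt x) ^+ 2))).
  have [cz vz' [M bz]] := zW; have cW := vz_cont cz vz'.
  apply: cc_integrable => //.
    move=> x; apply: (@continuous_comp _ _ _ (@boundary_pt R d) (fun y => invr y * (p y ^+ 2 + q y ^+ 2))).
      exact: continuous_snocl.
    exact: cW.
  by exists M => x i xi; apply: (bz _ (lift ord_max i)); rewrite /boundary_pt snoc_lift.
rewrite !ipE -(RintegralD mT (L2_mul mT Ls1 Lp) (L2_mul mT Ls2 Lq)).
have E1 := RintegralZl (kap / 2) mT iat; have E2 := RintegralZl (kap^-1 * b1) mT iW.
have I1 := integrableZR mT (kap / 2) iat; have I2 := integrableZR mT (kap^-1 * b1) iW.
rewrite /a1 [kap^-1 * _]mulrA -E1 -E2 -(RintegralD mT I1 I2); apply: le_Rintegral => //.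
- exact: integrableDR (L2_mul mT Ls1 Lp) (L2_mul mT Ls2 Lq).
- exact: integrableDR.
move=> x _; apply: le_trans (bd_young _ _ _ _ k0 (ab x)) _; rewrite !exprMn c2 !mul1r lerD2l -mulrA ler_wpM2l ?invr_ge0 ?(ltW k0)//.
have W0 : 0 <= p (boundary_pt x) ^+ 2 + q (boundary_pt x) ^+ 2 by rewrite addr_ge0 ?sqr_ge0.
(* At the origin [invr] has the default value 0, but [p] and [q] vanish there. *)
have [x0|x0] := eqVneq (boundary_pt x) 0.
  have [_ [r r0 hr] _ _] := hp; have [_ [r' r0' hr'] _ _] := hq.
  rewrite x0 hr ?hr' ?expr0n/= ?addr0 ?mulr0// => i; by rewrite mxE normr0.
have en : enorm (boundary_pt x) = enorm x.
  rewrite /enorm /dotp big_ord_recr/= /boundary_pt snoc_max mulr0 addr0.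
  congr Num.sqrt; apply: eq_bigr => i _.
  by rewrite (_ : widen_ord _ i = lift ord_max i) ?snoc_lift//; apply: val_inj; rewrite /= /fintype.bump leqNgt ltn_ord.
rewrite mulrA ler_wpM2r// /invr en ler_pdivlMr; first by rewrite mulrC.
by rewrite -en enorm_gt0.
Qed.

Lemma dtn_energy (v1 v2 : V -> R) : smooth v1 -> bsupp v1 -> smooth v2 -> bsupp v2 ->
  \int[mu]_(x in Om) dens v1 v2 x =
  nm v1 ^+ 2 + nm v2 ^+ 2 + \sum_i (nm (pd i v1) ^+ 2 + nm (pd i v2) ^+ 2).
Proof.
move=> s1' b1' s2' b2'; have L1 := smooth_L2 s1' b1'; have L2' := smooth_L2 s2' b2'.
have Ld1 i := smooth_pd_L2 i s1' b1'; have Ld2 i := smooth_pd_L2 i s2' b2'.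
have i1 : mu.-integrable Om (EFin \o (fun x => v1 x ^+ 2 + v2 x ^+ 2)).
  by apply: integrableDR => //; exact: L2_sq.
have ig (v : V -> R) : (forall i, L (pd i v)) -> mu.-integrable Om (EFin \o gradp v v).
  by move=> h; apply: integrable_sumR => // i; exact: L2_mul.
have i2 := integrableDR mO (ig _ Ld1) (ig _ Ld2).
rewrite /dens (RintegralD mO i1 i2) (RintegralD mO (ig _ Ld1) (ig _ Ld2)).
by rewrite nrm_sum_sq// !gradp_int// -big_split.
Qed.

Definition hsize (v1 v2 : V -> R) (g1 g2 : 'I_d.+1 -> V -> R) : R :=
  nm v1 ^+ 2 + nm v2 ^+ 2 + \sum_i (nm (g1 i) ^+ 2 + nm (g2 i) ^+ 2).

Lemma nrm_sub3 (phi u p : V -> R) eta : L phi -> L u -> L p -> nm (fun x => phi x - u x) <= eta ->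
  nm (fun x => phi x - p x) <= nm u + nm p + eta.
Proof.
move=> Lphi Lu Lp h; apply: le_trans (nrmB mO Lphi Lp) _.
have := nrm_close mO Lphi Lu; move: (nm phi) (nm u) (nm p) (nm (fun x => phi x - u x)) h => x y z w; lra.
Qed.

(** An [H^1] bound for [phi - (p + i q)] valid for every smooth [phi] close to [u]: the factor 3
    comes from squaring three terms, the 1 pays for the approximation. *)
Definition test_energy (p q : V -> R) : R :=
  3 * (hsize u1 u2 G1 G2 + hsize p q (fun i => pd i p) (fun i => pd i q) + 1).

Lemma hsize_ge0 v w g g' : 0 <= hsize v w g g'.
Proof. by rewrite !addr_ge0 ?sqr_ge0// sumr_ge0// => i _; rewrite addr_ge0 ?sqr_ge0. Qed.

Lemma pdw (phi r : V -> R) i : smooth phi -> nice r ->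
  pd i (fun x => phi x - r x) = (fun x => pd i phi x - pd i r x).
Proof. by move=> sphi nr; exact: has_pdE (has_pdB (smooth_has i sphi) (nice_has i nr)). Qed.

Lemma diff_energy (phi1 phi2 p q : V -> R) eta : smooth phi1 -> bsupp phi1 -> smooth phi2 -> bsupp phi2 ->
  adm p -> adm q -> nm (fun x => phi1 x - u1 x) <= eta -> nm (fun x => phi2 x - u2 x) <= eta ->
  (forall i, nm (fun x => pd i phi1 x - G1 i x) <= eta /\ nm (fun x => pd i phi2 x - G2 i x) <= eta) ->
  0 < eta -> eta <= (2 * d.+2%:R)^-1 ->
  \int[mu]_(x in Om) dens (fun x => phi1 x - p x) (fun x => phi2 x - q x) x <= test_energy p q.
Proof.
move=> sf1 bf1 sf2 bf2 hp hq hu1 hu2 hg eta0 eta1.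
have [np vp bp p0] := hp; have [nq vq bq q0] := hq.
have Lp := nice_L2 np bp; have Lq := nice_L2 nq bq.
have Ldp i := nice_pd_L2 i np bp; have Ldq i := nice_pd_L2 i nq bq.
have Lf1' := smooth_L2 sf1 bf1; have Lf2' := smooth_L2 sf2 bf2.
have Ldf1 i := smooth_pd_L2 i sf1 bf1; have Ldf2 i := smooth_pd_L2 i sf2 bf2.
have bw1 : bsupp (fun x => phi1 x - p x) := bsuppD bf1 (bsuppN bp).
have bw2 : bsupp (fun x => phi2 x - q x) := bsuppD bf2 (bsuppN bq).
rewrite (dtn_energy (smoothB sf1 (nice_smooth np)) bw1 (smoothB sf2 (nice_smooth nq)) bw2).
have e0 := ltW eta0.
have ge f : 0 <= nm f by exact: nrm_ge0.
have s0 : forall (f u r : V -> R), L f -> L u -> L r -> nm (fun x => f x - u x) <= eta ->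
    nm (fun x => f x - r x) ^+ 2 <= 3 * (nm u ^+ 2 + nm r ^+ 2 + eta ^+ 2).
  by move=> f u r Lf Lu Lr h; exact: (sq3 (ge _) (nrm_sub3 Lf Lu Lr h) (ge _) (ge _) e0).
have h1 := add_sq3 (s0 _ _ _ Lf1' Lu1 Lp hu1) (s0 _ _ _ Lf2' Lu2 Lq hu2) erefl.
have h3 : \sum_i (nm (pd i (fun x => phi1 x - p x)) ^+ 2 + nm (pd i (fun x => phi2 x - q x)) ^+ 2) <=
    \sum_i 3 * ((nm (G1 i) ^+ 2 + nm (G2 i) ^+ 2) + (nm (pd i p) ^+ 2 + nm (pd i q) ^+ 2) + 2 * eta ^+ 2).
  apply: ler_sum => i _; have [g1 g2] := hg i; rewrite (pdw _ sf1 np) (pdw _ sf2 nq).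
  exact: add_sq3 (s0 _ _ _ (Ldf1 i) (LG1 i) (Ldp i) g1) (s0 _ _ _ (Ldf2 i) (LG2 i) (Ldq i) g2) erefl.
have {}h3 : \sum_i (nm (pd i (fun x => phi1 x - p x)) ^+ 2 + nm (pd i (fun x => phi2 x - q x)) ^+ 2) <=
    3 * (\sum_i (nm (G1 i) ^+ 2 + nm (G2 i) ^+ 2) + \sum_i (nm (pd i p) ^+ 2 + nm (pd i q) ^+ 2) +
      d.+1%:R * (2 * eta ^+ 2)).
  apply: le_trans h3 _; rewrite -mulr_sumr 2!big_split sumr_const card_ord.
  by rewrite -[_ *+ d.+1]mulr_natl.
have h4 : (d.+1%:R + 1) * 2 * eta ^+ 2 <= 1.
  have e1 : (d.+1%:R + 1) * 2 * eta <= 1.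
    by rewrite mulrC -ler_pdivlMr ?mulr_gt0 ?addr_gt0// mul1r [_ * 2]mulrC natr1.
  have e2 : eta <= 1.
    apply: le_trans e1; rewrite ler_peMl//; rewrite -[leLHS]mulr1.
    by rewrite ler_pM ?ler01// ?ler1n// lerDr ler0n.
  by rewrite expr2 mulrA; apply: le_trans e2; rewrite ler_piMl.
exact: energy_sum h1 h3 h4.
Qed.

Lemma grad_int (v1 v2 : V -> R) : nice v1 -> bsupp v1 -> nice v2 -> bsupp v2 ->
  \int[mu]_(x in Om) (gradp v1 v1 x + gradp v2 v2 x) = \sum_i (nm (pd i v1) ^+ 2 + nm (pd i v2) ^+ 2).
Proof.
move=> nv1 bv1 nv2 bv2.
have Ld1 i := nice_pd_L2 i nv1 bv1; have Ld2 i := nice_pd_L2 i nv2 bv2.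
have ig (v : V -> R) : (forall i, L (pd i v)) -> mu.-integrable Om (EFin \o gradp v v).
  by move=> h; apply: integrable_sumR => // i; exact: L2_mul.
by rewrite (RintegralD mO (ig _ Ld1) (ig _ Ld2)) !gradp_int// big_split.
Qed.

Lemma pd_diff_sum (phi r v : V -> R) : smooth phi -> bsupp phi -> adm r -> nice v -> bsupp v ->
  \sum_i <<pd i (fun x => phi x - r x), pd i v>> = \sum_i <<pd i phi, pd i v>> + <<lap r, v>>.
Proof.
move=> sphi bphi hr nv bv; have nr := adm_nice hr.
transitivity (\sum_i (<<pd i phi, pd i v>> - <<pd i v, pd i r>>)).
  apply: eq_bigr => i _; rewrite (pdw _ sphi nr) (ipC _ _ (pd i v)).
  exact: (ipBl mO (smooth_pd_L2 i sphi bphi) (Zc_L2 (adm_pd_Zc i hr)) (nice_pd_L2 i nv bv)).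
by rewrite sumrB (green_adm (nice_smooth nv) bv hr) opprK [<<v, _>>]ipC.
Qed.

Lemma res_ip (m e : R) (p q v : V -> R) : adm p -> adm q -> L v ->
  <<res1 m e p q, v>> = - <<lap p, v>> - m * <<p, v>> + e * <<q, v>> /\
  <<res2 m e p q, v>> = - <<lap q, v>> - m * <<q, v>> - e * <<p, v>>.
Proof.
move=> hp hq Lv; have Lp := Zc_L2 (adm_Zc hp); have Lq := Zc_L2 (adm_Zc hq).
have lp := Zc_L2 (adm_lap_Zc hp); have lq := Zc_L2 (adm_lap_Zc hq).
have N (f : V -> R) : L f -> <<fun x => - f x, v>> = - <<f, v>>.
  move=> Lf; rewrite -mulN1r -(ipZl mO _ Lf Lv); apply: eq_ip => x _.
  by rewrite mulN1r.
have mZ f := @L2Z _ _ _ mu Om mO m f; have eZ f := @L2Z _ _ _ mu Om mO e f.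
split.
  have := ipDl mO (L2B mO (L2N mO lp) (mZ _ Lp)) (eZ _ Lq) Lv.
  by rewrite (ipBl mO (L2N mO lp) (mZ _ Lp) Lv) (N _ lp) !ipZl.
have := ipBl mO (L2B mO (L2N mO lq) (mZ _ Lq)) (eZ _ Lp) Lv.
by rewrite (ipBl mO (L2N mO lq) (mZ _ Lq) Lv) (N _ lq) !ipZl.
Qed.

(** The test function [v] is the decaying extension of the boundary values of [phi - w], with
    [w = p + i q] and [phi] close to [u]. The boundary term of the weak equation is then nearly [a1]
    minus the pairing of [alpha u] with [w], while the Helmholtz form of [phi - w] against [v] has a
    sign. What remains is [f] minus the residual of [w], tested with [v], and the mismatch of
    frequencies [e - l2]. *)
Lemma robin_test (e : R) : e != 0 -> exists2 C1 : R, 0 <= C1 &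
  forall p q, adm p -> adm q -> forall tau, 0 < tau ->
  exists v1 v2 : V -> R,
  [/\ [/\ nice v1, bsupp v1, nice v2 & bsupp v2],
      nm v1 ^+ 2 + nm v2 ^+ 2 <= (1 + `|l1| + `|e|) / `|e| * test_energy p q,
      \sum_i (nm (pd i v1) ^+ 2 + nm (pd i v2) ^+ 2) <= C1 * test_energy p q &
      a1 <= <|s1, tr p|> + <|s2, tr q|> + (<<f1, v1>> + <<f2, v2>> -
        (<<res1 l1 e p q, v1>> + <<res2 l1 e p q, v2>>)) +
        (e - l2) * (<<u2, v1>> - <<u1, v2>>) + tau].
Proof.
move=> e0; have [C1 C10 H] := @dtn_test R d l1 e e0; exists C1 => // p q hp hq tau tau0.
have [np vp bp p0] := hp; have [nq vq bq q0] := hq.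
set E := test_energy p q.
set Mc := 1 + `|l1| + `|e|.
have Mc0 : 0 <= Mc / `|e| by rewrite divr_ge0// !addr_ge0.
have Lp := nice_L2 np bp; have Lq := nice_L2 nq bq.
have Ldp i := nice_pd_L2 i np bp; have Ldq i := nice_pd_L2 i nq bq.
have E0 : 0 <= E by rewrite mulr_ge0// addr_ge0// addr_ge0// hsize_ge0.
pose B := 1 + (Mc / `|e| * E + C1 * E).
have B0 : 0 <= B by rewrite !addr_ge0// mulr_ge0.
pose S := nb s1 + nb s2.
have S0 : 0 <= S by rewrite addr_ge0// nrm_ge0.
pose X := d.+1%:R * (2 * B) + `|l1| * (2 * B) + `|e| * (2 * B) + 2 * S.
have X0 : 0 <= X by rewrite !addr_ge0// ?mulr_ge0.
(* The first bound keeps the energy of [phi - w] below [test_energy], by [diff_energy]; the second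
   makes all replacement errors, [eta * X] in total, at most [tau]. *)
pose eta := Num.min ((2 * d.+2%:R)^-1) (tau / (X + 1)).
have eta0 : 0 < eta.
  by rewrite lt_min invr_gt0 mulr_gt0//= divr_gt0// ltr_wpDl.
have eta1 : eta <= (2 * d.+2%:R)^-1 by rewrite ge_min lexx.
have etaX : eta * X <= tau.
  apply: (@le_trans _ _ (tau / (X + 1) * X)); first by rewrite ler_wpM2r// ge_min lexx orbT.
  by rewrite mulrAC ler_pdivrMr ?ltr_wpDl// ler_wpM2l ?(ltW tau0)// lerDl.
have [phi1 [phi2 [[sf1 bf1 sf2 bf2] [hu1 hu2] hg [ht1 ht2]]]] := approx eta0.
pose w1 x := phi1 x - p x; pose w2 x := phi2 x - q x.
have sw1 : smooth w1 := smoothB sf1 (nice_smooth np).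
have sw2 : smooth w2 := smoothB sf2 (nice_smooth nq).
have bw1 : bsupp w1 by apply: bsuppD => //; exact: bsuppN.
have bw2 : bsupp w2 by apply: bsuppD => //; exact: bsuppN.
have [v1 [v2 [[nv1 nv2 bv1 bv2] form [tv1 tv2] sqv grv]]] := H w1 w2 sw1 sw2 bw1 bw2 _ eta0.
have Lf1' := smooth_L2 sf1 bf1; have Lf2' := smooth_L2 sf2 bf2.
have Ldf1 i := smooth_pd_L2 i sf1 bf1; have Ldf2 i := smooth_pd_L2 i sf2 bf2.
have EE : \int[mu]_(x in Om) dens w1 w2 x <= E.
  exact: (diff_energy sf1 bf1 sf2 bf2 hp hq hu1 hu2 hg eta0 eta1).
have bv : nm v1 ^+ 2 + nm v2 ^+ 2 <= Mc / `|e| * E.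
  rewrite -nrm_sum_sq//; [|exact: nice_L2|exact: nice_L2].
  by apply: le_trans sqv _; rewrite ler_wpM2l.
have gv : \sum_i (nm (pd i v1) ^+ 2 + nm (pd i v2) ^+ 2) <= C1 * E.
  apply: (@le_trans _ _ (C1 * \int[mu]_(x in Om) dens w1 w2 x)); last by rewrite ler_wpM2l.
  by apply: le_trans grv; rewrite -(grad_int nv1 bv1 nv2 bv2).
exists v1, v2; split => //.
have Lv1 := nice_L2 nv1 bv1; have Lv2 := nice_L2 nv2 bv2.
have Ldv1 i := nice_pd_L2 i nv1 bv1; have Ldv2 i := nice_pd_L2 i nv2 bv2.
have G0 : 0 <= \sum_i (nm (pd i v1) ^+ 2 + nm (pd i v2) ^+ 2).
  by rewrite sumr_ge0// => i _; rewrite addr_ge0 ?sqr_ge0.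
have ME0 : 0 <= Mc / `|e| * E by rewrite mulr_ge0.
have CE0 : 0 <= C1 * E by rewrite mulr_ge0.
have [Bv1 Bv2] := sq_bd (nrm_ge0 _ _ _) (nrm_ge0 _ _ _) (le_trans bv (ler_wpDr CE0 (lexx _))).
have Bdv i : nm (pd i v1) <= B /\ nm (pd i v2) <= B.
  have hi : nm (pd i v1) ^+ 2 + nm (pd i v2) ^+ 2 <= C1 * E.
    apply: le_trans gv; rewrite [leRHS](bigD1 i)//= lerDl sumr_ge0// => j _.
    by rewrite addr_ge0 ?sqr_ge0.
  exact: sq_bd (nrm_ge0 _ _ _) (nrm_ge0 _ _ _) (le_trans hi (ler_wpDl ME0 (lexx _))).
pose A1 := \sum_i (<<pd i phi1, pd i v1>> + <<pd i phi2, pd i v2>>).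
pose A0 := \sum_i (<<G1 i, pd i v1>> + <<G2 i, pd i v2>>).
pose x := <<res1 l1 e p q, v1>> + <<res2 l1 e p q, v2>>.
(* The part of the form carried by [w] is integrated by parts onto [w]; its Neumann condition leaves
   no boundary term, and the residual of [w] appears. *)
have FE : 0 <= A1 - l1 * (<<phi1, v1>> + <<phi2, v2>>) + e * (<<phi2, v1>> - <<phi1, v2>>) - x.
  have Ip1 := L2_mul mO (smooth_L2 sw1 bw1) Lv1; have Ip2 := L2_mul mO (smooth_L2 sw2 bw2) Lv2.
  have Ip3 := L2_mul mO (smooth_L2 sw2 bw2) Lv1; have Ip4 := L2_mul mO (smooth_L2 sw1 bw1) Lv2.
  have gi (w v : V -> R) : (forall i, L (pd i w)) -> (forall i, L (pd i v)) ->
      mu.-integrable Om (EFin \o gradp w v) /\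
      \int[mu]_(y in Om) gradp w v y = \sum_i <<pd i w, pd i v>>.
    move=> hw hv; split; first by apply: integrable_sumR => // i; exact: L2_mul.
    rewrite (Rintegral_sum mO); last by move=> i; exact: L2_mul.
    by apply: eq_bigr => i _; rewrite ipE.
  have Ldw1 i := smooth_pd_L2 i sw1 bw1; have Ldw2 i := smooth_pd_L2 i sw2 bw2.
  have [ig1 E1] := gi _ _ Ldw1 Ldv1; have [ig2 E2] := gi _ _ Ldw2 Ldv2.
  have E3 := RintegralD mO ig1 ig2; have E4 := RintegralD mO Ip1 Ip2; have E5 := RintegralB mO Ip3 Ip4.
  rewrite E3 E4 E5 E1 E2 (pd_diff_sum sf1 bf1 hp nv1 bv1) (pd_diff_sum sf2 bf2 hq nv2 bv2) in form.
  rewrite -!ipE /w1 /w2 !ipBl// in form.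
  have Ll1 := Zc_L2 (adm_lap_Zc hp); have Ll2 := Zc_L2 (adm_lap_Zc hq).
  have -> : x = - <<lap p, v1>> - l1 * <<p, v1>> + e * <<q, v1>> +
      (- <<lap q, v2>> - l1 * <<q, v2>> - e * <<p, v2>>).
    by rewrite /x (res_ip l1 e hp hq Lv1).1 (res_ip l1 e hp hq Lv2).2.
  by rewrite /A1 big_split; exact: (form_alg form).
have abs2 (y z y' z' c c' : R) : `|y - y'| <= c -> `|z - z'| <= c' -> `|y + z - (y' + z')| <= c + c'.
  by move=> h1 h2; rewrite opprD addrACA; apply: le_trans (ler_normD _ _) (lerD h1 h2).
have abs2B (y z y' z' c c' : R) : `|y - y'| <= c -> `|z - z'| <= c' -> `|y - z - (y' - z')| <= c + c'.
  move=> h1 h2; rewrite (_ : _ - _ = (y - y') - (z - z')); last by ring.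
  by apply: le_trans (ler_normB _ _) (lerD h1 h2).
have dbl c : 2 * c = c + c :> R by rewrite mulr_natl mulr2n.
have cl (f f' v : V -> R) : L f -> L f' -> L v -> nm (fun x => f x - f' x) <= eta -> nm v <= B ->
    `|<<f, v>> - <<f', v>>| <= eta * B.
  move=> h1 h2 h3 h4 h5; apply: le_trans (ip_close mO h1 h2 h3) _.
  by apply: ler_pM; rewrite ?nrm_ge0.
have hA : `|A1 - A0| <= d.+1%:R * (2 * (eta * B)).
  apply: sum_close => i; have [g1 g2] := hg i; have [? ?] := Bdv i.
  by rewrite dbl; apply: abs2; apply: cl.
have hu : `|<<phi1, v1>> + <<phi2, v2>> - (<<u1, v1>> + <<u2, v2>>)| <= 2 * (eta * B).
  by rewrite dbl; apply: abs2; apply: cl.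
have hv : `|<<phi2, v1>> - <<phi1, v2>> - (<<u2, v1>> - <<u1, v2>>)| <= 2 * (eta * B).
  by rewrite dbl; apply: abs2B; apply: cl.
have hb : `|<|s1, tr v1|> + <|s2, tr v2|> - (a1 - (<|s1, tr p|> + <|s2, tr q|>))| <= 2 * eta * S.
  have one (s t : 'rV[R]_d -> R) (v phi r w : V -> R) : L2 mu' setT s -> L2 mu' setT t ->
      smooth phi -> bsupp phi -> nice v -> bsupp v -> adm r -> w = (fun x => phi x - r x) ->
      nb (fun x => phi (boundary_pt x) - t x) <= eta -> nb (fun x => w (boundary_pt x) - v (boundary_pt x)) <= eta ->
      `|<|s, tr v|> - (<|s, t|> - <|s, tr r|>)| <= 2 * eta * nb s.
    move=> Ls Lt sphi bphi nv bv' hr -> h1 h2.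
    have Lv := tr_L2 (nice_smooth nv) bv'; have Lr := tr_L2 (nice_smooth (adm_nice hr)) (adm_bsupp hr).
    have Lphi := tr_L2 sphi bphi.
    have Lw := L2B mT Lphi Lr.
    have c1 := ip_close mT Lphi Lt Ls; have c2 := ip_close mT Lw Lv Ls.
    rewrite (ipBl mT Lphi Lr Ls) in c2.
    rewrite ![<|s, _|>]ipC (_ : _ - _ = - (<|tr phi, s|> - <|tr r, s|> - <|tr v, s|>) + (<|tr phi, s|> - <|t, s|>)); last by ring.
    apply: le_trans (ler_normD _ _) _; rewrite normrN -mulrA dbl; apply: lerD.
      by apply: le_trans c2 _; rewrite ler_wpM2r ?nrm_ge0.
    by apply: le_trans c1 _; rewrite ler_wpM2r ?nrm_ge0.
  rewrite a1E (_ : _ - (_ - _) = <|s1, tr v1|> + <|s2, tr v2|> -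
    ((<|s1, t1|> - <|s1, tr p|>) + (<|s2, t2|> - <|s2, tr q|>))); last by ring.
  by rewrite /S mulrDr; apply: abs2; [apply: (@one _ _ _ phi1 _ w1)|apply: (@one _ _ _ phi2 _ w2)].
have EQ := weak nv1 bv1 nv2 bv2; rewrite -addrA in EQ.
have := form_error FE hA hu hv hb EQ; move=> h; apply: le_trans h _.
rewrite -/X -/x; exact: (test_alg _ _ _ _ _ _ _ _ _ etaX).
Qed.

(** The mismatch of frequencies puts a multiple of [u] into the right-hand side to be matched in the
    norm weighted by [r], but [r u] need not be square integrable; a truncation of [u] takes its
    place. *)
Lemma trunc_L2 (u : V -> R) eta : L u -> 0 < eta -> exists ut : V -> R,
  [/\ L ut, L (fun x => enorm x * ut x) & nm (fun x => u x - ut x) <= eta].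
Proof.
move=> Lu eta0; have [M [g [M1 mg hg sg [bg cg]]]] := truncate Lu eta0.
have mge : measurable_fun Om (fun x => enorm x * g x).
  apply: measurable_funM; last exact: measurable_funTS.
  by apply: measurable_funTS; apply: continuous_measurable_rV; exact: enorm_cont.
have L1 : L (fun x => enorm x * g x) by apply: L2_le Lu.
exists (fun x => enorm x * g x); split => //.
  apply: (@L2_le _ _ _ _ _ mO _ (fun x => M * u x)); last exact: L2Z.
    apply: measurable_funM => //.
    by apply: measurable_funTS; apply: continuous_measurable_rV; exact: enorm_cont.
  move=> x Ox; rewrite !normrM [`|M|]ger0_norm ?(le_trans _ M1)// ger0_norm ?enorm_ge0//.
  have [->|gx] := eqVneq (g x) 0.
    by rewrite normr0 !mulr0 mulr_ge0// (le_trans _ M1).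
  have /andP[_ eM] := sg _ gx; apply: ler_pM => //; first exact: enorm_ge0.
    by rewrite mulr_ge0 ?enorm_ge0.
  by have := cg _ Ox; rewrite normrM ger0_norm ?enorm_ge0.
by rewrite -nrmN (_ : (fun x => - (u x - _)) = (fun x => enorm x * g x - u x))//;
  apply/funext => x; rewrite opprB.
Qed.

Lemma ip_weight (f v : V -> R) : <<f, v>> = <<fun x => enorm x * f x, fun x => invr x * v x>>.
Proof.
apply: eq_ip => x Ox; rewrite mulrACA mul_enorm_invr ?mul1r//.
by apply: contraPneq Ox => ->; rewrite /half_space/= mxE ltxx.
Qed.

Lemma split_ip (c : R) (f u ut F v : V -> R) : L f -> L u -> L ut -> L F -> L v ->
  L (fun x => enorm x * f x) -> L (fun x => enorm x * ut x) -> L (fun x => enorm x * F x) ->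
  L (fun x => invr x * v x) ->
  <<f, v>> + c * <<u, v>> - <<F, v>> <=
  nm (fun x => enorm x * F x - (enorm x * f x + c * (enorm x * ut x))) * nm (fun x => invr x * v x) +
  `|c| * (nm (fun x => u x - ut x) * nm v).
Proof.
move=> Lf Lu Lut LF Lv Lrf Lru LrF Liv.
have E : <<f, v>> + c * <<u, v>> - <<F, v>> =
    - <<fun x => enorm x * F x - (enorm x * f x + c * (enorm x * ut x)), fun x => invr x * v x>> +
    c * <<fun x => u x - ut x, v>>.
  have Lc := L2Z mO c Lru; have Ls := L2D mO Lrf Lc.
  rewrite (ipBl mO LrF Ls Liv) (ipDl mO Lrf Lc Liv) (ipZl mO c Lru Liv) (ipBl mO Lu Lut Lv) -!ip_weight.
  by ring.
rewrite E; apply: lerD.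
  by apply: le_trans (ler_norm _) _; rewrite normrN; apply: ip_le => //; apply: L2B => //; apply: L2D => //; exact: L2Z.
by apply: le_trans (ler_norm _) _; rewrite normrM ler_wpM2l// ip_le//; exact: L2B.
Qed.

Lemma b1_ge0 : 0 <= b1.
Proof. by apply: le_trans (ab1 0); rewrite mulr_ge0 ?enorm_ge0. Qed.

(** [l2] is moved away from 0 by [eps], keeping its sign, so that [|e| = |l2| + eps]: this gives
    [eps <= |e|] and still [|e| <= l1]. *)
Lemma shift_e eps : `|l2| < l1 -> 0 < eps -> eps <= l1 - `|l2| ->
  exists e, [/\ e != 0, `|e| <= l1, eps <= `|e| & `|e - l2| = eps].
Proof.
move=> l12 e0 e1; case: (leP 0 l2) => h.
  exists (l2 + eps); have p : 0 < l2 + eps by rewrite ltr_wpDl.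
  rewrite gtr0_norm// gt_eqF// addrAC subrr add0r gtr0_norm//; split => //; last by rewrite lerDr.
  by move: e1; rewrite ger0_norm// lerBrDl.
exists (l2 - eps); have p : l2 - eps < 0 by rewrite subr_lt0 (lt_trans h).
rewrite ltr0_norm// lt_eqF// addrAC subrr add0r normrN gtr0_norm//; split => //.
  by move: e1; rewrite ltr0_norm// opprB lerBrDl addrC.
by rewrite opprB lerDl oppr_ge0 ltW.
Qed.

(** The parameters are fixed in the order [eta], the truncations of [u], [eps], [e], [C1], [del],
    each one paying for those before it. The coefficient [18] is twice the trace constant [9], since
    half of [a1] is absorbed. *)
Lemma trace_bound : `|l2| < l1 ->
  a1 <= 18 * b1 * Kc R d * (nm (fun x => enorm x * f1 x) ^+ 2 + nm (fun x => enorm x * f2 x) ^+ 2).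
Proof.
move=> l12; have l10 : 0 < l1 by apply: le_lt_trans l12.
set n1 := nm (fun x => enorm x * f1 x); set n2 := nm (fun x => enorm x * f2 x).
have n10 : 0 <= n1 by exact: nrm_ge0. have n20 : 0 <= n2 by exact: nrm_ge0.
have K1 := Kc_ge1 R d; set K := Kc R d in K1 *; have K0 : 0 <= K by apply: le_trans K1.
have bb := b1_ge0.
pose Y := 4 * (n1 + n2) + 8; have Y0 : 0 <= Y by rewrite addr_ge0// mulr_ge0// addr_ge0.
pose P := n1 ^+ 2 + n2 ^+ 2 + Y; have P0 : 0 <= P by rewrite addr_ge0// addr_ge0 ?sqr_ge0.
pose Eu := hsize u1 u2 G1 G2; have Eu0 : 0 <= Eu := hsize_ge0 _ _ _ _.
(* Bounds [eps * test_energy p q] and is independent of [eps]. *)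
pose Q := 3 * (Eu + 1 + (1 + 2 * l1) * ((K + 1) * P) + 2 * K * P).
have Q0 : 0 <= Q.
  have l0' : 0 <= 1 + 2 * l1 by rewrite addr_ge0// mulr_ge0// ltW.
  have KP : 0 <= (K + 1) * P by rewrite mulr_ge0// addr_ge0.
  by rewrite mulr_ge0// addr_ge0//; [rewrite addr_ge0 ?mulr_ge0// addr_ge0|rewrite mulr_ge0// mulr_ge0].
(* Bounds [eps] times the norms of [v1] and [v2], by [small_v]; hence the truncation error
   [eta = g / Mq] costs at most [g] against them. *)
pose Mq := 1 + (1 + 2 * l1) * Q.
have Mq0 : 0 < Mq by rewrite ltr_pwDl// mulr_ge0// addr_ge0// mulr_ge0// ltW.
apply: (@le_eps_lin _ _ _ (18 * b1 * K * Y + 10)) => g g0 g1.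
pose eta := g / Mq; have eta0 : 0 < eta by rewrite divr_gt0.
have [w1 [Lw1 Lrw1 hw1]] := trunc_L2 Lu1 eta0; have [w2 [Lw2 Lrw2 hw2]] := trunc_L2 Lu2 eta0.
pose Mu := nm (fun x => enorm x * w1 x) + nm (fun x => enorm x * w2 x) + 1.
have Mu0 : 0 < Mu by rewrite ltr_wpDl// addr_ge0// nrm_ge0.
pose eps := Num.min (Num.min 1 (l1 - `|l2|)) (g / Mu).
have eps0 : 0 < eps by rewrite !lt_min ltr01 subr_gt0 l12 divr_gt0.
have eps1 : eps <= 1 by rewrite !ge_min lexx.
have epsl : eps <= l1 - `|l2| by rewrite !ge_min lexx orbT.
have epsM : eps * Mu <= g by rewrite -ler_pdivlMr// ge_min lexx orbT.
have [e [en0 el eeps edif]] := shift_e l12 eps0 epsl.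
have [C1 C10 H] := robin_test en0.
(* Bounds the norms of [v1 / r] and [v2 / r] by Hardy's inequality; it may be huge, but [del] is
   chosen after it. *)
pose Z := 1 + 4 * (C1 * (Q / eps)).
have Z1 : 1 <= Z by rewrite lerDl mulr_ge0// mulr_ge0// divr_ge0// ltW.
have Z0 : 0 < Z by apply: lt_le_trans Z1.
pose del := g / Z; have del0 : 0 < del by rewrite divr_gt0.
have delg : del <= g by rewrite ler_pdivrMr// ler_peMr// ltW.
pose c := e - l2.
(* At the shifted frequency [l1 + i e], [u] has the right-hand side [f - i c u]; [w] is given nearly
   that residual, with [u] truncated. *)
have LH1 := L2D mO Lrf1 (L2Z mO c Lrw2); have LH2 := L2D mO Lrf2 (L2Z mO (- c) Lrw1).
have [p [q [hp hq np nq]]] := neumann_dense d2 l1 en0 LH1 LH2 del0.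
have [r1 r2] := adm_res l1 e hp hq.
have Lr1 := Zc_L2 (Zc_enorm r1); have Lr2 := Zc_L2 (Zc_enorm r2).
have [_ Eb EW EG] := neumann_est d2 en0 el hp hq.
set Phi := nm _ ^+ 2 + nm _ ^+ 2 in Eb EW EG.
have cw (w : V -> R) (c' : R) : `|c'| = eps -> L (fun x => enorm x * w x) -> nm (fun x => enorm x * w x) <= Mu ->
    nm (fun x => c' * (enorm x * w x)) <= g.
  move=> hc Lw hw; rewrite nrmZ// hc; apply: le_trans epsM; rewrite ler_wpM2l//; exact: ltW.
have Mu1 : nm (fun x => enorm x * w1 x) <= Mu.
  by rewrite /Mu -addrA lerDl addr_ge0// nrm_ge0.
have Mu2 : nm (fun x => enorm x * w2 x) <= Mu.
  by rewrite /Mu addrAC lerDr addr_ge0// nrm_ge0.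
have near (f w F : V -> R) (c' : R) : `|c'| = eps -> L (fun x => enorm x * f x) -> L (fun x => enorm x * w x) ->
    L F -> nm (fun x => enorm x * w x) <= Mu ->
    nm (fun x => F x - (enorm x * f x + c' * (enorm x * w x))) <= del ->
    nm F <= nm (fun x => enorm x * f x) + 2 * g.
  move=> hc Lf Lw LF hw hF; have LH := L2D mO Lf (L2Z mO c' Lw).
  apply: le_trans (nrm_close mO LF LH) _.
  have := nrmD mO Lf (L2Z mO c' Lw); have := cw _ _ hc Lw hw.
  rewrite (_ : 2 * g = g + g) ?addrA; last by rewrite mulr_natl mulr2n.
  move=> h1 h2; apply: lerD; last exact: le_trans hF delg.
  by apply: le_trans h2 _; rewrite lerD2l.
have hPhi : Phi <= n1 ^+ 2 + n2 ^+ 2 + g * Y.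
  apply: phi_bound => //; rewrite ?nrm_ge0//.
    exact: near edif Lrf1 Lrw2 Lr1 Mu2 np.
  by apply: near _ Lrf2 Lrw1 Lr2 Mu1 nq; rewrite normrN.
have PhiP : Phi <= P.
  by apply: le_trans hPhi _; rewrite lerD2l ler_piMl.
have Phi0 : 0 <= Phi by rewrite addr_ge0 ?sqr_ge0.
have W0 : 0 <= nm p ^+ 2 + nm q ^+ 2 by rewrite addr_ge0 ?sqr_ge0.
have EQ : eps * test_energy p q <= Q.
  exact: (energy_bound eps0 eps1 eeps W0 (ltW l10) K1 Phi0 PhiP Eu0 erefl EW EG erefl).
have E0 : 0 <= test_energy p q by rewrite mulr_ge0// addr_ge0// addr_ge0// hsize_ge0.
have [v1 [v2 [[nv1 bv1 nv2 bv2] hv hgv hmain]]] := H p q hp hq g g0.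
have Mc0 : 0 <= 1 + `|l1| + `|e| by rewrite !addr_ge0.
have Mcl : 1 + `|l1| + `|e| <= 1 + 2 * l1.
  by rewrite -addrA lerD2l (gtr0_norm l10) mulr_natl mulr2n lerD2l.
have [sv1 sv2] := small_v eps0 eeps (nrm_ge0 _ _ _) (nrm_ge0 _ _ _) hv E0 EQ Mc0 Mcl.
have Lv1 := nice_L2 nv1 bv1; have Lv2 := nice_L2 nv2 bv2.
have [Liv1 hi1] := hardy_nice nv1 bv1; have [Liv2 hi2] := hardy_nice nv2 bv2.
have hiv : nm (fun x => invr x * v1 x) ^+ 2 + nm (fun x => invr x * v2 x) ^+ 2 <= 4 * (C1 * (Q / eps)).
  apply: le_trans (lerD hi1 hi2) _; rewrite -mulrDr ler_wpM2l// -big_split.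
  by apply: le_trans hgv _; rewrite ler_wpM2l// ler_pdivlMr// mulrC.
have [iv1 iv2] := sq_bd (nrm_ge0 _ _ _) (nrm_ge0 _ _ _) hiv.
have LF1 := Zc_L2 r1; have LF2 := Zc_L2 r2.
have S1 := split_ip c Lf1 Lu2 Lw2 LF1 Lv1 Lrf1 Lrw2 Lr1 Liv1.
have S2 := split_ip (- c) Lf2 Lu1 Lw1 LF2 Lv2 Lrf2 Lrw1 Lr2 Liv2.
have sm (x y : R) : 0 <= x -> 0 <= y -> x <= del -> y <= Z -> x * y <= g.
  by move=> x0 y0 hx hy; apply: le_trans (ler_pM x0 y0 hx hy) _; rewrite divfK// gt_eqF.
have sm2 (x y : R) : 0 <= x -> 0 <= y -> x <= eta -> eps * y <= Mq -> eps * (x * y) <= g.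
  move=> x0 y0 hx hy; rewrite mulrCA; apply: le_trans (ler_pM x0 _ hx hy) _; last by rewrite divfK// gt_eqF.
  by rewrite mulr_ge0// ltW.
have D1 := sm _ _ (nrm_ge0 _ _ _) (nrm_ge0 _ _ _) np iv1.
have D2 := sm _ _ (nrm_ge0 _ _ _) (nrm_ge0 _ _ _) nq iv2.
have D3 := sm2 _ _ (nrm_ge0 _ _ _) (nrm_ge0 _ _ _) hw2 sv1.
have D4 := sm2 _ _ (nrm_ge0 _ _ _) (nrm_ge0 _ _ _) hw1 sv2.
rewrite edif in S1; rewrite normrN edif in S2.
(* With [kap = 1] half of [a1] moves to the left side. *)
have Bd := @bd_form 1 1 p q (expr1n _ _) ltr01 hp hq; rewrite mul1r in Bd.
apply: (trace_final _ Bd Eb D1 D3 D2 D4 bb K0 hPhi).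
apply: le_trans hmain _; rewrite lerD2r -addrA lerD2l.
apply: le_trans (lerD S1 S2); rewrite -/c mulrBr mulNr.
by rewrite le_eqVlt; apply/orP; left; apply/eqP; ring.
Qed.

(** Chosen so that [9 b1 K / kap <= 1 / 8], the share of the boundary term that [duality_final]
    absorbs; the 1 keeps it positive when [b1 = 0]. *)
Definition kap : R := 72 * b1 * Kc R d + 1.

(** Pairing [u] with [u / r^2] gives the square of the norm of [u / r]. This weight is produced as
    the residual of a smooth Neumann function [w], so that the weak equation of [u] tested with [w]
    trades it for [f] against [w] and for the boundary term, which [trace_bound] controls. *)
Lemma duality : `|l2| < l1 ->
  nm (fun x => invr x * u1 x) ^+ 2 + nm (fun x => invr x * u2 x) ^+ 2 <=
  4 / 3 * (8 * Kc R d + 9 * (kap * (b1 * Kc R d))) *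
    (nm (fun x => enorm x * f1 x) ^+ 2 + nm (fun x => enorm x * f2 x) ^+ 2).
Proof.
move=> l12; have l10 : 0 < l1 by apply: le_lt_trans l12.
have tb := trace_bound l12.
have [Liu1 Liu2 _] := hardy_u.
set n1 := nm (fun x => enorm x * f1 x) in tb *; set n2 := nm (fun x => enorm x * f2 x) in tb *.
set V1 := nm (fun x => invr x * u1 x); set V2 := nm (fun x => invr x * u2 x).
have V10 : 0 <= V1 by exact: nrm_ge0. have V20 : 0 <= V2 by exact: nrm_ge0.
have K1 := Kc_ge1 R d; set K := Kc R d in K1 tb *; have K0 : 0 <= K by apply: le_trans K1.
have bb := b1_ge0.
have kap0 : 0 < kap by rewrite ltr_wpDl// mulr_ge0// mulr_ge0.
pose Y := 4 * (V1 + V2) + 8; have Y0 : 0 <= Y by rewrite addr_ge0// mulr_ge0// addr_ge0.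
pose P := V1 ^+ 2 + V2 ^+ 2 + Y; have P0 : 0 <= P by rewrite addr_ge0// addr_ge0 ?sqr_ge0.
pose U := nm u1 + nm u2 + 1; have U0 : 0 < U by rewrite ltr_wpDl// addr_ge0// nrm_ge0.
apply: (@le_eps_lin _ _ _ (4 / 3 * (2 + 2 * (V1 + V2) + 2))) => g g0 g1.
have gU0 : 0 < g / U by rewrite divr_gt0.
pose D := (K + 1) * P + 1; have D0 : 0 < D by rewrite ltr_wpDl// mulr_ge0// addr_ge0.
(* Since [|e| |w|^2] is at most [(K + 1) P], the second bound makes the mismatch [eps |u| |w|] of
   order [g], even when [e] itself is as small as [eps]. *)
pose eps := Num.min (l1 - `|l2|) ((g / U) ^+ 2 / D).
have eps0 : 0 < eps by rewrite lt_min subr_gt0 l12 divr_gt0// exprn_gt0.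
have epsl : eps <= l1 - `|l2| by rewrite ge_min lexx.
have epsD : eps * D <= (g / U) ^+ 2 by rewrite -ler_pdivlMr// ge_min lexx orbT.
have [e' [en0 el eeps edif]] := shift_e l12 eps0 epsl.
(* The adjoint problem lives at the conjugate frequency. *)
pose e := - e'.
have en0' : e != 0 by rewrite oppr_eq0. have el' : `|e| <= l1 by rewrite normrN.
have eeps' : eps <= `|e| by rewrite normrN.
(* The target [u / r] for [r] times the residual means that the residual itself approximates
   [u / r^2]. *)
have [p [q [hp hq np nq]]] := neumann_dense d2 l1 en0' Liu1 Liu2 g0.
have [r1 r2] := adm_res l1 e hp hq.
have Lr1 := Zc_L2 (Zc_enorm r1); have Lr2 := Zc_L2 (Zc_enorm r2).
have [EI Eb EW _] := neumann_est d2 en0' el' hp hq.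
set Phi := nm (fun x => enorm x * res1 l1 e p q x) ^+ 2 +
  nm (fun x => enorm x * res2 l1 e p q x) ^+ 2 in EI Eb EW.
have nearV (u F : V -> R) : L (fun x => invr x * u x) -> L F -> nm (fun x => F x - invr x * u x) <= g ->
    nm F <= nm (fun x => invr x * u x) + 2 * g.
  move=> Lu LF h; apply: le_trans (nrm_close mO LF Lu) _; rewrite lerD2l.
  by apply: le_trans h _; rewrite ler_peMl ?(ltW g0)// ler1n.
have hPhi : Phi <= V1 ^+ 2 + V2 ^+ 2 + g * Y.
  exact: (phi_bound (nrm_ge0 _ _ _) (nrm_ge0 _ _ _) (nearV _ _ Liu1 Lr1 np) (nearV _ _ Liu2 Lr2 nq) V10 V20 g0 g1).
have PhiP : Phi <= P by apply: le_trans hPhi _; rewrite lerD2l ler_piMl.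
have EWP : `|e| * (nm p ^+ 2 + nm q ^+ 2) <= (K + 1) * P.
  by apply: le_trans EW _; rewrite ler_wpM2l// addr_ge0.
have [ep eq'] := eps_term eps0 eeps' (nrm_ge0 _ _ p) (nrm_ge0 _ _ q) erefl EWP U0 g0 epsD.
have np' := adm_nice hp; have nq' := adm_nice hq; have bp := adm_bsupp hp; have bq := adm_bsupp hq.
have Lp := nice_L2 np' bp; have Lq := nice_L2 nq' bq.
have [g11 g21] := green_weak hp; have [g12 g22] := green_weak hq.
have EQ := weak np' bp nq' bq; rewrite big_split/= g11 g22 in EQ.
have LF1 := Zc_L2 r1; have LF2 := Zc_L2 r2.
have R1 := (res_ip l1 e hp hq Lu1).1; have R2 := (res_ip l1 e hp hq Lu2).2.
rewrite ![ip mu Om _ u1]ipC in R1; rewrite ![ip mu Om _ u2]ipC in R2.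
have main : <<u1, res1 l1 e p q>> + <<u2, res2 l1 e p q>> = <<f1, p>> + <<f2, q>> +
    (-1) * (<|s1, tr p|> + <|s2, tr q|>) + (l2 - e') * (<<u1, q>> - <<u2, p>>).
  exact: (dual_alg EQ R1 R2).
have low (u F : V -> R) : L (fun x => invr x * u x) -> L F -> L (fun x => enorm x * F x) ->
    nm (fun x => enorm x * F x - invr x * u x) <= g ->
    nm (fun x => invr x * u x) ^+ 2 <= <<u, F>> + g * nm (fun x => invr x * u x).
  move=> Lu LF LrF h; rewrite -(ip_diag mu Om) [<<u, F>>]ipC (ip_weight F u) -lerBlDl.
  apply: le_trans (ler_norm _) _; rewrite distrC; apply: le_trans (ip_close mO LrF Lu Lu) _.
  by rewrite ler_wpM2r ?nrm_ge0.
have low1 := low _ _ Liu1 LF1 Lr1 np; have low2 := low _ _ Liu2 LF2 Lr2 nq.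
have Lip := Zc_L2 (Zc_invr (adm_Zc hp)); have Liq := Zc_L2 (Zc_invr (adm_Zc hq)).
have c1 : <<f1, p>> <= n1 * nm (fun x => invr x * p x).
  by rewrite ip_weight; apply: le_trans (ler_norm _) _; exact: ip_le.
have c2 : <<f2, q>> <= n2 * nm (fun x => invr x * q x).
  by rewrite ip_weight; apply: le_trans (ler_norm _) _; exact: ip_le.
have x1 := cross_term K1 c1; have x2 := cross_term K1 c2.
have hT : (l2 - e') * (<<u1, q>> - <<u2, p>>) <= 2 * g.
  apply: le_trans (ler_norm _) _; rewrite normrM distrC edif.
  have one (u w : V -> R) : L u -> L w -> nm u <= U -> eps * nm w <= g / U -> eps * `|<<u, w>>| <= g.
    move=> Lu Lw hu hw; apply: (@le_trans _ _ (nm u * (eps * nm w))).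
      by rewrite mulrCA ler_wpM2l ?(ltW eps0)// ip_le.
    apply: le_trans (ler_pM (nrm_ge0 _ _ _) _ hu hw) _; first by rewrite mulr_ge0 ?nrm_ge0// ltW.
    by rewrite mulrC divfK// gt_eqF.
  have hU1 : nm u1 <= U by rewrite /U -addrA lerDl addr_ge0// nrm_ge0.
  have hU2 : nm u2 <= U by rewrite /U addrAC lerDr addr_ge0// nrm_ge0.
  apply: (@le_trans _ _ (eps * (`|<<u1, q>>| + `|<<u2, p>>|))).
    by rewrite ler_wpM2l ?(ltW eps0)// ler_normB.
  by rewrite mulrDr [2 * g]mulr_natl mulr2n; apply: lerD; exact: one.
have Bd := @bd_form (-1) kap p q (etrans (sqrrN 1) (expr1n _ _)) kap0 hp hq.
have {}Bd : -1 * (<|s1, tr p|> + <|s2, tr q|>) <= kap / 2 * a1 + 8^-1 * Phi.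
  apply: le_trans Bd _; rewrite lerD2l; apply: (@le_trans _ _ (kap^-1 * (b1 * (9 * K * Phi)))).
    by rewrite ler_wpM2l ?invr_ge0 ?(ltW kap0)// ler_wpM2l.
  have Phi0 : 0 <= Phi by rewrite addr_ge0 ?sqr_ge0.
  rewrite (_ : kap^-1 * _ = 9 * b1 * K / kap * Phi); last by field; rewrite gt_eqF.
  by rewrite ler_wpM2r// ler_pdivrMr//; exact: kap_le.
have x2' : <<f2, q>> <= 8 * K * n2 ^+ 2 + (32 * K)^-1 * (4 * K * Phi - nm (fun x => invr x * p x) ^+ 2).
  by apply: le_trans x2 _; rewrite lerD2l ler_wpM2l ?invr_ge0 ?mulr_ge0// lerBrDl.
have fin : V1 ^+ 2 + V2 ^+ 2 <= <<f1, p>> + <<f2, q>> + -1 * (<|s1, tr p|> + <|s2, tr q|>) +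
    (l2 - e') * (<<u1, q>> - <<u2, p>>) + g * (V1 + V2).
  by rewrite -main mulrDr addrACA; exact: lerD.
exact: (duality_final fin x1 x2' erefl hT tb Bd kap0 K1 hPhi).
Qed.

Hypothesis energy1 : \sum_i (nm (G1 i) ^+ 2 + nm (G2 i) ^+ 2) + a1 =
  <<f1, u1>> + <<f2, u2>> + l1 * (nm u1 ^+ 2 + nm u2 ^+ 2).
Hypothesis energy2 : \int[mu']_x (b x * (t1 x ^+ 2 + t2 x ^+ 2)) =
  <<f2, u1>> - <<f1, u2>> + l2 * (nm u1 ^+ 2 + nm u2 ^+ 2).

(** Subtract from the real energy identity the imaginary one times the sign of [l2]. The coefficient
    of [|u|^2] becomes [l1 - |l2| <= 0], and the boundary part keeps a sign because [|b| <= a].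
    Hardy's inequality then turns the Dirichlet integral into [u / r]. *)
Lemma energy_case : l1 <= `|l2| ->
  nm (fun x => invr x * u1 x) ^+ 2 + nm (fun x => invr x * u2 x) ^+ 2 <=
  64 * (nm (fun x => enorm x * f1 x) ^+ 2 + nm (fun x => enorm x * f2 x) ^+ 2).
Proof.
move=> l12; have [Liu1 Liu2 hV] := hardy_u.
have iat : mu'.-integrable setT (EFin \o (fun x => a x * (t1 x ^+ 2 + t2 x ^+ 2))).
  have h1 := integrableDR mT (L2_mul mT Ls1 Lt1) (L2_mul mT Ls2 Lt2).
  rewrite (_ : (fun x => _) = fun x => s1 x * t1 x + s2 x * t2 x)//.
  by apply/funext => x; rewrite /s1 /s2; ring.
have ibt : mu'.-integrable setT (EFin \o (fun x => b x * (t1 x ^+ 2 + t2 x ^+ 2))).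
  apply: (le_integrableR mT _ _ iat); last first.
    by move=> x _; rewrite normrM [`|_ + _|]ger0_norm ?addr_ge0 ?sqr_ge0// ler_wpM2r ?addr_ge0 ?sqr_ge0.
  by apply: measurable_funM => //; apply: measurable_funD; apply: measurable_funX; [case: Lt1|case: Lt2].
pose sg : R := if 0 <= l2 then 1 else -1.
have sgl : sg * l2 = `|l2|.
  rewrite /sg; have [h|h] := boolP (0 <= l2); first by rewrite mul1r ger0_norm.
  by rewrite mulN1r ltr0_norm// ltNge.
have sg1 : `|sg| = 1 by rewrite /sg; case: (0 <= l2); rewrite ?normrN normr1.
have ba : sg * \int[mu']_x (b x * (t1 x ^+ 2 + t2 x ^+ 2)) <= a1.
  rewrite /a1 -(RintegralZl sg mT ibt); apply: le_Rintegral => //; first exact: integrableZR.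
  move=> x _; rewrite mulrA ler_wpM2r ?addr_ge0 ?sqr_ge0//.
  by apply: le_trans (ler_norm _) _; rewrite normrM sg1 mul1r.
set n1 := nm (fun x => enorm x * f1 x); set n2 := nm (fun x => enorm x * f2 x).
set V1 := nm (fun x => invr x * u1 x) in hV *; set V2 := nm (fun x => invr x * u2 x) in hV *.
have cs (f u : V -> R) : L (fun x => enorm x * f x) -> L (fun x => invr x * u x) ->
    `|<<f, u>>| <= nm (fun x => enorm x * f x) * nm (fun x => invr x * u x).
  by move=> Lf Lu; rewrite ip_weight; exact: ip_le.
have c11 := le_trans (ler_norm _) (cs _ _ Lrf1 Liu1); have c22 := le_trans (ler_norm _) (cs _ _ Lrf2 Liu2).
have c21 := cs _ _ Lrf2 Liu1; have c12 := cs _ _ Lrf1 Liu2.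
have cx : - (sg * (<<f2, u1>> - <<f1, u2>>)) <= n2 * V1 + n1 * V2.
  apply: le_trans (ler_norm _) _; rewrite normrN normrM sg1 mul1r.
  by apply: le_trans (ler_normB _ _) (lerD c21 c12).
have U0 : (l1 - `|l2|) * (nm u1 ^+ 2 + nm u2 ^+ 2) <= 0.
  by rewrite mulr_le0_ge0 ?subr_le0// addr_ge0 ?sqr_ge0.
exact: (energy_alg energy1 energy2 sgl ba c11 c22 cx U0 (nrm_ge0 _ _ _) (nrm_ge0 _ _ _) hV).
Qed.

Lemma resolvent_real :
  nm (fun x => invr x * u1 x) ^+ 2 + nm (fun x => invr x * u2 x) ^+ 2 <=
  (64 + 4 / 3 * (8 * Kc R d + 9 * (kap * (b1 * Kc R d)))) *
    (nm (fun x => enorm x * f1 x) ^+ 2 + nm (fun x => enorm x * f2 x) ^+ 2).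
Proof.
have N0 : 0 <= nm (fun x => enorm x * f1 x) ^+ 2 + nm (fun x => enorm x * f2 x) ^+ 2.
  by rewrite addr_ge0 ?sqr_ge0.
have K1 := Kc_ge1 R d; have bb := b1_ge0; have K0 : 0 <= Kc R d by apply: le_trans K1.
have C0 : 0 <= 4 / 3 * (8 * Kc R d + 9 * (kap * (b1 * Kc R d))).
  by rewrite mulr_ge0// addr_ge0 ?mulr_ge0// addr_ge0// !mulr_ge0.
have [l12|l12] := leP l1 `|l2|.
  by apply: le_trans (energy_case l12) _; rewrite ler_wpM2r// lerDl.
by apply: le_trans (duality l12) _; rewrite ler_wpM2r// lerDr.
Qed.

End Robin.

(** * Complex-valued data *)

Section ComplexParts.
Variable R : realType.
Implicit Types z w a : R[i].

Lemma ReD z w : complex.Re (z + w) = complex.Re z + complex.Re w.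
Proof. by case: z; case: w. Qed.
Lemma ImD z w : complex.Im (z + w) = complex.Im z + complex.Im w.
Proof. by case: z; case: w. Qed.
Lemma ReB z w : complex.Re (z - w) = complex.Re z - complex.Re w.
Proof. by case: z; case: w. Qed.
Lemma ImB z w : complex.Im (z - w) = complex.Im z - complex.Im w.
Proof. by case: z; case: w. Qed.

Lemma Re_sum (I : Type) (s : seq I) (F : I -> R[i]) :
  complex.Re (\sum_(i <- s) F i) = \sum_(i <- s) complex.Re (F i).
Proof. exact: (big_morph _ ReD). Qed.
Lemma Im_sum (I : Type) (s : seq I) (F : I -> R[i]) :
  complex.Im (\sum_(i <- s) F i) = \sum_(i <- s) complex.Im (F i).
Proof. exact: (big_morph _ ImD). Qed.

Lemma ReM z w : complex.Re (z * w) = complex.Re z * complex.Re w - complex.Im z * complex.Im w.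
Proof. by case: z; case: w. Qed.
Lemma ImM z w : complex.Im (z * w) = complex.Re z * complex.Im w + complex.Im z * complex.Re w.
Proof. by case: z => ? ?; case: w. Qed.

Lemma Re_mulJ z w : complex.Re (z * w^*) = complex.Re z * complex.Re w + complex.Im z * complex.Im w.
Proof. by rewrite ReM; case: w => c d /=; rewrite mulrN opprK. Qed.
Lemma Im_mulJ z w : complex.Im (z * w^*) = complex.Im z * complex.Re w - complex.Re z * complex.Im w.
Proof. by rewrite ImM; case: w => c d /=; rewrite mulrN addrC. Qed.

Lemma Re_mulr z (c : R) : complex.Re (c%:C * z) = c * complex.Re z.
Proof. by rewrite ReM /= mul0r subr0. Qed.
Lemma Im_mulr z (c : R) : complex.Im (c%:C * z) = c * complex.Im z.
Proof. by rewrite ImM /= mul0r addr0. Qed.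

Lemma cabs_sq z : cabs z ^+ 2 = complex.Re z ^+ 2 + complex.Im z ^+ 2.
Proof. by case: z => x y; rewrite /cabs/= sqr_sqrtr// addr_ge0 ?sqr_ge0. Qed.
Lemma cabs_ge0 z : 0 <= cabs z.
Proof. by case: z => x y; exact: sqrtr_ge0. Qed.
Lemma Re_le_cabs z : complex.Re z <= cabs z.
Proof.
apply: le_trans (ler_norm _) _; rewrite -(@ler_pXn2r _ 2)// ?nnegrE ?cabs_ge0//.
by rewrite cabs_sq real_normK ?num_real// lerDl sqr_ge0.
Qed.
Lemma cabs_mulr z (c : R) : cabs (c%:C * z) = `|c| * cabs z.
Proof.
apply/eqP; rewrite -(@eqrXn2 _ 2)// ?mulr_ge0 ?cabs_ge0// exprMn !cabs_sq Re_mulr Im_mulr.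
by rewrite !exprMn real_normK ?num_real// mulrDr.
Qed.

End ComplexParts.

Section LebesgueNorms.
Variables (R : realType) (n : nat) (D : set 'rV[R]_n).
Hypothesis mD : measurable D.
Local Notation mu := (leb R n).
Implicit Types f g : 'rV[R]_n -> R[i].
Local Notation re f := (fun x => complex.Re (f x)).
Local Notation im f := (fun x => complex.Im (f x)).

Lemma cLnorm2E f : cLnorm D 2%:E f =
  ((\int[mu]_(x in D) (complex.Re (f x) ^+ 2 + complex.Im (f x) ^+ 2)%:E) `^ 2^-1)%E.
Proof.
rewrite /cLnorm unlock; congr (_ `^ _)%E; rewrite [RHS]integral_mkcond.
apply: eq_integral => x _; rewrite !patchE; case: (x \in D).
  rewrite abse_EFin poweR_EFin ger0_norm ?cabs_ge0//.
  by rewrite powR_mulrn ?cabs_ge0// cabs_sq.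
have -> : point = 0%E :> \bar R by [].
by rewrite abse0 poweR0r// pnatr_eq0.
Qed.

Lemma cL2_fin f : cmeasurable D f -> (cLnorm D 2%:E f < +oo)%E -> L2 mu D (re f) /\ L2 mu D (im f).
Proof.
move=> [m1 m2]; rewrite cLnorm2E => /lty_poweRy fin.
have {}fin : (\int[mu]_(x in D) (complex.Re (f x) ^+ 2 + complex.Im (f x) ^+ 2)%:E < +oo)%E.
  by apply: fin; rewrite invr_neq0// pnatr_eq0.
have i12 : mu.-integrable D (EFin \o (fun x => complex.Re (f x) ^+ 2 + complex.Im (f x) ^+ 2)).
  apply/integrableP; split.
    by apply/measurable_EFinP; apply: measurable_funD; exact: measurable_funX.
  apply: le_lt_trans fin; rewrite le_eqVlt; apply/orP; left; apply/eqP.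
  by apply: eq_integral => x _ /=; rewrite ger0_norm// addr_ge0 ?sqr_ge0.
split; (split; [by []|apply: (le_integrableR mD _ _ i12); first exact: measurable_funX]).
  by move=> x _; rewrite ger0_norm ?sqr_ge0// lerDl sqr_ge0.
by move=> x _; rewrite ger0_norm ?sqr_ge0// lerDr sqr_ge0.
Qed.

Lemma cL2_val f : L2 mu D (re f) -> L2 mu D (im f) ->
  cLnorm D 2%:E f = (Num.sqrt (nrm mu D (re f) ^+ 2 + nrm mu D (im f) ^+ 2))%:E.
Proof.
move=> L1 L2'; rewrite cLnorm2E.
have i12 := integrableDR mD (L2_sq L1) (L2_sq L2').
have -> : (\int[mu]_(x in D) (complex.Re (f x) ^+ 2 + complex.Im (f x) ^+ 2)%:E)%E =
    (nrm mu D (re f) ^+ 2 + nrm mu D (im f) ^+ 2)%:E.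
  rewrite -(nrm_sum_sq mD L1 L2') /Rintegral fineK//; exact: integrable_fin_num.
by rewrite poweR_EFin powR12_sqrt// addr_ge0 ?sqr_ge0.
Qed.

Lemma cL2_near (F : nat -> 'rV[R]_n -> R[i]) eta :
  (forall k, L2 mu D (re (F k)) /\ L2 mu D (im (F k))) ->
  cLnorm D 2%:E (F k) @[k --> \oo] --> 0%E -> 0 < eta ->
  \forall k \near \oo, nrm mu D (re (F k)) <= eta /\ nrm mu D (im (F k)) <= eta.
Proof.
move=> LF F0 eta0.
have : \forall k \near \oo, (cLnorm D 2%:E (F k) < eta%:E)%E.
  by apply: (F0 (fun y => (y < eta%:E)%E)); apply: open_ereal_lt'; rewrite lte_fin.
apply: filterS => k; have [L1 L2'] := LF k; rewrite cL2_val// lte_fin => /ltW h.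
have key x y : 0 <= x -> Num.sqrt (x ^+ 2 + y ^+ 2) <= eta -> x <= eta.
  move=> x0; apply: le_trans; rewrite -[leLHS]ger0_norm// -sqrtr_sqr ler_wsqrtr// lerDl sqr_ge0 //.
split; [apply: key h|]; first exact: nrm_ge0.
by move: h; rewrite addrC; apply: key; exact: nrm_ge0.
Qed.

Lemma cint_pair f g : L2 mu D (re f) -> L2 mu D (im f) -> L2 mu D (re g) -> L2 mu D (im g) ->
  complex.Re (cint D (fun x => f x * (g x)^*)) = ip mu D (re f) (re g) + ip mu D (im f) (im g) /\
  complex.Im (cint D (fun x => f x * (g x)^*)) = ip mu D (im f) (re g) - ip mu D (re f) (im g).
Proof.
move=> L1 L2' L3 L4; rewrite /= !ipE; split.
  rewrite -(RintegralD mD (L2_mul mD L1 L3) (L2_mul mD L2' L4)).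
  by apply: eq_Rintegral => x _; rewrite Re_mulJ.
rewrite -(RintegralB mD (L2_mul mD L2' L3) (L2_mul mD L1 L4)).
by apply: eq_Rintegral => x _; rewrite Im_mulJ.
Qed.

Lemma cint_pair_sum (I : finType) (f g : I -> 'rV[R]_n -> R[i]) :
  (forall i, L2 mu D (re (f i)) /\ L2 mu D (im (f i))) -> (forall i, L2 mu D (re (g i)) /\ L2 mu D (im (g i))) ->
  complex.Re (cint D (fun x => \sum_i f i x * (g i x)^*)) =
    \sum_i (ip mu D (re (f i)) (re (g i)) + ip mu D (im (f i)) (im (g i))) /\
  complex.Im (cint D (fun x => \sum_i f i x * (g i x)^*)) =
    \sum_i (ip mu D (im (f i)) (re (g i)) - ip mu D (re (f i)) (im (g i))).
Proof.
move=> Lf Lg; split.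
  transitivity (\int[mu]_(x in D) \sum_i (complex.Re (f i x) * complex.Re (g i x) +
      complex.Im (f i x) * complex.Im (g i x))).
    by apply: eq_Rintegral => x _; rewrite Re_sum; apply: eq_bigr => i _; rewrite Re_mulJ.
  have h i := let: conj a b := Lf i in let: conj c d := Lg i in
    (integrableDR mD (L2_mul mD a c) (L2_mul mD b d)).
  rewrite (Rintegral_sum mD)//; apply: eq_bigr => i _; have [? ?] := Lf i; have [? ?] := Lg i.
  by rewrite !ipE RintegralD//; exact: L2_mul.
transitivity (\int[mu]_(x in D) \sum_i (complex.Im (f i x) * complex.Re (g i x) -
    complex.Re (f i x) * complex.Im (g i x))).
  by apply: eq_Rintegral => x _; rewrite Im_sum; apply: eq_bigr => i _; rewrite Im_mulJ.
have h i := let: conj a b := Lf i in let: conj c d := Lg i in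
  (integrableBR mD (L2_mul mD b c) (L2_mul mD a d)).
rewrite (Rintegral_sum mD)//; apply: eq_bigr => i _; have [? ?] := Lf i; have [? ?] := Lg i.
by rewrite !ipE RintegralB//; exact: L2_mul.
Qed.

End LebesgueNorms.

Section EssentialBounds.
Variables (R : realType) (n : nat).
Local Notation mu := (leb R n).

Lemma cLinf_ae (f : 'rV[R]_n -> R[i]) (c : R) : (cLnorm setT +oo f <= c%:E)%E ->
  {ae mu, forall x, cabs (f x) <= c}.
Proof.
rewrite /cLnorm unlock /=; case: ifPn => [_ /ess_supP|].
  by apply: filterS => x; rewrite /= patchE in_setT/= lee_fin ger0_norm ?cabs_ge0.
(* In this branch the whole space is a null set, so that anything holds almost everywhere. *)
rewrite -leNgt => m0 _; exists setT; split => //.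
by apply/eqP; rewrite eq_le m0 measure_ge0.
Qed.

Lemma cLinf_fin (f : 'rV[R]_n -> R[i]) : (cLnorm setT +oo f < +oo)%E ->
  exists2 A : R, 0 <= A & {ae mu, forall x, cabs (f x) <= A}.
Proof.
move=> h; exists (fine (cLnorm setT +oo f)); first by rewrite fine_ge0// /cLnorm Lnorm_ge0.
by apply: cLinf_ae; rewrite fineK// ge0_fin_numE// /cLnorm Lnorm_ge0.
Qed.

Lemma enorm_le_sum (x : 'rV[R]_n) : enorm x <= \sum_i `|x ord0 i|.
Proof.
have s0 : 0 <= \sum_i `|x ord0 i| by apply: sumr_ge0.
rewrite -(@ler_pXn2r _ 2)// ?nnegrE ?enorm_ge0// enorm_sq expr2 mulr_suml.
apply: ler_sum => i _; rewrite -real_normK ?num_real// expr2 ler_wpM2l//.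
by rewrite (bigD1 i)//= lerDl sumr_ge0.
Qed.

(** The norm of [x alpha] is a sum over the components, and [|x|] is at most the sum of the [|x_j|];
    the finitely many exceptional null sets are merged. *)
Lemma weighted_bound (f : 'rV[R]_n -> R[i]) (b : R) :
  (\sum_(j < n) cLnorm setT +oo (fun x => (x ord0 j)%:C * f x)%R <= b%:E)%E ->
  {ae mu, forall x, enorm x * complex.Re (f x) <= b}.
Proof.
move=> h; pose N j := cLnorm setT +oo (fun x => (x ord0 j)%:C * f x)%R.
have N0 j : (0 <= N j)%E by rewrite /N /cLnorm Lnorm_ge0.
have Nfin j : N j \is a fin_num.
  rewrite ge0_fin_numE//; apply: le_lt_trans (ltry b); apply: le_trans h.
  by rewrite (bigD1 j)//=; apply: leeDl; apply: sume_ge0 => k _; exact: N0.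
have sN : \sum_j fine (N j) <= b.
  by rewrite -lee_fin -sumEFin; apply: le_trans h; apply: lee_sum => j _; rewrite fineK.
have : {ae mu, forall x : 'rV[R]_n, forall j : 'I_n, cabs ((x ord0 j)%:C * f x) <= fine (N j)}.
  by apply: filter_forall => j; apply: cLinf_ae; rewrite fineK.
apply: filterS => x hx; apply: (@le_trans _ _ (enorm x * cabs (f x))).
  by rewrite ler_wpM2l ?enorm_ge0// Re_le_cabs.
apply: (@le_trans _ _ ((\sum_j `|x ord0 j|) * cabs (f x))).
  by rewrite ler_wpM2r ?cabs_ge0// enorm_le_sum.
apply: le_trans sN; rewrite mulr_suml; apply: ler_sum => j _.
by rewrite -cabs_mulr; exact: hx.
Qed.

(** [alpha] is set to 0 where one of the almost everywhere bounds fails, so that the real-variable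
    argument can use them at every point; integrals do not see the change. *)
Lemma good_part (alpha : 'rV[R]_n -> R[i]) (b : R) : 0 <= b -> cmeasurable setT alpha ->
  (cLnorm setT +oo alpha < +oo)%E ->
  {ae mu, forall x, `|complex.Im (alpha x)| <= complex.Re (alpha x)} ->
  (\sum_(j < n) cLnorm setT +oo (fun x => (x ord0 j)%:C * alpha x)%R <= b%:E)%E ->
  exists (A : R) (al1 al2 : 'rV[R]_n -> R),
  [/\ measurable_fun setT al1 /\ measurable_fun setT al2, forall x, al1 x <= A, forall x, `|al2 x| <= al1 x,
      forall x, enorm x * al1 x <= b &
      {ae mu, forall x, complex.Re (alpha x) = al1 x /\ complex.Im (alpha x) = al2 x}].
Proof.
move=> b0 [m1 m2] /cLinf_fin[A A0 hA] hs /weighted_bound hb.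
pose P x := [&& `|complex.Im (alpha x)| <= complex.Re (alpha x), complex.Re (alpha x) <= A &
  enorm x * complex.Re (alpha x) <= b].
have me : measurable_fun setT (fun x : 'rV[R]_n => enorm x).
  by apply: continuous_measurable_rV; exact: enorm_cont.
have mP : measurable_fun setT P.
  apply: measurable_and; first by apply: measurable_fun_ler => //; exact: measurableT_comp.
  by apply: measurable_and; apply: measurable_fun_ler => //; exact: measurable_funM.
exists A, (fun x => if P x then complex.Re (alpha x) else 0), (fun x => if P x then complex.Im (alpha x) else 0).
split.
- by split; apply: measurable_fun_ifT.
- by move=> x; case: ifPn => // /and3P[].
- by move=> x; case: ifPn => [/and3P[]//|_]; rewrite normr0.
- by move=> x; case: ifPn => [/and3P[]//|_]; rewrite mulr0.
apply: filterS (filterI (filterI hA hs) hb) => x [[h1 h2] h3].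
suff -> : P x by [].
by rewrite /P h2 h3 (le_trans (Re_le_cabs _) h1).
Qed.

End EssentialBounds.

Section TestPairs.
Variables (R : realType) (d : nat).
Local Notation Om := (half_space R d).
Local Notation mu := (leb R d.+1).
Local Notation mu' := (leb R d).
Let mO : measurable Om := @measurable_half R d.
Notation V := 'rV[R]_d.+1.
Local Notation cpx v1 v2 := (fun x => v1 x +i* v2 x).

Lemma ibp_test (v phi : V -> R) (i : 'I_d.+1) : nice v -> test_fun Om phi ->
  \int[mu]_(x in Om) (v x * pderiv [:: i] phi x) = - \int[mu]_(x in Om) (pd i v x * phi x).
Proof.
move=> nv tphi; have [sphi bphi] := test_fun_smooth tphi.
have cv := nice_cont nv; have cphi := smooth_cont sphi.
have cdv := nice_cont (nice_pd i nv); have cdphi := @smooth_pd_cont R d.+1 i phi sphi.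
have bdphi := bsupp_pd bphi (smooth_has i sphi).
have -> : pderiv [:: i] phi = pd i phi by rewrite pdE.
have i1 : mu.-integrable Om (EFin \o (fun x => v x * pd i phi x)).
  by apply: cc_integrable => //; [exact: contM|exact: bsuppMr].
have i2 : mu.-integrable Om (EFin \o (fun x => pd i v x * phi x)).
  by apply: cc_integrable => //; [exact: contM|exact: bsuppMr].
apply/eqP; rewrite -subr_eq0 opprK addrC -(RintegralD mO i2 i1); apply/eqP.
have h := has_pdM (nice_has i nv) (smooth_has i sphi).
have cG : continuous (fun x => v x * phi x) by exact: contM.
have cdG : continuous (fun x => pd i v x * phi x + v x * pd i phi x).
  by apply: contD; exact: contM.
have bG : bsupp (fun x => v x * phi x) by exact: bsuppMr.
have [im|im] := eqVneq i ord_max; last exact: (ibp_half im cG cdG bG h).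
rewrite im in h cdG *; rewrite (ibp_half_max cG cdG bG h).
rewrite /Rintegral integral0_eq ?oppr0// => x _.
have [_ [K [_ KO phi0]]] := tphi; rewrite phi0 ?mulr0// => /KO.
by rewrite /half_space/= /boundary_pt snoc_max ltxx.
Qed.

Lemma cmeas_cont n (D : set 'rV[R]_n) (v1 v2 : 'rV[R]_n -> R) : continuous v1 -> continuous v2 ->
  cmeasurable D (cpx v1 v2).
Proof. by move=> c1 c2; split; apply: measurable_funTS; exact: continuous_measurable_rV. Qed.

Lemma cfin n (D : set 'rV[R]_n) (v1 v2 : 'rV[R]_n -> R) : measurable D -> L2 (leb R n) D v1 -> L2 (leb R n) D v2 ->
  (cLnorm D 2%:E (cpx v1 v2) < +oo)%E.
Proof. by move=> mD h1 h2; rewrite (cL2_val mD (f := cpx v1 v2))// ltry. Qed.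

Variables v1 v2 : V -> R.
Hypotheses (nv1 : nice v1) (nv2 : nice v2) (bv1 : bsupp v1) (bv2 : bsupp v2).

Lemma in_H1_nice : in_H1 (cpx v1 v2) (fun i => cpx (pd i v1) (pd i v2)).
Proof.
split.
- by apply: cmeas_cont; exact: nice_cont.
- by apply: cfin => //; exact: nice_L2.
- move=> i; split; first by apply: cmeas_cont; apply: nice_cont; exact: nice_pd.
  by apply: cfin => //; exact: nice_pd_L2.
move=> i phi tphi.
have Re0 (f : V -> R[i]) (g : V -> R) : complex.Re (cint Om (fun x => f x * (g x)%:C)) =
    \int[mu]_(x in Om) (complex.Re (f x) * g x).
  by apply: eq_Rintegral => x _; rewrite mulrC Re_mulr mulrC.
have Im0 (f : V -> R[i]) (g : V -> R) : complex.Im (cint Om (fun x => f x * (g x)%:C)) =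
    \int[mu]_(x in Om) (complex.Im (f x) * g x).
  by apply: eq_Rintegral => x _; rewrite mulrC Im_mulr mulrC.
apply/eqP; rewrite eq_complex; apply/andP; split; apply/eqP.
  have -> z : complex.Re (- z : R[i]) = - complex.Re z by case: z.
  by rewrite !Re0; exact: ibp_test.
have -> z : complex.Im (- z : R[i]) = - complex.Im z by case: z.
by rewrite !Im0; exact: ibp_test.
Qed.

Lemma is_trace_nice : is_trace (cpx v1 v2) (fun i => cpx (pd i v1) (pd i v2))
  (fun x' => v1 (boundary_pt x') +i* v2 (boundary_pt x')).
Proof.
have sv1 := nice_smooth nv1; have sv2 := nice_smooth nv2.
have cb (v : V -> R) : smooth v -> continuous (fun x : 'rV[R]_d => v (boundary_pt x)).
  by move=> sv x; apply: continuous_comp; [exact: continuous_snocl|exact: smooth_cont].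
have L1 := tr_L2 sv1 bv1; have L2' := tr_L2 sv2 bv2.
split.
- by apply: cmeas_cont; exact: cb.
- exact: cfin.
have z n (D : set 'rV[R]_n) (w : 'rV[R]_n -> R[i]) : measurable D ->
    cLnorm D 2%:E (fun x => w x - w x) = 0%E.
  move=> mD; rewrite (_ : (fun x => w x - w x) = cpx (fun=> 0) (fun=> 0)); last first.
    by apply/funext => x; rewrite subrr.
  have L0 : L2 (leb R n) D (fun=> 0).
    split; first exact: measurable_cst.
    by under eq_fun do rewrite expr0n/=; exact: integrable0.
  rewrite (cL2_val mD (f := cpx (fun=> 0) (fun=> 0)))//=.
  by rewrite nrm0 expr0n addr0 sqrtr0.
(* The pair is itself smooth with compact support, so the constant sequence shows that its trace is
   its restriction. *)
exists (fun=> cpx v1 v2); split.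
- by move=> _; split; [exact: (test_funT (nice_smooth nv1))|exact: (test_funT (nice_smooth nv2))].
- by under eq_fun do rewrite z//; exact: cvg_cst.
- move=> i; rewrite (_ : (fun x => _) = fun x => (pd i v1 x +i* pd i v2 x) - (pd i v1 x +i* pd i v2 x)); last first.
    by apply/funext => x; rewrite /cpartial !pdE.
  by under eq_fun do rewrite z//; exact: cvg_cst.
by under eq_fun do rewrite z//; exact: cvg_cst.
Qed.

End TestPairs.

(** * Real and imaginary parts of the weak equation *)

Section RealForm.
Variables (R : realType) (d : nat).
Local Notation Om := (half_space R d).
Local Notation mu := (leb R d.+1).
Local Notation mu' := (leb R d).
Let mO : measurable Om := @measurable_half R d.
Let mT : @measurable _ 'rV[R]_d setT := measurableT.
Notation V := 'rV[R]_d.+1.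
Local Notation re f := (fun x => complex.Re (f x)).
Local Notation im f := (fun x => complex.Im (f x)).
Local Notation nm := (nrm mu Om).
Local Notation nb := (nrm mu' setT).

Lemma in_H1_L2 (u : V -> R[i]) gu : in_H1 u gu ->
  [/\ L2 mu Om (re u), L2 mu Om (im u), forall i, L2 mu Om (re (gu i)) & forall i, L2 mu Om (im (gu i))].
Proof.
move=> [mu1 fu hg _]; have [? ?] := cL2_fin mO mu1 fu.
by split => // i; have [m f] := hg i; have [] := cL2_fin mO m f.
Qed.

Lemma trace_approx (u : V -> R[i]) gu (t : 'rV[R]_d -> R[i]) : in_H1 u gu -> is_trace u gu t ->
  forall eta, 0 < eta -> exists phi1 phi2 : V -> R,
  [/\ [/\ smooth phi1, bsupp phi1, smooth phi2 & bsupp phi2],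
      nm (fun x => phi1 x - complex.Re (u x)) <= eta /\ nm (fun x => phi2 x - complex.Im (u x)) <= eta,
      forall i, nm (fun x => pd i phi1 x - complex.Re (gu i x)) <= eta /\
        nm (fun x => pd i phi2 x - complex.Im (gu i x)) <= eta &
      nb (fun x => phi1 (boundary_pt x) - complex.Re (t x)) <= eta /\
      nb (fun x => phi2 (boundary_pt x) - complex.Im (t x)) <= eta].
Proof.
move=> hu [mt ft [phi [tphi c1 c2 c3]]] eta eta0.
have [Lu1 Lu2 Lg1 Lg2] := in_H1_L2 hu; have [Lt1 Lt2] := cL2_fin mT mt ft.
have sm k : [/\ smooth (re (phi k)), bsupp (re (phi k)), smooth (im (phi k)) & bsupp (im (phi k))].
  by have [h1 h2] := tphi k; have [? ?] := test_fun_smooth h1; have [? ?] := test_fun_smooth h2.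
have LB n (D : set 'rV[R]_n) (F : nat -> 'rV[R]_n -> R[i]) (g : 'rV[R]_n -> R[i]) : measurable D ->
    (forall k, L2 (leb R n) D (re (F k)) /\ L2 (leb R n) D (im (F k))) ->
    L2 (leb R n) D (re g) -> L2 (leb R n) D (im g) ->
    cLnorm D 2%:E (fun x => F k x - g x) @[k --> \oo] --> 0%E ->
    \forall k \near \oo, nrm (leb R n) D (fun x => complex.Re (F k x) - complex.Re (g x)) <= eta /\
      nrm (leb R n) D (fun x => complex.Im (F k x) - complex.Im (g x)) <= eta.
  move=> mD LF L1 L2' cv.
  have eR k : (fun x => complex.Re (F k x - g x)) = (fun x => complex.Re (F k x) - complex.Re (g x)).
    by apply/funext => x; rewrite ReB.
  have eI k : (fun x => complex.Im (F k x - g x)) = (fun x => complex.Im (F k x) - complex.Im (g x)).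
    by apply/funext => x; rewrite ImB.
  have := @cL2_near R n D mD (fun k x => F k x - g x) eta _ cv eta0.
  under eq_near do rewrite eR eI; apply => k; rewrite eR eI.
  by have [? ?] := LF k; split; exact: L2B.
have n1 := LB _ _ _ _ mO _ Lu1 Lu2 c1.
have n2 i := LB _ _ (fun k => cpartial i (phi k)) _ mO _ (Lg1 i) (Lg2 i) (c2 i).
have n3 := LB _ _ (fun k x' => phi k (boundary_pt x')) _ mT _ Lt1 Lt2 c3.
have {}n1 : \forall k \near \oo, nm (fun x => complex.Re (phi k x) - complex.Re (u x)) <= eta /\
    nm (fun x => complex.Im (phi k x) - complex.Im (u x)) <= eta.
  apply: n1 => k; have [s1 b1 s2 b2] := sm k.
  by split; [exact: cc_L2 mO (smooth_cont s1) b1|exact: cc_L2 mO (smooth_cont s2) b2].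
have {}n2 : \forall k \near \oo, forall i, nm (fun x => complex.Re (cpartial i (phi k) x) - complex.Re (gu i x)) <= eta /\
    nm (fun x => complex.Im (cpartial i (phi k) x) - complex.Im (gu i x)) <= eta.
  apply: filter_forall => i; apply: n2 => {}i k; have [s1 b1 s2 b2] := sm k.
  rewrite /cpartial/= -!pdE; split; apply: cc_L2 => //; try exact: smooth_pd_cont.
    exact: bsupp_pd b1 (smooth_has i s1).
  exact: bsupp_pd b2 (smooth_has i s2).
have {}n3 : \forall k \near \oo, nb (fun x => complex.Re (phi k (boundary_pt x)) - complex.Re (t x)) <= eta /\
    nb (fun x => complex.Im (phi k (boundary_pt x)) - complex.Im (t x)) <= eta.
  apply: n3 => k; have [s1 b1 s2 b2] := sm k.
  by split; [exact: (tr_L2 s1 b1)|exact: (tr_L2 s2 b2)].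
have [k [h1 h2 h3]] : exists k, [/\ nm (fun x => complex.Re (phi k x) - complex.Re (u x)) <= eta /\
    nm (fun x => complex.Im (phi k x) - complex.Im (u x)) <= eta,
    forall i, nm (fun x => complex.Re (cpartial i (phi k) x) - complex.Re (gu i x)) <= eta /\
    nm (fun x => complex.Im (cpartial i (phi k) x) - complex.Im (gu i x)) <= eta &
    nb (fun x => complex.Re (phi k (boundary_pt x)) - complex.Re (t x)) <= eta /\
    nb (fun x => complex.Im (phi k (boundary_pt x)) - complex.Im (t x)) <= eta].
  have [k h] := filter_ex (filterI (filterI n1 n2) n3).
  by exists k; have [[? ?] ?] := h.
exists (re (phi k)), (im (phi k)); split => // i.
by rewrite !pdE; exact: (h2 i).
Qed.

Section Equation.
Variables (alpha : 'rV[R]_d -> R[i]) (A : R) (a b : 'rV[R]_d -> R).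
Hypotheses (malpha : cmeasurable setT alpha) (ma : measurable_fun setT a) (mb : measurable_fun setT b).
Hypotheses (aA : forall x, a x <= A) (ab : forall x, `|b x| <= a x).
Hypothesis aae : {ae mu', forall x, complex.Re (alpha x) = a x /\ complex.Im (alpha x) = b x}.

Lemma boundary_real (t T : 'rV[R]_d -> R[i]) : cmeasurable setT t -> cmeasurable setT T ->
  L2 mu' setT (re t) -> L2 mu' setT (im t) -> L2 mu' setT (re T) -> L2 mu' setT (im T) ->
  let s1 x := a x * complex.Re (t x) - b x * complex.Im (t x) in
  let s2 x := a x * complex.Im (t x) + b x * complex.Re (t x) in
  complex.Re (cint setT (fun x => alpha x * t x * (T x)^*)) =
    ip mu' setT s1 (re T) + ip mu' setT s2 (im T) /\
  complex.Im (cint setT (fun x => alpha x * t x * (T x)^*)) =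
    ip mu' setT s2 (re T) - ip mu' setT s1 (im T).
Proof.
move=> [mt1 mt2] [mT1 mT2] Lt1 Lt2 LT1 LT2 s1 s2.
have na x : `|a x| <= A by rewrite ger0_norm// (le_trans _ (ab x)).
have nb x : `|b x| <= A by apply: le_trans (ab x) (aA x).
have Ls1 : L2 mu' setT s1 by apply: (L2B mT); exact: (L2_bd mT _ (fun x _ => _)).
have Ls2 : L2 mu' setT s2 by apply: (L2D mT); exact: (L2_bd mT _ (fun x _ => _)).
have [ml1 ml2] := malpha; have [ms1 _] := Ls1; have [ms2 _] := Ls2.
have mr1 : measurable_fun setT (fun x => complex.Re (alpha x) * complex.Re (t x) - complex.Im (alpha x) * complex.Im (t x)).
  by apply: measurable_funB; exact: measurable_funM.
have mr2 : measurable_fun setT (fun x => complex.Re (alpha x) * complex.Im (t x) + complex.Im (alpha x) * complex.Re (t x)).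
  by apply: measurable_funD; exact: measurable_funM.
have aeq (f g : 'rV[R]_d -> R) : measurable_fun setT f -> measurable_fun setT g -> {ae mu', forall x, f x = g x} ->
    \int[mu']_x f x = \int[mu']_x g x.
  move=> mf mg fg; rewrite /Rintegral; congr fine; apply: ae_eq_integral => //; try exact/measurable_EFinP.
  by apply: filterS fg => x /= -> _.
have rE x : complex.Re (alpha x * t x * (T x)^*) =
    (complex.Re (alpha x) * complex.Re (t x) - complex.Im (alpha x) * complex.Im (t x)) * complex.Re (T x) +
    (complex.Re (alpha x) * complex.Im (t x) + complex.Im (alpha x) * complex.Re (t x)) * complex.Im (T x).
  by rewrite Re_mulJ ReM ImM.
have iE x : complex.Im (alpha x * t x * (T x)^*) =
    (complex.Re (alpha x) * complex.Im (t x) + complex.Im (alpha x) * complex.Re (t x)) * complex.Re (T x) -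
    (complex.Re (alpha x) * complex.Re (t x) - complex.Im (alpha x) * complex.Im (t x)) * complex.Im (T x).
  by rewrite Im_mulJ ReM ImM.
rewrite !ipE -(RintegralD mT (L2_mul mT Ls1 LT1) (L2_mul mT Ls2 LT2)).
rewrite -(RintegralB mT (L2_mul mT Ls2 LT1) (L2_mul mT Ls1 LT2)); split; apply: aeq.
- by under eq_fun do rewrite rE; apply: measurable_funD; exact: measurable_funM.
- by apply: measurable_funD; exact: measurable_funM.
- by apply: filterS aae => x [e1 e2]; rewrite rE e1 e2.
- by under eq_fun do rewrite iE; apply: measurable_funB; exact: measurable_funM.
- by apply: measurable_funB; exact: measurable_funM.
- by apply: filterS aae => x [e1 e2]; rewrite iE e1 e2.
Qed.

Lemma weak_real (u v w : V -> R[i]) gu gv (tu tv : 'rV[R]_d -> R[i]) :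
  in_H1 u gu -> in_H1 v gv -> cmeasurable setT tu -> cmeasurable setT tv ->
  (cLnorm setT 2%:E tu < +oo)%E -> (cLnorm setT 2%:E tv < +oo)%E ->
  L2 mu Om (re w) -> L2 mu Om (im w) ->
  cint Om (fun x => \sum_(i < d.+1) gu i x * (gv i x)^*) +
    cint setT (fun x' => alpha x' * tu x' * (tv x')^*) = cint Om (fun x => w x * (v x)^*) ->
  let s1 x := a x * complex.Re (tu x) - b x * complex.Im (tu x) in
  let s2 x := a x * complex.Im (tu x) + b x * complex.Re (tu x) in
  \sum_i (ip mu Om (re (gu i)) (re (gv i)) + ip mu Om (im (gu i)) (im (gv i))) +
    (ip mu' setT s1 (re tv) + ip mu' setT s2 (im tv)) =
    ip mu Om (re w) (re v) + ip mu Om (im w) (im v) /\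
  \sum_i (ip mu Om (im (gu i)) (re (gv i)) - ip mu Om (re (gu i)) (im (gv i))) +
    (ip mu' setT s2 (re tv) - ip mu' setT s1 (im tv)) =
    ip mu Om (im w) (re v) - ip mu Om (re w) (im v).
Proof.
move=> hu hv mtu mtv ftu ftv Lw1 Lw2 E s1 s2.
have [Lu1 Lu2 Lgu1 Lgu2] := in_H1_L2 hu; have [Lv1 Lv2 Lgv1 Lgv2] := in_H1_L2 hv.
have [Lt1 Lt2] := cL2_fin mT mtu ftu; have [LT1 LT2] := cL2_fin mT mtv ftv.
have [r1 i1] := cint_pair_sum mO (fun i => conj (Lgu1 i) (Lgu2 i)) (fun i => conj (Lgv1 i) (Lgv2 i)).
have [r2 i2] := boundary_real mtu mtv Lt1 Lt2 LT1 LT2.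
have [r3 i3] := cint_pair mO Lw1 Lw2 Lv1 Lv2.
by rewrite -r1 -i1 -r2 -i2 -r3 -i3 -E ReD ImD.
Qed.

Lemma energy_im (t1 t2 : 'rV[R]_d -> R) : L2 mu' setT t1 -> L2 mu' setT t2 ->
  \int[mu']_x (b x * (t1 x ^+ 2 + t2 x ^+ 2)) =
  ip mu' setT (fun x => a x * t2 x + b x * t1 x) t1 - ip mu' setT (fun x => a x * t1 x - b x * t2 x) t2.
Proof.
move=> Lt1 Lt2.
have na x : `|a x| <= A by rewrite ger0_norm// (le_trans _ (ab x)).
have nb x : `|b x| <= A by apply: le_trans (ab x) (aA x).
have Ls1 : L2 mu' setT (fun x => a x * t1 x - b x * t2 x).
  by apply: (L2B mT); exact: (L2_bd mT _ (fun x _ => _)).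
have Ls2 : L2 mu' setT (fun x => a x * t2 x + b x * t1 x).
  by apply: (L2D mT); exact: (L2_bd mT _ (fun x _ => _)).
rewrite !ipE -(RintegralB mT (L2_mul mT Ls2 Lt1) (L2_mul mT Ls1 Lt2)).
by apply: eq_Rintegral => x _; ring.
Qed.

End Equation.
End RealForm.

Theorem theorem1p4 (R : realType) (n : nat) (n_ge3 : (3 <= n)%N)
  (Cstar : R) (CstarP : is_smallest (kato_ponce_const R n.-1) Cstar)
  (Sstar : R) (SstarP : is_smallest (sobolev_const R n.-1) Sstar)
  (alpha : 'rV[R]_(n.-1) -> R[i])
  (alpha_meas : cmeasurable setT alpha)
  (alpha_bounded : (cLnorm setT +oo alpha < +oo)%E)
  (alpha_sector : {ae leb R n.-1, forall x,
     `|complex.Im (alpha x)| <= complex.Re (alpha x)})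
  (b1 b2 : R) (b1_ge0 : 0 <= b1) (b2_ge0 : 0 <= b2)
  (small : 2 * Cstar * (b1 + Sstar * b2) < 1)
  (xalpha_bound : (\sum_(j < n.-1)
     cLnorm setT +oo (fun x => (x ord0 j)%:C * alpha x)%R <= b1%:E)%E)
  (frac_xalpha_bound : (\sum_(j < n.-1)
     frac_lap_Lnorm (2 * n.-1)%:R%:E (fun x => (x ord0 j)%:C * alpha x)%R
     <= b2%:E)%E) :
  exists c : R, 0 < c /\
    forall (lambda : R[i]) (u w : 'rV[R]_(n.-1).+1 -> R[i]),
      robin_laplacian alpha u w ->
      let f := fun x => w x - lambda * u x in
      (cLnorm (half_space R n.-1) 2%:E (fun x => (enorm x)%:C * f x)%R
       < +oo)%E ->
      (cLnorm (half_space R n.-1) 2%:E (fun x => ((enorm x)^-1)%:C * u x)%R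
       <= c%:E *
          cLnorm (half_space R n.-1) 2%:E (fun x => (enorm x)%:C * f x)%R)%E.
Proof.
move: alpha alpha_meas alpha_bounded alpha_sector xalpha_bound {frac_xalpha_bound CstarP SstarP small b2_ge0}.
have d2 : (2 <= n.-1)%N by case: n n_ge3 => // n'; rewrite ltnS.
move: n.-1 d2 => d d2 {n n_ge3} alpha malpha al_fin al_sec al_wt.
have [A [a [b [[ma mb] aA ab ab1 aae]]]] := good_part b1_ge0 malpha al_fin al_sec al_wt.
(* The constant of [resolvent_real], which bounds squares; hence the square root below. *)
pose C := 64 + 4 / 3 * (8 * Kc R d + 9 * (kap d b1 * (b1 * Kc R d))).
have K0 : 0 <= Kc R d by apply: le_trans (Kc_ge1 R d).
have kap0 : 0 <= kap d b1 by rewrite addr_ge0// mulr_ge0// mulr_ge0.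
have C0 : 0 < C.
  by rewrite ltr_pwDl// mulr_ge0// addr_ge0// mulr_ge0// mulr_ge0// mulr_ge0.
exists (Num.sqrt C); split; first by rewrite sqrtr_gt0.
move=> lambda u w [mw fw [gu [tu [hu ht rob]]]] f ff.
have mO := @measurable_half R d.
have mT : @measurable _ 'rV[R]_d setT by exact: measurableT.
have [Lu1 Lu2 Lg1 Lg2] := in_H1_L2 hu.
have [mt ft _] := ht; have [Lt1 Lt2] := cL2_fin mT mt ft.
have [Lw1 Lw2] := cL2_fin mO mw fw.
have AP := trace_approx hu ht.
have [Liu1 Liu2 _] := hardy_u d2 Lu1 Lu2 Lg1 Lg2 AP.
pose l1 := complex.Re lambda; pose l2 := complex.Im lambda.
pose f1 x := complex.Re (f x); pose f2 x := complex.Im (f x).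
have f1E x : f1 x = complex.Re (w x) - (l1 * complex.Re (u x) - l2 * complex.Im (u x)).
  by rewrite /f1 /f ReB ReM.
have f2E x : f2 x = complex.Im (w x) - (l1 * complex.Im (u x) + l2 * complex.Re (u x)).
  by rewrite /f2 /f ImB ImM.
have Lf1 : L2 (leb R d.+1) (half_space R d) f1.
  by rewrite (funext f1E); apply: (L2B mO) => //; apply: (L2B mO); exact: L2Z.
have Lf2 : L2 (leb R d.+1) (half_space R d) f2.
  by rewrite (funext f2E); apply: (L2B mO) => //; apply: (L2D mO); exact: L2Z.
have reF : (fun x => complex.Re ((enorm x)%:C * f x)) = (fun x => enorm x * f1 x).
  by apply/funext => x; rewrite Re_mulr.
have imF : (fun x => complex.Im ((enorm x)%:C * f x)) = (fun x => enorm x * f2 x).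
  by apply/funext => x; rewrite Im_mulr.
have [Lrf1 Lrf2] : L2 (leb R d.+1) (half_space R d) (fun x => enorm x * f1 x) /\
    L2 (leb R d.+1) (half_space R d) (fun x => enorm x * f2 x).
  have me : measurable_fun (half_space R d) (fun x : 'rV[R]_d.+1 => enorm x).
    by apply: measurable_funTS; apply: continuous_measurable_rV; exact: enorm_cont.
  rewrite -reF -imF; apply: (cL2_fin mO _ ff); split; [rewrite reF|rewrite imF].
    by apply: measurable_funM => //; case: Lf1.
  by apply: measurable_funM => //; case: Lf2.
have wip1 g : L2 (leb R d.+1) (half_space R d) g -> ip (leb R d.+1) (half_space R d) (fun x => complex.Re (w x)) g =
    ip (leb R d.+1) (half_space R d) f1 g + (l1 * ip (leb R d.+1) (half_space R d) (fun x => complex.Re (u x)) g -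
    l2 * ip (leb R d.+1) (half_space R d) (fun x => complex.Im (u x)) g).
  move=> Lg; have Z1 := L2Z mO l1 Lu1; have Z2 := L2Z mO l2 Lu2.
  rewrite -(ipZl mO l1 Lu1 Lg) -(ipZl mO l2 Lu2 Lg) -(ipBl mO Z1 Z2 Lg) -(ipDl mO Lf1 (L2B mO Z1 Z2) Lg).
  by apply: eq_ip => x _; rewrite f1E subrK.
have wip2 g : L2 (leb R d.+1) (half_space R d) g -> ip (leb R d.+1) (half_space R d) (fun x => complex.Im (w x)) g =
    ip (leb R d.+1) (half_space R d) f2 g + (l1 * ip (leb R d.+1) (half_space R d) (fun x => complex.Im (u x)) g +
    l2 * ip (leb R d.+1) (half_space R d) (fun x => complex.Re (u x)) g).
  move=> Lg; have Z1 := L2Z mO l1 Lu2; have Z2 := L2Z mO l2 Lu1.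
  rewrite -(ipZl mO l1 Lu2 Lg) -(ipZl mO l2 Lu1 Lg) -(ipDl mO Z1 Z2 Lg) -(ipDl mO Lf2 (L2D mO Z1 Z2) Lg).
  by apply: eq_ip => x _; rewrite f2E subrK.
have WR v gv tv := @weak_real _ _ alpha A a b malpha ma mb aA ab aae u v w gu gv tu tv hu.
(* The real part alone suffices against smooth test pairs, as the pair [(v1, v2)] is arbitrary. *)
have weak v1 v2 : nice v1 -> bsupp v1 -> nice v2 -> bsupp v2 -> _ :=
  fun nv1 bv1 nv2 bv2 => (WR _ _ _ (in_H1_nice nv1 nv2 bv1 bv2) mt
    (let: And3 m _ _ := is_trace_nice nv1 nv2 bv1 bv2 in m) ft
    (let: And3 _ f _ := is_trace_nice nv1 nv2 bv1 bv2 in f) Lw1 Lw2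
    (rob _ _ _ (in_H1_nice nv1 nv2 bv1 bv2) (is_trace_nice nv1 nv2 bv1 bv2))).1.
(* Testing with [u] itself; the two parts become the energy identities of [energy_case]. *)
have [E1 E2] := WR _ _ _ hu mt mt ft ft Lw1 Lw2 (rob _ _ _ hu ht).
have final := @resolvent_real R d d2 l1 l2 A b1 a b _ _ _ _ f1 f2 _ _ Lu1 Lu2 Lg1 Lg2 Lt1 Lt2
  Lf1 Lf2 Lrf1 Lrf2 ma mb aA ab ab1 AP.
have reU : (fun x => complex.Re (((enorm x)^-1)%:C * u x)) = (fun x => invr x * complex.Re (u x)).
  by apply/funext => x; rewrite Re_mulr.
have imU : (fun x => complex.Im (((enorm x)^-1)%:C * u x)) = (fun x => invr x * complex.Im (u x)).
  by apply/funext => x; rewrite Im_mulr.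
rewrite (cL2_val mO (f := fun x => ((enorm x)^-1)%:C * u x)) ?reU ?imU//.
rewrite (cL2_val mO (f := fun x => (enorm x)%:C * f x)) ?reF ?imF//.
rewrite -EFinM lee_fin -sqrtrM ?(ltW C0)// ler_wsqrtr//.
have gsum0 : \sum_i (ip (leb R d.+1) (half_space R d) (fun x => complex.Im (gu i x)) (fun x => complex.Re (gu i x)) -
    ip (leb R d.+1) (half_space R d) (fun x => complex.Re (gu i x)) (fun x => complex.Im (gu i x))) = 0.
  by rewrite big1// => i _; rewrite ipC subrr.
apply: final.
- move=> v1 v2 nv1 bv1 nv2 bv2; have Lv1 := nice_L2 nv1 bv1; have Lv2 := nice_L2 nv2 bv2.
  rewrite (weak _ _ nv1 bv1 nv2 bv2) (wip1 _ Lv1) (wip2 _ Lv2); ring.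
- rewrite (a1E Lt1 Lt2 ma mb aA ab) -!ip_diag.
  have E1' : \sum_i (nrm (leb R d.+1) (half_space R d) (fun x => complex.Re (gu i x)) ^+ 2 +
    nrm (leb R d.+1) (half_space R d) (fun x => complex.Im (gu i x)) ^+ 2) =
    \sum_i (ip (leb R d.+1) (half_space R d) (fun x => complex.Re (gu i x)) (fun x => complex.Re (gu i x)) +
      ip (leb R d.+1) (half_space R d) (fun x => complex.Im (gu i x)) (fun x => complex.Im (gu i x))).
    by apply: eq_bigr => i _; rewrite !ip_diag.
  rewrite E1' E1 (wip1 _ Lu1) (wip2 _ Lu2).
  rewrite [ip _ _ (fun x => complex.Im (u x)) (fun x => complex.Re (u x))]ipC; ring.
rewrite (energy_im ma mb aA ab Lt1 Lt2) -!ip_diag.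
rewrite gsum0 add0r in E2; rewrite E2 (wip1 _ Lu2) (wip2 _ Lu1).
rewrite [ip _ _ (fun x => complex.Im (u x)) (fun x => complex.Re (u x))]ipC; ring.
Qed.
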